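(* Let $n\ge 1$ be an integer, let $\mu$ be a positive Radon measure on the Siegel domain $\mathcal{U}\subset\mathbb{C}^{n+1}$ and let $\frac{n}{2}<\alpha<\frac{n+1}{2}$. Then $\mu$ is a Carleson measure for the Hardy-Sobolev space $H^2_\alpha$ if and only if $\mu$ is $\alpha$-subcapacitary.
   Context: Write $\zeta=(\zeta',\zeta_{n+1})\in\mathbb{C}^n\times\mathbb{C}$, $z\cdot\overline{w}=\sum_{j=1}^n z_j\overline{w_j}$ for $z,w\in\mathbb{C}^n$, and let $H_k$ denote $k$-dimensional Lebesgue (Hausdorff) measure. Siegel domain: $\rho(\zeta)=\operatorname{Im}\zeta_{n+1}-\frac14|\zeta'|^2$ and $\mathcal{U}=\{\zeta\in\mathbb{C}^{n+1}:\rho(\zeta)>0\}$. Hardy-Sobolev space: a holomorphic function $F$ on $\mathcal{U}$ vanishes at infinity if for every $R>0$, $\lim_{\operatorname{Im}\zeta_{n+1}\to\infty}\sup_{|\zeta'|\le R}|F(\zeta',\zeta_{n+1})|=0$. For $0\le\alpha<\frac{n+1}{2}$ and an integer $m>\alpha$, $H^2_\alpha$ is the space of holomorphic functions $F$ on $\mathcal{U}$ that vanish at infinity and satisfy $\int_{\mathcal{U}}|\rho^m(\zeta)\,\partial^m_{\zeta_{n+1}}F(\zeta)|^2\rho(\zeta)^{-(2\alpha+1)}\,dH_{2n+2}(\zeta)<\infty$, with norm $$\|F\|_{H^2_\alpha}^2=\frac{4^{m}}{\Gamma(2m-2\alpha)}\int_{\mathcal{U}}|\rho^m(\zeta)\,\partial^m_{\zeta_{n+1}}F(\zeta)|^2\rho(\zeta)^{-(2\alpha+1)}\,dH_{2n+2}(\zeta).$$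 It is known that neither the space nor this norm depends on the choice of the integer $m>\alpha$, and that $H^2_\alpha$ is a Hilbert space. Carleson measure: a positive Radon measure $\mu$ on $\mathcal{U}$ is a Carleson measure for $H^2_\alpha$ if there is a constant $C>0$ such that $\int_{\mathcal{U}}|f|^2\,d\mu\le C\|f\|_{H^2_\alpha}^2$ for all $f\in H^2_\alpha$. Heisenberg group: $\mathbb{H}_n=\mathbb{C}^n\times\mathbb{R}$ with group law $[z,t]\cdot[w,s]=[z+w,\,t+s-\frac12\operatorname{Im}(z\cdot\overline{w})]$, equipped with its Haar measure $H_{2n+1}$ (Lebesgue measure). Its distance is $d(x,y)=d(x\cdot y^{-1})$ where $d([z,t])=\big(\frac1{16}|z|^4+t^2\big)^{1/4}$, and $B(x,r)$ is the open $d$-ball of center $x\in\mathbb{H}_n$ and radius $r>0$. Riesz capacity: for $0<\alpha<n+1$ and $x,y\in\mathbb{H}_n$ let $I_\alpha(x,y)=\dfrac{\Gamma(n+1-\alpha)}{2^\alpha(2\pi)^{n+1}d(x,y)^{2n+2-2\alpha}}$, and for measurable $f\ge0$ on $\mathbb{H}_n$ let $I_\alpha(f)(x)=\int_{\mathbb{H}_n}I_\alpha(x,y)f(y)\,dH_{2n+1}(y)\in[0,\infty]$. For $A\subseteq\mathbb{H}_n$, $$\operatorname{cap}_\alpha(A)=\inf\{\|f\|_{L^2(\mathbb{H}_n)}^2: f\ge0,\ f\in L^2(\mathbb{H}_n),\ I_\alpha(f)\ge1\text{ on }A\}.$$ Tents: let $\Psi^{-1}[z,t,h]=(z,\,t+\frac{i}{4}|z|^2+ih)$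 for $[z,t]\in\mathbb{H}_n$, $h>0$, which is a diffeomorphism of $\mathbb{H}_n\times(0,\infty)$ onto $\mathcal{U}$. For a Borel set $E\subseteq\mathbb{H}_n$, $T(E)=\Psi^{-1}\{[z,t,h]\in\mathbb{H}_n\times(0,\infty): B([z,t],h^{1/2})\subseteq E\}$. Subcapacitary measure: a positive Radon measure $\mu$ on $\mathcal{U}$ is $\alpha$-subcapacitary if there is a constant $C>0$ such that for every finite collection of pairwise disjoint balls $B(x_1,r_1),\dots,B(x_N,r_N)$ in $\mathbb{H}_n$, $$\sum_{i=1}^N\mu\big(T(B(x_i,r_i))\big)\le C\operatorname{cap}_\alpha\Big(\bigcup_{i=1}^N B(x_i,r_i)\Big).$$ *)

(* Defs.v *)
From HB Require Import structures.
From mathcomp Require Import all_boot all_order all_algebra.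
From mathcomp Require Import all_classical all_reals all_analysis.
From mathcomp Require Import complex.

Set Implicit Arguments.
Unset Strict Implicit.
Unset Printing Implicit Defensive.

Import Order.TTheory GRing.Theory Num.Theory.
Import numFieldNormedType.Exports.

Local Open Scope classical_set_scope.
Local Open Scope complex_scope.
Local Open Scope ring_scope.

(* The type ascription is what gives R[i] its topology: the normed structures
   of MathComp-Analysis are attached to the sort of a numFieldType. *)
Definition Cplx (R : realType) : numFieldType := R[i].

Notation cabs := (@Normc.normc _).

Section euler_gamma.
Context {R : realType}.

(* Only meaningful for 0 < s. *)
Definition Gamma (s : R) : R :=
  \int[@lebesgue_measure R]_(t in `]0, +oo[) (t `^ (s - 1) * expR (- t)).

End euler_gamma.

Notation borel T := (g_sigma_algebraType (@open T)).

Section radon.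
Context {R : realType} {T : ptopologicalType}.

Definition radon_measure (mu : {measure set (borel T) -> \bar R}) : Prop :=
  [/\ forall K : set T, compact K -> (mu K < +oo)%E,
      forall A : set (borel T), measurable A ->
        mu A = ereal_inf [set mu O | O in [set O : set T | open O /\ A `<=` O]]
    & forall O : set T, open O ->
        mu O = ereal_sup
          [set mu K | K in [set K : set T | compact K /\ K `<=` O]]].

End radon.


(* pushforward, with the measurability proof as an argument so that the
   measure structure is inferred. *)
Section image_measure.
Context d1 d2 (T1 : measurableType d1) (T2 : measurableType d2) (R : realType).
Variables (m : {measure set T1 -> \bar R}) (f : T1 -> T2).

Definition image_measure (mf : measurable_fun [set: T1] f) :
  set T2 -> \bar R := pushforward m f.

Variable mf : measurable_fun [set: T1] f.

Let image_measure0 : image_measure mf set0 = 0%E.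
Proof. by rewrite /image_measure /pushforward preimage_set0 measure0. Qed.

Let image_measure_ge0 A : (0 <= image_measure mf A)%E.
Proof. exact: measure_ge0. Qed.

Let image_measure_sigma_additive : semi_sigma_additive (image_measure mf).
Proof.
move=> F mF tF mUF; rewrite /image_measure /pushforward preimage_bigcup.
apply: measure_semi_sigma_additive.
- by move=> n; rewrite -[X in measurable X]setTI; exact: mf.
- apply/trivIsetP => /= i j _ _ ij; rewrite -preimage_setI.
  by move/trivIsetP : tF => /(_ _ _ _ _ ij) ->//; rewrite preimage_set0.
- by rewrite -preimage_bigcup -[X in measurable X]setTI; exact: mf.
Qed.

HB.instance Definition _ := isMeasure.Build _ _ _ (image_measure mf)
  image_measure0 image_measure_ge0 image_measure_sigma_additive.

End image_measure.

Section lebesgue_tuple.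
Context {R : realType}.
Local Notation mR := (measurableTypeR R).

Definition cons_pair n (p : mR * n.-tuple mR) : n.+1.-tuple mR :=
  [tuple of p.1 :: p.2].

Lemma measurable_cons_pair n : measurable_fun setT (@cons_pair n).
Proof. exact: measurable_cons. Qed.

Section step.
Variables (n : nat) (m : {sigma_finite_measure set (n.-tuple mR) -> \bar R}).

Definition lebesgue_cons : set (n.+1.-tuple mR) -> \bar R :=
  image_measure (@lebesgue_measure R \x m)%E (@measurable_cons_pair n).

HB.instance Definition _ := Measure.on lebesgue_cons.

Let lebesgue_cons_sigma_finite : sigma_finite setT lebesgue_cons.
Proof.
have /sigma_finiteP[F [TF ndF Foo]] := sigma_finiteT (@lebesgue_measure R).
have /sigma_finiteP[G [TG ndG Goo]] := sigma_finiteT m.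
pose u (t : n.+1.-tuple mR) : mR * n.-tuple mR := (thead t, [tuple of behead t]).
have mu : measurable_fun setT u.
  by apply/measurable_fun_pair => /=;
    [exact: measurable_tnth | exact: measurable_behead].
have consK : cancel (@cons_pair n) u.
  by move=> [x t]; rewrite /u /cons_pair theadE; congr pair; exact/val_inj.
exists (fun k => u @^-1` (F k `*` G k)).
  rewrite -preimage_bigcup; apply/esym; rewrite -subTset => t _ /=.
  have [i _ Fi] : (\bigcup_i F i) (thead t) by rewrite -TF.
  have [j _ Gj] : (\bigcup_i G i) [tuple of behead t] by rewrite -TG.
  exists (maxn i j) => //; split => /=.
  - by move: Fi; exact/subsetPset/ndF/leq_maxl.
  - by move: Gj; exact/subsetPset/ndG/leq_maxr.
move=> k; have [mF Fk] := Foo k; have [mG Gk] := Goo k; split.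
  by rewrite -[X in measurable X]setTI; apply: mu => //; exact: measurableX.
rewrite /lebesgue_cons /image_measure /pushforward -comp_preimage.
rewrite (_ : u \o _ = idfun); last by apply/funext => p; exact: consK.
apply: (@eq_ind_r _ _ (fun x => x < +oo)%E _ _
  (product_measure1E (@lebesgue_measure R) m mF mG)).
by rewrite lte_mul_pinfty// ge0_fin_numE.
Qed.

HB.instance Definition _ := Measure_isSigmaFinite.Build _ _ _ lebesgue_cons
  lebesgue_cons_sigma_finite.

End step.

Fixpoint lebesgue_tuple n : {sigma_finite_measure set (n.-tuple mR) -> \bar R} :=
  if n is k.+1 then lebesgue_cons (lebesgue_tuple k)
  else dirac [tuple].

Lemma lebesgue_tuple_box n (A : 'I_n -> set mR) :
  (forall i, measurable (A i)) ->
  (lebesgue_tuple n [set x | forall i, A i (tnth x i)] =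
  \prod_(i < n) lebesgue_measure (A i))%E.
Proof.
elim: n A => [|n IH] A mA.
  rewrite big_ord0 /= diracE mem_set//= => -[]//.
rewrite big_ord_recl -IH//.
pose B := [set x : n.-tuple mR | forall i, A (lift ord0 i) (tnth x i)].
have mB : measurable B.
  rewrite (_ : B = \bigcap_(i in [set: 'I_n])
      ((fun x => tnth x i) @^-1` A (lift ord0 i))).
    apply: fin_bigcap_measurable => // i _.
    by rewrite -[X in measurable X]setTI; apply: measurable_tnth.
  by apply/seteqP; split => x /= h i => [_|]; apply: h.
apply/esym; apply: (eq_trans (esym (product_measure1E (@lebesgue_measure R)
  (lebesgue_tuple n) (mA ord0) mB))).
rewrite /= /lebesgue_cons /image_measure /pushforward.
congr (product_measure1 _ _ _).
apply/seteqP; split => -[x t] /=.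
  move=> [xA tB] i; case: (unliftP ord0 i) => [j|] ->.
    by rewrite tnthS; exact: tB.
  by rewrite tnth0.
move=> h; split; first by have := h ord0; rewrite tnth0.
by move=> i; have := h (lift ord0 i); rewrite tnthS.
Qed.

End lebesgue_tuple.

(* A map into a topological space that is continuous for the sup distance on
   coordinates is Borel measurable: its preimages of open sets are countable
   unions of rational cubes. *)
Section tuple_borel_measurable.
Context {R : realType} {T : ptopologicalType}.
Local Notation mR := (measurableTypeR R).

Lemma tuple_borel_measurable N (f : N.-tuple mR -> borel T) :
  (forall (x : N.-tuple mR) (O : set T), open O -> O (f x) ->
    exists2 e : R, 0 < e & forall y : N.-tuple mR,
      (forall i, `|tnth y i - tnth x i : R| < e) -> O (f y)) ->
  measurable_fun setT f.
Proof.
move=> fcont.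
apply: (@measurability _ _ _ (borel T) setT f (@open T)) => //.
move=> _ [V oV <-]; rewrite setTI.
pose box (c : N.-tuple (rat * rat)) : set (N.-tuple mR) :=
  \bigcap_(i in [set: 'I_N]) ((fun x => @tnth N mR x i) @^-1`
      [set` `](ratr (tnth c i).1), (ratr (tnth c i).2)[ ]).
have -> : f @^-1` V = \bigcup_(c in [set c | box c `<=` f @^-1` V]) box c.
  apply/seteqP; split; last by move=> x [c /= cV xc]; exact: cV.
  move=> x Vfx; have [e e0 eV] := fcont x V oV Vfx.
  have qP i : exists q : rat * rat,
      (ratr q.1 \in `](tnth x i - e : R), (tnth x i : R)[) &&
      (ratr q.2 \in `](tnth x i : R), (tnth x i + e : R)[).
    have [|q1 q1P] := @rat_in_itvoo R (tnth x i - e) (tnth x i).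
      by rewrite ltrBlDr ltrDl.
    have [|q2 q2P] := @rat_in_itvoo R (tnth x i) (tnth x i + e).
      by rewrite ltrDl.
    by exists (q1, q2); rewrite q1P.
  exists [tuple xchoose (qP i) | i < N].
    move=> y yc; apply: eV => i.
    have /= := yc i Logic.I; rewrite tnth_mktuple !in_itv/=.
    have := xchooseP (qP i); rewrite !in_itv/=.
    move=> /andP[/andP[a1 a2] /andP[b1 b2]] /andP[y1 y2].
    rewrite ltr_distl (lt_trans a1 y1)//=.
    exact: lt_trans y2 b2.
  move=> i _ /=; rewrite tnth_mktuple in_itv/=.
  have := xchooseP (qP i); rewrite !in_itv/=.
  by move=> /andP[/andP[a1 a2] /andP[b1 b2]]; rewrite a2 b1.
rewrite bigcup_mkcond; apply: countable_bigcupT_measurable => // c.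
case: ifP => // _; apply: fin_bigcap_measurable => // i _.
by rewrite -[X in measurable X]setTI; apply: measurable_tnth => //;
  exact: measurable_itv.
Qed.

End tuple_borel_measurable.

Section spaces.
Variables (R : realType) (n : nat).
Local Notation C := (Cplx R).
Local Notation mR := (measurableTypeR R).

Definition Cn1 := ('rV[C]_n * C)%type.
HB.instance Definition _ := NormedModule.copy Cn1 ('rV[C]_n * C)%type.
HB.instance Definition _ := isPointed.Build Cn1 (0, 0).

Definition heis := ('rV[C]_n * R)%type.
HB.instance Definition _ := Topological.copy heis ('rV[C]_n * R)%type.
HB.instance Definition _ := isPointed.Build heis (0, 0).

Definition row_of_seq (x : seq R) : 'rV[C]_n :=
  \row_j (nth 0 x j.*2 +i* nth 0 x j.*2.+1).

Definition Cn1_of_tuple (x : (n.*2.+2).-tuple mR) : borel Cn1 :=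
  (row_of_seq x, (nth 0 x n.*2 +i* nth 0 x n.*2.+1 : C)).

Definition heis_of_tuple (x : (n.*2.+1).-tuple mR) : borel heis :=
  (row_of_seq x, nth 0 x n.*2).

Let cplx_ball (e : C) : 0 < e -> exists2 d : R, 0 < d &
  forall a b a' b' : R, `|a' - a| < d -> `|b' - b| < d ->
    ball (a +i* b : C) e (a' +i* b').
Proof.
case: e => e i; rewrite ltcE /= => /andP[/eqP -> e0].
exists (e / 2); first exact: divr_gt0.
move=> a b a' b' aa bb; rewrite -ball_normE /=.
rewrite normc_def ltcR /= [ltRHS]splitr.
apply: (@le_lt_trans _ _ (`|a' - a| + `|b' - b|)); last exact: ltrD.
rewrite -[leRHS]ger0_norm ?addr_ge0// -sqrtr_sqr ler_wsqrtr//.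
rewrite -[(a - a') ^+ 2]real_normK ?num_real// distrC.
rewrite -[(b - b') ^+ 2]real_normK ?num_real// [`|b - b'|]distrC.
by rewrite sqrrD addrAC lerDl mulrn_wge0// mulr_ge0.
Qed.

Let row_ball (z : seq R) (A : set 'rV[C]_n) : nbhs (row_of_seq z) A ->
  exists2 d : R, 0 < d & forall w : seq R,
    (forall k, (k < n.*2)%N -> `|nth 0 w k - nth 0 z k| < d) ->
    A (row_of_seq w).
Proof.
move=> /nbhs_ballP[e /= e0 eA]; have [d d0 dP] := cplx_ball e0.
exists d => // w wz; apply: eA; split => // i j; rewrite !mxE.
by apply: dP; apply: wz; rewrite ?ltn_double ?ltn_Sdouble.
Qed.

Lemma measurable_heis_of_tuple : measurable_fun setT heis_of_tuple.
Proof.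
apply: tuple_borel_measurable => x V oV Vx.
have : nbhs (heis_of_tuple x : heis) V by exact: open_nbhs_nbhs.
move=> [[A B] /= [/row_ball[d d0 dA] /nbhs_ballP[e /= e0 eB]] ABV].
exists (Num.min d e) => [|y yx]; first by rewrite lt_min d0.
have {}yx k (kn : (k < n.*2.+1)%N) : `|nth 0 y k - nth 0 x k| < Num.min d e.
  by have := yx (Ordinal kn); rewrite !(tnth_nth 0).
apply: ABV; split => /=.
  apply: dA => k kn; apply: lt_le_trans (yx k _) _; first exact: ltnW.
  by rewrite ge_min lexx.
apply: eB; rewrite -ball_normE /= distrC.
by apply: lt_le_trans (yx _ _) _; rewrite ?ge_min ?lexx ?orbT.
Qed.

Lemma measurable_Cn1_of_tuple : measurable_fun setT Cn1_of_tuple.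
Proof.
apply: tuple_borel_measurable => x V oV Vx.
have : nbhs (Cn1_of_tuple x : Cn1) V by exact: open_nbhs_nbhs.
move=> [[A B] /= [/row_ball[d d0 dA] /nbhs_ballP[e /= e0 eB]] ABV].
have [c c0 cP] := cplx_ball e0.
exists (Num.min d c) => [|y yx]; first by rewrite lt_min d0.
have {}yx k (kn : (k < n.*2.+2)%N) : `|nth 0 y k - nth 0 x k| < Num.min d c.
  by have := yx (Ordinal kn); rewrite !(tnth_nth 0).
apply: ABV; split => /=.
  apply: dA => k kn; apply: lt_le_trans (yx k _) _; first by rewrite 2?ltnW.
  by rewrite ge_min lexx.
by apply: eB; apply: cP; apply: lt_le_trans (yx _ _) _;
  rewrite ?ge_min ?lexx ?orbT.
Qed.

Definition lebesgue_Cn1 : {measure set (borel Cn1) -> \bar R} :=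
  image_measure (lebesgue_tuple n.*2.+2) measurable_Cn1_of_tuple.

Definition lebesgue_heis : {measure set (borel heis) -> \bar R} :=
  image_measure (lebesgue_tuple n.*2.+1) measurable_heis_of_tuple.

End spaces.

Section siegel_domain.
Variables (R : realType) (n : nat).
Local Notation C := (Cplx R).

Definition hdot (z w : 'rV[C]_n) : C := \sum_(j < n) z 0 j * (w 0 j)^*.

Definition sqnorm (z : 'rV[C]_n) : R := \sum_(j < n) cabs (z 0 j) ^+ 2.

Definition rho (z : Cn1 R n) : R := complex.Im z.2 - 4^-1 * sqnorm z.1.

Definition siegel : set (Cn1 R n) := [set z | 0 < rho z].

Lemma siegel_i : siegel (0, 'i).
Proof.
rewrite /siegel /rho /= /sqnorm big1 ?mulr0 ?subr0// => j _.
by rewrite mxE Normc.normc0 expr0n.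
Qed.

(* The Siegel domain as a space in its own right, with the subspace topology. *)
Definition siegelU := set_type siegel.
HB.instance Definition _ := Topological.copy siegelU (set_type siegel).
HB.instance Definition _ :=
  isPointed.Build siegelU (exist _ (0, 'i) (mem_set siegel_i)).

End siegel_domain.

Section hardy_sobolev.
Variables (R : realType) (n : nat).
Local Notation C := (Cplx R).
Implicit Type F : Cn1 R n -> C.

(* Functions on the Siegel domain are represented by total functions on
   C^n x C; everything below only depends on their values on the (open) Siegel
   domain. *)

(* Frechet differentiability over the field C. *)
Definition holomorphic F : Prop := forall z, siegel z -> differentiable F z.

Definition im_pinfty : set_system C :=
  [set A | exists M : R, forall w : C, M < complex.Im w -> A w].

Definition vanishes_at_infinity F : Prop :=
  forall r : R, 0 < r ->
    (fun w : C => ereal_sup [set (cabs (F (z, w)))%:E |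
       z in [set z : 'rV[C]_n | Num.sqrt (sqnorm z) <= r]])
    @ im_pinfty --> (0 : \bar R)%E.

Definition dlast F : Cn1 R n -> C := fun z => 'D_((0, 1) : Cn1 R n) F z.

Definition hs_integral (alpha : R) (m : nat) F : \bar R :=
  (\int[@lebesgue_Cn1 R n]_(z in @siegel R n)
     (cabs ((rho z ^+ m)%:C * iter m dlast F z) ^+ 2
      * rho z `^ (- (2 * alpha + 1)))%:E)%E.

Definition hs_normsq (alpha : R) (m : nat) F : \bar R :=
  ((4 ^+ m / Gamma (2 * m%:R - 2 * alpha))%:E * hs_integral alpha m F)%E.

Definition hardy_sobolev (alpha : R) (m : nat) F : Prop :=
  [/\ holomorphic F, vanishes_at_infinity F
    & (hs_integral alpha m F < +oo)%E].

Definition carleson (alpha : R) (m : nat)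
    (mu : {measure set (borel (siegelU R n)) -> \bar R}) : Prop :=
  exists2 c : R, 0 < c & forall F, hardy_sobolev alpha m F ->
    (\int[mu]_z (cabs (F (set_val z)) ^+ 2)%:E
       <= c%:E * hs_normsq alpha m F)%E.

End hardy_sobolev.

Section heisenberg.
Variables (R : realType) (n : nat).
Local Notation C := (Cplx R).
Local Notation H := (heis R n).

Definition hmul (x y : H) : H :=
  (x.1 + y.1, x.2 + y.2 - 2^-1 * complex.Im (hdot x.1 y.1)).

Definition hinv (x : H) : H := (- x.1, - x.2).

Lemma hmulV (x : H) : hmul x (hinv x) = (0, 0).
Proof.
rewrite /hmul /hinv /= !subrr (_ : hdot _ _ = (- sqnorm x.1)%:C) /=.
  by rewrite mulr0 subrr.
rewrite /hdot /sqnorm -sumrN rmorph_sum; apply: eq_bigr => j _.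
rewrite mxE; case: (x.1 0 j) => a b; apply/eqP; rewrite eq_complex /=.
rewrite sqr_sqrtr ?addr_ge0 ?sqr_ge0// !mulrN !opprK !expr2 opprD.
by rewrite eqxx [b * a]mulrC addrN eqxx.
Qed.

Definition hgauge (x : H) : R :=
  (16^-1 * sqnorm x.1 ^+ 2 + x.2 ^+ 2) `^ 4^-1.

Definition hdist (x y : H) : R := hgauge (hmul x (hinv y)).

Definition hball (x : H) (r : R) : set H := [set y | hdist x y < r].

(* On the diagonal this is 0 instead of +oo, which does not affect the
   potentials below since points are Lebesgue negligible. *)
Definition riesz_kernel (alpha : R) (x y : H) : R :=
  Gamma (n%:R + 1 - alpha) /
  (2 `^ alpha * (2 * pi) ^+ n.+1 * hdist x y `^ (2 * n%:R + 2 - 2 * alpha)).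

Definition riesz_potential (alpha : R) (f : H -> R) (x : H) : \bar R :=
  (\int[@lebesgue_heis R n]_y (riesz_kernel alpha x y * f y)%:E)%E.

Definition capacity (alpha : R) (A : set H) : \bar R :=
  ereal_inf [set ('N[@lebesgue_heis R n]_2%:E [EFin \o f] ^+ 2)%E |
    f in [set f : borel H -> R |
      [/\ forall x, 0 <= f x, f \in Lfun (@lebesgue_heis R n) 2%:E
        & forall x, A x -> (1 <= riesz_potential alpha f x)%E]]].

Definition Psi_inv (x : H) (h : R) : Cn1 R n :=
  (x.1, (x.2 +i* (4^-1 * sqnorm x.1 + h) : C)).

Definition tent (E : set H) : set (siegelU R n) :=
  [set z | exists x h,
    [/\ 0 < h, hball x (Num.sqrt h) `<=` E & set_val z = Psi_inv x h]].

Definition subcapacitary (alpha : R)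
    (mu : {measure set (borel (siegelU R n)) -> \bar R}) : Prop :=
  exists2 c : R, 0 < c &
    forall (N : nat) (x : 'I_N -> H) (r : 'I_N -> R),
      (forall i, 0 < r i) ->
      trivIset setT (fun i => hball (x i) (r i)) ->
      (\sum_(i < N) mu (tent (hball (x i) (r i)))
         <= c%:E * capacity alpha (\bigcup_i hball (x i) (r i)))%E.

End heisenberg.

(* Main.v *)
(* Both properties are equivalent to the trace inequality
   [\int (hpot g)^2 dmu <= c \int g^2] for the potentials [hpot g x h] of functions [g >= 0] on
   the Heisenberg group, where the Riesz kernel is regularised at the height [h].

   A function F of the Hardy-Sobolev space satisfies |F(x, h)| <= c hpot g x h with
   \int g^2 <= |F|^2: integrate the last derivative m times from infinity, apply the sub-mean
   value property on Whitney boxes and use the Cauchy-Schwarz inequality in the height. If mu is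
   subcapacitary, the capacity of a union of balls on which the potential of g exceeds t is at most
   c t^-2 \int g^2, and a covering argument gives the weak type estimate for mu. On Whitney cells
   this becomes an inequality for a finite symmetric kernel of quasi-metric type, for which the weak
   type estimate implies the strong one.

   Conversely, since 0 < n + 1 - 2 alpha < 1, the real part of the (n + 1 - 2 alpha)-th inverse power
   of the Cauchy-Szego base is comparable with its modulus. Testing the Carleson inequality with
   combinations of such powers shows that the energy of mu restricted to a union of Whitney cells is
   at most a multiple of its mass. By duality the mass of the union of the tents is at most
   c \int f^2 for each f admissible for the capacity. The fractional powers are replaced by finite
   sums over dyadic b of b^(2 alpha - n) / (b + A). *)

Require Import Defs.
From HB Require Import structures.
From mathcomp Require Import all_boot all_order all_algebra.
From mathcomp Require Import all_classical all_reals all_analysis.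
From mathcomp Require Import complex ring lra measurable_realfun.
Set Implicit Arguments.
Unset Strict Implicit.
Unset Printing Implicit Defensive.
Import Order.TTheory GRing.Theory Num.Theory.
Import numFieldNormedType.Exports.
Local Open Scope classical_set_scope.
Local Open Scope complex_scope.
Local Open Scope ring_scope.

(** * Integration on the Heisenberg group and on the Siegel domain *)

(** Neither complex logarithms nor complex powers with real exponents enter. With A the Cauchy-Szego
    base, A^-(n + 1 - 2 alpha) is up to a constant the integral of b^(2 alpha - n) / (b + A) against
    db / b, which converges because 0 < 2 alpha - n < 1. Its dyadic sum is a finite combination of
    simple poles, each of positive real part where Re A > 0, so nothing cancels and a single
    well-chosen term bounds the real part from below. This positivity is what the lower bound on
    alpha buys. In the other direction the obstacle is that the mass of a tent may grow without
    control when its ball is enlarged, while the hypothesis sees only disjoint balls. The covering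
    lemma therefore selects balls by the mass of their tents instead of by radius, and never
    enlarges them. The passage from weak to strong type takes place on finite sets of cells, where a
    maximum principle for the kernel replaces a capacitary strong type inequality. Most L^2 pairings
    are bounded by Young's inequality with a free parameter, which makes sense for values in
    [0, +oo]. *)

Lemma ge0_integral_image d1 d2 (T1 : measurableType d1) (T2 : measurableType d2)
    (R : realType) (m : {measure set T1 -> \bar R}) (g : T1 -> T2)
    (mg : measurable_fun [set: T1] g) (f : T2 -> \bar R) :
  measurable_fun [set: T2] f -> (forall x, 0 <= f x)%E ->
  (\int[image_measure m mg]_x f x = \int[m]_x f (g x))%E.
Proof.
move=> mf f0.
have := @ge0_integral_pushforward _ _ _ _ R g mg m setT f measurableT mf
  (fun x _ => f0 x).
rewrite preimage_setT => <-.
by apply: eq_measure_integral.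
Qed.

Section lebesgue_line.
Context {R : realType}.
Local Notation mR := (measurableTypeR R).
Local Notation leb := (@lebesgue_measure R).

Lemma measurable_shiftR (a : R) : measurable_fun [set: mR] (fun x : mR => (x + a : mR)).
Proof. by apply: measurable_funD. Qed.

(** The pushforward of Lebesgue measure under a translation agrees with it on half-open intervals,
    so uniqueness of Lebesgue measure gives equality on all measurable sets. *)
Lemma lebesgue_shift (a : R) (f : mR -> \bar R) : measurable_fun [set: mR] f ->
  (forall x, (0 <= f x)%E) ->
  (\int[leb]_x f (x + a)%R = \int[leb]_x f x)%E.
Proof.
move=> mf f0.
have E : forall A : set mR, measurable A ->
    leb A = pushforward leb (fun x : mR => (x + a : mR)) A.
  have mphi : measurable_fun [set: mR] (fun x : mR => (x + a : mR)) by exact: measurable_shiftR.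
  move=> A mA.
  have := @lebesgue_measure_unique R (image_measure leb mphi).
  move=> /(_ _ A mA); apply.
  move=> _ [[u v] _ <-] /=; rewrite /image_measure /pushforward.
  rewrite (_ : _ @^-1` _ = `]u - a, v - a]%classic); last first.
    by apply/seteqP; split => x /=; rewrite !in_itv/= ltrBlDr lerBrDr.
  rewrite !lebesgue_measure_itv/= !lte_fin ltrD2r; case: ifP => // _.
  by rewrite -!EFinB; congr EFin; ring.
have mphi := measurable_shiftR a.
rewrite -(ge0_integral_image leb mphi mf f0).
by apply: eq_measure_integral => A mA _; exact/esym/E.
Qed.

Lemma tuple0_integral (f : 0.-tuple mR -> \bar R) :
  (forall x, 0 <= f x)%E ->
  (\int[lebesgue_tuple 0]_x f x = f [tuple])%E.
Proof.
move=> f0; rewrite /= integral_dirac//; last first.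
  rewrite (_ : f = cst (f [tuple])); first exact: measurable_cst.
  by apply/funext => x; rewrite tuple0.
by rewrite diracT mul1e.
Qed.

Lemma tonelli_cons N (f : N.+1.-tuple mR -> \bar R) :
  measurable_fun [set: _] f -> (forall x, 0 <= f x)%E ->
  (\int[lebesgue_tuple N.+1]_x f x =
   \int[leb]_a \int[lebesgue_tuple N]_x f [tuple of a :: x])%E.
Proof.
move=> mf f0.
have mc := @measurable_cons_pair R N.
rewrite (@ge0_integral_image _ _ _ _ _ (leb \x lebesgue_tuple N)%E _ mc f mf f0).
rewrite (@fubini_tonelli1 _ _ _ _ _ leb (lebesgue_tuple N) (f \o @cons_pair R N)) //.
  by apply: measurableT_comp.
by move=> x; exact: f0.
Qed.

Lemma measurable_rcons_tuple N d (T : measurableType d) (g : T -> N.-tuple mR) (h : T -> mR) :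
  measurable_fun setT g -> measurable_fun setT h ->
  measurable_fun setT (fun x => [tuple of rcons (g x) (h x)] : N.+1.-tuple mR).
Proof.
move=> /measurable_fun_tnthP mg mh; apply/measurable_fun_tnthP => i.
have [iN|iN] := ltnP i N.
  rewrite (_ : _ \o _ = ((@tnth N mR)^~ (Ordinal iN)) \o g); first exact: mg.
  apply/funext => x /=; rewrite !(tnth_nth 0)/= nth_rcons size_tuple iN//.
rewrite (_ : _ \o _ = h)//.
apply/funext => x /=; rewrite !(tnth_nth 0)/= nth_rcons size_tuple ltnNge iN/=.
by rewrite (_ : i == N :> nat)// eqn_leq iN -ltnS ltn_ord.
Qed.

(** [lebesgue_tuple] is built by adding coordinates in front, whereas t on the Heisenberg group, and
    t and the imaginary part on the Siegel domain, come last. This version integrates them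
    innermost, at fixed horizontal coordinates. *)
Lemma tonelli_rcons N (f : N.+1.-tuple mR -> \bar R) :
  measurable_fun [set: _] f -> (forall x, 0 <= f x)%E ->
  (\int[lebesgue_tuple N.+1]_x f x =
   \int[lebesgue_tuple N]_x \int[leb]_a f [tuple of rcons x a])%E.
Proof.
elim: N f => [|N IH] f mf f0.
  rewrite tonelli_cons// tuple0_integral; last by move=> x; exact: integral_ge0.
  apply: eq_integral => a _; rewrite tuple0_integral//.
  by congr f; exact/val_inj.
rewrite tonelli_cons// [RHS]tonelli_cons.
- apply: eq_integral => a _.
  rewrite (IH (fun x => f [tuple of a :: x])); last by move=> x; exact: f0.
    apply: eq_integral => x _; apply: eq_integral => b _.
    by congr f; exact/val_inj.
  by apply: measurableT_comp => //; exact: measurable_cons.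
- apply: (@measurable_fun_fubini_tonelli_F _ _ _ _ R leb
    (fun p : N.+1.-tuple mR * mR => f [tuple of rcons p.1 p.2])) => //.
  by apply: measurableT_comp => //; exact: measurable_rcons_tuple.
- by move=> x; exact: integral_ge0.
Qed.
End lebesgue_line.
#[local] Opaque lebesgue_tuple.

Lemma continuous_borel_measurable (R : realType) (T : ptopologicalType) (f : T -> R) :
  continuous f -> measurable_fun [set: borel T] (f : borel T -> measurableTypeR R).
Proof.
move=> cf; apply: (measurability (@RGenOInfty.G R)).
  exact: RGenOInfty.measurableE.
move=> _ [_ [a ->] <-]; apply: sub_sigma_algebra; rewrite setTI.
by apply: open_comp => //= x _; exact: cf.
Qed.

Section heis_coordinates.
Variables (R : realType) (n : nat).
Local Notation C := (Cplx R).
Local Notation H := (heis R n).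
Local Notation mR := (measurableTypeR R).

Lemma Re_continuous : continuous (fun z : C => complex.Re z : R).
Proof.
move=> z A /nbhs_ballP[e /= e0 eA].
apply/nbhs_ballP; exists (e%:C : C) => /=; first by rewrite ltcR.
move=> w /= zw; apply: eA; rewrite -ball_normE /=.
rewrite -ltcR; apply: le_lt_trans zw; rewrite -raddfB.
exact: normc_ge_Re.
Qed.

Lemma Im_continuous : continuous (fun z : C => complex.Im z : R).
Proof.
rewrite (_ : (fun z : C => _) = (fun z : C => complex.Re (- ('i * z)) : R)); last first.
  by apply/funext => -[a b] /=; rewrite mul0r mul1r sub0r opprK.
move=> z; apply: (@continuous_comp _ _ _ (fun z : C => - ('i * z)) (fun z : C => complex.Re z : R)).
  by apply: continuousN; apply: mulrl_continuous.
exact: Re_continuous.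
Qed.

(** Indices follow [row_of_seq]: [j.*2] is the real and [j.*2.+1] the imaginary part of the j-th
    complex coordinate. From [n.*2] on [insub] fails and the value is t, so no bound on k has to be
    carried along. *)
Definition heis_coord (y : H) (k : nat) : R :=
  if insub k./2 is Some j then
    if odd k then complex.Im (y.1 0 j) else complex.Re (y.1 0 j)
  else y.2.

Lemma heis_coord_continuous k : continuous (heis_coord^~ k).
Proof.
move=> y; rewrite /heis_coord; case: insubP => [j _ _|_].
  have c1 : {for y, continuous (fun y : H => y.1 0 j : C)}.
    apply: (@continuous_comp _ _ _ (fun y : H => y.1) (fun x : 'rV[C]_n => x 0 j : C)).
      exact: cvg_fst.
    exact: coord_continuous.
  case: odd.
    exact: (@continuous_comp _ _ _ (fun y : H => y.1 0 j : C) _ y c1 (@Im_continuous _)).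
  exact: (@continuous_comp _ _ _ (fun y : H => y.1 0 j : C) _ y c1 (@Re_continuous _)).
exact: cvg_snd.
Qed.

Definition tuple_of_heis (y : borel H) : n.*2.+1.-tuple mR :=
  [tuple (heis_coord y i : mR) | i < n.*2.+1].

Lemma measurable_heis_coord k : measurable_fun [set: borel H] (heis_coord^~ k : borel H -> mR).
Proof. by apply: (@continuous_borel_measurable R H); exact: heis_coord_continuous. Qed.

Lemma measurable_tuple_of_heis : measurable_fun [set: borel H] tuple_of_heis.
Proof.
apply/measurable_fun_tnthP => i.
rewrite (_ : _ \o _ = (heis_coord^~ i : borel H -> mR)); first exact: measurable_heis_coord.
by apply/funext => y /=; rewrite tnth_mktuple.
Qed.

Lemma nth_tuple_of_heis y k : (k < n.*2.+1)%N -> nth 0 (tuple_of_heis y) k = heis_coord y k.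
Proof. by move=> kn; rewrite -(tnth_nth _ _ (Ordinal kn)) tnth_mktuple. Qed.

Lemma tuple_of_heisK : cancel tuple_of_heis (@heis_of_tuple R n).
Proof.
move=> y; rewrite /heis_of_tuple [RHS]surjective_pairing; congr pair.
  apply/rowP => j; rewrite mxE !nth_tuple_of_heis ?ltnS ?ltn_double ?ltn_Sdouble// ?leq_double//; last exact: ltnW.
  rewrite /heis_coord /= uphalf_double odd_double doubleK/= valK.
  by case: (y.1 0 j).
rewrite nth_tuple_of_heis// /heis_coord doubleK insubF// ltnn//.
Qed.

Lemma heis_integralE (f : borel H -> \bar R) : measurable_fun [set: borel H] f ->
  (forall y, 0 <= f y)%E ->
  (\int[@lebesgue_heis R n]_y f y =
    \int[lebesgue_tuple n.*2.+1]_x f (heis_of_tuple x))%E.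
Proof. by move=> mf f0; rewrite /lebesgue_heis; exact: ge0_integral_image. Qed.

Lemma row_of_seq_rcons (s : seq R) a : (n.*2 <= size s)%N ->
  row_of_seq n (rcons s a) = row_of_seq n s :> 'rV[C]_n.
Proof.
move=> sn; apply/rowP => j; rewrite !mxE !nth_rcons.
by rewrite !(leq_trans _ sn)// ?ltn_double ?ltn_Sdouble.
Qed.

Lemma heis_integral_rcons (f : borel H -> \bar R) : measurable_fun [set: borel H] f ->
  (forall y, 0 <= f y)%E ->
  (\int[@lebesgue_heis R n]_y f y =
    \int[lebesgue_tuple n.*2]_u \int[@lebesgue_measure R]_t f (row_of_seq n u : 'rV[C]_n, t : R))%E.
Proof.
move=> mf f0; rewrite heis_integralE//.
rewrite (@tonelli_rcons _ _ (fun x => f (heis_of_tuple x))); last 2 first.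
- by apply: measurableT_comp => //; exact: measurable_heis_of_tuple.
- by move=> x; exact: f0.
apply: eq_integral => u _; apply: eq_integral => t _; congr f.
rewrite /heis_of_tuple /= row_of_seq_rcons ?size_tuple//.
by rewrite nth_rcons size_tuple ltnn eqxx.
Qed.

Lemma Cn1_integral_rcons (f : borel (Cn1 R n) -> \bar R) : measurable_fun [set: borel (Cn1 R n)] f ->
  (forall y, 0 <= f y)%E ->
  (\int[@lebesgue_Cn1 R n]_y f y =
    \int[lebesgue_tuple n.*2]_u \int[@lebesgue_measure R]_t \int[@lebesgue_measure R]_s
       f (row_of_seq n u : 'rV[C]_n, ((t : R) +i* (s : R) : C)))%E.
Proof.
move=> mf f0; rewrite /lebesgue_Cn1 ge0_integral_image//.
rewrite (@tonelli_rcons _ _ (fun x => f (Cn1_of_tuple x))); last 2 first.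
- by apply: measurableT_comp => //; exact: measurable_Cn1_of_tuple.
- by move=> x; exact: f0.
have mg : measurable_fun [set: n.*2.+1.-tuple mR * mR]
    (fun p => f (Cn1_of_tuple [tuple of rcons p.1 p.2])).
  apply: measurableT_comp => //; apply: measurableT_comp; first exact: measurable_Cn1_of_tuple.
  exact: measurable_rcons_tuple.
rewrite (@tonelli_rcons _ _ (fun x => \int[@lebesgue_measure R]_a f (Cn1_of_tuple [tuple of rcons x a]))%E).
- apply: eq_integral => u _; apply: eq_integral => t _; apply: eq_integral => s _; congr f.
  rewrite /Cn1_of_tuple /= !row_of_seq_rcons ?size_rcons ?size_tuple//.
  by rewrite !nth_rcons !size_rcons size_tuple ltnn ltnSn !eqxx/= ltnn.
- exact: (@measurable_fun_fubini_tonelli_F _ _ _ _ R (@lebesgue_measure R) _ mg).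
- by move=> x; exact: integral_ge0.
Qed.
End heis_coordinates.
Arguments heis_coord {R n}.

Section siegel_integral.
Variables (R : realType) (n : nat).
Local Notation C := (Cplx R).
Local Notation H := (heis R n).
Local Notation mR := (measurableTypeR R).
Local Notation leb := (@lebesgue_measure R).

Lemma sqnormE (z : 'rV[C]_n) :
  sqnorm z = \sum_(j < n) (complex.Re (z 0 j) ^+ 2 + complex.Im (z 0 j) ^+ 2).
Proof.
apply: eq_bigr => j _; case: (z 0 j) => a b /=.
by rewrite sqr_sqrtr// addr_ge0// sqr_ge0.
Qed.

Lemma heis_coordRe (y : H) (j : 'I_n) : heis_coord y j.*2 = complex.Re (y.1 0 j).
Proof. by rewrite /heis_coord odd_double doubleK valK. Qed.

Lemma heis_coordIm (y : H) (j : 'I_n) : heis_coord y j.*2.+1 = complex.Im (y.1 0 j).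
Proof. by rewrite /heis_coord /= uphalf_double odd_double valK. Qed.

Lemma heis_coordT (y : H) : heis_coord y n.*2 = y.2.
Proof. by rewrite /heis_coord doubleK insubF// ltnn. Qed.

Lemma measurable_heis_Re d (T : measurableType d) (f : T -> borel H) j :
  measurable_fun [set: T] f -> measurable_fun [set: T] (fun x => complex.Re ((f x).1 0 j) : mR).
Proof.
move=> mf; rewrite (_ : (fun _ => _) = (heis_coord^~ (j : 'I_n).*2 : borel H -> mR) \o f).
  by apply: measurableT_comp => //; exact: measurable_heis_coord.
by apply/funext => x /=; rewrite heis_coordRe.
Qed.

Lemma measurable_heis_Im d (T : measurableType d) (f : T -> borel H) j :
  measurable_fun [set: T] f -> measurable_fun [set: T] (fun x => complex.Im ((f x).1 0 j) : mR).
Proof.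
move=> mf; rewrite (_ : (fun _ => _) = (heis_coord^~ (j : 'I_n).*2.+1 : borel H -> mR) \o f).
  by apply: measurableT_comp => //; exact: measurable_heis_coord.
by apply/funext => x /=; rewrite heis_coordIm.
Qed.

Lemma measurable_heis_t d (T : measurableType d) (f : T -> borel H) :
  measurable_fun [set: T] f -> measurable_fun [set: T] (fun x => (f x).2 : mR).
Proof.
move=> mf; rewrite (_ : (fun _ => _) = (heis_coord^~ n.*2 : borel H -> mR) \o f).
  by apply: measurableT_comp => //; exact: measurable_heis_coord.
by apply/funext => x /=; rewrite heis_coordT.
Qed.

Lemma measurable_heis_sqnorm d (T : measurableType d) (f : T -> borel H) :
  measurable_fun [set: T] f -> measurable_fun [set: T] (fun x => sqnorm (f x).1 : mR).
Proof.
move=> mf; rewrite (_ : (fun _ => _) = (fun x => \sum_(j < n)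
  (complex.Re ((f x).1 0 j) ^+ 2 + complex.Im ((f x).1 0 j) ^+ 2)) :> (T -> R)); last first.
  by apply/funext => x; rewrite sqnormE.
apply: measurable_sum => j; apply: measurable_funD; apply: measurable_funX.
  exact: measurable_heis_Re.
exact: measurable_heis_Im.
Qed.

Lemma measurable_Psi_inv d (T : measurableType d) (f : T -> borel H) (g : T -> mR) :
  measurable_fun [set: T] f -> measurable_fun [set: T] g ->
  measurable_fun [set: T] (fun x => Psi_inv (f x : H) (g x : R) : borel (Cn1 R n)).
Proof.
move=> mf mg.
(* Measurability into the Borel space of C^n x C is obtained by factoring through a tuple of real
   coordinates, each of which is plainly measurable. *)
pose v x : n.*2.+2.-tuple mR := [tuple of rcons
  (tuple_of_heis (f x)) (4^-1 * sqnorm (f x).1 + g x : mR)].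
have mv : measurable_fun [set: T] v.
  apply: measurable_rcons_tuple.
    by apply: measurableT_comp => //; exact: measurable_tuple_of_heis.
  apply: measurable_funD => //; apply: measurable_funM => //.
  exact: measurable_heis_sqnorm.
rewrite (_ : (fun _ => _) = (@Cn1_of_tuple R n) \o v).
  by apply: measurableT_comp => //; exact: measurable_Cn1_of_tuple.
apply/funext => x; rewrite [LHS]/Psi_inv [RHS]/Cn1_of_tuple.
rewrite [tval (v x)]/(rcons (tuple_of_heis (f x)) _).
rewrite row_of_seq_rcons ?size_tuple//.
rewrite !nth_rcons !size_tuple ltnSn ltnn eqxx.
rewrite nth_tuple_of_heis// heis_coordT; congr pair.
by have /(congr1 fst) := tuple_of_heisK (f x).
Qed.

Lemma sqnorm_continuous : continuous (@sqnorm R n).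
Proof.
rewrite (_ : @sqnorm R n = (fun z => \sum_(j < n)
  (complex.Re (z 0 j) ^+ 2 + complex.Im (z 0 j) ^+ 2)) :> ('rV[C]_n -> R)); last first.
  by apply/funext => x; rewrite sqnormE.
apply: (@continuous_big R^o) => [|j _ z]; first exact: add_continuous.
have c1 : {for z, continuous (fun x : 'rV[C]_n => x 0 j : C)} by exact: coord_continuous.
have c2 := @continuous_comp _ _ _ (fun x : 'rV[C]_n => x 0 j : C) _ z c1 (@Re_continuous _ _).
have c3 := @continuous_comp _ _ _ (fun x : 'rV[C]_n => x 0 j : C) _ z c1 (@Im_continuous _ _).
exact: (cvgD (cvgM c2 c2) (cvgM c3 c3)).
Qed.

Lemma rho_continuous : continuous (@rho R n).
Proof.
move=> z; apply: (@cvgB _ R^o).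
  apply: (@continuous_comp _ _ _ (fun z : Cn1 R n => z.2) (fun x : C => complex.Im x : R)).
    exact: cvg_snd.
  exact: Im_continuous.
apply: (@cvgM R); first exact: cvg_cst.
apply: (@continuous_comp _ _ _ (fun z : Cn1 R n => z.1) (@sqnorm R n)).
  exact: cvg_fst.
exact: sqnorm_continuous.
Qed.

Lemma siegel_open : open (@siegel R n).
Proof.
rewrite (_ : @siegel R n = @rho R n @^-1` [set x | 0 < x]); last by [].
apply: open_comp; last exact: open_gt.
by move=> z _; exact: rho_continuous.
Qed.

Lemma measurable_siegel : measurable (@siegel R n : set (borel (Cn1 R n))).
Proof. by apply: sub_sigma_algebra; exact: siegel_open. Qed.

Lemma rho_Psi_inv (y : H) (h : R) : rho (Psi_inv y h) = h.
Proof. by rewrite /rho /Psi_inv /= addrC addKr. Qed.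

(** At fixed (z, t) the passage from the height to the imaginary part is a translation by |z|^2 / 4,
    so the coordinates of [Psi_inv] have Jacobian 1, and rho becomes the height s. *)
Lemma siegel_integral (f : borel (Cn1 R n) -> \bar R) :
  measurable_fun (@siegel R n : set (borel (Cn1 R n))) f ->
  (forall z, siegel z -> 0 <= f z)%E ->
  (\int[@lebesgue_Cn1 R n]_(z in @siegel R n) f z =
   \int[@lebesgue_heis R n]_y \int[leb]_(s in `]0%R, +oo[) f (Psi_inv (y : H) (s : R)))%E.
Proof.
move=> mf f0; rewrite integral_mkcond.
have mS := measurable_siegel.
set g := f \_ (@siegel R n).
have mg : measurable_fun [set: borel (Cn1 R n)] g by apply/(measurable_restrictT _ mS).
have g0 z : (0 <= g z)%E by rewrite /g /patch; case: ifPn => //; rewrite inE; exact: f0.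
have mgP : measurable_fun [set: borel H * mR] (fun p => g (Psi_inv (p.1 : H) (p.2 : R))).
  apply: (measurableT_comp mg (measurable_Psi_inv _ _)).
    exact: measurable_fst.
  exact: measurable_snd.
have E y : (\int[leb]_(s in `]0%R, +oo[) f (Psi_inv (y : H) (s : R)) =
     \int[leb]_s g (Psi_inv (y : H) (s : R)))%E.
  rewrite integral_mkcond; apply: eq_integral => s _.
  rewrite /g /patch; congr (if _ then _ else _).
  by apply/idP/idP; rewrite !inE/= in_itv/= andbT /siegel/= rho_Psi_inv.
transitivity (\int[@lebesgue_heis R n]_y \int[leb]_s g (Psi_inv (y : H) (s : R)))%E; last first.
  by apply: eq_integral => y _; rewrite E.
rewrite Cn1_integral_rcons// heis_integral_rcons; last 2 first.
- exact: (@measurable_fun_fubini_tonelli_F _ _ _ _ R leb _ mgP).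
- by move=> y; exact: integral_ge0.
apply: eq_integral => u _; apply: eq_integral => t _.
pose a : R := 4^-1 * sqnorm (row_of_seq n u : 'rV[C]_n).
rewrite -(@lebesgue_shift _ a (fun s => g (row_of_seq n u, (t : R) +i* (s : R)))).
- by apply: eq_integral => s _; rewrite /Psi_inv /= [(s + a)%R]addrC.
- pose w (s : mR) : borel (Cn1 R n) := Psi_inv (row_of_seq n u, t : R) (s - a).
  have mw : measurable_fun [set: mR] w.
    by apply: measurable_Psi_inv => //; exact: measurable_funB.
  have := measurableT_comp mg mw; congr measurable_fun; apply/funext => s.
  by rewrite /w /Psi_inv /= addrC subrK.
- by move=> s; exact: g0.
Qed.
End siegel_integral.

(** * The metric of the Heisenberg group *)

Section heis_metric.
Variables (R : realType) (n : nat).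
Local Notation C := (Cplx R).
Local Notation H := (heis R n).
Implicit Types (x y w : H) (u v : 'rV[C]_n).

Definition hre u v : R := \sum_(j < n)
  (complex.Re (u 0 j) * complex.Re (v 0 j) + complex.Im (u 0 j) * complex.Im (v 0 j)).

Definition him u v : R := \sum_(j < n)
  (complex.Im (u 0 j) * complex.Re (v 0 j) - complex.Re (u 0 j) * complex.Im (v 0 j)).

Lemma hdotE u v : hdot u v = (hre u v +i* him u v : C).
Proof.
apply/eqP; rewrite eq_complex /hdot /hre /him; apply/andP; split; apply/eqP => /=.
  rewrite raddf_sum/=; apply: eq_bigr => j _.
  by case: (u 0 j) => a b; case: (v 0 j) => c d /=; ring.
rewrite raddf_sum/=; apply: eq_bigr => j _.
by case: (u 0 j) => a b; case: (v 0 j) => c d /=; ring.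
Qed.

(* The last coordinate of [hmul x (hinv y)]. *)
Definition htau x y : R := x.2 - y.2 + 2^-1 * him x.1 y.1.

Lemma himN u v : him u (- v) = - him u v.
Proof.
rewrite /him -sumrN; apply: eq_bigr => j _; rewrite !mxE.
by case: (u 0 j) => a b; case: (v 0 j) => c d /=; ring.
Qed.

Lemma himC u v : him v u = - him u v.
Proof. by rewrite /him -sumrN; apply: eq_bigr => j _; ring. Qed.

Lemma sqnorm_ge0 u : 0 <= sqnorm u.
Proof. by apply: sumr_ge0 => j _; exact: sqr_ge0. Qed.

Lemma sqnormB u v : sqnorm (u - v) = sqnorm u + sqnorm v - 2 * hre u v.
Proof.
rewrite !sqnormE /hre mulr_sumr -big_split -sumrB; apply: eq_bigr => j _ /=; rewrite !mxE.
by case: (u 0 j) => a b; case: (v 0 j) => c d /=; ring.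
Qed.

Lemma sqnormBC u v : sqnorm (u - v) = sqnorm (v - u).
Proof.
rewrite !sqnormB; congr (_ - 2 * _); first by rewrite addrC.
by apply: eq_bigr => j _; ring.
Qed.

Lemma hdistE x y :
  hdist x y = (16^-1 * sqnorm (x.1 - y.1) ^+ 2 + htau x y ^+ 2) `^ 4^-1.
Proof.
rewrite /hdist /hgauge /hmul /hinv /= hdotE /= himN /htau.
by congr (_ `^ _); congr (_ + _ ^+ 2); ring.
Qed.

Lemma hdist_ge0 x y : 0 <= hdist x y.
Proof. exact: powR_ge0. Qed.

Lemma hgauge_sq_ge0 x y : 0 <= 16^-1 * sqnorm (x.1 - y.1) ^+ 2 + htau x y ^+ 2.
Proof. by rewrite addr_ge0 ?sqr_ge0// mulr_ge0 ?sqr_ge0// invr_ge0. Qed.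

Lemma hdist_pow4 x y :
  (hdist x y ^+ 2) ^+ 2 = 16^-1 * sqnorm (x.1 - y.1) ^+ 2 + htau x y ^+ 2.
Proof.
rewrite -exprM hdistE -powR_mulrn ?powR_ge0// -powRrM.
by rewrite (_ : 4^-1 * (2 * 2)%:R = 1 :> R) ?powRr1 ?hgauge_sq_ge0//; field.
Qed.

Lemma sqnorm_le_hdist x y : 4^-1 * sqnorm (x.1 - y.1) <= hdist x y ^+ 2.
Proof.
rewrite -ler_sqr ?nnegrE ?sqr_ge0 ?mulr_ge0 ?invr_ge0 ?sqnorm_ge0// hdist_pow4.
by rewrite exprMn (_ : 4^-1 ^+ 2 = 16^-1) ?lerDl ?sqr_ge0//; field.
Qed.

Lemma htau_le_hdist x y : `|htau x y| <= hdist x y ^+ 2.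
Proof.
rewrite -ler_sqr ?nnegrE ?sqr_ge0// hdist_pow4 real_normK ?num_real//.
by rewrite lerDr mulr_ge0 ?sqr_ge0// invr_ge0.
Qed.

Lemma hdist_sq_le x y :
  hdist x y ^+ 2 <= 4^-1 * sqnorm (x.1 - y.1) + `|htau x y|.
Proof.
rewrite -ler_sqr ?nnegrE ?sqr_ge0 ?addr_ge0 ?mulr_ge0 ?invr_ge0 ?sqnorm_ge0//.
have E : `|htau x y| ^+ 2 = htau x y ^+ 2 by rewrite real_normK ?num_real.
have := normr_ge0 (htau x y); have := sqnorm_ge0 (x.1 - y.1).
by rewrite hdist_pow4 -E; nra.
Qed.

Lemma hdistxx x : hdist x x = 0.
Proof.
rewrite hdistE /htau !subrr (_ : sqnorm _ = 0).
  rewrite (_ : him _ _ = 0) ?mulr0 ?addr0 ?expr0n/= ?mulr0 ?addr0 ?powR0 ?invr_eq0//.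
  by apply: big1 => j _; ring.
by rewrite sqnormE big1// => j _; rewrite mxE /= expr0n/= addr0.
Qed.

Lemma hdistC x y : hdist x y = hdist y x.
Proof.
rewrite !hdistE sqnormBC; congr ((_ + _) `^ _).
by rewrite /htau [him y.1 _]himC; ring.
Qed.

(** [key t] says that u - t (u.v) v has nonnegative squared norm, where u.v is [hdot u v]; the claim
    is the case t = 1 / |v|^2. *)
Lemma hdot_cauchy_schwarz u v :
  hre u v ^+ 2 + him u v ^+ 2 <= sqnorm u * sqnorm v.
Proof.
set P := hre u v; set Q := him u v; set W := P ^+ 2 + Q ^+ 2.
have W0 : 0 <= W by rewrite addr_ge0 ?sqr_ge0.
have key t : 0 <= sqnorm u - 2 * t * W + t ^+ 2 * W * sqnorm v.
  pose a := t * P; pose b := t * Q.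
  rewrite (_ : _ + _ = \sum_(j < n)
    ((complex.Re (u 0 j) - a * complex.Re (v 0 j) + b * complex.Im (v 0 j)) ^+ 2 +
     (complex.Im (u 0 j) - a * complex.Im (v 0 j) - b * complex.Re (v 0 j)) ^+ 2)).
    by apply: sumr_ge0 => j _; rewrite addr_ge0 ?sqr_ge0.
  rewrite (_ : sqnorm u - _ + _ = sqnorm u - 2 * (a * P + b * Q) + (a ^+ 2 + b ^+ 2) * sqnorm v); last first.
    by rewrite /a /b /W; ring.
  clearbody a b; rewrite !sqnormE /P /Q /hre /him mulrDr !mulrA !mulr_sumr -big_split /= -sumrB -big_split /=.
  by apply: eq_bigr => j _; ring.
have [v0|v0] := eqVneq (sqnorm v) 0.
  (* For v = 0 the quantity in [key] is affine in t with slope -2 W, and it is negative at the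
     chosen t if W > 0. *)
  rewrite v0 mulr0 leNgt; apply/negP => Wgt.
  have := key ((sqnorm u + 1) / W); rewrite v0 mulr0 addr0.
  rewrite (_ : 2 * _ * W = 2 * (sqnorm u + 1)); last by field; rewrite gt_eqF.
  by have := sqnorm_ge0 u; lra.
have vgt : 0 < sqnorm v by rewrite lt_def v0 sqnorm_ge0.
have := key (sqnorm v)^-1.
rewrite (_ : _ + _ = sqnorm u - W / sqnorm v); last by field.
by rewrite subr_ge0 ler_pdivrMr.
Qed.

(** The triangle inequality of the plane for (a, p) and (b, q), with lengths replaced by upper
    bounds A and B so that no square root has to be taken. *)
Lemma minkowski2 (a b p q A B : R) : 0 <= A -> 0 <= B ->
  a ^+ 2 + p ^+ 2 <= A ^+ 2 -> b ^+ 2 + q ^+ 2 <= B ^+ 2 ->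
  (a + b) ^+ 2 + (p + q) ^+ 2 <= (A + B) ^+ 2.
Proof.
move=> A0 B0 hA hB.
suff : a * b + p * q <= A * B by nra.
have [|neg] := ltP 0 (a * b + p * q); last by rewrite (le_trans neg)// mulr_ge0.
move=> /ltW pos; rewrite -ler_sqr ?nnegrE ?mulr_ge0// [leRHS]exprMn.
apply: (@le_trans _ _ ((a ^+ 2 + p ^+ 2) * (b ^+ 2 + q ^+ 2))).
  by have := sqr_ge0 (a * q - b * p); lra.
by apply: ler_pM => //; rewrite addr_ge0 ?sqr_ge0.
Qed.

(** This is the last coordinate of x w^-1 = (x y^-1) (y w^-1); the correction is the twist of the
    group law. *)
Lemma htau_cocycle x y w :
  htau x w = htau x y + htau y w - 2^-1 * him (x.1 - y.1) (y.1 - w.1).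
Proof.
rewrite /htau.
suff -> : him (x.1 - y.1) (y.1 - w.1) = him x.1 y.1 - him x.1 w.1 + him y.1 w.1 by ring.
rewrite /him -sumrB -big_split; apply: eq_bigr => j _ /=; rewrite !mxE.
by case: (x.1 0 j) => a b; case: (y.1 0 j) => c d; case: (w.1 0 j) => e f /=; ring.
Qed.

(** The squared distance is the length of the planar vector (|z|^2 / 4, tau). Composing two
    increments with horizontal parts u and v adds their vectors and a third one, (hre u v, - him u
    v) / 2, of length at most |u| |v| / 2 <= 2 a b; hence d^2 <= a^2 + b^2 + 2 a b. *)
Lemma hdist_triangle x y w : hdist x w <= hdist x y + hdist y w.
Proof.
set a := hdist x y; set b := hdist y w.
have a0 : 0 <= a := hdist_ge0 x y.
have b0 : 0 <= b := hdist_ge0 y w.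
rewrite -ler_sqr ?nnegrE ?hdist_ge0 ?addr_ge0//.
rewrite -ler_sqr ?nnegrE ?sqr_ge0// hdist_pow4.
set u := x.1 - y.1; set v := y.1 - w.1.
have uv : sqnorm (x.1 - w.1) = sqnorm u + sqnorm v + 2 * hre u v.
  rewrite (_ : x.1 - w.1 = u - (- v)); last by rewrite /u /v opprK addrA subrK.
  rewrite sqnormB (_ : sqnorm (- v) = sqnorm v); last first.
    by rewrite !sqnormE; apply: eq_bigr => j _; rewrite mxE; case: (v 0 j) => c d /=; ring.
  rewrite (_ : hre u (- v) = - hre u v) ?mulrN ?opprK//.
  rewrite /hre -sumrN; apply: eq_bigr => j _; rewrite [(- v) _ _]mxE.
  by case: (v 0 j) => c d /=; ring.
have E1 := hdist_pow4 x y; have E2 := hdist_pow4 y w.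
rewrite -/a -/u in E1; rewrite -/b -/v in E2.
have CS := hdot_cauchy_schwarz u v.
have Su := sqnorm_le_hdist x y; have Sv := sqnorm_le_hdist y w.
rewrite -/a -/u in Su; rewrite -/b -/v in Sv.
have u0 := sqnorm_ge0 u; have v0 := sqnorm_ge0 v.
have h1 : (4^-1 * sqnorm u) ^+ 2 + htau x y ^+ 2 <= (a ^+ 2) ^+ 2 by rewrite E1 le_eqVlt; apply/orP; left; apply/eqP; field.
have h2 : (4^-1 * sqnorm v) ^+ 2 + htau y w ^+ 2 <= (b ^+ 2) ^+ 2 by rewrite E2 le_eqVlt; apply/orP; left; apply/eqP; field.
have h3 : (2^-1 * hre u v) ^+ 2 + (- (2^-1 * him u v)) ^+ 2 <= (2 * a * b) ^+ 2.
  have : sqnorm u * sqnorm v <= (4 * a ^+ 2) * (4 * b ^+ 2).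
    apply: ler_pM; [exact: u0|exact: v0| |].
      by clear -Su; lra.
    by clear -Sv; lra.
  by clear -CS; lra.
have h12 := minkowski2 (sqr_ge0 a) (sqr_ge0 b) h1 h2.
have h := minkowski2 (addr_ge0 (sqr_ge0 a) (sqr_ge0 b)) (mulr_ge0 (mulr_ge0 (ler0n _ 2) a0) b0) h12 h3.
rewrite uv (htau_cocycle x y w) -/u -/v.
rewrite (_ : (a + b) ^+ 2 = a ^+ 2 + b ^+ 2 + 2 * a * b); last by ring.
apply: le_trans h; rewrite le_eqVlt; apply/orP; left; apply/eqP.
by field.
Qed.
End heis_metric.

Section heis_balls.
Variables (R : realType) (n : nat).
Local Notation C := (Cplx R).
Local Notation H := (heis R n).
Local Notation mR := (measurableTypeR R).
Local Notation leb := (@lebesgue_measure R).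
Local Notation lam := (@lebesgue_heis R n).

(** The vertical condition is imposed on [htau] and not on the difference of the last coordinates:
    at fixed horizontal part it still describes an interval of length [2 * B], so the volume is that
    of a Euclidean box, and the box compares directly with gauge balls. *)
Definition hbox (x : H) (A B : R) : set (borel H) :=
  [set y : H | (forall k, (k < n.*2)%N -> `|heis_coord y k - heis_coord x k| < A)
          /\ `|htau x y| < B].

Lemma measurable_htau d (T : measurableType d) (f g : T -> borel H) :
  measurable_fun [set: T] f -> measurable_fun [set: T] g ->
  measurable_fun [set: T] (fun a => htau (f a : H) (g a : H) : mR).
Proof.
move=> mf mg; apply: measurable_funD.
  by apply: measurable_funB; exact: measurable_heis_t.
apply: measurable_funM => //; apply: measurable_sum => j.
apply: measurable_funB; apply: measurable_funM;
  by [exact: measurable_heis_Re | exact: measurable_heis_Im].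
Qed.

Lemma measurable_hdist d (T : measurableType d) (f g : T -> borel H) :
  measurable_fun [set: T] f -> measurable_fun [set: T] g ->
  measurable_fun [set: T] (fun a => hdist (f a : H) (g a : H) : mR).
Proof.
move=> mf mg; rewrite (_ : (fun _ => _) = (fun a => (16^-1 * (\sum_(j < n)
  ((complex.Re ((f a).1 0 j) - complex.Re ((g a).1 0 j)) ^+ 2 +
   (complex.Im ((f a).1 0 j) - complex.Im ((g a).1 0 j)) ^+ 2)) ^+ 2 +
   htau (f a : H) (g a : H) ^+ 2) `^ 4^-1) :> (T -> R)); last first.
  apply/funext => a; rewrite hdistE sqnormE; congr ((16^-1 * _ ^+ 2 + _) `^ _).
  apply: eq_bigr => j _; rewrite !mxE.
  by case: ((f a).1 0 j) => p q; case: ((g a).1 0 j) => r s /=.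
apply: (measurableT_comp (@measurable_powR R 4^-1)).
apply: measurable_funD; last by apply: measurable_funX; exact: measurable_htau.
apply: measurable_funM => //; apply: measurable_funX; apply: measurable_sum => j.
apply: measurable_funD; apply: measurable_funX; apply: measurable_funB;
  by [exact: measurable_heis_Re | exact: measurable_heis_Im].
Qed.

Lemma measurable_hball (x : H) r : measurable (hball x r : set (borel H)).
Proof.
rewrite (_ : hball x r = (fun y : borel H => hdist x (y : H) : mR) @^-1` `]-oo, r[).
  rewrite -[X in measurable X]setTI.
  apply: (measurable_hdist (measurable_cst _) (@measurable_id _ _ _)) => //.
by apply/seteqP; split => y /=; rewrite in_itv.
Qed.

Lemma measurable_hbox x A B : measurable (hbox x A B).
Proof.
rewrite (_ : hbox x A B = (\bigcap_(k in [set: 'I_n.*2])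
   ((fun y : borel H => heis_coord y k : mR) @^-1` `](heis_coord x k - A), (heis_coord x k + A)[))
   `&` ((fun y : borel H => htau x (y : H) : mR) @^-1` `](-B), B[)); last first.
  apply/seteqP; split => y /=.
    move=> [h1 h2]; split.
      by move=> k _ /=; rewrite in_itv/= -ltr_distl; exact: h1.
    by rewrite in_itv/= -ltr_norml.
  move=> [h1 h2]; split; last by move: h2; rewrite in_itv/= -ltr_norml.
  move=> k kn; have /= := h1 (Ordinal kn) Logic.I.
  by rewrite in_itv/= -ltr_distl.
apply: measurableI.
  apply: fin_bigcap_measurable => // k _.
  rewrite -[X in measurable X]setTI; apply: measurable_heis_coord => //.
rewrite -[X in measurable X]setTI.
by apply: (measurable_htau (measurable_cst _) (@measurable_id _ _ _)).
Qed.

Lemma lebesgue_itv_center (c A : R) : 0 <= A ->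
  leb `](c - A), (c + A)[%classic = (2 * A)%:E.
Proof.
move=> A0; rewrite lebesgue_measure_itv/= lte_fin.
case: ltP => [_|h]; first by rewrite -EFinB; congr EFin; ring.
by rewrite (_ : A = 0) ?mulr0//; lra.
Qed.

Lemma heis_coord_row (u : n.*2.-tuple mR) (t : R) k : (k < n.*2)%N ->
  heis_coord (row_of_seq n u, t : R) k = nth 0 u k.
Proof.
move=> kn; have k2 : (k./2 < n)%N.
  by rewrite -ltn_double (leq_ltn_trans _ kn)// -[leqRHS](odd_double_half k) leq_addl.
rewrite /heis_coord insubT /= mxE /=.
by rewrite -[in RHS](odd_double_half k); case: (odd k) => /=; rewrite ?add1n ?add0n.
Qed.

Lemma heis_coord_sqnorm (x y : H) k : (k < n.*2)%N ->
  (heis_coord y k - heis_coord x k) ^+ 2 <= sqnorm (x.1 - y.1).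
Proof.
move=> kn; have k2 : (k./2 < n)%N.
  by rewrite -ltn_double (leq_ltn_trans _ kn)// -[leqRHS](odd_double_half k) leq_addl.
rewrite sqnormE (bigD1 (Ordinal k2))//= !mxE /heis_coord !insubT /=.
apply: ler_wpDr; first by apply: sumr_ge0 => j _; rewrite addr_ge0 ?sqr_ge0.
case: (x.1 0 _) => p q; case: (y.1 0 _) => p' q' /=.
have := sqr_ge0 (p - p'); have := sqr_ge0 (q - q').
by case: (odd k); lra.
Qed.

Lemma hbox_volume x (A B : R) : 0 <= A -> 0 <= B ->
  lam (hbox x A B) = ((2 * A) ^+ n.*2 * (2 * B))%:E.
Proof.
move=> A0 B0.
have mB := measurable_hbox x A B.
transitivity (\int[lam]_y (\1_(hbox x A B) y)%:E)%E.
  by rewrite integral_indic// setIT.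
pose Q : set (n.*2.-tuple mR) := [set u | forall i : 'I_n.*2,
  `](heis_coord x i - A), (heis_coord x i + A)[%classic (tnth u i)].
have mQ : measurable Q.
  rewrite (_ : Q = \bigcap_(i in [set: 'I_n.*2]) ((fun u => tnth u i) @^-1`
     `](heis_coord x i - A), (heis_coord x i + A)[)); last first.
    by apply/seteqP; split => u /= h i => [_|]; apply: h.
  apply: fin_bigcap_measurable => // i _.
  by rewrite -[X in measurable X]setTI; apply: measurable_tnth => //; exact: measurable_itv.
rewrite heis_integral_rcons; last 2 first.
- by apply/measurable_EFinP; exact: measurable_indic.
- by move=> y; rewrite lee_fin.
transitivity (\int[lebesgue_tuple n.*2]_u ((2 * B)%:E * (\1_Q u)%:E))%E.
  apply: eq_integral => u _.
  (* The twist only moves the centre of the t-interval. *)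
  pose s : R := x.2 + 2^-1 * him x.1 (row_of_seq n u).
  transitivity (\int[leb]_t ((\1_Q u)%:E * (\1_(`](s - B), (s + B)[%classic : set mR) t)%:E))%E.
    apply: eq_integral => t _; rewrite -EFinM; congr EFin.
    rewrite !indicE -natrM mulnb; congr (_%:R); congr nat_of_bool.
    have tauE : htau x (row_of_seq n u, t : R) = s - t by rewrite /htau /s /=; ring.
    apply/idP/andP; rewrite !inE /hbox /Q /= in_itv /= -ltr_distl distrC tauE.
      move=> [h1 h2]; split => // i; rewrite in_itv/= -ltr_distl.
      by rewrite (tnth_nth 0) -(@heis_coord_row _ t)//; apply: h1.
    move=> [h1 h2]; split => // k kn.
    have := h1 (Ordinal kn); rewrite in_itv/= -ltr_distl.
    by rewrite (tnth_nth 0) -(@heis_coord_row _ t).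
  rewrite ge0_integralZl//; last first.
  - by apply/measurable_EFinP; exact: measurable_indic.
  rewrite [X in (_ * X)%E](_ : _ = (2 * B)%:E) 1?muleC//.
  rewrite (integral_indic _ measurableT) ?setIT; last exact: measurable_itv.
  exact: lebesgue_itv_center.
rewrite ge0_integralZl//; last 2 first.
- by apply/measurable_EFinP; exact: measurable_indic.
- by rewrite lee_fin mulr_ge0.
rewrite (integral_indic _ measurableT)// setIT.
transitivity ((2 * B)%:E * (\prod_(i < n.*2)
    leb `](heis_coord x i - A)%R, (heis_coord x i + A)%R[%classic))%E.
  congr (_ * _)%E.
  apply: (@lebesgue_tuple_box R n.*2 (fun i => `](heis_coord x i - A), (heis_coord x i + A)[%classic)).
  by move=> i; exact: measurable_itv.
rewrite (eq_bigr (fun=> (2 * A)%:E)); last by move=> i _; rewrite lebesgue_itv_center.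
by rewrite prodEFin prodr_const card_ord -EFinM mulrC.
Qed.

(** A ball of radius r lies between two boxes with half-sides proportional to r horizontally and to
    r^2 vertically. The homogeneous dimension 2 n + 2 is written as [(r ^+ 2) ^+ n.+1] because the
    later estimates use squared distances. *)
Lemma hball_volume : exists c C0 : R, [/\ 0 < c, 0 < C0 &
  forall (x : H) (r : R), 0 < r -> ((c * (r ^+ 2) ^+ n.+1)%:E <= lam (hball x r))%E /\
     (lam (hball x r) <= (C0 * (r ^+ 2) ^+ n.+1)%:E)%E].
Proof.
exists ((2 / n.+1%:R) ^+ n.*2), (4 ^+ n.*2 * 2); split.
- by rewrite exprn_gt0.
- by rewrite mulr_gt0// exprn_gt0.
move=> x r r0; have r0' := ltW r0; split.
  (* With this A one has n A^2 <= r^2, so inside the box |z|^2 / 4 is at most r^2 / 2, and [htau]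
     stays below the remaining r^2 / 2. *)
  pose A := r / n.+1%:R; pose B := r ^+ 2 / 2.
  have A0 : 0 <= A by rewrite divr_ge0.
  have B0 : 0 <= B by rewrite divr_ge0// sqr_ge0.
  rewrite (_ : _ * _ = (2 * A) ^+ n.*2 * (2 * B)); last first.
    rewrite /A /B [2 * (r ^+ 2 / 2)]mulrC divfK// exprS mulrCA [RHS]mulrC; congr (_ * _).
    by rewrite -[n.*2]mul2n !exprM -exprMn; congr (_ ^+ n); field.
  rewrite -(hbox_volume x A0 B0); apply: le_measure; rewrite ?inE.
  - exact: measurable_hbox.
  - exact: measurable_hball.
  move=> y [h1 h2]; rewrite /hball /=.
  rewrite -ltr_sqr ?nnegrE ?hdist_ge0//.
  apply: (le_lt_trans (hdist_sq_le x y)).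
  have : sqnorm (x.1 - y.1) <= 2 * n%:R * A ^+ 2.
    rewrite sqnormE (_ : 2 * _ * _ = \sum_(j < n) (2 * A ^+ 2)); last first.
      by rewrite sumr_const card_ord -mulr_natl; ring.
    apply: ler_sum => j _; rewrite !mxE.
    have := h1 j.*2; have := h1 j.*2.+1; rewrite ltn_double ltn_Sdouble ltn_ord.
    move=> /(_ isT) h3 /(_ isT); move: h3.
    rewrite !heis_coordRe !heis_coordIm.
    case: (x.1 0 j) => p q; case: (y.1 0 j) => p' q' /=.
    rewrite !ltr_norml => /andP[a1 a2] /andP[a3 a4].
    nra.
  have nA : n%:R * A ^+ 2 <= r ^+ 2.
    have -> : r = A * (n%:R + 1) by rewrite /A -natr1 divfK// natr1 pnatr_eq0.
    have h1' := mulr_ge0 (sqr_ge0 A) (ler0n R n).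
    have h2' := mulr_ge0 h1' (ler0n R n); have := sqr_ge0 A.
    by lra.
  by move: h2; rewrite /B; lra.
(* Each real coordinate differs by at most |z| <= 2 d < 2 r. *)
pose A := 2 * r; pose B := r ^+ 2.
have A0 : 0 <= A by rewrite mulr_ge0.
have B0 : 0 <= B by rewrite sqr_ge0.
rewrite (_ : _ * _ = (2 * A) ^+ n.*2 * (2 * B)); last first.
  have -> : 2 * A = 4 * r by rewrite /A; ring.
  have E : r ^+ n.*2 = (r ^+ 2) ^+ n by rewrite -mul2n exprM.
  by rewrite /B [(4 * r) ^+ _]exprMn E [_ ^+ n.+1]exprS; ring.
rewrite -(hbox_volume x A0 B0); apply: le_measure; rewrite ?inE.
- exact: measurable_hball.
- exact: measurable_hbox.
move=> y; rewrite /hball /= => xy.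
have xy2 : hdist x y ^+ 2 < r ^+ 2 by rewrite ltr_sqr ?nnegrE ?hdist_ge0.
split; last by apply: le_lt_trans xy2; exact: htau_le_hdist.
move=> k kn; rewrite -ltr_sqr ?nnegrE// real_normK ?num_real//.
apply: (le_lt_trans (heis_coord_sqnorm x y kn)).
by have := sqnorm_le_hdist x y; move: xy2; rewrite /A; lra.
Qed.
End heis_balls.

(** * Regularised Riesz potentials *)

Section growth_integral.
Context {R : realType}.

Lemma powR_pow2 (k : nat) (x : R) : (2 ^+ k) `^ x = (2 `^ x) ^+ k.
Proof.
by rewrite -powR_mulrn// -powRrM mulrC powRrM powR_mulrn// powR_ge0.
Qed.

Lemma dyadic_bracket (t : R) : 1 <= t -> exists k : nat, 2 ^+ k <= t < 2 ^+ k.+1.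
Proof.
move=> t1.
have ex : exists k : nat, t < 2 ^+ k.+1.
  exists (Num.bound t); apply: (lt_trans (archi_boundP (le_trans ler01 t1))).
  by rewrite -natrX ltr_nat (ltn_trans (ltnSn _))// ltn_expl.
have [k kt kmin] := ex_minnP ex.
exists k; rewrite kt andbT leNgt; apply/negP.
case: k kt kmin => [|k] kt kmin tk; first by move: tk; rewrite expr0 ltNge t1.
by have := kmin _ tk; rewrite ltnn.
Qed.

Lemma nneseries_geometric_le (c a : R) (u : nat -> \bar R) : 0 <= c -> 0 <= a < 1 ->
  (forall k, 0 <= u k)%E ->
  (forall k, u k <= (c * a ^+ k)%:E)%E ->
  (\sum_(0 <= k <oo) u k <= (c / (1 - a))%:E)%E.
Proof.
move=> c0 /andP[a0 a1] u0 uc.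
apply: lime_le; first by apply: is_cvg_nneseries => k _ _.
apply: nearW => N.
apply: (@le_trans _ _ (\sum_(0 <= k < N) (c * a ^+ k)%:E)%E).
  by apply: lee_sum => k _; exact: uc.
rewrite sumEFin lee_fin -mulr_sumr ler_wpM2l//.
rewrite -[leRHS]div1r ler_pdivlMr ?subr_gt0// mulrC big_mkord -opprB mulNr -subrX1 opprB.
by rewrite gerBl exprn_ge0.
Qed.

Lemma ge0_integralZ_indic d (T : measurableType d) (lam : {measure set T -> \bar R})
    (A : set T) (c : R) : measurable A -> 0 <= c ->
  (\int[lam]_x (c * \1_A x)%:E = c%:E * lam A)%E.
Proof.
move=> mA c0; under eq_integral do rewrite EFinM.
rewrite ge0_integralZl//; last by apply/measurable_EFinP; exact: measurable_indic.
by rewrite (integral_indic _ measurableT)// setIT.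
Qed.

Lemma powRN_le (b x y : R) : 0 <= b -> 0 < x -> x <= y -> y `^ (- b) <= x `^ (- b).
Proof.
move=> b0 x0 xy; rewrite !powRN lef_pV2 ?posrE ?powR_gt0//; last exact: lt_le_trans xy.
by apply: ge0_ler_powR => //; rewrite nnegrE ltW// (lt_le_trans x0).
Qed.

Lemma powRDp (x r s : R) : 0 < x -> x `^ (r + s) = x `^ r * x `^ s.
Proof. by move=> x0; rewrite powRD// (gt_eqF x0) implybT. Qed.

Lemma powRVp (x e : R) : 0 < x -> x^-1 `^ e = x `^ (- e).
Proof. by move=> x0; rewrite -powR_inv1 ?ltW// -powRrM mulN1r. Qed.

Lemma powR2_lt1 (s : R) : s < 0 -> 2 `^ s < 1.
Proof.
move=> s0; rewrite /powR ifF; last by apply/negbTE; rewrite pnatr_eq0.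
by rewrite expR_lt1 nmulr_rlt0// ln_gt0// ltr1n.
Qed.

(** Dyadic shells around the scale D: where N >= D the integrand is at most N^(-b - b'), and b + b'
    > q makes the shells summable; where N < D it is at most N^-b D^-b', and b < q does. Only the
    growth of sublevel sets enters, so the lemma serves both the Heisenberg group, with N a squared
    distance and q = n + 1, and the line, with N = |x| and q = 1. *)
Lemma growth_integral (q b b' C : R) : 0 < b -> 0 <= b' -> 0 <= C ->
  b < q -> q < b + b' ->
  exists2 C' : R, 0 < C' & forall d (T : measurableType d)
    (lam : {measure set T -> \bar R}) (N : T -> R),
    measurable_fun [set: T] N -> (forall x, 0 <= N x) ->
    (forall r : R, 0 < r -> (lam [set x | N x < r]%R <= (C * r `^ q)%:E)%E) ->
    forall D : R, 0 < D ->
    (\int[lam]_x (N x `^ (- b) * (N x + D) `^ (- b'))%:E <=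
       (C' * D `^ (q - b - b'))%:E)%E.
Proof.
move=> bgt0 b'0 C0 bq qb; have b0 := ltW bgt0.
pose a1 : R := 2 `^ (q - b - b'); pose a2 : R := 2 `^ (b - q).
have a1P : 0 <= a1 < 1 by rewrite powR_ge0 /= powR2_lt1//; lra.
have a2P : 0 <= a2 < 1 by rewrite powR_ge0 /= powR2_lt1//; lra.
pose c1 : R := C * 2 `^ q; pose c2 : R := C * 2 `^ q * 2 `^ b.
have c10 : 0 <= c1 by rewrite mulr_ge0 ?powR_ge0.
have c20 : 0 <= c2 by rewrite !mulr_ge0 ?powR_ge0.
exists (c1 / (1 - a1) + c2 / (1 - a2) + 1).
  rewrite ltr_wpDl// addr_ge0// divr_ge0// subr_ge0 ltW//.
    by case/andP: a1P.
  by case/andP: a2P.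
move=> d T lam N mN N0 Nr D D0.
(* [A k] is for the shells above D and [B k] for those below; each shell is replaced by a whole
   sublevel set, which is harmless in a geometric sum. *)
pose A k := [set x | N x < 2 ^+ k.+1 * D].
pose B k := [set x | N x < 2 / 2 ^+ k * D].
have mlt r : measurable [set x | N x < r].
  rewrite (_ : [set _ | _] = N @^-1` `]-oo, r[).
    by rewrite -[X in measurable X]setTI; exact: mN.
  by apply/seteqP; split => x /=; rewrite in_itv.
pose u k : R := (2 ^+ k * D) `^ (- b - b').
pose v k : R := (2 ^- k.+1 * D) `^ (- b) * D `^ (- b').
pose F k x := ((u k * \1_(A k) x)%:E + (v k * \1_(B k) x)%:E)%E.
have u0 k : 0 <= u k by exact: powR_ge0.
have v0 k : 0 <= v k by rewrite mulr_ge0 ?powR_ge0.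
have F0 k x : (0 <= F k x)%E by rewrite /F adde_ge0// lee_fin mulr_ge0.
have mF1 k : measurable_fun [set: T] (fun x => (u k * \1_(A k) x)%:E).
  apply/measurable_EFinP; apply: measurable_funM => //; apply: measurable_indic; exact: mlt.
have mF2 k : measurable_fun [set: T] (fun x => (v k * \1_(B k) x)%:E).
  apply/measurable_EFinP; apply: measurable_funM => //; apply: measurable_indic; exact: mlt.
have mF k : measurable_fun [set: T] (F k) by exact: emeasurable_funD.
have mg : measurable_fun [set: T] (fun x => (N x `^ (- b) * (N x + D) `^ (- b'))%:E).
  apply/measurable_EFinP; apply: measurable_funM.
    exact: (measurableT_comp (measurable_powR (- b))).
  by apply: (measurableT_comp (measurable_powR (- b'))); exact: measurable_funD.
apply: (@le_trans _ _ (\int[lam]_x (\sum_(0 <= k <oo) F k x))%E).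
  apply: ge0_le_integral => //.
  - by move=> x _; rewrite lee_fin mulr_ge0 ?powR_ge0.
  - by apply: ge0_emeasurable_sum => // k x _ _; exact: F0.
  move=> x _.
  (* At N x = 0 a power with nonzero exponent is 0 by convention, so the singular points contribute
     nothing. *)
  have [Nx0|Nx0] := eqVneq (N x) 0.
    rewrite Nx0 [0 `^ _]powR0 ?oppr_eq0 ?gt_eqF//.
    by rewrite mul0r; exact: nneseries_ge0.
  have Nxgt : 0 < N x by rewrite lt_def Nx0 N0.
  suff [k hk] : exists k, ((N x `^ (- b) * (N x + D) `^ (- b'))%:E <= F k x)%E.
    apply: (le_trans hk).
    apply: le_trans (nneseries_lim_ge k.+1 _) => [|i _ _]; last exact: F0.
    by rewrite big_nat_recr//= leeDr// sume_ge0// => i _; exact: F0.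
  have [DN|ND] := leP D (N x).
    have [k /andP[k1 k2]] := @dyadic_bracket (N x / D) ltac:(by rewrite ler_pdivlMr ?mul1r).
    exists k; rewrite /F -EFinD lee_fin; apply: ler_wpDr; first by rewrite mulr_ge0.
    rewrite indicE mem_set ?mulr1; last by rewrite /A /= -ltr_pdivrMr.
    have h : 2 ^+ k * D <= N x by rewrite -ler_pdivlMr.
    rewrite /u powRD; last by rewrite mulf_neq0 ?implybT// gt_eqF// exprn_gt0.
    apply: ler_pM; rewrite ?powR_ge0//.
      by apply: powRN_le => //; rewrite mulr_gt0// exprn_gt0.
    apply: powRN_le => //; first by rewrite mulr_gt0// exprn_gt0.
    by rewrite (le_trans h)// lerDl ltW.
  have [k /andP[k1 k2]] := @dyadic_bracket (D / N x) ltac:(by rewrite ler_pdivlMr ?mul1r// ltW).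
  exists k; rewrite /F -EFinD lee_fin; apply: ler_wpDl; first by rewrite mulr_ge0.
  rewrite indicE mem_set ?mulr1; last first.
    rewrite /B /=; move: k1; rewrite ler_pdivlMr// => k1.
    rewrite mulrAC ltr_pdivlMr ?exprn_gt0// mulrC.
    by apply: (le_lt_trans k1); lra.
  apply: ler_pM; rewrite ?powR_ge0//.
    apply: powRN_le => //; first by rewrite mulr_gt0// invr_gt0 exprn_gt0.
    move: k2; rewrite ltr_pdivrMr// => k2.
    by rewrite mulrC ler_pdivrMr ?exprn_gt0// mulrC ltW.
  by apply: powRN_le => //; rewrite lerDr.
rewrite integral_nneseries//.
rewrite (@eq_eseriesr _ _ (fun k => (u k)%:E * lam (A k) + (v k)%:E * lam (B k))%E); last first.
  move=> k _; rewrite /F ge0_integralD//.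
  - by rewrite !ge0_integralZ_indic//; exact: mlt.
  - by move=> x _; rewrite lee_fin mulr_ge0.
  - by move=> x _; rewrite lee_fin mulr_ge0.
rewrite nneseriesD//; last 2 first.
- by move=> k _ _; rewrite mule_ge0// lee_fin.
- by move=> k _ _; rewrite mule_ge0// lee_fin.
have Dq0 : 0 <= D `^ (q - b - b') by exact: powR_ge0.
apply: (@le_trans _ _ ((c1 * D `^ (q - b - b') / (1 - a1))%:E + (c2 * D `^ (q - b - b') / (1 - a2))%:E)%E).
  have Dpos k : 0 < 2 ^+ k * D :> R by rewrite mulr_gt0// exprn_gt0.
  have DposV k : 0 < 2 / 2 ^+ k * D :> R by rewrite mulr_gt0// divr_gt0// exprn_gt0.
  apply: leeD; apply: nneseries_geometric_le => //.
  - by rewrite mulr_ge0.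
  - by move=> k; rewrite mule_ge0// lee_fin.
  - move=> k; apply: (@le_trans _ _ ((u k)%:E * (C * (2 ^+ k.+1 * D) `^ q)%:E)%E).
      by apply: lee_wpmul2l; [rewrite lee_fin | exact: Nr].
    rewrite -EFinM lee_fin /u /c1 /a1 le_eqVlt; apply/orP; left; apply/eqP.
    rewrite exprS -mulrA [(2 * _) `^ _]powRM ?(ltW (Dpos _))//.
    set e := - b - b'; rewrite -powR_pow2 (_ : q - b - b' = e + q); last by rewrite /e; ring.
    have p2 : 0 < 2 ^+ k :> R by rewrite exprn_gt0.
    rewrite (powRDp _ _ D0) (powRDp _ _ p2).
    by rewrite !powRM ?(ltW p2) ?(ltW D0)//; ring.
  - by rewrite mulr_ge0.
  - by move=> k; rewrite mule_ge0// lee_fin.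
  - move=> k; apply: (@le_trans _ _ ((v k)%:E * (C * (2 / 2 ^+ k * D) `^ q)%:E)%E).
      by apply: lee_wpmul2l; [rewrite lee_fin | exact: Nr].
    rewrite -EFinM lee_fin /v /c2 /a2 le_eqVlt; apply/orP; left; apply/eqP.
    have p2 : 0 < 2 ^+ k :> R by rewrite exprn_gt0.
    rewrite exprS invfM (_ : q - b - b' = (- b) + (- b') + q); last by ring.
    rewrite !(powRDp _ _ D0).
    rewrite !powRM ?mulr_ge0 ?invr_ge0 ?(ltW p2)//; try exact: ltW.
    rewrite !powRVp// opprK -powR_pow2 (powRDp _ _ p2).
    ring.
by rewrite -EFinD lee_fin mulrDl mul1r mulrDl; rewrite !(mulrAC _ _ (D `^ _)) lerDl.
Qed.
End growth_integral.

#[local] Opaque hdist.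
Section potentials.
Variables (R : realType) (n : nat) (alpha : R).
Hypotheses (alpha_gt : n%:R / 2 < alpha) (alpha_lt : alpha < (n%:R + 1) / 2).
Local Notation C := (Cplx R).
Local Notation H := (heis R n).
Local Notation mR := (measurableTypeR R).
Local Notation lam := (@lebesgue_heis R n).
Local Notation b := (n%:R + 1 - alpha).
Local Notation sg := (n%:R + 1 - 2 * alpha).
Implicit Types (x y w : H).

(* [hP] is the Riesz kernel regularised at height [h], and [hK] that of its square: the convolution
   of [hP x h] and [hP w h'] is comparable with [hK x h w h']. *)
Definition hN x (h : R) y : R := hdist x y ^+ 2 + h.
Definition hP x (h : R) y : R := hN x h y `^ (- (n%:R + 1 - alpha)).
Definition hK x (h : R) w (h' : R) : R :=
  (hdist x w ^+ 2 + h + h') `^ (- (n%:R + 1 - 2 * alpha)).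

Lemma b_gt0 : 0 < b. Proof. by have := ler0n R n; have := alpha_gt; have := alpha_lt; lra. Qed.
Lemma sg_gt0 : 0 < sg. Proof. by have := alpha_gt; have := alpha_lt; lra. Qed.
Lemma alpha_gt0 : 0 < alpha. Proof. by have := ler0n R n; have := alpha_gt; have := alpha_lt; lra. Qed.
Let q : R := n%:R + 1.

Lemma hN_ge0 x h y : 0 <= h -> 0 <= hN x h y.
Proof. by move=> h0; rewrite addr_ge0 ?sqr_ge0. Qed.

Lemma hN_gt0 x h y : 0 < h -> 0 < hN x h y.
Proof. by move=> h0; rewrite ltr_wpDl ?sqr_ge0. Qed.

Lemma hP_ge0 x h y : 0 <= hP x h y. Proof. exact: powR_ge0. Qed.
Lemma hK_ge0 x h w h' : 0 <= hK x h w h'. Proof. exact: powR_ge0. Qed.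

Lemma hKC x h w h' : hK x h w h' = hK w h' x h.
Proof. by rewrite /hK hdistC addrAC. Qed.

Lemma measurable_hN x h : measurable_fun [set: borel H] (fun y => hN x h (y : H) : mR).
Proof.
apply: measurable_funD => //; apply: measurable_funX.
exact: (measurable_hdist (measurable_cst _) (@measurable_id _ _ _)).
Qed.

Lemma measurable_hP x h : measurable_fun [set: borel H] (fun y => hP x h (y : H) : mR).
Proof. exact: (measurableT_comp (measurable_powR _) (measurable_hN x h)). Qed.

Lemma powR_q (r : R) : 0 <= r -> r `^ q = r ^+ n.+1.
Proof. by move=> r0; rewrite /q natr1 powR_mulrn. Qed.

Lemma hN_growth : exists2 C0 : R, 0 < C0 & forall x (h : R), 0 <= h ->
  forall r : R, 0 < r -> (lam [set y | hN x h y < r]%R <= (C0 * r `^ q)%:E)%E.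
Proof.
have [c [C0 [c0 C00 hV]]] := hball_volume R n.
exists C0 => // x h h0 r r0.
have s0 : 0 < Num.sqrt r by rewrite sqrtr_gt0.
apply: (@le_trans _ _ (lam (hball x (Num.sqrt r)))).
  apply: le_measure; rewrite ?inE.
  - rewrite (_ : [set _ | _] = (fun y : borel H => hN x h (y : H) : mR) @^-1` `]-oo, r[).
      by rewrite -[X in measurable X]setTI; exact: measurable_hN.
    by apply/seteqP; split => y /=; rewrite in_itv.
  - exact: measurable_hball.
  move=> y /= yr; rewrite /hball /= -ltr_sqr ?nnegrE ?hdist_ge0 ?sqrtr_ge0//.
  by rewrite (sqr_sqrtr (ltW r0)); move: yr h0; rewrite /hN; clear -R n alpha alpha_gt alpha_lt; move=> *; lra.
by have [_] := hV x _ s0; rewrite (sqr_sqrtr (ltW r0)) -(powR_q (ltW r0)).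
Qed.

Lemma hdist_sq_triangle x y w : hdist x w ^+ 2 <= 2 * hdist x y ^+ 2 + 2 * hdist w y ^+ 2.
Proof.
have h := hdist_triangle x y w; rewrite [hdist y w]hdistC in h.
have h0 := hdist_ge0 x w; have h1 := hdist_ge0 x y; have h2 := hdist_ge0 w y.
move: h h0 h1 h2; move: (hdist x w) (hdist x y) (hdist w y) => d1 d2 d3 h h0 h1 h2.
apply: (@le_trans _ _ ((d2 + d3) ^+ 2)); first by rewrite ler_sqr ?nnegrE ?addr_ge0.
by have := sqr_ge0 (d2 - d3); lra.
Qed.

(** By the triangle inequality D <= 2 (N + N'), so the larger of N and N' is at least a fifth of the
    smaller one plus D. The integrand is thus bounded by a sum of two functions of the kind treated
    in [growth_integral], with both exponents n + 1 - alpha; the resulting power of D is n + 1 - 2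
    (n + 1 - alpha), that of [hK]. *)
Lemma hPP_integral_le : exists2 c : R, 0 < c & forall x (h : R) w (h' : R), 0 < h -> 0 < h' ->
  (\int[lam]_y (hP x h y * hP w h' y)%:E <= (c * hK x h w h')%:E)%E.
Proof.
have [C0 C00 hG] := hN_growth.
have bq : b < q by rewrite /q; have := alpha_gt0; lra.
have qb : q < b + b by rewrite /q; have := sg_gt0; lra.
have [C1 C10 hC1] := growth_integral b_gt0 (ltW b_gt0) (ltW C00) bq qb.
exists (5 `^ b * (C1 + C1)); first by rewrite mulr_gt0 ?powR_gt0// addr_gt0.
move=> x h w h' h0 h'0; set D := hdist x w ^+ 2 + h + h'.
have D0 : 0 < D by rewrite /D -addrA ltr_wpDl ?sqr_ge0// addr_gt0.
pose f (x0 : H) (h1 : R) (y : H) : R := hN x0 h1 y `^ (- b) * (hN x0 h1 y + D) `^ (- b).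
have f0 x0 h1 y : 0 <= f x0 h1 y by rewrite mulr_ge0 ?powR_ge0.
have mf x0 h1 : measurable_fun [set: borel H] (fun y => (f x0 h1 (y : H))%:E).
  apply/measurable_EFinP; apply: measurable_funM; first exact: measurable_hP.
  apply: (measurableT_comp (measurable_powR _)).
  by apply: measurable_funD => //; exact: measurable_hN.
have key (N N' : R) : 0 < N -> N <= N' -> D <= 2 * N + 2 * N' ->
    N' `^ (- b) <= 5 `^ b * (N + D) `^ (- b).
  move=> N0 NN DN.
  have -> : 5 `^ b * (N + D) `^ (- b) = ((N + D) / 5) `^ (- b).
    by rewrite powRM ?invr_ge0// ?(ltW (addr_gt0 N0 D0))// powRVp// opprK mulrC.
  by apply: powRN_le; [exact: ltW b_gt0 | rewrite divr_gt0// addr_gt0 | rewrite ler_pdivrMr//; move: N0 NN DN; clear -R n alpha alpha_gt alpha_lt; move=> *; lra].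
have DNN y : D <= 2 * hN x h y + 2 * hN w h' y.
  by have := hdist_sq_triangle x y w; move: h0 h'0; rewrite /D /hN; move: (hdist x w ^+ 2) (hdist x y ^+ 2) (hdist w y ^+ 2) ; clear -R n alpha alpha_gt alpha_lt; move=> *; lra.
apply: (@le_trans _ _ (\int[lam]_y ((5 `^ b)%:E * ((f x h y)%:E + (f w h' y)%:E)))%E).
  apply: ge0_le_integral => //.
  - by move=> y _; rewrite lee_fin mulr_ge0 ?hP_ge0.
  - by apply/measurable_EFinP; apply: measurable_funM; exact: measurable_hP.
  - apply: emeasurable_funM => //; exact: emeasurable_funD.
  move=> y _; rewrite -EFinD -EFinM lee_fin.
  have N0 := hN_gt0 x y h0; have N'0 := hN_gt0 w y h'0.
  have [NN|NN] := leP (hN x h y) (hN w h' y).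
    apply: (@le_trans _ _ (5 `^ b * f x h y)); last first.
      by rewrite ler_wpM2l ?powR_ge0// lerDl.
    rewrite /f mulrCA ler_wpM2l ?hP_ge0//; exact: key.
  apply: (@le_trans _ _ (5 `^ b * f w h' y)); last first.
    by rewrite ler_wpM2l ?powR_ge0// lerDr.
  rewrite /f mulrCA mulrC ler_wpM2l ?hP_ge0//.
  by apply: key => //; [exact: ltW | rewrite addrC].
rewrite ge0_integralZl//; last 2 first.
- exact: emeasurable_funD.
- by move=> y _; rewrite adde_ge0// lee_fin.
rewrite ge0_integralD//; last 2 first.
- by move=> y _; rewrite lee_fin.
- by move=> y _; rewrite lee_fin.
have h1 := hC1 _ _ lam _ (measurable_hN x h) (fun y => hN_ge0 x y (ltW h0)) (hG x h (ltW h0)) D D0.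
have h2 := hC1 _ _ lam _ (measurable_hN w h') (fun y => hN_ge0 w y (ltW h'0)) (hG w h' (ltW h'0)) D D0.
rewrite -mulrA EFinM; apply: lee_wpmul2l; first by rewrite lee_fin powR_ge0.
rewrite mulrDl EFinD; rewrite (_ : hK x h w h' = D `^ (q - b - b)); last first.
  by rewrite /hK -/D; congr (_ `^ _); rewrite /q; ring.
apply: leeD; [exact: h1 | exact: h2].
Qed.

(** On the ball of radius sqrt D about x both regularised distances are at most 4 D, and the volume
    of this ball is of order D^(n + 1). *)
Lemma hPP_integral_ge : exists2 c : R, 0 < c & forall x (h : R) w (h' : R), 0 < h -> 0 < h' ->
  ((c * hK x h w h')%:E <= \int[lam]_y (hP x h y * hP w h' y)%:E)%E.
Proof.
have [c [C0 [c0 C00 hV]]] := hball_volume R n.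
exists (c * (4 `^ (- b) * 4 `^ (- b))); first by rewrite !mulr_gt0 ?powR_gt0.
move=> x h w h' h0 h'0; set D := hdist x w ^+ 2 + h + h'.
have D0 : 0 < D by rewrite /D -addrA ltr_wpDl ?sqr_ge0// addr_gt0.
have s0 : 0 < Num.sqrt D by rewrite sqrtr_gt0.
pose k : R := (4 * D) `^ (- b) * (4 * D) `^ (- b).
have k0 : 0 <= k by rewrite mulr_ge0 ?powR_ge0.
apply: (@le_trans _ _ (\int[lam]_y (k * \1_(hball x (Num.sqrt D)) y)%:E)%E); last first.
  apply: ge0_le_integral => //.
  - by move=> y _; rewrite lee_fin mulr_ge0.
  - apply/measurable_EFinP; apply: measurable_funM => //; apply: measurable_indic.
    exact: measurable_hball.
  - by apply/measurable_EFinP; apply: measurable_funM; exact: measurable_hP.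
  move=> y _; rewrite lee_fin indicE.
  have [yB|_] := boolP (y \in _); last by rewrite mulr0 mulr_ge0 ?hP_ge0.
  rewrite mulr1; move: yB; rewrite inE /hball /= => yB.
  have yD : hdist x y ^+ 2 < D.
    by rewrite -(sqr_sqrtr (ltW D0)) ltr_sqr ?nnegrE ?hdist_ge0 ?sqrtr_ge0.
  have := hdist_sq_triangle w x y; rewrite [hdist w x]hdistC [hdist y x]hdistC => tr.
  have := sqr_ge0 (hdist x w) => dxw.
  apply: ler_pM; rewrite ?powR_ge0//; apply: powRN_le; rewrite ?hN_gt0 ?(ltW b_gt0)//.
    by move: yD h0 h'0 dxw; rewrite /hN /D; move: (hdist x w ^+ 2) (hdist x y ^+ 2) ; clear -R n alpha alpha_gt alpha_lt; move=> *; lra.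
  by move: yD tr h0 h'0 dxw; rewrite /hN /D; move: (hdist x w ^+ 2) (hdist x y ^+ 2) (hdist w y ^+ 2) ; clear -R n alpha alpha_gt alpha_lt; move=> *; lra.
rewrite ge0_integralZ_indic//; last exact: measurable_hball.
have [hV1 _] := hV x _ s0.
apply: (@le_trans _ _ (k%:E * (c * (Num.sqrt D ^+ 2) ^+ n.+1)%:E)%E); last first.
  by apply: lee_wpmul2l => //; rewrite lee_fin.
rewrite -EFinM lee_fin (sqr_sqrtr (ltW D0)) -(powR_q (ltW D0)) /k /hK -/D.
rewrite (_ : - sg = (- b) + (- b) + q); last by rewrite /q; ring.
rewrite !(powRDp _ _ D0) !(powRM _ (ler0n R 4) (ltW D0)).
by rewrite le_eqVlt; apply/orP; left; apply/eqP; ring.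
Qed.

Lemma hN_comparable x h y z : 0 < h -> hdist x z ^+ 2 <= h -> 
  hN x h y <= 3 * hN z h y.
Proof.
move=> h0 xz; have := hdist_sq_triangle x z y; rewrite [hdist y z]hdistC /hN.
by have := sqr_ge0 (hdist z y); move: h0 xz; move: (hdist x z ^+ 2) (hdist x y ^+ 2) (hdist z y ^+ 2) ; clear -R n alpha alpha_gt alpha_lt; move=> *; lra.
Qed.

(** Averaging the singular kernel over a ball of radius sqrt h regularises it at height h. This is
    how a condition on a Riesz potential at boundary points is turned into one on the potentials
    [hpot]. *)
Lemma riesz_ball_integral_le : exists2 c : R, 0 < c & forall x (h : R) y, 0 < h ->
  (\int[lam]_(w in hball x (Num.sqrt h)) ((hdist (w : H) y ^+ 2) `^ (- b))%:E <=
    (c * h `^ q * hP x h y)%:E)%E.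
Proof.
have [C0 C00 hG] := hN_growth.
have bq : b < q by rewrite /q; have := alpha_gt0; lra.
have qb : q < b + b by rewrite /q; have := sg_gt0; lra.
have [C1 C10 hC1] := growth_integral b_gt0 (ltW b_gt0) (ltW C00) bq qb.
have [c [C2 [c0 C20 hV]]] := hball_volume R n.
exists (C2 * 5 `^ b + 11 `^ b * C1 * 5 `^ b).
  by rewrite addr_gt0// !mulr_gt0// powR_gt0.
move=> x h y h0; have h0' := ltW h0.
have hq0 : 0 <= h `^ q by exact: powR_ge0.
have s0 : 0 < Num.sqrt h by rewrite sqrtr_gt0.
set B := hball x (Num.sqrt h).
have mB : measurable (B : set (borel H)) by exact: measurable_hball.
have inB w : B w -> hdist x w ^+ 2 < h.
  move=> Bw; rewrite -(sqr_sqrtr h0') ltr_sqr ?nnegrE ?hdist_ge0 ?sqrtr_ge0//.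
have mf : measurable_fun [set: borel H] (fun w => ((hdist (w : H) y ^+ 2) `^ (- b))%:E).
  apply/measurable_EFinP; apply: (measurableT_comp (measurable_powR _)).
  apply: measurable_funX; exact: (measurable_hdist (@measurable_id _ _ _) (measurable_cst _)).
have mfB : measurable_fun (B : set (borel H)) (fun w => ((hdist (w : H) y ^+ 2) `^ (- b))%:E).
  exact: measurable_funS mf.
have iV (u : R) : 0 < u -> (u / 5) `^ (- b) = u `^ (- b) * 5 `^ b.
  by move=> u0; rewrite powRM ?invr_ge0// ?(ltW u0)// powRVp// opprK.
(* If y is far, every w of the ball has d(w, y) >= d(x, y) / 2, and the kernel at w is bounded by a
   multiple of its regularised value at x. *)
have [far|near] := leP (4 * h) (hdist x y ^+ 2).
  apply: (@le_trans _ _ (\int[lam]_(w in B) (hP x h y * 5 `^ b)%:E)%E).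
    apply: ge0_le_integral => //; first by move=> w _; rewrite lee_fin powR_ge0.
    move=> w Bw; rewrite lee_fin /hP -iV; last exact: hN_gt0.
    apply: powRN_le; [exact: ltW b_gt0 | by rewrite divr_gt0// hN_gt0 |].
    have xw := ltW (inB _ Bw).
    have dxw := hdist_ge0 x w; have dwy := hdist_ge0 w y; have dxy := hdist_ge0 x y.
    have tr := hdist_triangle x w y.
    rewrite ler_pdivrMr// /hN.
    have h2 : 2 * hdist x w <= hdist x y.
      move: far xw dxw dxy; move: (hdist x w) (hdist x y) => u v far xw u0 v0.
      by rewrite -ler_sqr ?nnegrE ?mulr_ge0// exprMn; lra.
    have h3 : hdist x y <= 2 * hdist w y by move: h2 tr; move: (hdist x w) (hdist x y) (hdist w y) ; clear -R n alpha alpha_gt alpha_lt; move=> *; lra.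
    have h4 : hdist x y ^+ 2 <= 4 * hdist w y ^+ 2.
      move: h3 dxy dwy; move: (hdist w y) (hdist x y) => u v h3 v0 u0.
      by rewrite -ler_sqr ?nnegrE ?mulr_ge0// exprMn in h3; lra.
    by move: h4 far; move: (hdist w y ^+ 2) (hdist x y ^+ 2) ; clear -R n alpha alpha_gt alpha_lt; move=> *; lra.
  rewrite integral_cst//; have [_ hV2] := hV x _ s0.
  rewrite (sqr_sqrtr h0') -powR_q// in hV2.
  apply: (@le_trans _ _ ((hP x h y * 5 `^ b)%:E * (C2 * h `^ q)%:E)%E).
    by apply: lee_wpmul2l => //; rewrite lee_fin mulr_ge0 ?powR_ge0.
  rewrite -EFinM lee_fin.
  have : 0 <= 11 `^ b * C1 * 5 `^ b * h `^ q * hP x h y.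
    by rewrite !mulr_ge0 ?powR_ge0 ?(ltW C10).
  by clear -R n alpha alpha_gt alpha_lt; move=> *; lra.
(* If y is near, the ball stays within squared distance 10 h of y, so the extra factor (N + h)^-b is
   at least (11 h)^-b there. It is inserted to make the integral over the whole group converge. *)
pose g (w : H) : R := hN y 0 w `^ (- b) * (hN y 0 w + h) `^ (- b).
have mg : measurable_fun [set: borel H] (fun w => (g (w : H))%:E).
  apply/measurable_EFinP; apply: measurable_funM; first exact: measurable_hP.
  apply: (measurableT_comp (measurable_powR _)).
  by apply: measurable_funD => //; exact: measurable_hN.
have g0 w : 0 <= g w by rewrite mulr_ge0 ?powR_ge0.
have k0 : 0 <= 11 `^ b * h `^ b by rewrite mulr_ge0 ?powR_ge0.
apply: (@le_trans _ _ (\int[lam]_w ((11 `^ b * h `^ b)%:E * (g (w : H))%:E))%E).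
  rewrite integral_mkcond; apply: ge0_le_integral => //.
  - by move=> w _; rewrite /patch; case: ifP => // _; rewrite lee_fin powR_ge0.
  - by apply/(measurable_restrictT _ mB).
  - by apply: emeasurable_funM.
  move=> w _; rewrite /patch; case: ifPn => [|_]; last by rewrite -EFinM lee_fin mulr_ge0.
  rewrite inE => Bw; rewrite -EFinM lee_fin /g /hN addr0 [hdist y w]hdistC mulrCA.
  rewrite -[leLHS]mulr1; apply: ler_wpM2l; first exact: powR_ge0.
  have xw := ltW (inB _ Bw).
  have wy : hdist w y ^+ 2 + h <= 11 * h.
    have := hdist_sq_triangle w x y; rewrite [hdist w x]hdistC [hdist y x]hdistC.
    move: xw near h0; move: (hdist x w ^+ 2) (hdist x y ^+ 2) (hdist w y ^+ 2) ; clear -R n alpha alpha_gt alpha_lt; move=> *; lra.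
  have h11 : 0 < 11 * h by rewrite mulr_gt0.
  have : (11 * h) `^ (- b) <= (hdist w y ^+ 2 + h) `^ (- b).
    by apply: powRN_le => //; [exact: ltW b_gt0 | rewrite ltr_wpDl ?sqr_ge0].
  rewrite powRN -powRM// => h12; rewrite -ler_pdivrMl ?powR_gt0// mulr1; exact: h12.
rewrite ge0_integralZl//; last by move=> w _; rewrite lee_fin.
have h1 := hC1 _ _ lam _ (measurable_hN y 0) (fun w => hN_ge0 y w (lexx 0)) (hG y 0 (lexx 0)) h h0.
apply: (@le_trans _ _ ((11 `^ b * h `^ b)%:E * (C1 * h `^ (q - b - b))%:E)%E).
  by apply: lee_wpmul2l => //; rewrite lee_fin.
rewrite -EFinM lee_fin.
have hPl : h `^ (- b) <= 5 `^ b * hP x h y.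
  rewrite mulrC /hP -iV; last exact: hN_gt0.
  apply: powRN_le; [exact: ltW b_gt0 | by rewrite divr_gt0// hN_gt0 |].
  by rewrite ler_pdivrMr// /hN; move: near; move: (hdist x y ^+ 2) ; clear -R n alpha alpha_gt alpha_lt; move=> *; lra.
have -> : h `^ (q - b - b) = h `^ q * h `^ (- b) * h `^ (- b) by rewrite -!(powRDp _ _ h0).
apply: (@le_trans _ _ (11 `^ b * C1 * h `^ q * h `^ (- b))).
  have hb : h `^ b * h `^ (- b) = 1 by rewrite powRN mulfV// gt_eqF// powR_gt0.
  rewrite le_eqVlt; apply/orP; left; apply/eqP.
  transitivity (11 `^ b * C1 * h `^ q * h `^ (- b) * (h `^ b * h `^ (- b))); first by ring.
  by rewrite hb mulr1.
apply: (@le_trans _ _ (11 `^ b * C1 * h `^ q * (5 `^ b * hP x h y))).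
  by apply: ler_wpM2l => //; rewrite !mulr_ge0 ?powR_ge0 ?(ltW C10).
have : 0 <= C2 * 5 `^ b * h `^ q * hP x h y.
  by rewrite !mulr_ge0 ?powR_ge0 ?(ltW C20).
by clear -R n alpha alpha_gt alpha_lt; move=> *; lra.
Qed.
End potentials.

(** * Exchange of integrals over the Heisenberg group *)

Section heis_tonelli.
Variables (R : realType) (n : nat).
Local Notation H := (heis R n).
Local Notation mR := (measurableTypeR R).
Local Notation lam := (@lebesgue_heis R n).

Section one.
Context d (T : measurableType d) (m : {sigma_finite_measure set T -> \bar R}).
Variable f : borel H * T -> \bar R.
Hypotheses (mf : measurable_fun [set: borel H * T] f) (f0 : forall p, (0 <= f p)%E).

Let g (p : n.*2.+1.-tuple mR * T) : \bar R := f (heis_of_tuple p.1, p.2).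
Let mg : measurable_fun [set: n.*2.+1.-tuple mR * T] g.
Proof.
apply: (measurableT_comp mf); apply: measurable_fun_pair => //.
by apply: measurableT_comp => //; exact: measurable_heis_of_tuple.
Qed.
Let g0 p : (0 <= g p)%E. Proof. exact: f0. Qed.

Lemma heis_integral_pair t :
  (\int[lam]_x f (x, t) = \int[lebesgue_tuple n.*2.+1]_u g (u, t))%E.
Proof.
rewrite heis_integralE//.
exact: (measurableT_comp mf (pair2_measurable t)).
Qed.

Lemma measurable_heis_integral : measurable_fun [set: T] (fun t => \int[lam]_x f (x, t))%E.
Proof.
rewrite (_ : (fun t => _) = (fun t => \int[lebesgue_tuple n.*2.+1]_u g (u, t))%E).
  exact: (@measurable_fun_fubini_tonelli_G _ _ _ _ R (lebesgue_tuple n.*2.+1) _ mg g0).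
by apply/funext => t; exact: heis_integral_pair.
Qed.

(** [lebesgue_heis] is introduced only as a measure, so Tonelli's theorem is applied to the
    sigma-finite [lebesgue_tuple] and transported along [heis_of_tuple]. *)
Lemma heis_tonelli :
  (\int[lam]_x \int[m]_t f (x, t) = \int[m]_t \int[lam]_x f (x, t))%E.
Proof.
rewrite heis_integralE; last 2 first.
- exact: (@measurable_fun_fubini_tonelli_F _ _ _ _ R m _ mf f0).
- by move=> y; exact: integral_ge0.
rewrite (@fubini_tonelli _ _ _ _ R (lebesgue_tuple n.*2.+1) m g mg g0).
by apply: eq_integral => t _; rewrite heis_integral_pair.
Qed.
End one.

Lemma heis_tonelli2 (f : borel H * borel H -> \bar R) :
  measurable_fun [set: borel H * borel H] f -> (forall p, (0 <= f p)%E) ->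
  (\int[lam]_x \int[lam]_y f (x, y) = \int[lam]_y \int[lam]_x f (x, y))%E.
Proof.
move=> mf f0.
pose g (p : borel H * n.*2.+1.-tuple mR) : \bar R := f (p.1, heis_of_tuple p.2).
have mg : measurable_fun [set: borel H * n.*2.+1.-tuple mR] g.
  apply: (measurableT_comp mf); apply: measurable_fun_pair => //.
  by apply: measurableT_comp => //; exact: measurable_heis_of_tuple.
transitivity (\int[lam]_x \int[lebesgue_tuple n.*2.+1]_u g (x, u))%E.
  apply: eq_integral => x _; rewrite heis_integralE//.
  exact: (measurableT_comp mf (pair1_measurable x)).
rewrite (heis_tonelli (lebesgue_tuple n.*2.+1) mg (fun p => f0 _)).
rewrite heis_integralE//; first exact: measurable_heis_integral.
by move=> y; exact: integral_ge0.
Qed.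
End heis_tonelli.

(** * Finiteness and positivity of the Gamma integral *)

Section gamma.
Context {R : realType}.
Local Notation leb := (@lebesgue_measure R).
Local Notation mR := (measurableTypeR R).

Lemma lebesgue_abs_growth (r : R) : 0 < r ->
  (leb [set x : mR | (`|x : R| < r)%R] <= (2 * r `^ 1)%:E)%E.
Proof.
move=> r0; rewrite (_ : [set _ | _] = `](- r), r[%classic); last first.
  by apply/seteqP; split => x /=; rewrite in_itv/= ltr_norml.
rewrite lebesgue_measure_itv/= lte_fin powRr1 ?(ltW r0)//.
by case: ifP => _; rewrite -?EFinB lee_fin; lra.
Qed.

Lemma measurable_gamma_integrand (s : R) :
  measurable_fun [set: mR] (fun t : mR => ((t : R) `^ (s - 1) * expR (- (t : R)))%:E).
Proof.
apply/measurable_EFinP; apply: measurable_funM; first exact: measurable_powR.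
by apply: measurableT_comp; [exact: measurable_expR | exact: oppr_measurable].
Qed.

(** The exponential is dominated by a multiple of (t + 1)^-(k + 1), which reduces the claim to
    [growth_integral] on the line. The power of t is split at s' = min(s, 1/2), so that the singular
    exponent 1 - s' lies in (0, 1). *)
Lemma gamma_integral_lty (s : R) : 0 < s ->
  (\int[leb]_(t in `]0%R, +oo[) (t `^ (s - 1) * expR (- t))%:E < +oo)%E.
Proof.
move=> s0; pose s' : R := Num.min s 2^-1.
have s's : s' <= s by rewrite ge_min lexx.
have s'0 : 0 < s' by rewrite lt_min s0 invr_gt0/=.
have s'2 : s' <= 2^-1 by rewrite ge_min lexx orbT.
pose k := (Num.bound (s + 1)).
have sk : s + 1 < k%:R by apply: archi_boundP; lra.
pose b' : R := k.+1%:R - (s - s').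
have b'1 : 1 < b' by rewrite /b' -natr1; lra.
have [C C0 hC] := @growth_integral R 1 (1 - s') b' 2 ltac:(lra) ltac:(lra) ltac:(lra) ltac:(lra) ltac:(lra).
have := hC _ _ leb (fun x : mR => `|x : R|) (@normr_measurable R setT) (fun x => normr_ge0 _)
  lebesgue_abs_growth 1 ltr01.
set I := (X in (X <= _)%E) => hI.
pose K : R := (k.+1)`!%:R * expR 1.
have K0 : 0 < K by rewrite mulr_gt0// ?expR_gt0// ltr0n fact_gt0.
apply: (@le_lt_trans _ _ (K%:E * I)%E); last first.
  rewrite lte_mul_pinfty ?lee_fin ?(ltW K0)//.
  by apply: (le_lt_trans hI); rewrite ltry.
rewrite /I -ge0_integralZl//; last 2 first.
- apply/measurable_EFinP; apply: measurable_funM.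
    by apply: (measurableT_comp (measurable_powR _)); exact: normr_measurable.
  apply: (measurableT_comp (measurable_powR _)); exact: measurable_funD.
- by rewrite lee_fin ltW.
rewrite [leLHS]integral_mkcond; apply: ge0_le_integral => //.
- move=> x _; rewrite /patch; case: ifP => // _.
  by rewrite lee_fin mulr_ge0 ?powR_ge0 ?expR_ge0.
- apply/(measurable_restrictT _ (measurable_itv _)).
  exact: measurable_funS (measurable_gamma_integrand s).
- apply: emeasurable_funM => //; apply/measurable_EFinP; apply: measurable_funM.
    by apply: (measurableT_comp (measurable_powR _)); exact: normr_measurable.
  apply: (measurableT_comp (measurable_powR _)); exact: measurable_funD.
move=> x _; rewrite /patch; case: ifPn => [|_]; last first.
  by rewrite -EFinM lee_fin !mulr_ge0 ?powR_ge0 ?(ltW K0).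
rewrite inE /= in_itv/= andbT => x0; rewrite -EFinM lee_fin.
have x1 : 0 < `|x : R| + 1 by rewrite ltr_wpDl.
rewrite gtr0_norm// in x1 *.
have -> : s - 1 = - (1 - s') + (s - s') by ring.
rewrite (powRDp _ _ x0) -mulrA [leRHS]mulrCA ler_wpM2l ?powR_ge0//.
have -> : - b' = (s - s') - k.+1%:R by rewrite /b'; ring.
rewrite (powRDp _ _ x1) [leRHS]mulrCA; apply: ler_pM; rewrite ?powR_ge0 ?expR_ge0//.
  by apply: ge0_ler_powR; rewrite ?nnegrE ?(ltW x0) ?(ltW x1) ?subr_ge0// lerDl.
rewrite powRN powR_mulrn ?(ltW x1)// ler_pdivlMr ?exprn_gt0//.
have := @expR_ge1Dxn R (x + 1) k (ltW x1).
rewrite expRD => h.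
rewrite expRN ler_pdivrMl ?expR_gt0// /K.
have f0 : 0 < (k.+1)`!%:R :> R by rewrite ltr0n fact_gt0.
have : (x + 1) ^+ k.+1 / (k.+1)`!%:R <= expR x * expR 1 by move: h; lra.
rewrite ler_pdivrMr// => h2.
by rewrite (le_trans h2)// le_eqVlt; apply/orP; left; apply/eqP; ring.
Qed.

(** [Gamma] converts an extended integral into a real number and would be 0 if that integral were
    +oo; finiteness therefore comes before the lower bound, which is read off on [1, 2]. *)
Lemma Gamma_gt0 (s : R) : 0 < s -> 0 < Gamma s.
Proof.
move=> s0; rewrite /Gamma /Rintegral.
have fin := gamma_integral_lty s0.
(* The sign of s - 1 is unknown, so the minimum of the power over both endpoints is taken. *)
pose c : R := Num.min (1 `^ (s - 1)) (2 `^ (s - 1)) * expR (- 2).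
have c0 : 0 < c by rewrite mulr_gt0 ?expR_gt0// lt_min !powR_gt0.
apply: (@lt_le_trans _ _ c) => //.
rewrite -lee_fin fineK; last first.
  rewrite ge0_fin_numE//; apply: integral_ge0 => x _.
  by rewrite lee_fin mulr_ge0 ?powR_ge0 ?expR_ge0.
apply: (@le_trans _ _ (\int[leb]_(t in `[1%R, 2%R]) (t `^ (s - 1) * expR (- t))%:E)%E); last first.
  apply: ge0_subset_integral => //.
  - exact: measurable_funS (measurable_gamma_integrand s).
  - by move=> x _; rewrite lee_fin mulr_ge0 ?powR_ge0 ?expR_ge0.
  - by move=> x /=; rewrite !in_itv/= andbT => /andP[x1 _]; rewrite (lt_le_trans _ x1).
apply: (@le_trans _ _ (\int[leb]_(t in `[1%R, 2%R]) c%:E)%E).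
  rewrite integral_cst//= lebesgue_measure_itv/= lte_fin ltr1n -EFinB -EFinM lee_fin.
  by rewrite -[X in _ * X](_ : 1 = _) ?mulr1//; lra.
apply: ge0_le_integral => //.
- by move=> x _; rewrite lee_fin ltW.
- exact: measurable_funS (measurable_gamma_integrand s).
move=> x /=; rewrite in_itv/= => /andP[x1 x2]; rewrite lee_fin.
rewrite /c; apply: ler_pM; last by rewrite ler_expR lerN2.
- by rewrite le_min !powR_ge0.
- exact: expR_ge0.
have [s1|s1] := leP 1 s.
  rewrite ge_min; apply/orP; left; apply: ge0_ler_powR; rewrite ?nnegrE ?subr_ge0//.
  exact: le_trans x1.
rewrite ge_min; apply/orP; right.
have -> : s - 1 = - (1 - s) by ring.
by apply: powRN_le => //; [lra | rewrite (lt_le_trans _ x1)].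
Qed.
End gamma.

(** * Comparison of Riesz potentials with their regularisations *)

Section riesz.
Variables (R : realType) (n : nat) (alpha : R).
Hypotheses (alpha_gt : n%:R / 2 < alpha) (alpha_lt : alpha < (n%:R + 1) / 2).
Local Notation H := (heis R n).
Local Notation mR := (measurableTypeR R).
Local Notation lam := (@lebesgue_heis R n).
Local Notation b := (n%:R + 1 - alpha).
Local Notation hP := (hP alpha).
Implicit Types (x y w : H) (f : borel H -> R).

Definition hpot f x (h : R) : \bar R := (\int[lam]_y (hP x h (y : H) * f y)%:E)%E.

Lemma riesz_constant_gt0 : 0 < Gamma b / (2 `^ alpha * (2 * pi) ^+ n.+1).
Proof.
rewrite divr_gt0 ?Gamma_gt0 ?(b_gt0 alpha_gt alpha_lt)// mulr_gt0 ?powR_gt0//.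
by rewrite exprn_gt0// mulr_gt0// pi_gt0.
Qed.

Lemma riesz_kernelE x y : riesz_kernel alpha x y =
  Gamma b / (2 `^ alpha * (2 * pi) ^+ n.+1) * (hdist x y ^+ 2) `^ (- b).
Proof.
rewrite /riesz_kernel invfM -!mulrA; congr (_ * _); congr (_ * _).
have : 0 <= hdist x y := hdist_ge0 x y; move: (hdist x y) => d d0.
rewrite powRN; congr (_^-1); rewrite -(powR_mulrn 2 d0) -powRrM.
by congr (_ `^ _); ring.
Qed.

Lemma measurable_hdist_neg d (T : measurableType d) (g1 g2 : T -> borel H) :
  measurable_fun [set: T] g1 -> measurable_fun [set: T] g2 ->
  measurable_fun [set: T] (fun a => (hdist (g1 a : H) (g2 a : H) ^+ 2) `^ (- b) : mR).
Proof.
move=> m1 m2; apply: (measurableT_comp (measurable_powR _)).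
by apply: measurable_funX; exact: measurable_hdist.
Qed.

Lemma riesz_potentialE f x :
  measurable_fun [set: borel H] (f : borel H -> mR) -> (forall y, 0 <= f y) ->
  (riesz_potential alpha f x =
  (Gamma b / (2 `^ alpha * (2 * pi) ^+ n.+1))%:E *
     \int[lam]_y ((hdist x (y : H) ^+ 2) `^ (- b) * f y)%:E)%E.
Proof.
move=> mf f0; rewrite /riesz_potential -ge0_integralZl//; last 3 first.
- apply/measurable_EFinP; apply: measurable_funM => //.
  by apply: measurable_hdist_neg.
- by move=> y _; rewrite lee_fin mulr_ge0 ?powR_ge0.
- by rewrite lee_fin ltW// riesz_constant_gt0.
by apply: eq_integral => y _; rewrite riesz_kernelE -EFinM mulrA.
Qed.

(** Integrate the condition over the ball and exchange the integrals: the volume, of order h^(n +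
    1), is at most the integral of f against the averaged kernel, which [riesz_ball_integral_le]
    bounds by h^(n + 1) times the regularised one. *)
Lemma hpot_ge1 : exists2 c : R, 0 < c & forall f,
  measurable_fun [set: borel H] (f : borel H -> mR) -> (forall y, 0 <= f y) ->
  forall x (h : R), 0 < h ->
  (forall y, hball x (Num.sqrt h) y -> (1 <= riesz_potential alpha f y)%E) ->
  (1 <= c%:E * hpot f x h)%E.
Proof.
have [c1 c10 hB] := riesz_ball_integral_le alpha_gt alpha_lt.
have [c2 [C0 [c20 C00 hV]]] := hball_volume R n.
set cI := Gamma b / (2 `^ alpha * (2 * pi) ^+ n.+1).
have cI0 : 0 < cI := riesz_constant_gt0.
exists (cI * c1 / c2); first by rewrite divr_gt0// mulr_gt0.
move=> f mf f0 x h h0 hf.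
set B := hball x (Num.sqrt h).
have s0 : 0 < Num.sqrt h by rewrite sqrtr_gt0.
have mB : measurable (B : set (borel H)) by exact: measurable_hball.
have hq0 : 0 < h `^ (n%:R + 1) by exact: powR_gt0.
pose F (p : borel H * borel H) : \bar R :=
  (\1_B p.1 * (((hdist (p.1 : H) (p.2 : H) ^+ 2) `^ (- b)) * f p.2))%:E.
have mF : measurable_fun [set: borel H * borel H] F.
  apply/measurable_EFinP; apply: measurable_funM.
    by apply: measurableT_comp => //; exact: measurable_indic.
  apply: measurable_funM; first exact: measurable_hdist_neg.
  exact: measurableT_comp.
have F0 p : (0 <= F p)%E by rewrite lee_fin !mulr_ge0 ?powR_ge0.
have V : ((c2 * h `^ (n%:R + 1))%:E <= cI%:E * \int[lam]_w \int[lam]_y F (w, y))%E.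
  apply: (@le_trans _ _ (lam B)).
    by have [+ _] := hV x _ s0; rewrite (sqr_sqrtr (ltW h0)) -(powR_q n (ltW h0)).
  have mI : measurable_fun [set: borel H] (fun w => \int[lam]_y F (w, y))%E.
    apply: (@measurable_heis_integral _ _ _ _ (fun p => F (p.2, p.1))) => //.
    by apply: measurableT_comp => //; exact: measurable_swap.
  rewrite -ge0_integralZl//; last 2 first.
  - by move=> w _; exact: integral_ge0.
  - by rewrite lee_fin ltW.
  rewrite -(setIT B) -(integral_indic _ measurableT)//.
  apply: ge0_le_integral => //.
  - by apply/measurable_EFinP; exact: measurable_indic.
  - exact: emeasurable_funM.
  move=> w _; rewrite indicE; have [wB|_] := boolP (w \in B); last first.
    by rewrite mule_ge0 ?lee_fin ?(ltW cI0)//; exact: integral_ge0.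
  have := hf w; rewrite -inE => /(_ wB); rewrite riesz_potentialE// -/cI.
  congr (_ <= _)%E; congr (_ * _)%E; apply: eq_integral => y _.
  by rewrite /F/= indicE wB mul1r.
rewrite (heis_tonelli2 mF F0) in V.
have mP : measurable_fun [set: borel H] (fun y => (hP x h (y : H) * f y)%:E).
  by apply/measurable_EFinP; apply: measurable_funM => //; exact: measurable_hP.
have step : (\int[lam]_y \int[lam]_w F (w, y) <= (c1 * h `^ (n%:R + 1))%:E * hpot f x h)%E.
  rewrite /hpot -ge0_integralZl//; last 2 first.
  - by move=> y _; rewrite lee_fin mulr_ge0 ?hP_ge0.
  - by rewrite lee_fin mulr_ge0 ?(ltW c10)// ltW.
  apply: ge0_le_integral => //.
  - by move=> y _; exact: integral_ge0.
  - exact: (@measurable_heis_integral _ _ _ _ F).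
  - exact: emeasurable_funM.
  move=> y _.
  have -> : (\int[lam]_w F (w, y) = (f y)%:E *
     \int[lam]_(w in B) ((hdist (w : H) y ^+ 2) `^ (- b))%:E)%E.
    rewrite -ge0_integralZl//; last 3 first.
    - apply: (@measurable_funS _ _ _ _ setT) => //; apply/measurable_EFinP.
      exact: measurable_hdist_neg.
    - by move=> w _; rewrite lee_fin powR_ge0.
    - by rewrite lee_fin.
    rewrite [RHS]integral_mkcond; apply: eq_integral => w _.
    rewrite /F/= /patch indicE; case: ifP => wB; last by rewrite mul0r.
    by rewrite mul1r -EFinM mulrC.
  rewrite [(_ * f y)%R]mulrC [(f y * _)%:E]EFinM muleCA.
  apply: lee_wpmul2l; first by rewrite lee_fin.
  by rewrite -EFinM; exact: hB.
have : ((c2 * h `^ (n%:R + 1))%:E <= cI%:E * ((c1 * h `^ (n%:R + 1))%:E * hpot f x h))%E.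
  by apply: (le_trans V); apply: lee_wpmul2l => //; rewrite lee_fin ltW.
rewrite muleA -EFinM; have pot0 : (0 <= hpot f x h)%E.
  by apply: integral_ge0 => y _; rewrite lee_fin mulr_ge0 ?hP_ge0.
move: pot0; case: (hpot f x h) => [p| |]//.
  move=> p0; rewrite -!EFinM !lee_fin => hh.
  have -> : cI * c1 / c2 * p = (cI * (c1 * h `^ (n%:R + 1)) * p) / (c2 * h `^ (n%:R + 1)).
    by field; rewrite !gt_eqF.
  by rewrite ler_pdivlMr ?mul1r// mulr_gt0.
move=> _ _; rewrite gt0_muley ?leey// lte_fin divr_gt0// mulr_gt0//.
Qed.

(** If y is within squared distance M h of x, then d(y, w)^2 <= 2 M (d(x, w)^2 + h), so the
    regularised kernel at x is dominated by the singular kernel at y. *)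
Lemma hpot_le_riesz (M : R) : 1 <= M -> exists2 c : R, 0 < c & forall f,
  measurable_fun [set: borel H] (f : borel H -> mR) -> (forall y, 0 <= f y) ->
  forall x (h : R) y, 0 < h -> hdist x y ^+ 2 <= M * h ->
  (hpot f x h <= c%:E * riesz_potential alpha f y)%E.
Proof.
move=> M1; set cI := Gamma b / (2 `^ alpha * (2 * pi) ^+ n.+1).
have cI0 : 0 < cI := riesz_constant_gt0.
exists ((2 * M) `^ b / cI).
  by rewrite divr_gt0// powR_gt0// mulr_gt0// (lt_le_trans ltr01).
have M0 : 0 < 2 * M by rewrite mulr_gt0// (lt_le_trans ltr01).
move=> f mf f0 x h y h0 xy; rewrite riesz_potentialE// -/cI muleA -EFinM.
rewrite divfK ?gt_eqF//.
have mg : measurable_fun [set: borel H] (fun w => ((hdist y (w : H) ^+ 2) `^ (- b) * f w)%:E).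
  by apply/measurable_EFinP; apply: measurable_funM => //; exact: measurable_hdist_neg.
rewrite -ge0_integralZl//; last 2 first.
- by move=> w _; rewrite lee_fin mulr_ge0 ?powR_ge0.
- by rewrite lee_fin powR_ge0.
(* Only almost everywhere: where [hdist y w] is 0 the singular kernel has the conventional value
   0. *)
apply: ae_ge0_le_integral => //.
- by move=> w _; rewrite lee_fin mulr_ge0 ?hP_ge0.
- by apply/measurable_EFinP; apply: measurable_funM => //; exact: measurable_hP.
- by move=> w _; rewrite mule_ge0 ?lee_fin ?powR_ge0// mulr_ge0 ?powR_ge0.
- exact: emeasurable_funM.
have mZ : measurable [set w : borel H | hdist y w = 0].
  rewrite (_ : [set _ | _] = (fun w : borel H => hdist y (w : H) : mR) @^-1` [set 0]) //.
  rewrite -[X in measurable X]setTI.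
  by apply: (measurable_hdist (measurable_cst _) (@measurable_id _ _ _)).
exists [set w : borel H | hdist y w = 0]; split.
- exact: mZ.
(* The exceptional set lies in sublevel sets of arbitrarily small measure. *)
- have [C0 C00 hG] := hN_growth R n.
  apply/eqP; rewrite eq_le measure_ge0 andbT; apply/lee_addgt0Pr => e e0; rewrite add0e.
  pose r := (e / C0) `^ (n%:R + 1)^-1.
  have r0 : 0 < r by rewrite powR_gt0// divr_gt0.
  apply: (@le_trans _ _ (lam [set w | hN y 0 w < r]%R)).
    apply: le_measure; rewrite ?inE//.
      rewrite (_ : [set _ | _] = (fun w : borel H => hN y 0 (w : H) : mR) @^-1` `]-oo, r[).
        by rewrite -[X in measurable X]setTI; exact: measurable_hN.
      by apply/seteqP; split => w /=; rewrite in_itv.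
    by move=> w /= w0; rewrite /hN w0 expr0n/= addr0.
  apply: (le_trans (hG y 0 (lexx 0) r r0)).
  rewrite /r -powRrM mulVf; last by rewrite gt_eqF// ltr_wpDl.
  by rewrite powRr1 ?divr_ge0 ?(ltW e0) ?(ltW C00)// mulrC divfK ?gt_eqF.
move=> w /= hw; apply: contrapT => w0; apply: hw => _.
rewrite -EFinM lee_fin mulrA ler_wpM2r//.
have wp : 0 < hdist y w ^+ 2.
  by rewrite exprn_gt0// lt_def hdist_ge0 andbT; apply/eqP.
have -> : (2 * M) `^ b * (hdist y w ^+ 2) `^ (- b) = (hdist y w ^+ 2 / (2 * M)) `^ (- b).
  rewrite [RHS]powRM ?invr_ge0 ?sqr_ge0 ?(ltW M0)// powRVp// opprK mulrC//.
apply: powRN_le; [exact: ltW (b_gt0 alpha_gt alpha_lt) | by rewrite divr_gt0 |].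
rewrite ler_pdivrMr// /hN.
have := hdist_sq_triangle y x w; rewrite [hdist w x]hdistC [hdist y x]hdistC => tr.
apply: (le_trans tr).
have : hdist x w ^+ 2 <= hdist x w ^+ 2 * M by rewrite ler_peMr ?sqr_ge0.
by move: xy; clear -R; move=> *; lra.
Qed.
End riesz.

(** * Cauchy's formula on squares *)

Section complex_abs.
Context {R : realType}.
Local Notation C := (Cplx R).
Implicit Types z w : C.

Lemma cabsE z : `|z| = (cabs z)%:C :> C.
Proof. by rewrite normc_def; case: z. Qed.

Lemma cabs_le z (r : R) : (cabs z <= r) = (`|z| <= r%:C).
Proof. by rewrite cabsE lecR. Qed.

Lemma cabs_lt z (r : R) : (cabs z < r) = (`|z| < r%:C).
Proof. by rewrite cabsE ltcR. Qed.

Lemma cabs_ge0 z : 0 <= cabs z.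
Proof. by case: z => a b; exact: sqrtr_ge0. Qed.

Lemma cabsD z w : cabs (z + w) <= cabs z + cabs w. Proof. exact: le_normcD. Qed.
Lemma cabsN z : cabs (- z) = cabs z. Proof. exact: normcN. Qed.
Lemma cabsM z w : cabs (z * w) = cabs z * cabs w. Proof. exact: Normc.normcM. Qed.
Lemma cabsV z : cabs z^-1 = (cabs z)^-1. Proof. exact: Normc.normcV. Qed.
Lemma cabs0 : cabs (0 : C) = 0. Proof. exact: Normc.normc0. Qed.
Lemma cabs1 : cabs (1 : C) = 1. Proof. exact: Normc.normc1. Qed.

Lemma cabs_eq0 z : (cabs z == 0) = (z == 0).
Proof. by apply/eqP/eqP => [/Normc.eq0_normc//|->]; exact: cabs0. Qed.

Lemma cabs_gt0 z : (0 < cabs z) = (z != 0).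
Proof. by rewrite lt_def cabs_eq0 cabs_ge0 andbT. Qed.

Lemma cabsB z w : cabs (z - w) = cabs (w - z).
Proof. by rewrite -cabsN opprB. Qed.

Lemma cabsDB z w : cabs z - cabs w <= cabs (z - w).
Proof. by rewrite lerBlDr -[in leLHS](subrK w z) cabsD. Qed.

Lemma cabsX z k : cabs (z ^+ k) = cabs z ^+ k.
Proof. by elim: k => [|k IH]; rewrite ?expr0 ?cabs1// !exprS cabsM IH. Qed.

Lemma cabs_real (r : R) : cabs (r%:C : C) = `|r|.
Proof. by rewrite /= expr0n/= addr0 sqrtr_sqr. Qed.

Lemma cabs_Re z : `|complex.Re z| <= cabs z.
Proof.
case: z => a b /=; rewrite -sqrtr_sqr ler_sqrt ?addr_ge0 ?sqr_ge0//.
by rewrite lerDl sqr_ge0.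
Qed.

Lemma cabs_Im z : `|complex.Im z| <= cabs z.
Proof.
case: z => a b /=; rewrite -sqrtr_sqr ler_sqrt ?addr_ge0 ?sqr_ge0//.
by rewrite lerDr sqr_ge0.
Qed.

Lemma cabs_le_ReIm z : cabs z <= `|complex.Re z| + `|complex.Im z|.
Proof.
case: z => a b /=; rewrite -[leRHS]ger0_norm ?addr_ge0// -sqrtr_sqr ler_sqrt ?sqr_ge0//.
rewrite -[a ^+ 2]real_normK ?num_real// -[b ^+ 2]real_normK ?num_real//.
by rewrite sqrrD addrAC lerDl mulrn_wge0// mulr_ge0.
Qed.

Lemma cabs_sum_le (I : Type) (s : seq I) (F : I -> C) : cabs (\sum_(i <- s) F i) <= \sum_(i <- s) cabs (F i).
Proof.
elim: s => [|i s IH]; first by rewrite !big_nil cabs0.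
by rewrite !big_cons (le_trans (cabsD _ _))// lerD2l.
Qed.

End complex_abs.
#[local] Arguments Normc.normc : simpl never.

Section segment_integral.
Context {R : realType}.
Local Notation C := (Cplx R).
Local Notation leb := (@lebesgue_measure R).

(** The point y is not confined to the segment: this is continuity on the whole line at the points
    of the segment, so that endpoints are treated like interior points. *)
Definition cont_on (a b : R) (g : R -> R) :=
  forall x, a <= x <= b -> forall e : R, 0 < e ->
  exists2 d : R, 0 < d & forall y, `|y - x| < d -> `|g y - g x| < e.

Definition rint (a b : R) (g : R -> R) : R := \int[leb]_(x in `[a, b]) g x.

Lemma cont_on_integrable a b g : cont_on a b g -> leb.-integrable `[a, b] (EFin \o g).
Proof.
move=> cg; apply: continuous_compact_integrable; first exact: segment_compact.
apply: continuous_in_subspaceT => x; rewrite inE/= in_itv/= => xab.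
apply/cvgrPdist_lt => e e0; have [d d0 dP] := cg x xab e e0.
apply/nbhs_ballP; exists d => // y; rewrite /ball/= => xy.
by rewrite distrC; apply: dP; rewrite distrC.
Qed.

Lemma rintD a b f g : cont_on a b f -> cont_on a b g ->
  rint a b (fun x => f x + g x) = rint a b f + rint a b g.
Proof. by move=> cf cg; apply: RintegralD => //; exact: cont_on_integrable. Qed.

Lemma rintZ a b k f : cont_on a b f ->
  rint a b (fun x => k * f x) = k * rint a b f.
Proof. by move=> cf; apply: RintegralZl => //; exact: cont_on_integrable. Qed.

Lemma rint_cst a b k : a <= b -> rint a b (fun=> k) = k * (b - a).
Proof.
move=> ab; rewrite /rint Rintegral_cst//= lebesgue_measure_itv/= lte_fin.
case: ltP => [_|ba]; first by rewrite -EFinB.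
by rewrite (@le_anti _ _ a b) ?ab ?subrr ?mulr0.
Qed.

Lemma eq_rint a b f g : (forall x, a <= x <= b -> f x = g x) -> rint a b f = rint a b g.
Proof. by move=> fg; apply: eq_Rintegral => x; rewrite inE/= in_itv/=; exact: fg. Qed.

Lemma cont_onW a b a' b' g : a <= a' -> b' <= b -> cont_on a b g -> cont_on a' b' g.
Proof.
by move=> aa bb cg x /andP[ax xb]; apply: cg; rewrite (le_trans aa)//= (le_trans xb).
Qed.

Lemma rint_split a c b g : a <= c -> c <= b -> cont_on a b g ->
  rint a b g = rint a c g + rint c b g.
Proof.
move=> ac cb cg; have ig := cont_on_integrable cg.
have := @Rintegral_itvB R g (BLeft a) (BRight b) c ig.
rewrite !bnd_simp ac cb => /(_ isT isT) /eqP; rewrite subr_eq addrC => /eqP.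
rewrite /rint => ->; congr (_ + _).
apply: Rintegral_itv_obnd_cbnd.
apply: integrableS ig => //; first by apply: subset_itvr; rewrite bnd_simp.
Qed.

Lemma cont_on_norm a b g : cont_on a b g -> cont_on a b (fun x => `|g x|).
Proof.
move=> cg x xab e e0; have [d d0 dP] := cg x xab e e0; exists d => // y yx.
exact: le_lt_trans (ler_dist_dist _ _) (dP y yx).
Qed.

Lemma cont_on_cst a b k : cont_on a b (fun=> k).
Proof. by move=> x _ e e0; exists 1 => // y _; rewrite subrr normr0. Qed.

Lemma rint_le a b f g : cont_on a b f -> cont_on a b g ->
  (forall x, a <= x <= b -> f x <= g x) -> rint a b f <= rint a b g.
Proof.
move=> cf cg fg; apply: le_Rintegral => //; do ?exact: cont_on_integrable.
Qed.

Lemma rint_norm a b f : cont_on a b f -> `|rint a b f| <= rint a b (fun x => `|f x|).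
Proof. by move=> cf; apply: le_normr_Rintegral => //; exact: cont_on_integrable. Qed.

Lemma rint_bound a b f M : a <= b -> cont_on a b f ->
  (forall x, a <= x <= b -> `|f x| <= M) -> `|rint a b f| <= M * (b - a).
Proof.
move=> ab cf fM; apply: (le_trans (rint_norm cf)); rewrite -rint_cst//.
by apply: rint_le => //; [exact: cont_on_norm | exact: cont_on_cst].
Qed.

Lemma rint_shift a b c g : cont_on (a + c) (b + c) g ->
  rint (a + c) (b + c) g = rint a b (fun x => g (x + c)).
Proof.
move=> cg; have ig := cont_on_integrable cg.
rewrite /rint /Rintegral; congr fine.
rewrite [LHS]integral_mkcond [RHS]integral_mkcond.
pose G : measurableTypeR R -> \bar R := (EFin \o g) \_ `[a + c, b + c].
rewrite -/G; have mG : measurable_fun [set: measurableTypeR R] G.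
  by apply/(measurable_restrictT _ (measurable_itv _)); exact: measurable_int ig.
have -> : (fun x => (g (x + c))%:E) \_ `[a, b] = (fun x : measurableTypeR R => G (x + c)%R).
  apply/funext => x; rewrite /G /patch; congr (if _ then _ else _).
  by apply/idP/idP; rewrite !inE/= !in_itv/= !lerD2r.
(* [lebesgue_shift] is for nonnegative functions, hence the split into positive and negative
   parts. *)
rewrite integralE [RHS]integralE; congr (_ - _)%E.
  have h : forall x, (0 <= G^\+ x)%E by move=> x; exact: funepos_ge0.
  rewrite -(@lebesgue_shift R c _ (measurable_funepos mG) h).
  by apply: eq_integral => x _; rewrite !funeposE.
have h : forall x, (0 <= G^\- x)%E by move=> x; exact: funeneg_ge0.
rewrite -(@lebesgue_shift R c _ (measurable_funeneg mG) h).
by apply: eq_integral => x _; rewrite !funenegE.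
Qed.
End segment_integral.

Section complex_segment.
Context {R : realType}.
Local Notation C := (Cplx R).
Implicit Types (f g : R -> C).

Definition ccont_on (a b : R) f :=
  cont_on a b (fun x => complex.Re (f x)) /\ cont_on a b (fun x => complex.Im (f x)).

Definition cint (a b : R) f : C :=
  (rint a b (fun x => complex.Re (f x)) +i* rint a b (fun x => complex.Im (f x)))%C.

Lemma cont_onD a b (f g : R -> R) : cont_on a b f -> cont_on a b g ->
  cont_on a b (fun x => f x + g x).
Proof.
move=> cf cg x xab e e0; have e2 : 0 < e / 2 by rewrite divr_gt0.
have [d1 d10 h1] := cf x xab _ e2; have [d2 d20 h2] := cg x xab _ e2.
exists (Num.min d1 d2); first by rewrite lt_min d10.
move=> y; rewrite lt_min => /andP[y1 y2].
rewrite (_ : _ - _ = (f y - f x) + (g y - g x)); last by ring.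
by rewrite (le_lt_trans (ler_normD _ _))// [ltRHS]splitr ltrD ?h1 ?h2.
Qed.

Lemma cont_onZ a b (k : R) (f : R -> R) : cont_on a b f -> cont_on a b (fun x => k * f x).
Proof.
move=> cf x xab e e0; have k0 : 0 < `|k| + 1 by rewrite ltr_wpDl.
have [d d0 dP] := cf x xab (e / (`|k| + 1)) (divr_gt0 e0 k0).
exists d => // y yx; rewrite -mulrBr normrM.
have := dP y yx; rewrite ltr_pdivlMr// mulrC => h.
by apply: le_lt_trans h; rewrite mulrDl mul1r lerDl.
Qed.

Lemma ccont_onD a b f g : ccont_on a b f -> ccont_on a b g -> ccont_on a b (fun x => f x + g x).
Proof.
move=> [f1 f2] [g1 g2]; split.
  rewrite (_ : (fun _ => _) = (fun x => complex.Re (f x) + complex.Re (g x))); first exact: cont_onD.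
  by apply/funext => x; case: (f x) => ? ?; case: (g x).
rewrite (_ : (fun _ => _) = (fun x => complex.Im (f x) + complex.Im (g x))); first exact: cont_onD.
by apply/funext => x; case: (f x) => ? ?; case: (g x).
Qed.

Lemma ccont_onZ a b (k : C) f : ccont_on a b f -> ccont_on a b (fun x => k * f x).
Proof.
case: k => k1 k2 [f1 f2]; split.
  rewrite (_ : (fun _ => _) = (fun x => k1 * complex.Re (f x) + (- k2) * complex.Im (f x))).
    by apply: cont_onD; exact: cont_onZ.
  by apply/funext => x; case: (f x) => ? ? /=; ring.
rewrite (_ : (fun _ => _) = (fun x => k1 * complex.Im (f x) + k2 * complex.Re (f x))).
  by apply: cont_onD; exact: cont_onZ.
by apply/funext => x; case: (f x) => ? ? /=; ring.
Qed.

Lemma ccont_onB a b f g : ccont_on a b f -> ccont_on a b g -> ccont_on a b (fun x => f x - g x).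
Proof.
move=> cf cg; rewrite (_ : (fun _ => _) = (fun x => f x + (-1) * g x)).
  by apply: ccont_onD => //; exact: ccont_onZ.
by apply/funext => x; rewrite mulN1r.
Qed.

Lemma ccont_onW a b a' b' f : a <= a' -> b' <= b -> ccont_on a b f -> ccont_on a' b' f.
Proof. by move=> aa bb [f1 f2]; split; apply: cont_onW aa bb _. Qed.

Lemma cintD a b f g : ccont_on a b f -> ccont_on a b g ->
  cint a b (fun x => f x + g x) = cint a b f + cint a b g.
Proof.
move=> [f1 f2] [g1 g2]; rewrite /cint.
have -> : (fun x => complex.Re (f x + g x)) = (fun x => complex.Re (f x) + complex.Re (g x)).
  by apply/funext => x; case: (f x) => ? ?; case: (g x).
have -> : (fun x => complex.Im (f x + g x)) = (fun x => complex.Im (f x) + complex.Im (g x)).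
  by apply/funext => x; case: (f x) => ? ?; case: (g x).
by rewrite !rintD.
Qed.

Lemma cintZ a b k f : ccont_on a b f -> cint a b (fun x => k * f x) = k * cint a b f.
Proof.
case: k => k1 k2 [f1 f2]; rewrite /cint.
have -> : (fun x => complex.Re ((k1 +i* k2)%C * f x)) = (fun x => k1 * complex.Re (f x) + (- k2) * complex.Im (f x)).
  by apply/funext => x; case: (f x) => ? ? /=; ring.
have -> : (fun x => complex.Im ((k1 +i* k2)%C * f x)) = (fun x => k1 * complex.Im (f x) + k2 * complex.Re (f x)).
  by apply/funext => x; case: (f x) => ? ? /=; ring.
rewrite !rintD ?rintZ//; do ?exact: cont_onZ.
by apply/eqP; rewrite eq_complex /=; apply/andP; split; apply/eqP; ring.
Qed.

Lemma cintB a b f g : ccont_on a b f -> ccont_on a b g ->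
  cint a b (fun x => f x - g x) = cint a b f - cint a b g.
Proof.
move=> cf cg; rewrite (_ : (fun _ => _) = (fun x => f x + (-1) * g x)).
  by rewrite cintD ?cintZ ?mulN1r//; exact: ccont_onZ.
by apply/funext => x; rewrite mulN1r.
Qed.

Lemma cint_cst a b (k : C) : a <= b -> cint a b (fun=> k) = k * (b - a)%:C.
Proof.
case: k => k1 k2 ab; rewrite /cint !rint_cst//.
by apply/eqP; rewrite eq_complex /=; apply/andP; split; apply/eqP; ring.
Qed.

Lemma eq_cint a b f g : (forall x, a <= x <= b -> f x = g x) -> cint a b f = cint a b g.
Proof. by move=> fg; rewrite /cint; congr (_ +i* _)%C; apply: eq_rint => x xab; rewrite fg. Qed.

Lemma cint_split a c b f : a <= c -> c <= b -> ccont_on a b f ->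
  cint a b f = cint a c f + cint c b f.
Proof. by move=> ac cb [f1 f2]; rewrite /cint !(rint_split ac cb). Qed.

(** The factor 2 is the price of estimating real and imaginary parts separately; no sharp constant
    is needed later. *)
Lemma cint_bound a b f M : a <= b -> ccont_on a b f ->
  (forall x, a <= x <= b -> cabs (f x) <= M) -> cabs (cint a b f) <= 2 * M * (b - a).
Proof.
move=> ab [f1 f2] fM; apply: (le_trans (cabs_le_ReIm _)) => /=.
rewrite -mulrA mulr_natl mulr2n; apply: lerD; apply: rint_bound => // x xab.
  exact: le_trans (cabs_Re _) (fM x xab).
exact: le_trans (cabs_Im _) (fM x xab).
Qed.

Lemma cint_shift a b c f : ccont_on (a + c) (b + c) f ->
  cint (a + c) (b + c) f = cint a b (fun x => f (x + c)).
Proof. by move=> [f1 f2]; rewrite /cint !rint_shift. Qed.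
End complex_segment.
#[local] Arguments cint : simpl never.

(** * Contour integrals over rectangles and Goursat's theorem *)

Section rectangles.
Context {R : realType}.
Local Notation C := (Cplx R).
Implicit Types (f g : C -> C) (z w : C).

Definition cpt (x y : R) : C := (x +i* y)%C.

Definition ccontat f z := forall e : R, 0 < e ->
  exists2 d : R, 0 < d & forall w, cabs (w - z) < d -> cabs (f w - f z) < e.

(** Stated without a quotient, so that w = z is not excluded, and with the real modulus [cabs],
    since the norm of [C] takes values in [C]. *)
Definition cderiv f z (l : C) := forall e : R, 0 < e ->
  exists2 d : R, 0 < d & forall w, cabs (w - z) < d ->
    cabs (f w - f z - l * (w - z)) <= e * cabs (w - z).

Definition cdiff f z := exists l, cderiv f z l.

Lemma cderiv_cont f z l : cderiv f z l -> ccontat f z.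
Proof.
move=> df e e0; have [d d0 dP] := df 1 ltr01.
have k0 : 0 < cabs l + 1 by rewrite ltr_wpDl ?cabs_ge0.
exists (Num.min d (e / (cabs l + 1))); first by rewrite lt_min d0 divr_gt0.
move=> w; rewrite lt_min ltr_pdivlMr// => /andP[h1 h2].
have := dP w h1; rewrite mul1r => h3.
apply: le_lt_trans h2; rewrite mulrDr mulr1 -[X in cabs X](subrK (l * (w - z))).
by rewrite (le_trans (cabsD _ _))// addrC cabsM mulrC lerD2l.
Qed.

Lemma cdiff_cont f z : cdiff f z -> ccontat f z.
Proof. by move=> [l]; exact: cderiv_cont. Qed.

Definition rect (x1 x2 y1 y2 : R) : set C :=
  [set z | x1 <= complex.Re z <= x2 /\ y1 <= complex.Im z <= y2].

(** The counterclockwise contour integral of f dz: bottom edge minus top edge, plus i times right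
    edge minus left edge. *)
Definition rectint f (x1 x2 y1 y2 : R) : C :=
  cint x1 x2 (fun x => f (cpt x y1) - f (cpt x y2)) +
  'i * cint y1 y2 (fun y => f (cpt x2 y) - f (cpt x1 y)).

Lemma ccontat_line f (c u : C) (g : R -> C) a b : cabs u <= 1 ->
  (forall x, g x = f (c + x%:C * u)) ->
  (forall x, a <= x <= b -> ccontat f (c + x%:C * u)) -> ccont_on a b g.
Proof.
move=> u1 gE cf; split => x xab e e0; have [d d0 dP] := cf x xab e e0;
  exists d => // y yx; rewrite !gE -raddfB;
  (apply: le_lt_trans; [|apply: dP; last first]).
- exact: cabs_Re.
- rewrite (_ : _ - _ = (y - x)%:C * u); last by rewrite rmorphB; ring.
  rewrite cabsM cabs_real; apply: le_lt_trans yx.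
  by rewrite ler_piMr.
- exact: cabs_Im.
- rewrite (_ : _ - _ = (y - x)%:C * u); last by rewrite rmorphB; ring.
  rewrite cabsM cabs_real; apply: le_lt_trans yx.
  by rewrite ler_piMr.
Qed.

Lemma ccont_hor f y a b : (forall x, a <= x <= b -> ccontat f (cpt x y)) ->
  ccont_on a b (fun x => f (cpt x y)).
Proof.
move=> cf.
have E x : cpt x y = cpt 0 y + x%:C * 1.
  by apply/eqP; rewrite eq_complex /=; apply/andP; split; apply/eqP; ring.
apply: (@ccontat_line f (cpt 0 y) 1); first by rewrite cabs1.
  by move=> x; rewrite -E.
by move=> x xab; rewrite -E; exact: cf.
Qed.

Lemma ccont_ver f x a b : (forall y, a <= y <= b -> ccontat f (cpt x y)) ->
  ccont_on a b (fun y => f (cpt x y)).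
Proof.
move=> cf.
have E y : cpt x y = cpt x 0 + y%:C * 'i.
  by apply/eqP; rewrite eq_complex /=; apply/andP; split; apply/eqP; ring.
apply: (@ccontat_line f (cpt x 0) 'i).
- by rewrite /Normc.normc /= expr0n/= add0r expr1n sqrtr1.
- by move=> y; rewrite -E.
by move=> y yab; rewrite -E; exact: cf.
Qed.

#[local] Arguments rectint : simpl never.

Definition bcont f (x1 x2 y1 y2 : R) :=
  [/\ ccont_on x1 x2 (fun x => f (cpt x y1)), ccont_on x1 x2 (fun x => f (cpt x y2)),
      ccont_on y1 y2 (fun y => f (cpt x1 y)) & ccont_on y1 y2 (fun y => f (cpt x2 y))].

Lemma rect_bcont f x1 x2 y1 y2 : x1 <= x2 -> y1 <= y2 ->
  (forall z, rect x1 x2 y1 y2 z -> ccontat f z) -> bcont f x1 x2 y1 y2.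
Proof.
move=> x12 y12 cf; split;
  [apply: ccont_hor|apply: ccont_hor|apply: ccont_ver|apply: ccont_ver] => t tI;
  by apply: cf; split; rewrite //= ?lexx ?x12 ?y12.
Qed.

Lemma eq_rectint f g x1 x2 y1 y2 : x1 <= x2 -> y1 <= y2 ->
  (forall z, rect x1 x2 y1 y2 z -> [\/ complex.Re z = x1, complex.Re z = x2,
      complex.Im z = y1 | complex.Im z = y2] -> f z = g z) ->
  rectint f x1 x2 y1 y2 = rectint g x1 x2 y1 y2.
Proof.
move=> x12 y12 fg; rewrite /rectint; congr (_ + _ * _); apply: eq_cint => t tI.
  rewrite !fg//=; do ?split => //=; rewrite ?lexx ?y12//; by [apply: Or43 | apply: Or44].
rewrite !fg//=; do ?split => //=; rewrite ?lexx ?x12//; by [apply: Or41 | apply: Or42].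
Qed.

Lemma rectintD f g x1 x2 y1 y2 : bcont f x1 x2 y1 y2 -> bcont g x1 x2 y1 y2 ->
  rectint (fun z => f z + g z) x1 x2 y1 y2 = rectint f x1 x2 y1 y2 + rectint g x1 x2 y1 y2.
Proof.
move=> [f1 f2 f3 f4] [g1 g2 g3 g4]; rewrite /rectint !cintB ?cintD//; do ?exact: ccont_onD.
by ring.
Qed.

Lemma rectintZ f k x1 x2 y1 y2 : bcont f x1 x2 y1 y2 ->
  rectint (fun z => k * f z) x1 x2 y1 y2 = k * rectint f x1 x2 y1 y2.
Proof.
move=> [f1 f2 f3 f4]; rewrite /rectint !cintB ?cintZ//; do ?exact: ccont_onZ.
by ring.
Qed.

Lemma bcontD f g x1 x2 y1 y2 : bcont f x1 x2 y1 y2 -> bcont g x1 x2 y1 y2 ->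
  bcont (fun z => f z + g z) x1 x2 y1 y2.
Proof. by move=> [f1 f2 f3 f4] [g1 g2 g3 g4]; split; apply: ccont_onD. Qed.

Lemma bcontZ f k x1 x2 y1 y2 : bcont f x1 x2 y1 y2 -> bcont (fun z => k * f z) x1 x2 y1 y2.
Proof. by move=> [f1 f2 f3 f4]; split; apply: ccont_onZ. Qed.

Lemma rectint_bound f x1 x2 y1 y2 M : x1 <= x2 -> y1 <= y2 -> bcont f x1 x2 y1 y2 ->
  (forall z, rect x1 x2 y1 y2 z -> [\/ complex.Re z = x1, complex.Re z = x2,
      complex.Im z = y1 | complex.Im z = y2] -> cabs (f z) <= M) ->
  cabs (rectint f x1 x2 y1 y2) <= 4 * M * ((x2 - x1) + (y2 - y1)).
Proof.
move=> x12 y12 [f1 f2 f3 f4] fM.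
have h1 : cabs (cint x1 x2 (fun x => f (cpt x y1) - f (cpt x y2))) <= 2 * (2 * M) * (x2 - x1).
  apply: cint_bound => //; first exact: ccont_onB.
  move=> t tI; apply: (le_trans (cabsD _ _)); rewrite cabsN mulr_natl mulr2n.
  by apply: lerD; apply: fM; rewrite /rect/= ?tI ?lexx ?y12//; [apply: Or43 | apply: Or44].
have h2 : cabs (cint y1 y2 (fun y => f (cpt x2 y) - f (cpt x1 y))) <= 2 * (2 * M) * (y2 - y1).
  apply: cint_bound => //; first exact: ccont_onB.
  move=> t tI; apply: (le_trans (cabsD _ _)); rewrite cabsN mulr_natl mulr2n.
  by apply: lerD; apply: fM; rewrite /rect/= ?tI ?lexx ?x12//; [apply: Or42 | apply: Or41].
have i1 : cabs ('i : C) = 1 by rewrite /Normc.normc /= expr0n/= add0r expr1n sqrtr1.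
rewrite /rectint; apply: (le_trans (cabsD _ _)); rewrite cabsM i1 mul1r.
by move: h1 h2; lra.
Qed.

Lemma rectint_splitx f x1 x2 x3 y1 y2 : x1 <= x2 -> x2 <= x3 ->
  bcont f x1 x3 y1 y2 -> ccont_on y1 y2 (fun y => f (cpt x2 y)) ->
  rectint f x1 x3 y1 y2 = rectint f x1 x2 y1 y2 + rectint f x2 x3 y1 y2.
Proof.
move=> x12 x23 [f1 f2 f3 f4] f5; rewrite /rectint (cint_split x12 x23); last exact: ccont_onB.
rewrite (eq_cint (f := fun y => f (cpt x3 y) - f (cpt x1 y))
  (g := fun y => (f (cpt x3 y) - f (cpt x2 y)) + (f (cpt x2 y) - f (cpt x1 y)))); last first.
  by move=> y _; rewrite addrA subrK.
by rewrite [cint y1 y2 _]cintD; [ring | exact: ccont_onB | exact: ccont_onB].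
Qed.

Lemma rectint_splity f x1 x2 y1 y2 y3 : y1 <= y2 -> y2 <= y3 ->
  bcont f x1 x2 y1 y3 -> ccont_on x1 x2 (fun x => f (cpt x y2)) ->
  rectint f x1 x2 y1 y3 = rectint f x1 x2 y1 y2 + rectint f x1 x2 y2 y3.
Proof.
move=> y12 y23 [f1 f2 f3 f4] f5; rewrite /rectint (cint_split y12 y23); last exact: ccont_onB.
rewrite (eq_cint (f := fun x => f (cpt x y1) - f (cpt x y3))
  (g := fun x => (f (cpt x y1) - f (cpt x y2)) + (f (cpt x y2) - f (cpt x y3)))); last first.
  by move=> y _; rewrite addrA subrK.
by rewrite [cint x1 x2 _]cintD; [ring | exact: ccont_onB | exact: ccont_onB].
Qed.

Lemma rectint_affine (k l c : C) x1 x2 y1 y2 : x1 <= x2 -> y1 <= y2 ->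
  rectint (fun z => k + l * (z - c)) x1 x2 y1 y2 = 0.
Proof.
move=> x12 y12; rewrite /rectint.
rewrite (eq_cint (g := fun=> l * (cpt 0 (y1 - y2)))); last first.
  move=> x _; rewrite (_ : cpt 0 (y1 - y2) = cpt x y1 - cpt x y2); first by ring.
  by apply/eqP; rewrite eq_complex /=; apply/andP; split; apply/eqP; ring.
rewrite (eq_cint (f := fun y => _ - _) (g := fun=> l * (cpt (x2 - x1) 0))); last first.
  move=> y _; rewrite (_ : cpt (x2 - x1) 0 = cpt x2 y - cpt x1 y); first by ring.
  by apply/eqP; rewrite eq_complex /=; apply/andP; split; apply/eqP; ring.
rewrite !cint_cst//.
rewrite (_ : cpt 0 (y1 - y2) = - ('i * (y2 - y1)%:C)); last first.
  by apply/eqP; rewrite eq_complex /=; apply/andP; split; apply/eqP; ring.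
by rewrite (_ : cpt (x2 - x1) 0 = (x2 - x1)%:C)//; ring.
Qed.

Lemma ccontat_affine (k l c z : C) : ccontat (fun z => k + l * (z - c)) z.
Proof.
apply: (@cderiv_cont _ z l) => e e0; exists 1 => // w _.
rewrite (_ : _ - _ - _ = 0) ?cabs0 ?mulr_ge0 ?cabs_ge0 ?(ltW e0)//.
by ring.
Qed.

Lemma ccontatD f g z : ccontat f z -> ccontat g z -> ccontat (fun z => f z + g z) z.
Proof.
move=> cf cg e e0; have e2 : 0 < e / 2 by rewrite divr_gt0.
have [d1 d10 h1] := cf _ e2; have [d2 d20 h2] := cg _ e2.
exists (Num.min d1 d2); first by rewrite lt_min d10.
move=> y; rewrite lt_min => /andP[y1 y2].
rewrite (_ : _ - _ = (f y - f z) + (g y - g z)); last by ring.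
by rewrite (le_lt_trans (cabsD _ _))// [ltRHS]splitr ltrD ?h1 ?h2.
Qed.

Lemma ccontatZ k f z : ccontat f z -> ccontat (fun z => k * f z) z.
Proof.
move=> cf e e0; have k0 : 0 < cabs k + 1 by rewrite ltr_wpDl ?cabs_ge0.
have [d d0 dP] := cf (e / (cabs k + 1)) (divr_gt0 e0 k0).
exists d => // y yx; rewrite -mulrBr cabsM.
have := dP y yx; rewrite ltr_pdivlMr// mulrC => h.
by apply: le_lt_trans h; rewrite mulrDl mul1r lerDl cabs_ge0.
Qed.

Lemma rect_sub (x1 x2 y1 y2 u1 u2 v1 v2 : R) : x1 <= u1 -> u2 <= x2 -> y1 <= v1 -> v2 <= y2 ->
  rect u1 u2 v1 v2 `<=` rect x1 x2 y1 y2.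
Proof.
move=> h1 h2 h3 h4 z [/andP[a1 a2] /andP[a3 a4]]; split; apply/andP; split.
- exact: le_trans a1.
- exact: le_trans h2.
- exact: le_trans a3.
- exact: le_trans h4.
Qed.

Lemma cabs_quarter (J j1 j2 j3 j4 : C) : J = j1 + j2 + (j3 + j4) ->
  [\/ cabs J <= 4 * cabs j1, cabs J <= 4 * cabs j2, cabs J <= 4 * cabs j3 | cabs J <= 4 * cabs j4].
Proof.
move=> ->; set J' := _ + _.
have h1 := cabsD (j1 + j2) (j3 + j4); have h2 := cabsD j1 j2; have h3 := cabsD j3 j4.
have [c1|c1] := leP (cabs J') (4 * cabs j1); first by apply: Or41.
have [c2|c2] := leP (cabs J') (4 * cabs j2); first by apply: Or42.
have [c3|c3] := leP (cabs J') (4 * cabs j3); first by apply: Or43.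
apply: Or44; rewrite -/J' in h1.
move: h1 h2 h3 c1 c2 c3; move: (cabs J') (cabs j1) (cabs j2) (cabs j3) (cabs j4) => *; lra.
Qed.

(** Quartering: one of the four parts always keeps a quarter of the integral, so after k steps at
    least 4^-k of it is left on a rectangle of size 2^-k. At the common point of these rectangles
    the affine part of f integrates to 0, and the remainder is o(2^-k) on a boundary of length
    O(2^-k), a contradiction. *)
Lemma goursat f x1 x2 y1 y2 : x1 <= x2 -> y1 <= y2 ->
  (forall z, rect x1 x2 y1 y2 z -> cdiff f z) -> rectint f x1 x2 y1 y2 = 0.
Proof.
move=> x12 y12 df; apply/eqP; rewrite -cabs_eq0 -[_ == _]negbK; apply/negP => eta0.
set eta := cabs (rectint f x1 x2 y1 y2) in eta0.
have {}eta0 : 0 < eta by rewrite lt_def eta0 cabs_ge0.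
set a := x2 - x1; set b := y2 - y1.
have a0 : 0 <= a by rewrite subr_ge0.
have b0 : 0 <= b by rewrite subr_ge0.
have cf z : rect x1 x2 y1 y2 z -> ccontat f z by move=> zR; exact/cdiff_cont/df.
pose ak k : R := a / 2 ^+ k; pose bk k : R := b / 2 ^+ k.
have ak0 k : 0 <= ak k by rewrite divr_ge0// exprn_ge0.
have bk0 k : 0 <= bk k by rewrite divr_ge0// exprn_ge0.
have akS k : ak k = ak k.+1 + ak k.+1 by rewrite /ak exprS; field; rewrite expf_neq0.
have bkS k : bk k = bk k.+1 + bk k.+1 by rewrite /bk exprS; field; rewrite expf_neq0.
pose Inv k (p : R * R) := [/\ x1 <= p.1, p.1 + ak k <= x2, y1 <= p.2, p.2 + bk k <= y2 &
  eta <= 4 ^+ k * cabs (rectint f p.1 (p.1 + ak k) p.2 (p.2 + bk k))].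
pose nested k (p p' : R * R) := [/\ p.1 <= p'.1, p'.1 + ak k.+1 <= p.1 + ak k,
  p.2 <= p'.2 & p'.2 + bk k.+1 <= p.2 + bk k].
have step k p : Inv k p -> exists p', Inv k.+1 p' /\ nested k p p'.
  move=> [h1 h2 h3 h4 h5]; case: p h1 h2 h3 h4 h5 => x y /= h1 h2 h3 h4 h5.
  have cR z : rect x (x + ak k) y (y + bk k) z -> ccontat f z.
    by move=> zR; apply: cf; apply: rect_sub zR.
  have sA := ak0 k.+1; have sB := bk0 k.+1.
  have eA := akS k; have eB := bkS k.
  have sub u v : x <= u -> u + ak k.+1 <= x + ak k -> y <= v -> v + bk k.+1 <= y + bk k ->
     bcont f u (u + ak k.+1) v (v + bk k.+1).
    move=> i1 i2 i3 i4; apply: rect_bcont; rewrite ?lerDl// => z zR; apply: cR.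
    exact: rect_sub zR.
  have E : rectint f x (x + ak k) y (y + bk k) =
     (rectint f x (x + ak k.+1) y (y + bk k.+1) +
      rectint f x (x + ak k.+1) (y + bk k.+1) (y + bk k.+1 + bk k.+1)) +
     (rectint f (x + ak k.+1) (x + ak k.+1 + ak k.+1) y (y + bk k.+1) +
      rectint f (x + ak k.+1) (x + ak k.+1 + ak k.+1) (y + bk k.+1) (y + bk k.+1 + bk k.+1)).
    have hor t u u' : x <= u -> u' <= x + ak k -> y <= t <= y + bk k ->
        ccont_on u u' (fun r => f (cpt r t)).
      move=> hu hu' ht; apply: ccont_hor => r /andP[r1 r2]; apply: cR; split => //=.
      by rewrite (le_trans hu r1) (le_trans r2).
    have ver t : x <= t <= x + ak k -> ccont_on y (y + bk k) (fun r => f (cpt t r)).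
      by move=> ht; apply: ccont_ver => z zI; apply: cR; split.
    have xm : x <= x + ak k.+1 <= x + ak k by rewrite lerDl sA lerD2l eA lerDl.
    have ym : y <= y + bk k.+1 <= y + bk k by rewrite lerDl sB lerD2l eB lerDl.
    have yl : y <= y <= y + bk k by rewrite lexx lerDl bk0.
    have yr : y <= y + bk k <= y + bk k by rewrite lexx lerDl bk0.
    have xl : x <= x <= x + ak k by rewrite lexx lerDl ak0.
    have xr : x <= x + ak k <= x + ak k by rewrite lexx lerDl ak0.
    have /andP[xm1 xm2] := xm; have /andP[ym1 ym2] := ym.
    rewrite -!addrA -eA -eB !addrA.
    rewrite (@rectint_splitx f x (x + ak k.+1) (x + ak k) y (y + bk k)) //; last 2 first.
    - by split; [apply: hor|apply: hor|apply: ver|apply: ver].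
    - exact: ver.
    rewrite (@rectint_splity f x (x + ak k.+1) y (y + bk k.+1) (y + bk k)) //; last 2 first.
    - by split; [apply: hor|apply: hor|apply: ver|apply: ver].
    - exact: hor.
    rewrite (@rectint_splity f (x + ak k.+1) (x + ak k) y (y + bk k.+1) (y + bk k)) //; last 2 first.
    - by split; [apply: hor|apply: hor|apply: ver|apply: ver].
    - exact: hor.
    by rewrite !addrA.
  have : exists u v, [/\ (u = x \/ u = x + ak k.+1), (v = y \/ v = y + bk k.+1) &
     cabs (rectint f x (x + ak k) y (y + bk k)) <=
       4 * cabs (rectint f u (u + ak k.+1) v (v + bk k.+1))].
    have [|||] := cabs_quarter E => c1.
    - by exists x, y; split => //; left.
    - by exists x, (y + bk k.+1); split => //; [left|right].
    - by exists (x + ak k.+1), y; split => //; [right|left].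
    - by exists (x + ak k.+1), (y + bk k.+1); split => //; right.
  move=> [u [v [hu hv huv]]]; exists (u, v).
  have [u1 u2] : x <= u /\ u + ak k.+1 <= x + ak k.
    by case: hu => ->; rewrite eA; split; lra.
  have [v1 v2] : y <= v /\ v + bk k.+1 <= y + bk k.
    by case: hv => ->; rewrite eB; split; lra.
  split; split => //=.
  - exact: le_trans u1.
  - exact: le_trans h2.
  - exact: le_trans v1.
  - exact: le_trans h4.
  apply: (le_trans h5); rewrite [4 ^+ k.+1]exprSr -mulrA; apply: ler_wpM2l => //; exact: exprn_ge0.
have stepC k : exists s : R * R -> R * R, forall p, Inv k p -> Inv k.+1 (s p) /\ nested k p (s p).
  have [|s sP] := @choice _ _ (fun p p' => Inv k p -> Inv k.+1 p' /\ nested k p p').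
    move=> p; have [/step[p' hp']|ni] := pselect (Inv k p); last by exists p.
    by exists p'.
  by exists s.
have [s sP] := choice stepC.
pose P := fix P k := if k is k'.+1 then s k' (P k') else (x1, y1).
have PI k : Inv k (P k).
  elim: k => [|k IH] /=; last by have [] := sP k _ IH.
  split => /=; rewrite /ak /bk ?expr0 ?divr1 ?mul1r//.
  - by rewrite /a; lra.
  - by rewrite /b; lra.
  by rewrite /a /b (_ : x1 + _ = x2)1?(_ : y1 + _ = y2)//; ring.
have PN k : nested k (P k) (P k.+1) by have [] := sP k _ (PI k).
have PN2 k j : [/\ (P k).1 <= (P (j + k)%N).1, (P (j + k)%N).1 + ak (j + k)%N <= (P k).1 + ak k,
   (P k).2 <= (P (j + k)%N).2 & (P (j + k)%N).2 + bk (j + k)%N <= (P k).2 + bk k].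
  elim: j => [|j [i1 i2 i3 i4]]; first by rewrite add0n !lexx.
  have [j1 j2 j3 j4] := PN (j + k)%N; rewrite addSn; split.
  - exact: le_trans j1.
  - exact: le_trans i2.
  - exact: le_trans j3.
  - exact: le_trans i4.
have cross j k : (P j).1 <= (P k).1 + ak k /\ (P j).2 <= (P k).2 + bk k.
  have [jk|kj] := leqP j k.
    have [i1 _ i3 _] := PN2 j (k - j)%N; rewrite subnK// in i1 i3.
    by split; [apply: (le_trans i1)|apply: (le_trans i3)]; rewrite lerDl.
  have [_ i2 _ i4] := PN2 k (j - k)%N; rewrite subnK ?(ltnW kj)// in i2 i4.
  by split; [apply: le_trans i2|apply: le_trans i4]; rewrite lerDl.
(* The lower left corners increase and stay below every upper right corner, so their suprema lie in
   all the rectangles. *)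
pose px := sup [set (P k).1 | k in setT]; pose py := sup [set (P k).2 | k in setT].
have hx k : (P k).1 <= px <= (P k).1 + ak k.
  apply/andP; split.
    apply: ub_le_sup; last by exists k.
    by exists ((P 0%N).1 + ak 0%N) => _ [j _ <-]; have [] := cross j 0%N.
  apply: ge_sup; first by exists (P 0%N).1; exists 0%N.
  by move=> _ [j _ <-]; have [] := cross j k.
have hy k : (P k).2 <= py <= (P k).2 + bk k.
  apply/andP; split.
    apply: ub_le_sup; last by exists k.
    by exists ((P 0%N).2 + bk 0%N) => _ [j _ <-]; have [] := cross j 0%N.
  apply: ge_sup; first by exists (P 0%N).2; exists 0%N.
  by move=> _ [j _ <-]; have [] := cross j k.
have pR : rect x1 x2 y1 y2 (cpt px py).
  have := hx 0%N; have := hy 0%N; rewrite /ak /bk/= expr0 !divr1 /a /b => hy0 hx0.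
  by split => /=; move: hx0 hy0; rewrite ![_ + (_ - _)]addrC !subrK.
have [l dl] := df _ pR.
(* Chosen so that the final bound 4 e (a + b)^2 is below eta; the summand 1 covers the case a + b =
   0. *)
pose e := eta / (4 * (a + b) ^+ 2 + 1) / 2.
have den0 : 0 < 4 * (a + b) ^+ 2 + 1 by rewrite ltr_wpDl// mulr_ge0// sqr_ge0.
have e0 : 0 < e by rewrite !divr_gt0.
have [d d0 dP] := dl e e0.
have [k kd] : exists k, (a + b) / 2 ^+ k < d.
  exists (Num.bound ((a + b) / d)); rewrite ltr_pdivrMr ?exprn_gt0// mulrC -ltr_pdivrMr//.
  have h0 : 0 <= (a + b) / d by apply: divr_ge0; [exact: addr_ge0 | exact: ltW].
  apply: (lt_trans (archi_boundP h0)).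
  by rewrite -natrX ltr_nat ltn_expl.
have [h1 h2 h3 h4 h5] := PI k.
set R1 := (P k).1 in h1 h2 h5 *; set R2 := (P k).2 in h3 h4 h5 *.
pose err z := f z + (- f (cpt px py) + (- l) * (z - cpt px py)).
have bf : bcont f R1 (R1 + ak k) R2 (R2 + bk k).
  apply: rect_bcont; rewrite ?lerDl// => z zR; apply: cf; exact: rect_sub zR.
have baff : bcont (fun z => - f (cpt px py) + (- l) * (z - cpt px py)) R1 (R1 + ak k) R2 (R2 + bk k).
  by apply: rect_bcont; rewrite ?lerDl// => z zR; exact: ccontat_affine.
have E : rectint f R1 (R1 + ak k) R2 (R2 + bk k) = rectint err R1 (R1 + ak k) R2 (R2 + bk k).
  by rewrite /err rectintD// rectint_affine ?addr0// lerDl.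
have abk0 : 0 <= ak k + bk k by rewrite addr_ge0.
have bound : cabs (rectint f R1 (R1 + ak k) R2 (R2 + bk k)) <= 4 * (e * (ak k + bk k)) * (ak k + bk k).
  rewrite E; have -> : ak k + bk k = (R1 + ak k - R1) + (R2 + bk k - R2) by ring.
  apply: rectint_bound; rewrite ?lerDl//; first exact: bcontD.
  move=> z [/andP[z1 z2] /andP[z3 z4]] _.
  have zp : cabs (z - cpt px py) <= ak k + bk k.
    apply: (le_trans (cabs_le_ReIm _)); rewrite !raddfB/=.
    have /andP[i1 i2] := hx k; have /andP[i3 i4] := hy k.
    rewrite -/R1 -/R2 in i1 i2 i3 i4.
    by apply: lerD; rewrite ler_norml; apply/andP; split; lra.
  rewrite /err (_ : f z + _ = f z - f (cpt px py) - l * (z - cpt px py)); last by ring.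
  apply: (le_trans (dP z _)).
    by apply: (le_lt_trans zp); rewrite /ak /bk -mulrDl.
  rewrite (_ : (R1 + ak k - R1) + (R2 + bk k - R2) = ak k + bk k); last by ring.
  by rewrite ler_wpM2l ?(ltW e0).
have : eta <= 4 * e * (a + b) ^+ 2.
  apply: (le_trans h5).
  apply: (@le_trans _ _ (4 ^+ k * (4 * (e * (ak k + bk k)) * (ak k + bk k)))).
    by rewrite ler_wpM2l ?exprn_ge0.
  rewrite /ak /bk -mulrDl (_ : 4 ^+ k = 2 ^+ k * 2 ^+ k); last by rewrite -exprMn -natrM.
  by rewrite le_eqVlt; apply/orP; left; apply/eqP; field; rewrite expf_neq0.
have : 4 * e * (a + b) ^+ 2 < eta.
  rewrite /e; rewrite (_ : 4 * _ * _ = eta * ((4 * (a + b) ^+ 2) / (4 * (a + b) ^+ 2 + 1) / 2)); last first.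
    by field; rewrite gt_eqF.
  rewrite gtr_pMr// ltr_pdivrMr// mul1r ltr_pdivrMr//.
  by have := sqr_ge0 (a + b); lra.
lra.
Qed.
End rectangles.

Section cauchy.
Context {R : realType}.
Local Notation C := (Cplx R).
Implicit Types (f g : C -> C) (z w c : C).

Lemma cdiffD f g z : cdiff f z -> cdiff g z -> cdiff (fun z => f z + g z) z.
Proof.
move=> [l lf] [l' lg]; exists (l + l') => e e0; have e2 : 0 < e / 2 by rewrite divr_gt0.
have [d1 d10 h1] := lf _ e2; have [d2 d20 h2] := lg _ e2.
exists (Num.min d1 d2); first by rewrite lt_min d10.
move=> y; rewrite lt_min => /andP[y1 y2].
rewrite (_ : _ - _ - _ = (f y - f z - l * (y - z)) + (g y - g z - l' * (y - z))); last by ring.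
rewrite (le_trans (cabsD _ _))// [leRHS](_ : _ = e / 2 * cabs (y - z) + e / 2 * cabs (y - z)).
  by rewrite lerD ?h1 ?h2.
by field.
Qed.

Lemma cdiffZ k f z : cdiff f z -> cdiff (fun z => k * f z) z.
Proof.
move=> [l lf]; exists (k * l) => e e0; have k0 : 0 < cabs k + 1 by rewrite ltr_wpDl ?cabs_ge0.
have [d d0 dP] := lf (e / (cabs k + 1)) (divr_gt0 e0 k0).
exists d => // y yx; rewrite -mulrA -!mulrBr cabsM.
have := dP y yx; rewrite mulrAC ler_pdivlMr// mulrC => h.
by apply: le_trans h; rewrite mulrDl mul1r lerDl cabs_ge0.
Qed.

Lemma cdiff_cst k z : cdiff (fun=> k) z.
Proof.
exists 0 => e e0; exists 1 => // w _.
by rewrite subrr mul0r subr0 cabs0 mulr_ge0 ?cabs_ge0 ?(ltW e0).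
Qed.

Lemma ccontatM f g z : ccontat f z -> ccontat g z -> ccontat (fun z => f z * g z) z.
Proof.
move=> cf cg e e0.
pose A : R := cabs (f z) + 1; pose B : R := cabs (g z) + 1.
have A0 : 0 < A by rewrite ltr_wpDl ?cabs_ge0.
have B0 : 0 < B by rewrite ltr_wpDl ?cabs_ge0.
have [d1 d10 h1] := cf 1 ltr01.
have [d2 d20 h2] := cf (e / 2 / B) ltac:(by rewrite !divr_gt0).
have [d3 d30 h3] := cg (e / 2 / A) ltac:(by rewrite !divr_gt0).
exists (Num.min d1 (Num.min d2 d3)); first by rewrite !lt_min d10 d20.
move=> w; rewrite !lt_min => /and3P[w1 w2 w3].
rewrite (_ : _ - _ = f w * (g w - g z) + (f w - f z) * g z); last by ring.
rewrite (le_lt_trans (cabsD _ _))// !cabsM [ltRHS]splitr; apply: ltr_leD.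
  have fA : cabs (f w) <= A.
    by rewrite -[f w](subrK (f z)) (le_trans (cabsD _ _))// addrC lerD2l ltW// h1.
  have := h3 w w3; rewrite ltr_pdivlMr// mulrC => h.
  by apply: le_lt_trans h; rewrite ler_wpM2r ?cabs_ge0.
have := ltW (h2 w w2); rewrite ler_pdivlMr// => h.
by apply: le_trans h; rewrite ler_wpM2l ?cabs_ge0// lerDl.
Qed.

Lemma cdiff_inv c z : z != c -> cdiff (fun w => (w - c)^-1) z.
Proof.
move=> zc; have z0 : z - c != 0 by rewrite subr_eq0.
have zn : 0 < cabs (z - c) by rewrite cabs_gt0.
exists (- (z - c) ^- 2) => e e0.
set m := cabs (z - c) in zn.
(* The remainder is (w - z)^2 / ((w - c) (z - c)^2). The first bound keeps |w - c| >= m / 2, the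
   second makes 2 |w - z| / m^3 at most e. *)
exists (Num.min (m / 2) (e * m ^+ 3 / 2)).
  by rewrite lt_min !divr_gt0// mulr_gt0// exprn_gt0.
move=> w; rewrite lt_min => /andP[w1 w2].
have mw : m / 2 <= cabs (w - c).
  have := cabsDB (z - c) (z - w); rewrite (_ : z - c - (z - w) = w - c); last by ring.
  by rewrite -/m [cabs (z - w)]cabsB; move: w1; move: (cabs (w - z)) (cabs (w - c)) => *; lra.
have w0 : w - c != 0 by rewrite -cabs_gt0 (lt_le_trans _ mw)// divr_gt0.
rewrite (_ : _ - _ - _ = (w - z) ^+ 2 * ((w - c)^-1 * (z - c)^-1 ^+ 2)); last by field; rewrite z0 w0.
rewrite !cabsM !cabsV -/m mulrAC; apply: ler_wpM2r; first exact: cabs_ge0.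
have i1 : (cabs (w - c))^-1 <= 2 / m.
  by rewrite -[leRHS]invrK invf_div lef_pV2 ?posrE// ?divr_gt0// (lt_le_trans _ mw)// divr_gt0.
apply: (@le_trans _ _ (cabs (w - z) * (2 / m * (m^-1 * m^-1)))).
  by apply: ler_wpM2l; [exact: cabs_ge0 | rewrite ler_wpM2r// mulr_ge0// invr_ge0 ltW].
rewrite (_ : 2 / m * _ = 2 / m ^+ 3); last by field; rewrite gt_eqF.
by rewrite mulrA ler_pdivrMr ?exprn_gt0// -ler_pdivlMr// ltW.
Qed.

Lemma cdiffM f g z : cdiff f z -> cdiff g z -> cdiff (fun z => f z * g z) z.
Proof.
move=> [l lf] [l' lg]; have cf := cderiv_cont lf.
exists (l * g z + f z * l') => e e0.
pose A : R := cabs (f z) + 1; pose B : R := cabs (g z) + 1; pose D : R := cabs l' + 1.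
have A0 : 0 < A by rewrite ltr_wpDl ?cabs_ge0.
have B0 : 0 < B by rewrite ltr_wpDl ?cabs_ge0.
have D0 : 0 < D by rewrite ltr_wpDl ?cabs_ge0.
have [d1 d10 h1] := cf 1 ltr01.
have [d2 d20 h2] := lf (e / 3 / B) ltac:(by rewrite !divr_gt0).
have [d3 d30 h3] := lg (e / 3 / A) ltac:(by rewrite !divr_gt0).
have [d4 d40 h4] := cf (e / 3 / D) ltac:(by rewrite !divr_gt0).
exists (Num.min (Num.min d1 d4) (Num.min d2 d3)); first by rewrite !lt_min d10 d20 d40.
move=> w; rewrite !lt_min => /andP[/andP[w1 w4] /andP[w2 w3]].
rewrite (_ : _ - _ - _ = f w * (g w - g z - l' * (w - z)) + ((f w - f z) * l' * (w - z) +
   (f w - f z - l * (w - z)) * g z)); last by ring.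
have fA : cabs (f w) <= A.
  by rewrite -[f w](subrK (f z)) (le_trans (cabsD _ _))// addrC lerD2l ltW// h1.
have t0 := cabs_ge0 (w - z).
have i1 : cabs (f w * (g w - g z - l' * (w - z))) <= e / 3 * cabs (w - z).
  rewrite cabsM; apply: (@le_trans _ _ (A * (e / 3 / A * cabs (w - z)))).
    by apply: ler_pM; rewrite ?cabs_ge0// h3.
  by rewrite le_eqVlt; apply/orP; left; apply/eqP; field; rewrite gt_eqF.
have i2 : cabs ((f w - f z) * l' * (w - z)) <= e / 3 * cabs (w - z).
  rewrite !cabsM; apply: ler_wpM2r => //.
  apply: (@le_trans _ _ (e / 3 / D * D)); last by rewrite divfK// gt_eqF.
  by apply: ler_pM; rewrite ?cabs_ge0 ?(ltW (h4 _ w4))// lerDl.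
have i3 : cabs ((f w - f z - l * (w - z)) * g z) <= e / 3 * cabs (w - z).
  rewrite cabsM; apply: (@le_trans _ _ ((e / 3 / B * cabs (w - z)) * B)).
    by apply: ler_pM; rewrite ?cabs_ge0 ?h2// lerDl.
  by rewrite le_eqVlt; apply/orP; left; apply/eqP; field; rewrite gt_eqF.
apply: (le_trans (cabsD _ _)); apply: (le_trans (lerD i1 (cabsD _ _))).
by apply: (le_trans (lerD (lexx _) (lerD i2 i3))); lra.
Qed.

Definition square c (r : R) : set C :=
  rect (complex.Re c - r) (complex.Re c + r) (complex.Im c - r) (complex.Im c + r).
Definition sqint f c (r : R) : C :=
  rectint f (complex.Re c - r) (complex.Re c + r) (complex.Im c - r) (complex.Im c + r).

Lemma squareP c r z : square c r z <->
  `|complex.Re (z - c)| <= r /\ `|complex.Im (z - c)| <= r.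
Proof.
rewrite /square /rect !raddfB /= !ler_norml.
split => -[/andP[h1 h2] /andP[h3 h4]]; split; apply/andP; split; lra.
Qed.

(** The frame between the rectangle and the square is cut into four rectangles that avoid c, and
    Goursat's theorem applies to each. *)
Lemma rectint_shrink f (x1 x2 y1 y2 : R) c (e : R) : 0 < e ->
  x1 <= complex.Re c - e -> complex.Re c + e <= x2 ->
  y1 <= complex.Im c - e -> complex.Im c + e <= y2 ->
  (forall z, rect x1 x2 y1 y2 z -> z != c -> cdiff f z) ->
  rectint f x1 x2 y1 y2 = sqint f c e.
Proof.
move=> e0 h1 h2 h3 h4 df; rewrite /sqint.
set u1 := complex.Re c - e in h1 *; set u2 := complex.Re c + e in h2 *.
set v1 := complex.Im c - e in h3 *; set v2 := complex.Im c + e in h4 *.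
have u12 : u1 <= u2 by rewrite /u1 /u2; lra.
have v12 : v1 <= v2 by rewrite /v1 /v2; lra.
have neqRe z : complex.Re z != complex.Re c -> z != c by apply: contraNneq => ->.
have neqIm z : complex.Im z != complex.Im c -> z != c by apply: contraNneq => ->.
have hor t u u' : x1 <= u -> u' <= x2 -> y1 <= t <= y2 -> t != complex.Im c ->
   ccont_on u u' (fun r => f (cpt r t)).
  move=> hu hu' ht tc; apply: ccont_hor => r /andP[r1 r2]; apply: cdiff_cont; apply: df => /=.
    by split => //=; rewrite (le_trans hu r1) (le_trans r2).
  exact: neqIm.
have ver t v v' : y1 <= v -> v' <= y2 -> x1 <= t <= x2 -> t != complex.Re c ->
   ccont_on v v' (fun r => f (cpt t r)).
  move=> hu hu' ht tc; apply: ccont_ver => r /andP[r1 r2]; apply: cdiff_cont; apply: df => /=.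
    by split => //=; rewrite (le_trans hu r1) (le_trans r2).
  exact: neqRe.
have x1n : x1 != complex.Re c by rewrite lt_eqF//; rewrite /u1 in h1; lra.
have u1n : u1 != complex.Re c by rewrite lt_eqF// /u1; lra.
have u2n : u2 != complex.Re c by rewrite gt_eqF// /u2; lra.
have x2n : x2 != complex.Re c by rewrite gt_eqF//; rewrite /u2 in h2; lra.
have y1n : y1 != complex.Im c by rewrite lt_eqF//; rewrite /v1 in h3; lra.
have v1n : v1 != complex.Im c by rewrite lt_eqF// /v1; lra.
have v2n : v2 != complex.Im c by rewrite gt_eqF// /v2; lra.
have y2n : y2 != complex.Im c by rewrite gt_eqF//; rewrite /v2 in h4; lra.
have x12 : x1 <= x2 by rewrite (le_trans h1)// (le_trans u12).
have y12 : y1 <= y2 by rewrite (le_trans h3)// (le_trans v12).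
have g0 a1 a2 b1 b2 : x1 <= a1 -> a1 <= a2 -> a2 <= x2 -> y1 <= b1 -> b1 <= b2 -> b2 <= y2 ->
   (a2 < complex.Re c \/ complex.Re c < a1 \/ b2 < complex.Im c \/ complex.Im c < b1) ->
   rectint f a1 a2 b1 b2 = 0.
  move=> i1 i2 i3 i4 i5 i6 hc; apply: goursat => // z zR; apply: df.
    exact: rect_sub zR.
  case: zR => /andP[z1 z2] /andP[z3 z4].
  case: hc => [hc|[hc|[hc|hc]]].
  - by apply: neqRe; rewrite lt_eqF// (le_lt_trans z2).
  - by apply: neqRe; rewrite gt_eqF// (lt_le_trans hc).
  - by apply: neqIm; rewrite lt_eqF// (le_lt_trans z4).
  - by apply: neqIm; rewrite gt_eqF// (lt_le_trans hc).
have u1x2 : u1 <= x2 by rewrite (le_trans u12).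
have x1u2 : x1 <= u2 by rewrite (le_trans h1).
have v1y2 : v1 <= y2 by rewrite (le_trans v12).
have y1v2 : y1 <= v2 by rewrite (le_trans h3).
have x1I : x1 <= x1 <= x2 by rewrite lexx.
have x2I : x1 <= x2 <= x2 by rewrite lexx andbT.
have y1I : y1 <= y1 <= y2 by rewrite lexx.
have y2I : y1 <= y2 <= y2 by rewrite lexx andbT.
have u1I : x1 <= u1 <= x2 by rewrite h1.
have u2I : x1 <= u2 <= x2 by rewrite x1u2.
have v1I : y1 <= v1 <= y2 by rewrite h3.
have v2I : y1 <= v2 <= y2 by rewrite y1v2.
have c1 : u1 < complex.Re c by rewrite /u1; lra.
have c2 : complex.Re c < u2 by rewrite /u2; lra.
have c3 : v1 < complex.Im c by rewrite /v1; lra.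
have c4 : complex.Im c < v2 by rewrite /v2; lra.
rewrite (@rectint_splitx _ f x1 u1 x2)//; last 2 first.
- by split; [apply: hor|apply: hor|apply: ver|apply: ver].
- exact: ver.
rewrite (g0 x1 u1 y1 y2)//; last by left.
rewrite add0r (@rectint_splitx _ f u1 u2 x2)//; last 2 first.
- by split; [apply: hor|apply: hor|apply: ver|apply: ver].
- exact: ver.
rewrite (g0 u2 x2 y1 y2)//; last by right; left.
rewrite addr0 (@rectint_splity _ f u1 u2 y1 v1 y2)//; last 2 first.
- by split; [apply: hor|apply: hor|apply: ver|apply: ver].
- exact: hor.
rewrite (g0 u1 u2 y1 v1)//; last by right; right; left.
rewrite add0r (@rectint_splity _ f u1 u2 v1 v2 y2)//; last 2 first.
- by split; [apply: hor|apply: hor|apply: ver|apply: ver].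
- exact: hor.
by rewrite (g0 u1 u2 v2 y2) ?addr0//; right; right; right.
Qed.
End cauchy.

(** * Cauchy's formula and the Cauchy estimates *)

Section cauchy_formula.
Context {R : realType}.
Local Notation C := (Cplx R).
Implicit Types (f g : C -> C) (z w c : C).

Lemma sqint_shift f c (e : R) : 0 <= e ->
  (forall z, square c e z -> z != c -> ccontat f z) -> 0 < e ->
  sqint f c e = sqint (fun z => f (z + c)) 0 e.
Proof.
move=> e0 cf egt; rewrite /sqint /rectint /=.
have cptD x y : cpt (x + complex.Re c) (y + complex.Im c) = cpt x y + c by case: c {cf}.
have bR : complex.Re c - e <= complex.Re c + e by lra.
have bI : complex.Im c - e <= complex.Im c + e by lra.
have hor t : t = complex.Im c - e \/ t = complex.Im c + e ->
   ccont_on (complex.Re c - e) (complex.Re c + e) (fun r => f (cpt r t)).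
  move=> ht; apply: ccont_hor => r rI; apply: cf.
    by split => //=; case: ht => ->; rewrite lexx// ?andbT.
  by apply/eqP => E; case: ht; rewrite -[complex.Im c]/(complex.Im c) -E /=; move: egt; clear; lra.
have ver t : t = complex.Re c - e \/ t = complex.Re c + e ->
   ccont_on (complex.Im c - e) (complex.Im c + e) (fun r => f (cpt t r)).
  move=> ht; apply: ccont_ver => r rI; apply: cf.
    by split => //=; case: ht => ->; rewrite lexx// ?andbT.
  by apply/eqP => E; case: ht; rewrite -E /=; move: egt; clear; lra.
congr (_ + 'i * _).
  rewrite (_ : complex.Re c - e = 0 - e + complex.Re c); last by rewrite sub0r addrC.
  rewrite (_ : complex.Re c + e = 0 + e + complex.Re c); last by rewrite add0r addrC.
  rewrite cint_shift; last first.
    rewrite (_ : 0 - e + complex.Re c = complex.Re c - e); last by rewrite sub0r addrC.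
    rewrite (_ : 0 + e + complex.Re c = complex.Re c + e); last by rewrite add0r addrC.
    by apply: ccont_onB; apply: hor; [left|right].
  apply: eq_cint => x _; rewrite -!cptD; congr (f (cpt _ _) - f (cpt _ _)).
    by rewrite sub0r addrC.
  by rewrite add0r addrC.
rewrite (_ : complex.Im c - e = 0 - e + complex.Im c); last by rewrite sub0r addrC.
rewrite (_ : complex.Im c + e = 0 + e + complex.Im c); last by rewrite add0r addrC.
rewrite cint_shift; last first.
  rewrite (_ : 0 - e + complex.Im c = complex.Im c - e); last by rewrite sub0r addrC.
  rewrite (_ : 0 + e + complex.Im c = complex.Im c + e); last by rewrite add0r addrC.
  by apply: ccont_onB; apply: ver; [right|left].
apply: eq_cint => x _; rewrite -!cptD; congr (f (cpt _ _) - f (cpt _ _)).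
  by rewrite add0r addrC.
by rewrite sub0r addrC.
Qed.

(* Its value is 2 pi i, but all that matters is that it is a nonzero constant. *)
Definition kappa : C := sqint (fun z => (z - 0)^-1) 0 1.

Lemma sqint_inv0 (e : R) : 0 < e -> sqint (fun z : C => (z - 0)^-1) 0 e = kappa.
Proof.
move=> e0; pose M : R := Num.max e 1.
have eM : e <= M by rewrite le_max lexx.
have oneM : 1 <= M by rewrite le_max lexx orbT.
have shr (d : R) : 0 < d -> d <= M -> sqint (fun z : C => (z - 0)^-1) 0 M = sqint (fun z : C => (z - 0)^-1) 0 d.
  move=> d0 dM; rewrite {1}/sqint; apply: rectint_shrink => //=; try by move: d0 dM; clear; move=> *; lra.
  by move=> z _; exact: cdiff_inv.
by rewrite -(shr e e0 eM) (shr 1 ltr01 oneM).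
Qed.

Lemma rectint_inv (x1 x2 y1 y2 : R) c : x1 < complex.Re c < x2 -> y1 < complex.Im c < y2 ->
  rectint (fun z => (z - c)^-1) x1 x2 y1 y2 = kappa.
Proof.
move=> /andP[h1 h2] /andP[h3 h4].
pose e : R := Num.min (Num.min (complex.Re c - x1) (x2 - complex.Re c))
  (Num.min (complex.Im c - y1) (y2 - complex.Im c)).
have e0 : 0 < e by rewrite !lt_min !subr_gt0 h1 h2 h3.
have e1 : e <= complex.Re c - x1 by rewrite !ge_min lexx.
have e2 : e <= x2 - complex.Re c by rewrite !ge_min lexx !orbT.
have e3 : e <= complex.Im c - y1 by rewrite !ge_min lexx !orbT.
have e4 : e <= y2 - complex.Im c by rewrite !ge_min lexx !orbT.
have i1 : x1 <= complex.Re c - e by lra.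
have i2 : complex.Re c + e <= x2 by lra.
have i3 : y1 <= complex.Im c - e by lra.
have i4 : complex.Im c + e <= y2 by lra.
rewrite (@rectint_shrink _ _ x1 x2 y1 y2 c e)//.
  rewrite sqint_shift ?(ltW e0)//; last by move=> z _ zc; exact/cdiff_cont/cdiff_inv.
  rewrite -(sqint_inv0 e0); congr (sqint _ _ _).
  by apply/funext => z; rewrite addrK subr0.
by move=> z _; exact: cdiff_inv.
Qed.

(** The imaginary part is the sum of two integrals of 2 / (x^2 + 1) over [-1, 1], and this integrand
    is at least 1 there. *)
Lemma kappa_ge4 : 4 <= cabs kappa.
Proof.
have nz (x y : R) : x != 0 \/ y != 0 -> cpt x y != 0 :> C.
  by move=> h; apply/eqP => /eqP; rewrite eq_complex/= => /andP[/eqP x0 /eqP y0]; case: h; rewrite ?x0 ?y0 eqxx.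
have n1 : (-1 : R) != 0 by rewrite oppr_eq0 oner_eq0.
have n2 : (1 : R) != 0 by rewrite oner_eq0.
have [_ c1] : ccont_on (-1) 1 (fun x : R => (cpt x (-1) - 0)^-1 - (cpt x 1 - 0)^-1 : C).
  apply: ccont_onB; apply: (ccont_hor (f := fun z => (z - 0)^-1)) => x _;
  by apply/cdiff_cont/cdiff_inv/nz; right.
have [c2 _] : ccont_on (-1) 1 (fun y : R => (cpt 1 y - 0)^-1 - (cpt (-1) y - 0)^-1 : C).
  apply: ccont_onB; apply: (ccont_ver (f := fun z => (z - 0)^-1)) => x _;
  by apply/cdiff_cont/cdiff_inv/nz; left.
have key (x : R) : -1 <= x <= 1 -> 1 <= 2 / (x ^+ 2 + 1).
  move=> /andP[x1 x2]; rewrite ler_pdivlMr ?mul1r; last by rewrite ltr_wpDl ?sqr_ge0.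
  by have : 0 <= (1 - x) * (1 + x) by [apply: mulr_ge0; lra]; lra.
have le11 : -1 <= 1 :> R by lra.
apply: le_trans (cabs_Im _); apply: le_trans (ler_norm _).
rewrite /kappa /sqint /rectint /= !sub0r !add0r /cint /= mul0r mul1r add0r.
have -> : 4 = 2 + 2 :> R by lra.
have e2 : 2 = rint (-1) 1 (fun=> 1) :> R by rewrite rint_cst//; lra.
rewrite {1 2}e2; apply: lerD; apply: rint_le => //; do ?exact: cont_on_cst.
  move=> x xI; apply: (le_trans (key x xI)); rewrite /= !subr0 sqrrN expr1n.
  rewrite (_ : - _ - - _ = 2 / (x ^+ 2 + 1))//.
  by rewrite mulNr !opprK -mulrDl -(natrD _ 1 1).
move=> x xI; apply: (le_trans (key x xI)); rewrite /= !subr0 sqrrN expr1n [1 + _]addrC.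
by rewrite (_ : _ / _ - _ = 2 / (x ^+ 2 + 1))// mulNr opprK -mulrDl -(natrD _ 1 1).
Qed.

(** After shrinking the contour to a square of half-side e around c, the integral is at most 16 M
    e. *)
Lemma rectint_removable f (x1 x2 y1 y2 : R) c (d M : R) : 0 < d ->
  x1 < complex.Re c < x2 -> y1 < complex.Im c < y2 ->
  (forall z, rect x1 x2 y1 y2 z -> z != c -> cdiff f z) ->
  (forall z, square c d z -> z != c -> cabs (f z) <= M) ->
  rectint f x1 x2 y1 y2 = 0.
Proof.
move=> d0 /andP[h1 h2] /andP[h3 h4] df fM.
have M0 : 0 <= M.
  apply: le_trans (fM (c + d%:C) _ _); first exact: cabs_ge0.
    by apply/squareP; rewrite addrC addKr /= normr0 ger0_norm ?lexx (ltW d0).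
  by rewrite -subr_eq0 addrC addKr -cabs_gt0 cabs_real normr_gt0 gt_eqF.
apply/eqP; rewrite -cabs_eq0 eq_le cabs_ge0 andbT; apply/ler_addgt0Pr => eta eta0; rewrite add0r.
pose e : R := Num.min (Num.min d (eta / (16 * M + 1))) (Num.min (Num.min (complex.Re c - x1) (x2 - complex.Re c))
  (Num.min (complex.Im c - y1) (y2 - complex.Im c))).
have den0 : 0 < 16 * M + 1 by rewrite ltr_wpDl// mulr_ge0.
have e0 : 0 < e by rewrite !lt_min !subr_gt0 h1 h2 h3 h4 d0 divr_gt0.
have e1 : e <= complex.Re c - x1 by rewrite !ge_min lexx !orbT.
have e2 : e <= x2 - complex.Re c by rewrite !ge_min lexx !orbT.
have e3 : e <= complex.Im c - y1 by rewrite !ge_min lexx !orbT.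
have e4 : e <= y2 - complex.Im c by rewrite !ge_min lexx !orbT.
have ed : e <= d by rewrite !ge_min lexx.
have ee : e <= eta / (16 * M + 1) by rewrite !ge_min lexx !orbT.
have i1 : x1 <= complex.Re c - e by lra.
have i2 : complex.Re c + e <= x2 by lra.
have i3 : y1 <= complex.Im c - e by lra.
have i4 : complex.Im c + e <= y2 by lra.
rewrite (@rectint_shrink _ _ x1 x2 y1 y2 c e)//.
have neq z : square c e z -> [\/ complex.Re z = complex.Re c - e, complex.Re z = complex.Re c + e,
      complex.Im z = complex.Im c - e | complex.Im z = complex.Im c + e] -> z != c.
  by move=> _ hz; apply/eqP => E; rewrite E in hz; case: hz; move: e0; clear; move=> *; lra.
have := @rectint_bound R f (complex.Re c - e) (complex.Re c + e) (complex.Im c - e) (complex.Im c + e) M.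
rewrite -/(sqint f c e) => /(_ ltac:(lra) ltac:(lra)) h.
have hb : cabs (sqint f c e) <= 4 * M * (complex.Re c + e - (complex.Re c - e) + (complex.Im c + e - (complex.Im c - e))).
  apply: h.
    have cf z : square c e z -> z != c -> ccontat f z.
      move=> zS zc; apply/cdiff_cont/df => //; apply: rect_sub zS; lra.
    split; [apply: ccont_hor|apply: ccont_hor|apply: ccont_ver|apply: ccont_ver] => t tI;
    apply: cf; try (by split => //=; rewrite lexx; lra); apply: neq;
    try (by split => //=; rewrite lexx; lra);
    by [apply: Or43|apply: Or44|apply: Or41|apply: Or42].
  move=> z zS hz; apply: fM; last exact: neq zS hz.
  by apply: rect_sub zS; lra.
apply: (le_trans hb).
move: ee; rewrite ler_pdivlMr// => ee.
by move: ee e0 M0; clear; move=> *; nra.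
Qed.

(** Write f(z) / (z - c) as (f(z) - f(c)) / (z - c) + f(c) / (z - c): the first quotient is bounded
    near c because f is differentiable there, so its integral vanishes; the second gives [kappa]. *)
Lemma cauchy_formula f (x1 x2 y1 y2 : R) c :
  x1 < complex.Re c < x2 -> y1 < complex.Im c < y2 ->
  (forall z, rect x1 x2 y1 y2 z -> cdiff f z) ->
  rectint (fun z => f z * (z - c)^-1) x1 x2 y1 y2 = f c * kappa.
Proof.
move=> hx hy df.
have /andP[hx1 hx2] := hx; have /andP[hy1 hy2] := hy.
have x12 : x1 <= x2 by rewrite (le_trans (ltW hx1))// ltW.
have y12 : y1 <= y2 by rewrite (le_trans (ltW hy1))// ltW.
have cR : rect x1 x2 y1 y2 c by split; apply/andP; split; rewrite ltW.
have [l lf] := df c cR; have [d d0 dP] := lf 1 ltr01.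
have g0 : rectint (fun z => (f z + (-1) * f c) * (z - c)^-1) x1 x2 y1 y2 = 0.
  apply: (@rectint_removable _ x1 x2 y1 y2 c (d / 4) (cabs l + 1)) => //; first by rewrite divr_gt0.
    move=> z zR zc; apply: cdiffM; last exact: cdiff_inv.
    by apply: cdiffD; [exact: df | exact: cdiff_cst].
  move=> z /squareP[z1 z2] zc.
  have zn : 0 < cabs (z - c) by rewrite cabs_gt0 subr_eq0.
  have zd : cabs (z - c) < d.
    by apply: (le_lt_trans (cabs_le_ReIm _)); apply: (le_lt_trans (lerD z1 z2)); lra.
  rewrite cabsM cabsV ler_pdivrMr// mulN1r.
  rewrite -[X in cabs X](subrK (l * (z - c))) (le_trans (cabsD _ _))//.
  rewrite mulrDl mul1r cabsM addrC lerD2l; have := dP z zd; rewrite mul1r.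
  by [].
have bc z : rect x1 x2 y1 y2 z -> [\/ complex.Re z = x1, complex.Re z = x2,
      complex.Im z = y1 | complex.Im z = y2] -> z != c.
  move=> _ hz; apply/eqP => E; rewrite E in hz; move: hz hx1 hx2 hy1 hy2; clear => hz.
  by case: hz => ->; rewrite ltxx.
have bcI g : (forall z, rect x1 x2 y1 y2 z -> z != c -> cdiff g z) -> bcont g x1 x2 y1 y2.
  move=> dg; split; [apply: ccont_hor|apply: ccont_hor|apply: ccont_ver|apply: ccont_ver] => t tI;
  apply/cdiff_cont/dg; try (by split => //=; rewrite ?lexx ?x12 ?y12); apply: bc;
  try (by split => //=; rewrite ?lexx ?x12 ?y12);
  by [apply: Or43|apply: Or44|apply: Or41|apply: Or42].
rewrite (eq_rectint (g := fun z => (f z + (-1) * f c) * (z - c)^-1 + f c * (z - c)^-1))//; last first.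
  by move=> z _ _; ring.
rewrite rectintD.
- rewrite g0 add0r rectintZ ?rectint_inv//; apply: bcI => z _; exact: cdiff_inv.
- apply: bcI => z zR zc; apply: cdiffM; last exact: cdiff_inv.
  by apply: cdiffD; [exact: df | exact: cdiff_cst].
- by apply/bcontZ/bcI => z _; exact: cdiff_inv.
Qed.

Lemma bdry_cabs (r : R) z : 0 <= r -> [\/ complex.Re z = 0 - r, complex.Re z = 0 + r,
      complex.Im z = 0 - r | complex.Im z = 0 + r] -> r <= cabs z.
Proof.
move=> r0 h; have h1 := cabs_Re z; have h2 := cabs_Im z.
by case: h => E; [apply: le_trans h1|apply: le_trans h1|apply: le_trans h2|apply: le_trans h2];
  rewrite E ?sub0r ?add0r ?normrN ger0_norm.
Qed.

(** Differentiability is derived from continuity, a bound, and Cauchy's formula at points of modulus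
    at most r / 2. These survive uniform limits, which is what [cdiff_limit] exploits. Everything
    comes from the identity 1/(z - b) - 1/z - b/z^2 = b^2 / (z^2 (z - b)). *)
Lemma cauchy_taylor f (r M : R) : 0 < r -> 0 <= M ->
  (forall z, square 0 r z -> ccontat f z) ->
  (forall z, square 0 r z -> cabs (f z) <= M) ->
  (forall b : C, cabs b <= r / 2 -> sqint (fun z => f z * (z - b)^-1) 0 r = f b * kappa) ->
  exists l, [/\ cderiv f 0 l, cabs l <= 4 * M / r &
    forall b : C, cabs b <= r / 2 -> cabs (f b - f 0 - l * b) <= 8 * M / r ^+ 2 * cabs b ^+ 2].
Proof.
move=> r0 M0 cf fM hf.
have rr : 0 - r <= 0 + r by lra.
have k4 := kappa_ge4; have k0 : 0 < cabs kappa by apply: lt_le_trans k4.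
have kn0 : kappa != 0 by rewrite -cabs_gt0.
have bc g : (forall z, r <= cabs z -> cdiff g z) -> bcont (fun z => f z * g z) (0 - r) (0 + r) (0 - r) (0 + r).
  move=> dg; have cfg z : square 0 r z -> [\/ complex.Re z = 0 - r, complex.Re z = 0 + r,
      complex.Im z = 0 - r | complex.Im z = 0 + r] -> ccontat (fun z => f z * g z) z.
    by move=> zS hz; apply: ccontatM; [exact: cf | apply/cdiff_cont/dg/bdry_cabs => //; exact: ltW].
  split; [apply: (ccont_hor (f := fun z => f z * g z))|apply: (ccont_hor (f := fun z => f z * g z))|apply: (ccont_ver (f := fun z => f z * g z))|apply: (ccont_ver (f := fun z => f z * g z))] => t tI;
  apply: cfg; try (by split => //=; rewrite ?lexx ?rr);
  by [apply: Or43|apply: Or44|apply: Or41|apply: Or42].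
have nzb (b z : C) : cabs b <= r / 2 -> r <= cabs z -> z != b.
  by move=> br rz; apply/eqP => E; move: rz; rewrite E leNgt (le_lt_trans br)//; lra.
have n0 z : r <= cabs z -> z != 0 by move=> rz; rewrite -cabs_gt0 (lt_le_trans r0).
have dI (b : C) : cabs b <= r / 2 -> forall z, r <= cabs z -> cdiff (fun z => (z - b)^-1) z.
  by move=> br z rz; apply: cdiff_inv; exact: nzb.
have c00 : cabs (0 : C) <= r / 2 by rewrite cabs0 divr_ge0// ltW.
have dI2 z : r <= cabs z -> cdiff (fun z => (z - 0)^-1 * (z - 0)^-1) z.
  by move=> rz; apply: cdiffM; exact: dI.
pose l := sqint (fun z => f z * ((z - 0)^-1 * (z - 0)^-1)) 0 r / kappa.
have bound (g : C -> C) K : 0 <= K -> (forall z, r <= cabs z -> cdiff g z) ->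
   (forall z, r <= cabs z -> cabs (g z) <= K) ->
   cabs (sqint (fun z => f z * g z) 0 r) <= 16 * M * K * r.
  move=> K0 dg gK; have := @rectint_bound R (fun z => f z * g z) (0 - r) (0 + r) (0 - r) (0 + r) (M * K) rr rr (bc g dg).
  rewrite -/(sqint (fun z => f z * g z) 0 r) => h.
  have -> : 16 * M * K * r = 4 * (M * K) * (0 + r - (0 - r) + (0 + r - (0 - r))) by ring.
  apply: h => z zS hz; rewrite cabsM; apply: ler_pM; rewrite ?cabs_ge0//; first exact: fM.
  by apply/gK/bdry_cabs => //; exact: ltW.
have taylor (b : C) : cabs b <= r / 2 -> cabs (f b - f 0 - l * b) <= 8 * M / r ^+ 2 * cabs b ^+ 2.
  move=> br.
  pose g z := (z - b)^-1 + ((-1) * (z - 0)^-1 + (- b) * ((z - 0)^-1 * (z - 0)^-1)).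
  have dg z : r <= cabs z -> cdiff g z.
    move=> rz; apply: cdiffD; first exact: dI.
    by apply: cdiffD; apply: cdiffZ; [exact: dI | exact: dI2].
  have E : (f b - f 0 - l * b) * kappa = sqint (fun z => f z * g z) 0 r.
    rewrite [sqint _ _ _](_ : _ = sqint (fun z => f z * (z - b)^-1 + ((-1) * (f z * (z - 0)^-1) +
       (- b) * (f z * ((z - 0)^-1 * (z - 0)^-1)))) 0 r); last first.
      by congr (sqint _ 0 r); apply/funext => z; rewrite /g; ring.
    have b1 := bc _ (dI b br); have b2 := bc _ (dI 0 c00); have b3 := bc _ dI2.
    rewrite /sqint rectintD//; last by apply: bcontD; exact: bcontZ.
    rewrite rectintD; [|exact: bcontZ|exact: bcontZ].
    rewrite (rectintZ (-1) b2) (rectintZ (- b) b3).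
    rewrite -/(sqint (fun z => f z * (z - b)^-1) 0 r) -/(sqint (fun z => f z * (z - 0)^-1) 0 r).
    by rewrite !hf// /l /sqint; field.
  have gE z : r <= cabs z -> g z = b ^+ 2 * ((z - b)^-1 * (z^-1 * z^-1)).
    move=> rz; rewrite /g subr0; field.
    by apply/andP; split; [exact: n0 | rewrite subr_eq0; exact: nzb].
  have K0 : 0 <= cabs b ^+ 2 * (2 / r ^+ 3) by rewrite mulr_ge0 ?sqr_ge0// divr_ge0// exprn_ge0// ltW.
  have := bound g _ K0 dg.
  have -> : 16 * M * (cabs b ^+ 2 * (2 / r ^+ 3)) * r = (8 * M / r ^+ 2 * cabs b ^+ 2) * 4.
    by field; rewrite gt_eqF.
  rewrite -E cabsM => h; rewrite -(ler_pM2r k0).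
  apply: (@le_trans _ _ (8 * M / r ^+ 2 * cabs b ^+ 2 * 4)); last first.
    by apply: ler_wpM2l => //; rewrite mulr_ge0 ?sqr_ge0// divr_ge0 ?sqr_ge0// mulr_ge0.
  apply: h => z rz; rewrite gE// cabsM cabsX; apply: ler_wpM2l; first exact: sqr_ge0.
  have zb : r / 2 <= cabs (z - b).
    by have := cabsDB z b; move: rz br; move: (cabs z) (cabs b) (cabs (z - b)) => *; lra.
  have zb0 : 0 < cabs (z - b) by rewrite (lt_le_trans _ zb)// divr_gt0.
  have z0 : 0 < cabs z by rewrite (lt_le_trans r0).
  rewrite !cabsM !cabsV (_ : 2 / r ^+ 3 = (r / 2)^-1 * (r^-1 * r^-1)); last by field; rewrite gt_eqF.
  apply: ler_pM; rewrite ?mulr_ge0 ?invr_ge0 ?cabs_ge0//.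
    by rewrite lef_pV2 ?posrE// divr_gt0.
  by apply: ler_pM; rewrite ?invr_ge0 ?cabs_ge0// lef_pV2 ?posrE.
exists l; split => //.
  move=> e e0; pose B : R := 8 * M / r ^+ 2.
  have B0 : 0 <= B by rewrite divr_ge0 ?sqr_ge0// mulr_ge0.
  have B1 : 0 < B + 1 by rewrite ltr_wpDl.
  exists (Num.min (r / 2) (e / (B + 1))); first by rewrite lt_min !divr_gt0.
  move=> w; rewrite subr0 lt_min (ltr_pdivlMr _ _ B1) => /andP[w1 w2].
  apply: (@le_trans _ _ (B * cabs w ^+ 2)); first exact: (taylor w (ltW w1)).
  rewrite expr2 mulrA ler_wpM2r ?cabs_ge0//.
  by move: w2 (cabs_ge0 w) B0; move: (cabs w) => t; clear; move=> *; nra.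
rewrite /l cabsM cabsV ler_pdivrMr//.
have := bound _ (r^-1 * r^-1) _ dI2.
move=> /(_ ltac:(by rewrite mulr_ge0 ?invr_ge0 ?(ltW r0))) h.
apply: (@le_trans _ _ (16 * M * (r^-1 * r^-1) * r)).
  apply: h => z rz; rewrite cabsM subr0 !cabsV.
  have z0 : 0 < cabs z by rewrite (lt_le_trans r0).
  by apply: ler_pM; rewrite ?invr_ge0 ?cabs_ge0// lef_pV2 ?posrE.
rewrite (_ : 16 * M * _ * r = 4 * M / r * 4); last by field; rewrite gt_eqF.
by apply: ler_wpM2l => //; rewrite divr_ge0 ?(ltW r0)// mulr_ge0.
Qed.

Lemma cauchy_estimate f (r M : R) : 0 < r -> 0 <= M ->
  (forall z, square 0 r z -> cdiff f z) ->
  (forall z, square 0 r z -> cabs (f z) <= M) ->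
  exists l, [/\ cderiv f 0 l, cabs l <= 4 * M / r &
    forall b : C, cabs b <= r / 2 -> cabs (f b - f 0 - l * b) <= 8 * M / r ^+ 2 * cabs b ^+ 2].
Proof.
move=> r0 M0 df fM; have rr : 0 - r <= 0 + r by lra.
apply: cauchy_taylor => //; first by move=> z zS; apply/cdiff_cont/df.
move=> b br; apply: cauchy_formula => //.
  have := cabs_Re b; rewrite ler_norml => /andP[b1 b2].
  by apply/andP; split; move: br r0 b1 b2; clear; move=> *; lra.
have := cabs_Im b; rewrite ler_norml => /andP[b1 b2].
by apply/andP; split; move: br r0 b1 b2; clear; move=> *; lra.
Qed.
End cauchy_formula.

(** * Holomorphic functions on the Siegel domain *)

Section several_variables.
Variables (R : realType) (n : nat).
Local Notation C := (Cplx R).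
Local Notation V := (Cn1 R n).
Implicit Types (F : V -> C) (p v : V).

Lemma gt0_cplx (e : C) : 0 < e -> exists2 r : R, 0 < r & e = r%:C.
Proof.
move=> e0; exists (complex.Re e); first by move: e0; rewrite ltcE => /andP[].
by rewrite RRe_real// ger0_real// ltW.
Qed.

Lemma nbhs_translate p e (A : set V) : nbhs p A -> exists2 r : R, 0 < r &
  forall q (b : C), `|q - p| < r%:C -> cabs b <= r -> A (q + b *: e).
Proof.
move=> /nbhs_ballP[d /= d0 dA].
have k0 : 0 < 1 + `|e| by rewrite ltr_wpDr.
have [r r0 rE] := gt0_cplx (divr_gt0 d0 k0).
exists r => // q b qr br; apply: dA; rewrite -ball_normE /=.
rewrite opprD addrA -normrN opprD opprK opprB.
apply: (le_lt_trans (ler_normD _ _)); rewrite normrZ.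
apply: (@lt_le_trans _ _ (r%:C * (1 + `|e|))).
  by rewrite mulrDr mulr1; apply: ltr_leD => //; apply: ler_wpM2r => //; rewrite -cabs_le.
by rewrite -rE divfK// gt_eqF.
Qed.

Lemma small_multiple v (r : R) : 0 < r -> exists2 d : R, 0 < d &
  forall a : C, cabs a <= d -> `|a *: v| < r%:C.
Proof.
move=> r0; have k0 : 0 < `|v| + 1 by rewrite ltr_wpDl.
have r0C : 0 < r%:C :> C by rewrite ltcR.
have [d d0 dE] := gt0_cplx (divr_gt0 r0C k0).
exists d => // a ad; rewrite normrZ; apply: (@le_lt_trans _ _ (d%:C * `|v|)).
  by apply: ler_wpM2r => //; rewrite -cabs_le.
rewrite -dE mulrAC ltr_pdivrMr// ltr_pM2l//.
by rewrite ltrDl.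
Qed.

(** Ties the directional derivative of the definitions, a limit of quotients, to the one-variable
    notion for which Cauchy's formula is proved. *)
Lemma is_derive_cderiv F p v l :
  is_derive p v F l <-> cderiv (fun a => F (p + a *: v)) 0 l.
Proof.
split => [[df dl]|h].
  move: df; rewrite /derivable => /cvgrPdist_le /=; rewrite -[lim _]/('D_v F p) dl => df.
  move=> e e0.
  have /nbhs_ballP[d /= /gt0_cplx[r r0 ->] rP] := df e%:C ltac:(by rewrite ltcR).
  exists r => // w; rewrite subr0 scale0r addr0 => wr.
  have [->|w0] := eqVneq w 0.
    by rewrite scale0r addr0 subrr mulr0 subr0 cabs0 mulr0.
  have := rP w; rewrite -ball_normE /= sub0r normrN -cabs_lt => /(_ wr w0).
  rewrite -cabs_le cabsB => hw; rewrite -ler_pdivrMr ?cabs_gt0// -cabsV -cabsM.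
  apply: le_trans hw; rewrite le_eqVlt; apply/orP; left; apply/eqP; congr (cabs _).
  rewrite /GRing.scale /= [w *: v + p]addrC; field.
  by [].
have cv : h^-1 *: (F (h *: v + p) - F p) @[h --> 0^'] --> l.
  apply/cvgrPdist_le => e /gt0_cplx[r r0 ->].
  have [d d0 dP] := h r r0.
  apply/nbhs_ballP; exists d%:C => /=; first by rewrite ltcR.
  move=> w; rewrite -ball_normE /= sub0r normrN -cabs_lt => wd w0.
  have := dP w; rewrite subr0 scale0r addr0 => /(_ wd) hw.
  rewrite -cabs_le cabsB -(ler_pM2r (x := cabs w)) ?cabs_gt0//; apply: le_trans hw.
  rewrite -cabsM le_eqVlt; apply/orP; left; apply/eqP; congr (cabs _).
  by rewrite /GRing.scale /= [w *: v + p]addrC; field.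
by split; [apply/cvg_ex; exists l | apply: cvg_lim].
Qed.

(* Weaker than Frechet differentiability, and easily seen to be inherited by [dlast F]. *)
Definition cholo F := forall p, siegel p ->
  {for p, continuous F} /\ forall v, cdiff (fun a => F (p + a *: v)) 0.

Lemma holomorphic_cholo F : holomorphic F -> cholo F.
Proof.
move=> hF p ps; split; first exact/differentiable_continuous/hF.
move=> v; exists ('D_v F p); apply/is_derive_cderiv; split => //.
exact/diff_derivable/hF.
Qed.

Lemma cderiv_translate (f : C -> C) z l : cderiv (fun a => f (z + a)) 0 l <-> cderiv f z l.
Proof.
split => h e e0; have [d d0 dP] := h e e0; exists d => // w wd.
  by have := dP (w - z); rewrite subr0 addr0 [z + _]addrC subrK; exact.
have := dP (z + w); rewrite addr0 subr0 [_ - z]addrC addrA addNr add0r => H.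
by apply: H; rewrite subr0 in wd.
Qed.

Lemma cdiff_line F p v a : cholo F -> siegel (p + a *: v) -> cdiff (fun a => F (p + a *: v)) a.
Proof.
move=> hF ps; have [_ /(_ v)[l lP]] := hF _ ps.
exists l; apply/cderiv_translate.
rewrite (_ : (fun a0 => _) = (fun b => F (p + a *: v + b *: v)))//.
by apply/funext => b; rewrite scalerDl addrA.
Qed.

Lemma continuous_cabs_lt F p (e : R) : {for p, continuous F} -> 0 < e ->
  nbhs p [set q | cabs (F q - F p) < e].
Proof.
move=> cF e0; have /cvgrPdist_lt /(_ e%:C) := cF; rewrite ltcR => /(_ e0).
by apply: filterS => q; rewrite -cabs_lt cabsB.
Qed.

Lemma cabs_continuous F p :
  (forall e : R, 0 < e -> nbhs p [set q | cabs (F q - F p) < e]) -> {for p, continuous F}.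
Proof.
move=> h; apply/cvgrPdist_lt => e /gt0_cplx[r r0 ->]; have := h r r0.
by apply: filterS => q /=; rewrite -cabs_lt cabsB.
Qed.

Definition dquot F (b : C) q := b^-1 * (F (q + b *: (0, 1)) - F q).

Lemma dlast_approx F p : cholo F -> siegel p -> exists r M : R, [/\ 0 < r, 0 <= M &
  forall q, `|q - p| < r%:C -> [/\ siegel q, cabs (dlast F q) <= M &
    forall b : C, b != 0 -> cabs b <= r -> siegel (q + b *: (0, 1)) /\
       cabs (dlast F q - dquot F b q) <= M * cabs b]].
Proof.
move=> hF ps.
have [cF _] := hF p ps.
pose M := cabs (F p) + 1.
have M0 : 0 <= M by rewrite addr_ge0 ?cabs_ge0.
have nA : nbhs p [set q | siegel q /\ cabs (F q) <= M].
  near=> q; split; first by near: q; apply: open_nbhs_nbhs; split => //; exact: siegel_open.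
  have : cabs (F q - F p) < 1 by near: q; exact: continuous_cabs_lt.
  rewrite -{2}(subrK (F p) (F q)) /M => h; apply: (le_trans (cabsD _ _)).
  by rewrite addrC lerD2l ltW.
have [r r0 rP] := nbhs_translate (0, 1) nA.
(* The square of half-side r / 2 lies in the disc of radius r, where F is controlled. *)
pose r' := r / 2.
have r'0 : 0 < r' by rewrite divr_gt0.
exists (r' / 2), (4 * M / r' + 8 * M / r' ^+ 2); split.
- by rewrite divr_gt0.
- by rewrite addr_ge0// divr_ge0 ?sqr_ge0 ?mulr_ge0// ltW.
move=> q qp.
have qr : `|q - p| < r%:C.
  by apply: lt_le_trans qp _; rewrite lecR /r'; move: r0; clear; move=> *; lra.
have cs (z : C) : square 0 r' z -> cabs z <= r.
  move=> /squareP[]; rewrite subr0 => h1 h2; apply: (le_trans (cabs_le_ReIm _)).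
  by rewrite [leRHS]splitr; exact: lerD.
have [||l [lD lM lT]] := @cauchy_estimate R (fun a => F (q + a *: (0, 1))) r' M r'0 M0.
- by move=> z zs; apply: cdiff_line => //; case: (rP q z qr (cs z zs)).
- by move=> z zs; case: (rP q z qr (cs z zs)).
have dE : dlast F q = l by case/is_derive_cderiv: lD.
have p1 : 0 <= 4 * M / r' by rewrite divr_ge0 ?mulr_ge0// ltW.
have p2 : 0 <= 8 * M / r' ^+ 2 by rewrite divr_ge0 ?sqr_ge0 ?mulr_ge0// ltW.
split.
- have /(rP _ _ qr) : cabs (0 : C) <= r by rewrite cabs0 ltW.
  by rewrite scale0r addr0 => -[].
- by rewrite dE; apply: (le_trans lM); rewrite lerDl.
move=> b b0 br; split.
  have /(rP _ _ qr)[] // : cabs b <= r.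
  by apply: le_trans br _; rewrite /r'; move: r0; clear; move=> *; lra.
have := lT b br; rewrite scale0r addr0 => h.
have bp : 0 < cabs b by rewrite cabs_gt0.
rewrite -(ler_pM2r bp) dE cabsB -[leLHS]cabsM /dquot.
have -> : (b^-1 * (F (q + b *: (0, 1)) - F q) - l) * b = F (q + b *: (0, 1)) - F q - l * b.
  by field.
apply: (le_trans h); rewrite -[leRHS]mulrA -[cabs b * cabs b]expr2 ler_wpM2r ?sqr_ge0//.
by rewrite lerDr.
Unshelve. all: by end_near. Qed.

Lemma cabs_dist3 (a b c d : C) : cabs (a - d) <= cabs (a - b) + (cabs (b - c) + cabs (c - d)).
Proof.
rewrite -(subrKA b a (-d)) -(subrKA c b (-d)).
by apply: (le_trans (cabsD _ _)); rewrite lerD2l; exact: cabsD.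
Qed.

Lemma bcont_square (h : C -> C) (r : R) : 0 <= r ->
  (forall z, square 0 r z -> r <= cabs z -> ccontat h z) -> bcont h (0 - r) (0 + r) (0 - r) (0 + r).
Proof.
move=> r0 ch; have rr : 0 - r <= 0 + r by lra.
have cfg z : square 0 r z -> [\/ complex.Re z = 0 - r, complex.Re z = 0 + r,
    complex.Im z = 0 - r | complex.Im z = 0 + r] -> ccontat h z.
  by move=> zS hz; apply: ch => //; exact: bdry_cabs.
split; [apply: ccont_hor|apply: ccont_hor|apply: ccont_ver|apply: ccont_ver] => t tI;
apply: cfg; try (by split => //=; rewrite ?lexx ?rr);
by [apply: Or43|apply: Or44|apply: Or41|apply: Or42].
Qed.

(** Weierstrass's theorem: Cauchy's formula passes to the uniform limit, and [cauchy_taylor] turns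
    it back into differentiability. *)
Lemma cdiff_limit (f : C -> C) (r M : R) : 0 < r -> 0 <= M ->
  (forall z, square 0 r z -> cabs (f z) <= M) ->
  (forall e : R, 0 < e -> exists g : C -> C, (forall z, square 0 r z -> cdiff g z) /\
     forall z, square 0 r z -> cabs (f z - g z) <= e) ->
  cdiff f 0.
Proof.
move=> r0 M0 fMr hf; pose d := r / 2; have d0 : 0 < d by rewrite divr_gt0.
have sd (z : C) : square 0 d z -> square 0 r z.
  by apply: rect_sub; rewrite /d; move: r0; clear; move=> *; lra.
have cf z : square 0 d z -> ccontat f z.
  move=> zd e e0; have [g [dg fg]] := hf (e / 4) ltac:(by rewrite divr_gt0).
  have [t t0 tP] := cdiff_cont (dg z (sd z zd)) (e := e / 4) ltac:(by rewrite divr_gt0).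
  exists (Num.min t d); first by rewrite lt_min t0.
  move=> w; rewrite lt_min => /andP[wt wd].
  have wr : square 0 r w.
    have /squareP[z1 z2] := zd.
    have h1 := cabs_Re (w - z); have h2 := cabs_Im (w - z).
    have E1 : complex.Re (w - 0) = complex.Re (z - 0) + complex.Re (w - z) by rewrite -raddfD /= !subr0 addrC subrK.
    have E2 : complex.Im (w - 0) = complex.Im (z - 0) + complex.Im (w - z) by rewrite -raddfD /= !subr0 addrC subrK.
    apply/squareP; rewrite E1 E2 [r]splitr; split; apply: (le_trans (ler_normD _ _)); apply: lerD => //.
      by apply: (le_trans h1); exact: ltW.
    by apply: (le_trans h2); exact: ltW.
  have h1 := fg w wr; have h2 := fg z (sd z zd); have h3 := tP w wt.
  apply: (le_lt_trans (cabs_dist3 _ (g w) (g z) _)).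
  rewrite cabsB in h2.
  by move: h1 h2 h3 e0; clear; move: (cabs _) (cabs _) (cabs _) => *; lra.
have fM z : square 0 d z -> cabs (f z) <= M by move=> zd; exact/fMr/sd.
suff hb (b : C) : cabs b <= d / 2 -> sqint (fun z => f z * (z - b)^-1) 0 d = f b * kappa.
  by have [l [lD _ _]] := @cauchy_taylor R f d M d0 M0 cf fM hb; exists l.
move=> bd.
apply/eqP; rewrite -subr_eq0 -cabs_eq0 eq_le cabs_ge0 andbT.
apply/ler_addgt0Pr => e e0; rewrite add0r.
(* The contour integral contributes 32 times the approximation error and the value at b contributes
   |kappa| times it; together they make e. *)
pose K := 32 + cabs (kappa : C).
have K0 : 0 < K by rewrite ltr_wpDr ?cabs_ge0.
have [g [dg fg]] := hf (e / K) ltac:(by rewrite divr_gt0).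
have bs : square 0 r b.
  have h1 := cabs_Re b; have h2 := cabs_Im b.
  by apply/squareP; rewrite subr0; split; [apply: (le_trans h1)|apply: (le_trans h2)];
    apply: (le_trans bd); rewrite /d; move: r0; clear; move=> *; lra.
have nzb (z : C) : d <= cabs z -> z != b.
  move=> dz; apply/eqP => E; move: dz; rewrite E leNgt (le_lt_trans bd)//.
  by move: d0; clear; move=> *; lra.
have dI (z : C) : d <= cabs z -> ccontat (fun z => (z - b)^-1) z.
  by move=> dz; apply: cdiff_cont; apply: cdiff_inv; exact: nzb.
have gI (z : C) : square 0 d z -> ccontat g z.
  by move=> zd; apply/cdiff_cont/dg/sd.
have b1 := @bcont_square (fun z => g z * (z - b)^-1) d (ltW d0)
  (fun z zd dz => ccontatM (gI z zd) (dI z dz)).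
have b2 := @bcont_square (fun z => (f z + (-1) * g z) * (z - b)^-1) d (ltW d0)
  (fun z zd dz => ccontatM (ccontatD (cf z zd) (ccontatZ (-1) (gI z zd))) (dI z dz)).
have rr : 0 - d <= 0 + d by move: d0; clear; move=> *; lra.
have Eg : sqint (fun z => g z * (z - b)^-1) 0 d = g b * kappa.
  apply: cauchy_formula; last by move=> z zd; exact/dg/sd.
    have := cabs_Re b; rewrite /= ler_norml => /andP[c1 c2].
    by apply/andP; split; move: bd d0 c1 c2; clear; move=> *; lra.
  have := cabs_Im b; rewrite /= ler_norml => /andP[c1 c2].
  by apply/andP; split; move: bd d0 c1 c2; clear; move=> *; lra.
have -> : sqint (fun z => f z * (z - b)^-1) 0 d =
    sqint (fun z => (f z + (-1) * g z) * (z - b)^-1) 0 d + g b * kappa.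
  rewrite (_ : (fun z => f z * _) = (fun z => (f z + (-1) * g z) * (z - b)^-1 + g z * (z - b)^-1)).
    by rewrite -Eg; exact: (rectintD b2 b1).
  by apply/funext => z; rewrite -mulrDl mulN1r subrK.
have hb := @rectint_bound R _ _ _ _ _ (e / K * (2 / d)) rr rr b2.
rewrite -addrA -mulrBl; apply: (le_trans (cabsD _ _)).
apply: (@le_trans _ _ (32 * (e / K) + e / K * cabs (kappa : C))).
  apply: lerD.
    have -> : 32 * (e / K) = 4 * (e / K * (2 / d)) * (0 + d - (0 - d) + (0 + d - (0 - d))).
      by field; rewrite !gt_eqF.
    apply: hb => z zd hz; have dz := bdry_cabs (ltW d0) hz.
    rewrite cabsM cabsV mulN1r; apply: ler_pM; rewrite ?invr_ge0 ?cabs_ge0//.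
      exact/fg/sd.
    have zb : d / 2 <= cabs (z - b).
      by have := cabsDB z b; move: dz bd; move: (cabs z) (cabs b) (cabs (z - b)) => *; lra.
    rewrite -(invf_div d) lef_pV2// posrE ?divr_gt0//.
    by apply: lt_le_trans zb; rewrite divr_gt0.
  by rewrite cabsM ler_wpM2r ?cabs_ge0// cabsB fg.
by rewrite [e / K * _]mulrC -mulrDl -/K mulrC divfK// gt_eqF.
Qed.

(** The difference quotients of F in the last direction are differentiable along every complex line
    and converge locally uniformly, so continuity and differentiability along lines pass to the
    limit. *)
Lemma cholo_dlast F : cholo F -> cholo (dlast F).
Proof.
move=> hF p ps; have [r [M [r0 M0 rM]]] := dlast_approx hF ps.
have r0C : 0 < r%:C :> C by rewrite ltcR.
have pick (e : R) : 0 < e -> exists b : C, [/\ b != 0, cabs b <= r & M * cabs b <= e].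
  move=> e0; have M1 : 0 < M + 1 by rewrite ltr_wpDl.
  pose t := Num.min r (e / (M + 1)).
  have t0 : 0 < t by rewrite lt_min r0 divr_gt0.
  have bt : cabs (t%:C : C) = t by rewrite cabs_real ger0_norm// ltW.
  exists t%:C; rewrite -cabs_gt0 bt; split => //; first by rewrite ge_min lexx.
  apply: (@le_trans _ _ ((M + 1) * t)); first by rewrite ler_wpM2r ?lerDl// ltW.
  by rewrite mulrC -ler_pdivlMr// ge_min lexx orbT.
split.
  apply: cabs_continuous => e e0.
  have [b [b0 br bM]] := pick (e / 4) ltac:(by rewrite divr_gt0).
  have pp : `|p - p| < r%:C by rewrite subrr normr0.
  have [_ _ /(_ b b0 br)[pbs hp]] := rM p pp.
  have [cF _] := hF p ps; have [cFb _] := hF _ pbs.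
  have cQ : {for p, continuous (dquot F b)}.
    apply: (@cvgM C); first exact: cvg_cst.
    apply: (@cvgB C C); last exact: cF.
    apply: (@continuous_comp _ _ _ (fun q : V => q + b *: (0, 1)) F) => //.
    by apply: cvgD; [exact: cvg_id | exact: cvg_cst].
  near=> q => /=.
  have qr : `|q - p| < r%:C.
    by near: q; apply/nbhs_ballP; exists r%:C => //= q; rewrite -ball_normE /= distrC.
  have qQ : cabs (dquot F b q - dquot F b p) < e / 4.
    by near: q; apply: continuous_cabs_lt => //; rewrite divr_gt0.
  have [_ _ /(_ b b0 br)[_ hq]] := rM q qr.
  apply: (le_lt_trans (cabs_dist3 _ (dquot F b q) (dquot F b p) _)).
  have hp' : cabs (dquot F b p - dlast F p) <= e / 4 by rewrite cabsB (le_trans hp).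
  have := le_trans hq bM; have := e0.
  by move: hp' qQ; clear; move: (cabs _) (cabs _) (cabs _) => *; lra.
move=> v; have [d d0 dP] := small_multiple v r0.
have sq (z : C) : square 0 (d / 2) z -> `|p + z *: v - p| < r%:C.
  move=> /squareP[]; rewrite subr0 => h1 h2; rewrite addrC addKr; apply: dP.
  by apply: (le_trans (cabs_le_ReIm _)); rewrite [leRHS]splitr; exact: lerD.
apply: (@cdiff_limit _ (d / 2) M); rewrite ?divr_gt0//.
  by move=> z /sq/rM[].
move=> e e0; have [b [b0 br bM]] := pick e e0.
exists (fun z => dquot F b (p + z *: v)); split => z /sq zr; last first.
  by have [_ _ /(_ b b0 br)[_ h]] := rM _ zr; exact: le_trans h bM.
have [zs _ /(_ b b0 br)[zbs _]] := rM _ zr.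
have E a : p + a *: v + b *: (0, 1) = p + b *: (0, 1) + a *: v by rewrite addrAC.
apply: cdiffZ; rewrite (_ : (fun z => _ - _) =
   (fun a => F (p + b *: (0, 1) + a *: v) + (-1) * F (p + a *: v))); last first.
  by apply/funext => a; rewrite mulN1r E.
apply: cdiffD; last by apply/cdiffZ/cdiff_line.
by apply: cdiff_line => //; rewrite -E.
Unshelve. all: by end_near. Qed.
End several_variables.

(** * Sub-mean value property in one complex variable *)

Section submean.
Context {R : realType}.
Local Notation C := (Cplx R).
Local Notation mR := (measurableTypeR R).
Local Notation leb := (@lebesgue_measure R).

(** A quantity equivalent to the L^1 norm of f on the segment, with real and imaginary parts kept
    apart as in [cint]. *)
Definition aint (a b : R) (f : R -> C) : R :=
  rint a b (fun x => `|complex.Re (f x)|) + rint a b (fun x => `|complex.Im (f x)|).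

Lemma rint_ge0 (a b : R) (g : R -> R) : (forall x, 0 <= g x) -> 0 <= rint a b g.
Proof. by move=> g0; apply: Rintegral_ge0. Qed.

Lemma edge_bound (f g : R -> C) (a b a' b' r : R) : a <= b -> a' <= a -> b <= b' -> 0 < r ->
  ccont_on a' b' f -> ccont_on a b g ->
  (forall x, a <= x <= b -> cabs (g x) <= 2 / r * cabs (f x)) ->
  cabs (cint a b g) <= 4 / r * aint a' b' f.
Proof.
move=> ab aa bb r0 cf [g1 g2] gf; have [f1 f2] := cf; have [f3 f4] := ccont_onW aa bb cf.
have n1 := cont_on_norm f3; have n2 := cont_on_norm f4.
have ext (u : R -> R) : cont_on a' b' u -> (forall x, 0 <= u x) -> rint a b u <= rint a' b' u.
  move=> cu u0; have ab' : a <= b' := le_trans ab bb.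
  rewrite (rint_split aa ab' cu) (rint_split ab bb (cont_onW aa (lexx _) cu)).
  by rewrite addrC -addrA lerDl addr_ge0// rint_ge0.
have key (u : R -> R) : cont_on a b u -> (forall x, `|u x| <= cabs (g x)) ->
    `|rint a b u| <= 2 / r * aint a' b' f.
  move=> cu ug; apply: (le_trans (rint_norm cu)).
  apply: (@le_trans _ _ (rint a b (fun x => 2 / r * (`|complex.Re (f x)| + `|complex.Im (f x)|)))).
    apply: rint_le; [exact: cont_on_norm|apply/cont_onZ/cont_onD => //|].
    move=> x xI; apply: (le_trans (ug x)); apply: (le_trans (gf x xI)).
    by rewrite ler_wpM2l ?cabs_le_ReIm// divr_ge0// ltW.
  rewrite rintZ; last exact: cont_onD.
  rewrite ler_wpM2l ?divr_ge0 ?(ltW r0)// rintD// /aint; apply: lerD; apply: ext => //;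
    exact: cont_on_norm.
apply: (le_trans (cabs_le_ReIm _)).
have -> : 4 / r * aint a' b' f = 2 / r * aint a' b' f + 2 / r * aint a' b' f.
  by rewrite -mulrDl -mulrDl; congr (_ / _ * _); ring.
by apply: lerD; apply: key => // x; [exact: cabs_Re | exact: cabs_Im].
Qed.

Lemma aint_le (a b : R) (f : R -> C) (G : mR -> \bar R) : ccont_on a b f ->
  measurable_fun [set: mR] G -> (forall x, (0 <= G x)%E) ->
  (forall x : R, a <= x <= b -> ((cabs (f x))%:E <= G x)%E) ->
  ((aint a b f)%:E <= 2%:E * \int[leb]_x G x)%E.
Proof.
move=> [f1 f2] mG G0 fG.
have key (u : R -> R) : cont_on a b u -> (forall x, `|u x| <= cabs (f x)) ->
    ((rint a b (fun x => `|u x|))%:E <= \int[leb]_x G x)%E.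
  move=> cu uf; have iu := cont_on_integrable (cont_on_norm cu).
  rewrite /rint /Rintegral fineK; last exact: integrable_fin_num.
  apply: (@le_trans _ _ (\int[leb]_(x in `[a, b]) G x)%E).
    apply: ge0_le_integral => //; first exact: measurable_int iu.
    - exact: measurable_funTS.
    move=> x; rewrite /= in_itv /= => xI; apply: le_trans (fG x xI).
    by rewrite lee_fin.
  by apply: ge0_subset_integral.
have -> : (2%:E * \int[leb]_x G x = \int[leb]_x G x + \int[leb]_x G x)%E.
  by rewrite (_ : 2%:E = 1%:E + 1%:E)%E// ge0_muleDl ?mul1e.
by rewrite EFinD; apply: leeD; apply: key => // x; [exact: cabs_Re|exact: cabs_Im].
Qed.

(** Cauchy's formula at 0 on a rectangle whose sides keep distance at least r / 2 from 0, so that 1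
    / |z| <= 2 / r on it. The losses amount to a factor 4, which |kappa| >= 4 compensates. Edges are
    prolonged to the full length 2 r so that each term depends on the position of one edge only. *)
Lemma edge_sum (f : C -> C) (r x1 x2 y1 y2 : R) : 0 < r ->
  (forall z, square 0 r z -> cdiff f z) ->
  - r <= x1 <= - (r / 2) -> r / 2 <= x2 <= r -> - r <= y1 <= - (r / 2) -> r / 2 <= y2 <= r ->
  r * cabs (f 0) <= aint (- r) r (fun x => f (cpt x y1)) + aint (- r) r (fun x => f (cpt x y2)) +
     (aint (- r) r (fun y => f (cpt x1 y)) + aint (- r) r (fun y => f (cpt x2 y))).
Proof.
move=> r0 df hx1 hx2 hy1 hy2.
have [hx1a hx1b] := andP hx1; have [hx2a hx2b] := andP hx2.
have [hy1a hy1b] := andP hy1; have [hy2a hy2b] := andP hy2.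
have sq (z : C) : rect (- r) r (- r) r z -> square 0 r z by rewrite /square /= !sub0r !add0r.
have cf (x y : R) : - r <= x <= r -> - r <= y <= r -> cdiff f (cpt x y).
  by move=> xI yI; apply: df; exact: sq.
have x10 : x1 < 0 by move: hx1b r0; clear; lra.
have x20 : 0 < x2 by move: hx2a r0; clear; lra.
have y10 : y1 < 0 by move: hy1b r0; clear; lra.
have y20 : 0 < y2 by move: hy2a r0; clear; lra.
have E : rectint (fun z => f z * (z - 0)^-1) x1 x2 y1 y2 = f 0 * kappa.
  apply: cauchy_formula; rewrite /= ?x10 ?x20 ?y10 ?y20//.
  move=> z [/andP[z1 z2] /andP[z3 z4]]; apply/df/sq; split; apply/andP; split.
  - exact: le_trans z1.
  - exact: le_trans hx2b.
  - exact: le_trans z3.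
  - exact: le_trans hy2b.
have far (x y : R) : (r / 2 <= `|x|) || (r / 2 <= `|y|) -> r / 2 <= cabs (cpt x y - 0).
  rewrite subr0 => /orP[h|h]; apply: (le_trans h).
    exact: (cabs_Re (cpt x y)).
  exact: (cabs_Im (cpt x y)).
have r20 : 0 < r / 2 by rewrite divr_gt0.
have inv (x y : R) : (r / 2 <= `|x|) || (r / 2 <= `|y|) ->
    cabs (f (cpt x y) * (cpt x y - 0)^-1) <= 2 / r * cabs (f (cpt x y)).
  move=> /far h; rewrite cabsM mulrC ler_wpM2r ?cabs_ge0// cabsV -(invf_div r).
  by rewrite lef_pV2// posrE (lt_le_trans _ h).
have cdI (x y : R) : (r / 2 <= `|x|) || (r / 2 <= `|y|) -> - r <= x <= r -> - r <= y <= r ->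
    ccontat (fun z => f z * (z - 0)^-1) (cpt x y).
  move=> /far h xI yI; apply/cdiff_cont/cdiffM; first exact: cf.
  by apply: cdiff_inv; rewrite -subr_eq0 -cabs_gt0 (lt_le_trans _ h).
have wx (x : R) : x1 <= x <= x2 -> - r <= x <= r.
  by move=> /andP[a1 a2]; rewrite (le_trans hx1a a1) (le_trans a2).
have wy (y : R) : y1 <= y <= y2 -> - r <= y <= r.
  by move=> /andP[a1 a2]; rewrite (le_trans hy1a a1) (le_trans a2).
have nx1 : r / 2 <= `|x1| by rewrite ltr0_norm// lerNr.
have nx2 : r / 2 <= `|x2| by rewrite gtr0_norm.
have ny1 : r / 2 <= `|y1| by rewrite ltr0_norm// lerNr.
have ny2 : r / 2 <= `|y2| by rewrite gtr0_norm.
have x12 : x1 <= x2 := le_trans (ltW x10) (ltW x20).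
have y12 : y1 <= y2 := le_trans (ltW y10) (ltW y20).
have Ix1 : - r <= x1 <= r by apply: wx; rewrite lexx.
have Ix2 : - r <= x2 <= r by apply: wx; rewrite lexx x12.
have Iy1 : - r <= y1 <= r by apply: wy; rewrite lexx.
have Iy2 : - r <= y2 <= r by apply: wy; rewrite lexx y12.
have H (y : R) : r / 2 <= `|y| -> - r <= y <= r ->
    ccont_on x1 x2 (fun x => f (cpt x y) * (cpt x y - 0)^-1) /\
    cabs (cint x1 x2 (fun x => f (cpt x y) * (cpt x y - 0)^-1)) <=
      4 / r * aint (- r) r (fun x => f (cpt x y)).
  move=> ny yI.
  have c1 : ccont_on x1 x2 (fun x => f (cpt x y) * (cpt x y - 0)^-1).
    apply: (ccont_hor (f := fun z => f z * (z - 0)^-1)) => x xI; apply: cdI => //.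
      by rewrite ny orbT.
    exact: wx.
  split=> //; apply: edge_bound => //.
    by apply: ccont_hor => x xI; apply/cdiff_cont/cf.
  by move=> x xI; apply: inv; rewrite ny orbT.
have Vt (x : R) : r / 2 <= `|x| -> - r <= x <= r ->
    ccont_on y1 y2 (fun y => f (cpt x y) * (cpt x y - 0)^-1) /\
    cabs (cint y1 y2 (fun y => f (cpt x y) * (cpt x y - 0)^-1)) <=
      4 / r * aint (- r) r (fun y => f (cpt x y)).
  move=> nx xI.
  have c1 : ccont_on y1 y2 (fun y => f (cpt x y) * (cpt x y - 0)^-1).
    apply: (ccont_ver (f := fun z => f z * (z - 0)^-1)) => y yI; apply: cdI => //.
      by rewrite nx.
    exact: wy.
  split=> //; apply: edge_bound => //.
    by apply: ccont_ver => y yI; apply/cdiff_cont/cf.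
  by move=> y yI; apply: inv; rewrite nx.
have [h1 h1'] := H y1 ny1 Iy1; have [h2 h2'] := H y2 ny2 Iy2.
have [v1 v1'] := Vt x1 nx1 Ix1; have [v2 v2'] := Vt x2 nx2 Ix2.
have i1 : cabs ('i : C) = 1 by rewrite /Normc.normc /= expr0n/= add0r expr1n sqrtr1.
have B : cabs (f 0) * 4 <= 4 / r * (aint (- r) r (fun x => f (cpt x y1)) + aint (- r) r (fun x => f (cpt x y2)) +
     (aint (- r) r (fun y => f (cpt x1 y)) + aint (- r) r (fun y => f (cpt x2 y)))).
  apply: (@le_trans _ _ (cabs (f 0) * cabs (kappa : C))).
    by rewrite ler_wpM2l ?cabs_ge0 ?kappa_ge4.
  rewrite -cabsM -E /rectint cintB// cintB//.
  apply: (le_trans (cabsD _ _)); rewrite cabsM i1 mul1r.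
  rewrite mulrDr; apply: lerD; apply: (le_trans (cabsD _ _)); rewrite cabsN mulrDr.
    exact: lerD.
  by rewrite addrC; exact: lerD.
rewrite -(ler_pM2l (x := 4 / r)) ?divr_gt0//; apply: le_trans B.
by rewrite mulrA divfK ?gt_eqF// mulrC.
Qed.

(** By pigeonhole instead of averaging: if each of the four strips contained an edge on which [aint]
    is below r |f(0)| / 4, [edge_sum] would fail for the rectangle they bound. So in some strip, of
    width r / 2, every edge reaches that value. The measurable majorant G lets the property be
    applied to functions cut off outside a domain. *)
Lemma submean (f : C -> C) (r : R) (G : mR * mR -> \bar R) : 0 < r ->
  (forall z, square 0 r z -> cdiff f z) ->
  measurable_fun [set: mR * mR] G -> (forall p, (0 <= G p)%E) ->
  (forall x y : R, square 0 r (cpt x y) -> ((cabs (f (cpt x y)))%:E <= G (x, y))%E) ->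
  ((r ^+ 2 / 16 * cabs (f 0))%:E <= \int[leb]_x \int[leb]_y G (x, y))%E.
Proof.
move=> r0 df mG G0 fG.
pose L := r * cabs (f 0) / 4.
have sq (z : C) : rect (- r) r (- r) r z -> square 0 r z by rewrite /square /= !sub0r !add0r.
have L0 : 0 <= L by rewrite divr_ge0// mulr_ge0 ?cabs_ge0 ?ltW.
have r20 : 0 <= r / 2 by rewrite divr_ge0 ?ltW.
(* Integrates over a strip of width r / 2 the lower bound L / 2 that holds on every edge; the
   division by 2 comes from [aint_le]. *)
have fin (I : interval R) (h : mR -> \bar R) : leb [set` I] = (r / 2)%:E -> measurable_fun [set: mR] h ->
   (forall x, (0 <= h x)%E) -> (forall x, x \in I -> (L%:E <= 2%:E * h x)%E) ->
   ((r ^+ 2 / 16 * cabs (f 0))%:E <= \int[leb]_x h x)%E.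
  move=> lI mh h0 Lh; apply: (@le_trans _ _ (\int[leb]_(x in [set` I]) h x)%E); last first.
    by apply: ge0_subset_integral.
  have -> : r ^+ 2 / 16 * cabs (f 0) = (L / 2) * (r / 2) by rewrite /L; field.
  rewrite EFinM -lI -integral_cst//; apply: ge0_le_integral => //.
  - by move=> x _; rewrite lee_fin divr_ge0.
  - exact: measurable_funTS.
  move=> x xI; have := Lh x xI.
  case: (h x) (h0 x) => [s| |]//.
    by move=> _; rewrite -EFinM lee_fin => h2; rewrite /cst lee_fin ler_pdivrMr// mulrC.
  by move=> _ _; rewrite leey.
have lI1 : leb `[(- r), (- (r / 2))]%classic = (r / 2)%:E.
  rewrite lebesgue_measure_itv/= lte_fin ifT -?EFinB; last by move: r0; clear; lra.
  by congr _%:E; rewrite [in RHS](splitr (r / 2)); lra.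
have lI2 : leb `[(r / 2), r]%classic = (r / 2)%:E.
  rewrite lebesgue_measure_itv/= lte_fin ifT -?EFinB; last by move: r0; clear; lra.
  by congr _%:E; lra.
have mG1 := @measurable_fun_fubini_tonelli_F _ _ _ _ R leb _ mG G0.
have mG2 := @measurable_fun_fubini_tonelli_G _ _ _ _ R leb _ mG G0.
have W1 (t : R) : - r <= t <= - (r / 2) -> - r <= t <= r.
  by move=> /andP[t1 t2]; rewrite t1; move: t2 r0; clear; lra.
have W2 (t : R) : r / 2 <= t <= r -> - r <= t <= r.
  by move=> /andP[t1 t2]; rewrite t2 andbT; move: t1 r0; clear; lra.
have hor (t : R) : - r <= t <= r -> L <= aint (- r) r (fun x => f (cpt x t)) ->
    (L%:E <= 2%:E * \int[leb]_x G (x, t))%E.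
  move=> tI h; apply: (@le_trans _ _ (aint (- r) r (fun x => f (cpt x t)))%:E); first by rewrite lee_fin.
  apply: aint_le => //.
  - by apply: ccont_hor => x xI; apply/cdiff_cont/df/sq.
  - exact: (measurableT_comp mG (pair2_measurable t)).
  - by move=> x xI; apply: fG; apply: sq.
have ver (t : R) : - r <= t <= r -> L <= aint (- r) r (fun y => f (cpt t y)) ->
    (L%:E <= 2%:E * \int[leb]_y G (t, y))%E.
  move=> tI h; apply: (@le_trans _ _ (aint (- r) r (fun y => f (cpt t y)))%:E); first by rewrite lee_fin.
  apply: aint_le => //.
  - by apply: ccont_ver => x xI; apply/cdiff_cont/df/sq.
  - exact: (measurableT_comp mG (pair1_measurable t)).
  - by move=> y yI; apply: fG; apply: sq.
have swap : (\int[leb]_x \int[leb]_y G (x, y) = \int[leb]_y \int[leb]_x G (x, y))%E.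
  by apply: fubini_tonelli.
have [a1|/existsNP[x1 /not_implyP[x1I /negP]]] :=
    pselect (forall t : R, - r <= t <= - (r / 2) -> L <= aint (- r) r (fun y => f (cpt t y))).
  by apply: (fin _ _ lI1) => //= [x|x]; [exact: integral_ge0|]; rewrite in_itv/= => xI; apply: ver; [exact: W1|exact: a1].
rewrite -ltNge => L1.
have [a2|/existsNP[x2 /not_implyP[x2I /negP]]] :=
    pselect (forall t : R, r / 2 <= t <= r -> L <= aint (- r) r (fun y => f (cpt t y))).
  by apply: (fin _ _ lI2) => //= [x|x]; [exact: integral_ge0|]; rewrite in_itv/= => xI; apply: ver; [exact: W2|exact: a2].
(* The last two strips consist of horizontal edges, hence the exchange of the integrals. *)
rewrite -ltNge => L2; rewrite swap.
have [a3|/existsNP[y1 /not_implyP[y1I /negP]]] :=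
    pselect (forall t : R, - r <= t <= - (r / 2) -> L <= aint (- r) r (fun x => f (cpt x t))).
  by apply: (fin _ _ lI1) => //= [x|x]; [exact: integral_ge0|]; rewrite in_itv/= => xI; apply: hor; [exact: W1|exact: a3].
rewrite -ltNge => L3.
have [a4|/existsNP[y2 /not_implyP[y2I /negP]]] :=
    pselect (forall t : R, r / 2 <= t <= r -> L <= aint (- r) r (fun x => f (cpt x t))).
  by apply: (fin _ _ lI2) => //= [x|x]; [exact: integral_ge0|]; rewrite in_itv/= => xI; apply: hor; [exact: W2|exact: a4].
rewrite -ltNge => L4.
have := edge_sum r0 df x1I x2I y1I y2I.
have -> : r * cabs (f 0) = L + L + (L + L) by rewrite /L; field.
by rewrite leNgt !ltrD.
Qed.
End submean.

(** * Sub-mean value property on Heisenberg boxes *)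

Section polycube_submean.
Variables (R : realType) (n : nat).
Local Notation C := (Cplx R).
Local Notation V := (Cn1 R n).
Local Notation H := (heis R n).
Local Notation mR := (measurableTypeR R).
Local Notation leb := (@lebesgue_measure R).
Implicit Types (F : V -> C).

Lemma tuple_shift N (a : N.-tuple mR) (f : N.-tuple mR -> \bar R) :
  measurable_fun [set: N.-tuple mR] f -> (forall u, 0 <= f u)%E ->
  (\int[lebesgue_tuple N]_u f [tuple (tnth u i + tnth a i)%R | i < N] =
   \int[lebesgue_tuple N]_u f u)%E.
Proof.
have mshift M (c : M.-tuple mR) : measurable_fun [set: M.-tuple mR]
    (fun u : M.-tuple mR => [tuple (tnth u i + tnth c i : mR)%R | i < M]).
  apply/measurable_fun_tnthP => i.
  rewrite (_ : _ \o _ = (fun u : M.-tuple mR => tnth u i + tnth c i)%R).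
    by apply: measurable_funD => //; exact: measurable_tnth.
  by apply/funext => u /=; rewrite tnth_mktuple.
elim: N a f => [|N IH] a f mf f0.
  by congr (integral _ _ _); apply/funext => u; congr f; apply: eq_from_tnth => -[].
rewrite tonelli_cons; last 2 first.
- by apply: (measurableT_comp mf); exact: mshift.
- by move=> x; exact: f0.
rewrite [RHS]tonelli_cons//.
have mg : measurable_fun [set: mR * N.-tuple mR] (fun p : mR * N.-tuple mR => f [tuple of p.1 :: p.2]).
  by apply: (measurableT_comp mf); exact: measurable_cons_pair.
rewrite -(@lebesgue_shift _ (tnth a ord0) (fun x => \int[lebesgue_tuple N]_u f [tuple of x :: u])%E).
- apply: eq_integral => x _.
  rewrite -(IH [tuple of behead a] (fun u => f [tuple of (x + tnth a ord0)%R :: u])).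
  + apply: eq_integral => u _; congr f; apply: eq_from_tnth => i; rewrite tnth_mktuple.
    case: (unliftP ord0 i) => [j|] ->; last by rewrite !tnth0.
    by rewrite 2!tnthS tnth_mktuple; congr (_ + _); rewrite !(tnth_nth 0)/= nth_behead.
  + exact: (measurableT_comp mg (pair1_measurable _)).
  + by move=> u; exact: f0.
- exact: (@measurable_fun_fubini_tonelli_F _ _ _ _ R (lebesgue_tuple N) _ mg).
- by move=> x; exact: integral_ge0.
Qed.

Lemma measurable_to_Cn1 d (T : measurableType d) (f : T -> V) :
  (forall j, measurable_fun [set: T] (fun t => complex.Re ((f t).1 0 j) : mR)) ->
  (forall j, measurable_fun [set: T] (fun t => complex.Im ((f t).1 0 j) : mR)) ->
  measurable_fun [set: T] (fun t => complex.Re (f t).2 : mR) ->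
  measurable_fun [set: T] (fun t => complex.Im (f t).2 : mR) ->
  measurable_fun [set: T] (f : T -> borel V).
Proof.
move=> m1 m2 m3 m4.
pose c (k : nat) t : mR := if insub k./2 is Some j then
    if odd k then complex.Im ((f t).1 0 j) else complex.Re ((f t).1 0 j)
  else if odd k then complex.Im (f t).2 else complex.Re (f t).2.
pose v t : n.*2.+2.-tuple mR := [tuple c i t | i < n.*2.+2].
have mv : measurable_fun [set: T] v.
  apply/measurable_fun_tnthP => i.
  rewrite (_ : _ \o _ = c i); last by apply/funext => t /=; rewrite tnth_mktuple.
  by rewrite /c; case: insubP => [j _ _|_]; case: (odd i).
have vE k t : (k < n.*2.+2)%N -> nth 0 (v t) k = c k t.
  by move=> kn; rewrite -(tnth_nth _ _ (Ordinal kn)) tnth_mktuple.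
rewrite (_ : f = (@Cn1_of_tuple R n) \o v).
  by apply: measurableT_comp => //; exact: measurable_Cn1_of_tuple.
apply/funext => t; rewrite [LHS]surjective_pairing /= /Cn1_of_tuple; congr pair.
  apply/rowP => j; rewrite mxE !vE ?ltnS ?(leqW (ltnW _)) ?ltn_double ?ltn_Sdouble//.
  - by rewrite /c /= odd_double uphalf_double doubleK valK; case: ((f t).1 0 j).
  - by rewrite leq_double ltnW.
rewrite !vE// /c /= odd_double uphalf_double doubleK insubF ?ltnn//.
by case: ((f t).2).
Qed.

(** F is arbitrary off the Siegel domain; cutting |F| off there gives a Borel function on the whole
    space. *)
Definition sgabs F (q : V) : R := cabs (F q) * \1_(@siegel R n) q.

Lemma sgabs_ge0 F q : 0 <= sgabs F q.
Proof. by rewrite mulr_ge0 ?cabs_ge0. Qed.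

Lemma sgabsE F q : siegel q -> sgabs F q = cabs (F q).
Proof. by move=> qs; rewrite /sgabs indicE mem_set// mulr1. Qed.

Lemma cholo_cont F (O : set R) : cholo F -> open O -> open (@siegel R n `&` [set q | O (cabs (F q))]).
Proof.
move=> hF oO; rewrite openE => q [qs qO]; have [cF _] := hF q qs.
apply: filterI; first by apply: open_nbhs_nbhs; split => //; exact: siegel_open.
have /nbhs_ballP[e /= e0 eO] : nbhs (cabs (F q)) O by exact: open_nbhs_nbhs.
have := continuous_cabs_lt cF e0; apply: filterS => q' /= h.
apply: eO; rewrite -ball_normE /= distrC; apply: le_lt_trans h.
rewrite ler_norml cabsDB andbT lerNl opprB.
by rewrite [leRHS]cabsB cabsDB.
Qed.

Lemma measurable_sgabs F : cholo F -> measurable_fun [set: borel V] (sgabs F : borel V -> mR).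
Proof.
move=> hF; apply: (measurability (@RGenOInfty.G R)).
  exact: RGenOInfty.measurableE.
move=> _ [_ [a ->] <-]; rewrite setTI.
have mU : measurable (@siegel R n `&` [set q | `]a, +oo[%classic (cabs (F q))] : set (borel V)).
  by apply: sub_sigma_algebra; apply: cholo_cont.
have [a0|a0] := ltP a 0.
  rewrite (_ : _ @^-1` _ = setT)//; apply/seteqP; split => // q _ /=.
  by rewrite in_itv/= andbT (lt_le_trans a0)// sgabs_ge0.
rewrite (_ : _ @^-1` _ = (@siegel R n `&` [set q | `]a, +oo[%classic (cabs (F q))]))//.
apply/seteqP; split => q /=; rewrite !in_itv/= !andbT.
  have [qs|qs] := pselect (siegel q); first by rewrite sgabsE.
  by rewrite /sgabs indicE memNset// mulr0 ltNge a0.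
by move=> [qs]; rewrite sgabsE.
Qed.

Variables (x : H) (h : R).
Hypothesis h0 : 0 < h.

(* The point reached from [Psi_inv x h] by moving by [u_j] along the complex tangential direction
   [(e_j, (i/2) conj(z_j))] for each j and by [t + is] along the last coordinate. *)
Definition polymove (u : 'rV[C]_n) (t s : R) : V :=
  (x.1 + u, ((x.2 - him u x.1 / 2 + t) +i* (4^-1 * sqnorm x.1 + h + hre u x.1 / 2 + s))%C).

(** The tangential directions are chosen so that the terms linear in u cancel: rho changes only by s
    and by -|u|^2 / 4, and the box stays at a height comparable with h even when x is far from the
    origin. *)
Lemma rho_polymove u t s : rho (polymove u t s) = h + s - 4^-1 * sqnorm u.
Proof.
rewrite /rho /polymove /=.
have := sqnormB x.1 (- u); rewrite opprK => ->.
have -> : sqnorm (- u) = sqnorm u by rewrite !sqnormE; apply: eq_bigr => j _; rewrite mxE; case: (u 0 j) => a b /=; ring.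
have -> : hre x.1 (- u) = - hre u x.1.
  by rewrite /hre -sumrN; apply: eq_bigr => j _; rewrite mxE; case: (u 0 j) => a b /=; ring.
by field.
Qed.

Lemma hdist_polymove u (t s : R) :
  hdist x ((polymove u t s).1, complex.Re (polymove u t s).2) ^+ 2 <= 4^-1 * sqnorm u + `|t|.
Proof.
apply: (le_trans (hdist_sq_le _ _)); rewrite /polymove /=.
have -> : sqnorm (x.1 - (x.1 + u)) = sqnorm u by rewrite sqnormBC addrC addKr.
rewrite lerD2l /htau /=.
have -> : him x.1 (x.1 + u) = - him u x.1.
  rewrite himC; congr (- _); rewrite /him; apply: eq_bigr => j _; rewrite mxE.
  by case: (u 0 j) => a b; case: (x.1 0 j) => c e /=; ring.
by rewrite (_ : _ - _ + _ = - t) ?normrN//; field.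
Qed.

Lemma Cn1_addZ (p v : V) (a : C) : p + a *: v = (p.1 + a *: v.1, p.2 + a * v.2) :> V.
Proof. by []. Qed.

Lemma polymove_last u t s (a b : R) :
  polymove u t s + cpt a b *: (0, 1) = polymove u (t + a) (s + b).
Proof.
rewrite Cn1_addZ /polymove /= scaler0 addr0 mulr1; congr pair.
by apply/eqP; rewrite eq_complex /= !addrA !eqxx.
Qed.

Definition polydir (j : 'I_n) : V := (delta_mx 0 j, 'i / 2 * (x.1 0 j)^*).

Lemma hdot_dir u (c : C) (z : 'rV[C]_n) j :
  hdot (u + c *: delta_mx 0 j) z = hdot u z + c * (z 0 j)^*.
Proof.
rewrite /hdot (bigD1 j)//= [in RHS](bigD1 j)//= !mxE !eqxx mulr1 mulrDl addrAC -!addrA.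
congr (_ + _); congr (_ + _); apply: eq_bigr => k kj.
by rewrite !mxE eqxx (negPf kj) mulr0 addr0.
Qed.

Lemma polymove_dir u t s (a b : R) j :
  polymove u t s + cpt a b *: polydir j = polymove (u + cpt a b *: delta_mx 0 j) t s.
Proof.
rewrite Cn1_addZ /polymove /= -addrA; congr pair.
have := hdot_dir u (cpt a b) x.1 j; rewrite !hdotE => /eqP; rewrite eq_complex => /andP[/eqP /= -> /eqP /= ->].
by case: (x.1 0 j) => c d; apply/eqP; rewrite eq_complex /=; apply/andP; split; apply/eqP; field.
Qed.

Lemma polymove0 : polymove 0 0 0 = Psi_inv x h.
Proof.
rewrite /polymove /Psi_inv addr0; congr pair.
have := hdotE (0 : 'rV[C]_n) x.1; rewrite /hdot big1 => [|j _]; last by rewrite mxE mul0r.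
by move=> [<- <-]; rewrite !mul0r subr0 !addr0.
Qed.

Definition tbox (r : R) N : set (N.-tuple mR) := [set u | forall i, `|(tnth u i : R)| <= r].

Lemma measurable_tbox r N : measurable (@tbox r N).
Proof.
rewrite (_ : @tbox r N = \bigcap_(i in [set: 'I_N]) ((fun u => @tnth N mR u i) @^-1` `[- r, r]%classic)).
  apply: fin_bigcap_measurable => // i _.
  by rewrite -[X in measurable X]setTI; apply: measurable_tnth.
by apply/seteqP; split => u /= h1 i => [_|]; have := h1 i; rewrite /= in_itv/= -ler_norml//; exact.
Qed.

Lemma tbox_nth (r : R) N (u : N.-tuple mR) k : 0 <= r -> tbox r u -> `|nth 0 u k| <= r.
Proof.
move=> r0 ub; have [kN|kN] := ltnP k N.
  by have := ub (Ordinal kN); rewrite (tnth_nth 0).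
by rewrite nth_default ?normr0// size_tuple.
Qed.

Lemma sqnorm_tbox (r : R) N (u : N.-tuple mR) : 0 <= r -> tbox r u ->
  sqnorm (row_of_seq n u) <= (2 * n%:R) * r ^+ 2.
Proof.
move=> r0 ub; rewrite sqnormE (_ : 2 * n%:R * r ^+ 2 = \sum_(j < n) (r ^+ 2 + r ^+ 2)); last first.
  by rewrite sumr_const card_ord -mulr_natl; ring.
apply: ler_sum => j _; rewrite !mxE /=.
have sq (c : R) : `|c| <= r -> c ^+ 2 <= r ^+ 2.
  by move=> cr; rewrite -[c ^+ 2]real_normK ?num_real// ler_pXn2r.
by apply: lerD; apply: sq; apply: tbox_nth.
Qed.

Lemma row_of_seq_rcons2 (s : seq R) (a b : R) k (kn : (k < n)%N) : size s = k.*2 ->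
  row_of_seq n (rcons (rcons s a) b) = row_of_seq n s + cpt a b *: delta_mx 0 (Ordinal kn) :> 'rV[C]_n.
Proof.
move=> sk; apply/rowP => j; rewrite !mxE !nth_rcons !size_rcons sk eqxx.
rewrite -(inj_eq val_inj) /=.
have [jk|jk|jk] := ltngtP j k.
- have h1 : (j.*2.+1 < k.*2)%N by rewrite ltn_Sdouble.
  by rewrite (leqW (ltnW h1)) (leqW h1) (ltnW h1) h1 mulr0 addr0.
- have h1 : (k.*2.+1 < j.*2)%N by rewrite ltn_Sdouble.
  rewrite (leq_gtF (ltnW h1)) (leq_gtF (leqW (ltnW h1))) (gtn_eqF h1) (gtn_eqF (leqW h1)) mulr0 addr0 !nth_default ?sk//.
    by rewrite leqW// ltnW// ltnW.
  by rewrite ltnW// ltnW.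
rewrite jk ltnSn !ltnn !eqxx mulr1 !nth_default ?sk//.
by apply/eqP; rewrite eq_complex /= !add0r !eqxx.
Qed.

Lemma measurable_nth d (T : measurableType d) N (u : T -> N.-tuple mR) k :
  measurable_fun [set: T] u -> measurable_fun [set: T] (fun t => nth 0 (u t) k : mR).
Proof.
move=> mu; have [kN|kN] := ltnP k N.
  rewrite (_ : (fun _ => _) = (fun t => tnth (u t) (Ordinal kN))); last by apply/funext => t; rewrite (tnth_nth 0).
  exact: (measurableT_comp (measurable_tnth _) mu).
by rewrite (_ : (fun _ => _) = cst 0)//; apply/funext => t; rewrite nth_default// size_tuple.
Qed.

Lemma measurable_polymove d (T : measurableType d) N (u : T -> N.-tuple mR) (f g : T -> mR) :
  measurable_fun [set: T] u -> measurable_fun [set: T] f -> measurable_fun [set: T] g ->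
  measurable_fun [set: T] (fun a => polymove (row_of_seq n (u a)) (f a) (g a) : borel V).
Proof.
move=> mu mf mg; have mn k := measurable_nth k mu.
apply: measurable_to_Cn1 => [j|j||]; rewrite /polymove /=.
- rewrite (_ : (fun _ => _) = (fun t => complex.Re (x.1 0 j) + nth 0 (u t) j.*2)).
    by apply: measurable_funD; [exact: measurable_cst | exact: mn].
  by apply/funext => t; rewrite !mxE; case: (x.1 0 j).
- rewrite (_ : (fun _ => _) = (fun t => complex.Im (x.1 0 j) + nth 0 (u t) j.*2.+1)).
    by apply: measurable_funD; [exact: measurable_cst | exact: mn].
  by apply/funext => t; rewrite !mxE; case: (x.1 0 j).
- apply: measurable_funD => //; apply: measurable_funB => //.
  apply: measurable_funM => //; rewrite (_ : (fun _ => _) = (fun t => \sum_(j < n)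
    (nth 0 (u t) j.*2.+1 * complex.Re (x.1 0 j) - nth 0 (u t) j.*2 * complex.Im (x.1 0 j)))).
    by apply: measurable_sum => j; apply: measurable_funB; apply: measurable_funM; do ?[exact: mn | exact: measurable_cst].
  by apply/funext => t; apply: eq_bigr => j _; rewrite !mxE.
apply: measurable_funD => //; apply: measurable_funD => //.
apply: measurable_funM => //; rewrite (_ : (fun _ => _) = (fun t => \sum_(j < n)
  (nth 0 (u t) j.*2 * complex.Re (x.1 0 j) + nth 0 (u t) j.*2.+1 * complex.Im (x.1 0 j)))).
  by apply: measurable_sum => j; apply: measurable_funD; apply: measurable_funM; do ?[exact: mn | exact: measurable_cst].
by apply/funext => t; apply: eq_bigr => j _; rewrite !mxE.
Qed.

Lemma measurable_indic_itv d (T : measurableType d) (f : T -> mR) (I : interval R) :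
  measurable_fun [set: T] f -> measurable_fun [set: T] (fun a => \1_([set` I]) (f a : R) : mR).
Proof.
move=> mf; rewrite (_ : (fun _ => _) = \1_(f @^-1` [set` I])).
  by apply: measurable_indic; rewrite -[X in measurable X]setTI; apply: mf => //; exact: measurable_itv.
by apply/funext => a; rewrite !indicE.
Qed.

Section iteration.
Variables (F : V -> C) (r : R).
Hypotheses (hF : cholo F) (r0 : 0 < r) (rh : n%:R * r ^+ 2 <= h / 4).

Let g N (u : N.-tuple mR) (t s : R) := \1_(@tbox r N) u * sgabs F (polymove (row_of_seq n u) t s).

Let g_ge0 N (u : N.-tuple mR) t s : 0 <= g u t s.
Proof. by rewrite mulr_ge0 ?sgabs_ge0. Qed.

Let measurable_g d (T : measurableType d) N (u : T -> N.-tuple mR) (f f' : T -> mR) :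
  measurable_fun [set: T] u -> measurable_fun [set: T] f -> measurable_fun [set: T] f' ->
  measurable_fun [set: T] (fun a => (g (u a) (f a) (f' a))%:E).
Proof.
move=> mu mf mf'; apply/measurable_EFinP; apply: measurable_funM.
  apply: measurableT_comp => //; apply: measurable_indic; exact: measurable_tbox.
apply: (measurableT_comp (measurable_sgabs hF)); exact: measurable_polymove.
Qed.

(** [rh] keeps |u|^2 / 4 at most h / 8, and |s| takes at most h / 4, so rho stays positive on the
    box. *)
Let siegel_box N (u : N.-tuple mR) t s : tbox r u -> `|s| <= h / 4 -> siegel (polymove (row_of_seq n u) t s).
Proof.
move=> ub; rewrite ler_norml => /andP[s1 _]; rewrite /siegel /= rho_polymove.
have := sqnorm_tbox (ltW r0) ub; have := rh; have := h0; move: s1; clear.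
rewrite -mulrA; by move: (sqnorm _) (n%:R * r ^+ 2) => *; lra.
Qed.

(** One complex variable at a time: appending two real coordinates to u moves the point along the
    complex line in direction [polydir], on which the one-variable property gains a factor r^2 /
    16. *)
Lemma submean_iter k : (k <= n)%N ->
  (((r ^+ 2 / 16) ^+ k * cabs (F (Psi_inv x h)))%:E <= \int[lebesgue_tuple k.*2]_u (g u 0 0)%:E)%E.
Proof.
elim: k => [_|k IH kn].
  rewrite tuple0_integral => [|u]; last by rewrite lee_fin.
  have b0 : tbox r ([tuple] : 0.-tuple mR) by move=> -[].
  have E0 : row_of_seq n ([tuple] : 0.-tuple mR) = 0.
    by apply/rowP => j; rewrite !mxE !nth_nil; apply/eqP; rewrite eq_complex /= !eqxx.
  have s0 := siegel_box 0 b0 (s := 0) ltac:(by rewrite normr0 divr_ge0 ?ltW).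
  rewrite expr0 mul1r /g indicE mem_set// mul1r E0 in s0 *.
  by rewrite sgabsE// polymove0.
have r16 : 0 <= r ^+ 2 / 16 by rewrite divr_ge0 ?sqr_ge0.
rewrite exprS -mulrA EFinM; apply: (le_trans (lee_wpmul2l _ (IH (ltnW kn)))); first by rewrite lee_fin.
have mg2 : measurable_fun [set: k.*2.+2.-tuple mR] (fun u : k.*2.+2.-tuple mR => (g u 0 0)%:E).
  exact: (measurable_g (@measurable_id _ _ _) (measurable_cst _) (measurable_cst _)).
rewrite -ge0_integralZl//; last 2 first.
- exact: (measurable_g (@measurable_id _ _ _) (measurable_cst _) (measurable_cst _)).
- by move=> u _; rewrite lee_fin.
rewrite doubleS tonelli_rcons//; last by move=> u; rewrite lee_fin.
have mg3 : measurable_fun [set: k.*2.+1.-tuple mR * mR]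
    (fun p => (g [tuple of rcons p.1 p.2] 0 0)%:E).
  by apply: (measurableT_comp mg2); apply: measurable_rcons_tuple.
have mg4 : measurable_fun [set: k.*2.+1.-tuple mR] (fun u => \int[leb]_b (g [tuple of rcons u b] 0 0)%:E)%E.
  apply: (@measurable_fun_fubini_tonelli_F _ _ _ _ R leb _ mg3) => p; by rewrite lee_fin.
rewrite tonelli_rcons//; last by move=> u; apply: integral_ge0 => b _; rewrite lee_fin.
apply: ge0_le_integral => //.
- by move=> u _; rewrite mule_ge0// lee_fin.
- apply: emeasurable_funM => //.
  exact: (measurable_g (@measurable_id _ _ _) (measurable_cst _) (measurable_cst _)).
- pose q (p : k.*2.-tuple mR * mR) : \bar R := (\int[leb]_b (g [tuple of rcons [tuple of rcons p.1 p.2] b] 0 0)%:E)%E.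
  have mq : measurable_fun setT q.
    by apply: (measurableT_comp mg4); apply: measurable_rcons_tuple.
  apply: (@measurable_fun_fubini_tonelli_F _ _ _ _ R leb _ mq) => p.
  by apply: integral_ge0 => b _; rewrite lee_fin.
move=> u _.
have [ub|ub] := pselect (tbox r u); last first.
  rewrite {1}/g indicE memNset// mul0r mule0; apply: integral_ge0 => a _.
  by apply: integral_ge0 => b _; rewrite lee_fin.
have h4 : `|0 : R| <= h / 4 by rewrite normr0 divr_ge0 ?ltW.
rewrite {1}/g indicE mem_set// mul1r sgabsE; last exact: siegel_box.
set p := polymove _ 0 0.
have sqb (a b : R) : square 0 r (cpt a b) -> tbox r [tuple of rcons [tuple of rcons u a] b].
  move=> /squareP[]; rewrite subr0 /= => ha hb i; rewrite (tnth_nth 0) /= !nth_rcons !size_rcons size_tuple.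
  case: ltnP => _; first case: ltnP => _; first by apply: tbox_nth => //; exact: ltW.
    by case: eqP => // _; rewrite normr0 ltW.
  by case: eqP => // _; rewrite normr0 ltW.
have key (a b : R) : p + cpt a b *: polydir (Ordinal kn) =
    polymove (row_of_seq n [tuple of rcons [tuple of rcons u a] b]) 0 0.
  by rewrite polymove_dir -row_of_seq_rcons2// size_tuple.
have cE (z : C) : z = cpt (complex.Re z) (complex.Im z) by case: z.
have mG : measurable_fun [set: mR * mR] (fun p : mR * mR =>
   (g [tuple of rcons [tuple of rcons u p.1] p.2] 0 0)%:E).
  apply: (measurableT_comp mg2); apply: measurable_rcons_tuple => //.
  by apply: measurable_rcons_tuple.
have := @submean R (fun z => F (p + z *: polydir (Ordinal kn))) r _ r0 _ mG.
rewrite -EFinM scale0r addr0; apply.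
- move=> z zs; apply: cdiff_line => //; rewrite [z]cE key; apply: siegel_box => //.
  by apply: sqb; rewrite -cE.
- by move=> q; rewrite lee_fin.
move=> a b sab; rewrite key /= /g indicE mem_set ?mul1r ?lee_fin; last exact: sqb.
by rewrite sgabsE//; apply: siegel_box => //; exact: sqb.
Qed.

(** The last complex variable has its own radius r', because t and the height scale like h while the
    horizontal coordinates scale like sqrt h. *)
Lemma submean_polycube (r' : R) : 0 < r' -> r' <= h / 4 ->
  (((r ^+ 2 / 16) ^+ n * (r' ^+ 2 / 16) * cabs (F (Psi_inv x h)))%:E <=
   \int[lebesgue_tuple n.*2]_u \int[leb]_t \int[leb]_s
     (g u t s * \1_(`[(- r'), r']) (t : R) * \1_(`[(- r'), r']) (s : R))%:E)%E.
Proof.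
move=> r'0 r'h; have := submean_iter (leqnn n).
have p16 : 0 <= r' ^+ 2 / 16 by rewrite divr_ge0 ?sqr_ge0.
move=> hi.
rewrite [(r ^+ 2 / 16) ^+ n * _]mulrC -mulrA EFinM.
apply: (le_trans (lee_wpmul2l _ hi)); first by rewrite lee_fin.
pose G (q : n.*2.-tuple mR * (mR * mR)) := g q.1 q.2.1 q.2.2 * \1_(`[(- r'), r']%classic) (q.2.1 : R) * \1_(`[(- r'), r']%classic) (q.2.2 : R).
have mG : measurable_fun setT (fun q => (G q)%:E).
  apply/measurable_EFinP; apply: measurable_funM; first apply: measurable_funM.
  - apply/measurable_EFinP; apply: (measurable_g (u := fst) (f := fun q => q.2.1) (f' := fun q => q.2.2)) => //.
      by apply: (measurableT_comp (@measurable_fst _ _ _ _)).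
    by apply: (measurableT_comp (@measurable_snd _ _ _ _)).
  - apply: measurable_indic_itv.
    by apply: (measurableT_comp (@measurable_fst _ _ _ _)).
  - apply: measurable_indic_itv.
    by apply: (measurableT_comp (@measurable_snd _ _ _ _)).
have G0 q : (0 <= (G q)%:E)%E by rewrite lee_fin; apply: mulr_ge0 => //; apply: mulr_ge0.
rewrite -ge0_integralZl//; last 2 first.
- exact: (measurable_g (@measurable_id _ _ _) (measurable_cst _) (measurable_cst _)).
- by move=> u _; rewrite lee_fin.
have mG1 u : measurable_fun [set: mR * mR] (fun q => (G (u, q))%:E).
  exact: (measurableT_comp mG (pair1_measurable u)).
apply: ge0_le_integral => //.
- by move=> u _; rewrite mule_ge0// lee_fin.
- apply: emeasurable_funM => //.
  exact: (measurable_g (@measurable_id _ _ _) (measurable_cst _) (measurable_cst _)).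
- have mG2 : measurable_fun [set: (n.*2.-tuple mR * mR) * mR] (fun q => (G (q.1.1, (q.1.2, q.2)))%:E).
    apply: (measurableT_comp mG); apply/measurable_fun_pair.
      exact: (measurableT_comp (@measurable_fst _ _ _ _) (@measurable_fst _ _ _ _)).
    apply/measurable_fun_pair => //.
    exact: (measurableT_comp (@measurable_snd _ _ _ _) (@measurable_fst _ _ _ _)).
  have mG3 := @measurable_fun_fubini_tonelli_F _ _ _ _ R leb _ mG2 (fun q => G0 _).
  by apply: (@measurable_fun_fubini_tonelli_F _ _ _ _ R leb _ mG3) => q; apply: integral_ge0 => s _; exact: G0.
move=> u _.
have [ub|ub] := pselect (tbox r u); last first.
  rewrite {1}/g indicE memNset// mul0r mule0; apply: integral_ge0 => a _.
  by apply: integral_ge0 => b _; exact: (G0 (u, (a, b))).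
have h4 : `|0 : R| <= h / 4 by rewrite normr0 divr_ge0 ?ltW.
rewrite {1}/g indicE mem_set// mul1r sgabsE; last exact: siegel_box.
set p := polymove _ 0 0.
have key (a b : R) : p + cpt a b *: (0, 1) = polymove (row_of_seq n u) a b.
  by rewrite polymove_last !add0r.
have cE (z : C) : z = cpt (complex.Re z) (complex.Im z) by case: z.
have sI (z : C) : square 0 r' z -> `|complex.Re z| <= r' /\ `|complex.Im z| <= r'.
  by move=> /squareP; rewrite subr0.
have := @submean R (fun z => F (p + z *: (0, 1))) r' _ r'0 _ (mG1 u).
rewrite -EFinM scale0r addr0; apply.
- move=> z /sI[_ z2]; apply: cdiff_line => //; rewrite [z]cE key; apply: siegel_box => //.
  exact: le_trans z2 r'h.
- by move=> q.
move=> a b /sI/=[ha hb]; rewrite key /= /G /g /= !indicE.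
rewrite !mem_set/= ?in_itv/= -?ler_norml// !mulr1 mul1r lee_fin.
by rewrite sgabsE//; apply: siegel_box => //; exact: le_trans hb r'h.
Qed.
End iteration.
End polycube_submean.

(** The integral of a nonnegative function is a supremum over the simple functions below it, so
    monotonicity holds without measurability. This saves many side conditions on iterated
    integrals. *)
Lemma ge0_le_integralW d (T : measurableType d) (R : realType) (mu : {measure set T -> \bar R})
    (D : set T) (f g : T -> \bar R) :
  (forall x, D x -> (0 <= f x)%E) -> (forall x, D x -> (f x <= g x)%E) ->
  (\int[mu]_(x in D) f x <= \int[mu]_(x in D) g x)%E.
Proof.
move=> f0 fg; have g0 x : D x -> (0 <= g x)%E by move=> Dx; exact: le_trans (f0 x Dx) (fg x Dx).
rewrite !ge0_integralE//; apply: ge_ereal_sup => _ [h hf <-].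
apply: ereal_sup_ubound; exists h => // x; apply: le_trans (hf x) _.
by rewrite /patch; case: ifPn => //; rewrite inE; exact: fg.
Qed.

Section heis_submean.
Variables (R : realType) (n : nat).
Local Notation C := (Cplx R).
Local Notation V := (Cn1 R n).
Local Notation H := (heis R n).
Local Notation mR := (measurableTypeR R).
Local Notation leb := (@lebesgue_measure R).
Local Notation lam := (@lebesgue_heis R n).
Implicit Types (F : V -> C) (x y : H).

Lemma continuous_borel (T1 T2 : ptopologicalType) (f : T1 -> T2) : continuous f ->
  measurable_fun [set: borel T1] (f : borel T1 -> borel T2).
Proof.
move=> cf; apply: (@measurability _ _ (borel T1) (borel T2) setT (f : borel T1 -> borel T2) (@open T2)) => //.
move=> _ [U oU <-]; rewrite setTI; apply: sub_sigma_algebra.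
by apply: open_comp => // z _; exact: cf.
Qed.

Definition hpart (q : V) : H := (q.1, complex.Re q.2).

Lemma measurable_hpart : measurable_fun [set: borel V] (hpart : borel V -> borel H).
Proof.
apply: (@continuous_borel V H) => q.
apply: (@cvg_pair _ _ _ _ (nbhs q.1) (nbhs (complex.Re q.2))); first exact: cvg_fst.
apply: (@continuous_comp _ _ _ (fun q : V => q.2) (fun z : C => complex.Re z : R)); first exact: cvg_snd.
exact: Re_continuous.
Qed.

Lemma hpart_Psi_inv y s : hpart (Psi_inv y s) = y.
Proof. by case: y. Qed.

Section box.
Variables (x : H) (h : R).

(** A Whitney box around (x, h): in the geometry of the group its size is comparable with its
    height. *)
Definition wbox (y : H) (s : R) : bool := (hdist x y ^+ 2 <= h) && (h / 2 <= s <= 2 * h).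

Let wabs F (q : V) : R := (wbox (hpart q) (rho q))%:R * sgabs F q.

Lemma measurable_wbox d (T : measurableType d) (f : T -> borel H) (g : T -> mR) :
  measurable_fun [set: T] f -> measurable_fun [set: T] g ->
  measurable_fun [set: T] (fun a => (wbox (f a) (g a))%:R : mR).
Proof.
move=> mf mg.
have md : measurable_fun [set: T] (fun a => hdist x (f a) ^+ 2 : mR).
  by apply: measurable_funX; exact: (measurable_hdist (measurable_cst (x : borel H)) mf).
rewrite (_ : (fun _ => _) = \1_((fun a => hdist x (f a) ^+ 2 : mR) @^-1` `]-oo, h] `&` g @^-1` `[(h / 2), (2 * h)])).
  apply: measurable_indic; apply: measurableI; rewrite -[X in measurable X]setTI.
    by apply: md => //; exact: measurable_itv.
  by apply: mg => //; exact: measurable_itv.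
apply/funext => a; rewrite indicE /wbox; congr ((nat_of_bool _)%:R); apply/idP/idP.
  by move=> /andP[a1 a2]; rewrite in_setI; apply/andP; split; rewrite inE /= in_itv.
by rewrite in_setI => /andP[]; rewrite !inE /= !in_itv/= => -> ->.
Qed.

Let wabs_ge0 F q : 0 <= wabs F q.
Proof. by rewrite mulr_ge0 ?sgabs_ge0 ?ler0n. Qed.

Let measurable_wabs F : cholo F -> measurable_fun [set: borel V] (wabs F : borel V -> mR).
Proof.
move=> hF; apply: measurable_funM; last exact: measurable_sgabs.
apply: measurable_wbox; first exact: measurable_hpart.
by apply: (@continuous_borel_measurable R V); exact: rho_continuous.
Qed.

Lemma wabs_integral F : cholo F ->
  (\int[@lebesgue_Cn1 R n]_q (wabs F q)%:E =
   \int[lam]_y \int[leb]_(s in `]0%R, +oo[) ((wbox y s)%:R * cabs (F (Psi_inv (y : H) (s : R))))%:E)%E.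
Proof.
move=> hF; have mw : measurable_fun [set: borel V] (fun q => (wabs F q)%:E).
  apply/measurable_EFinP; exact: measurable_wabs.
have w0 q : (0 <= (wabs F q)%:E)%E by rewrite lee_fin.
transitivity (\int[@lebesgue_Cn1 R n]_(q in @siegel R n) (wabs F q)%:E)%E.
  rewrite [RHS]integral_mkcond; apply: eq_integral => q _; rewrite /patch.
  case: ifPn => //; rewrite notin_setE => qs.
  by rewrite /wabs /sgabs indicE memNset// !mulr0.
rewrite (siegel_integral (measurable_funTS mw) (fun q _ => w0 q)).
apply: eq_integral => y _; apply: eq_integral => s; rewrite inE/= in_itv/= andbT => s0.
by rewrite /wabs rho_Psi_inv hpart_Psi_inv sgabsE// /siegel /= rho_Psi_inv.
Qed.

(** The coordinates of [polymove] differ from those of C^n x C by a translation in u and then, at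
    fixed u, by translations in the last variable; so they have Jacobian 1. *)
Lemma wabs_shift F : cholo F ->
  (\int[@lebesgue_Cn1 R n]_q (wabs F q)%:E =
   \int[lebesgue_tuple n.*2]_u \int[leb]_t \int[leb]_s (wabs F (polymove x h (row_of_seq n u) t s))%:E)%E.
Proof.
move=> hF; have mw : measurable_fun [set: borel V] (fun q => (wabs F q)%:E).
  apply/measurable_EFinP; exact: measurable_wabs.
have w0 q : (0 <= (wabs F q)%:E)%E by rewrite lee_fin.
rewrite (Cn1_integral_rcons mw w0).
pose a : n.*2.-tuple mR := [tuple (heis_coord x i : mR) | i < n.*2].
pose W (u : n.*2.-tuple mR) : \bar R := (\int[leb]_t \int[leb]_s
  (wabs F (row_of_seq n u : 'rV[C]_n, ((t : R) +i* (s : R) : C)))%:E)%E.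
have mP : measurable_fun [set: (n.*2.-tuple mR * mR) * mR] (fun q => (row_of_seq n q.1.1, ((q.1.2 : R) +i* (q.2 : R))%C) : borel V).
  have m1 k : measurable_fun [set: (n.*2.-tuple mR * mR) * mR] (fun q => nth 0 q.1.1 k : mR).
    apply: (@measurable_nth _ _ _ _ (fun q : (n.*2.-tuple mR * mR) * mR => q.1.1)).
    exact: (measurableT_comp (@measurable_fst _ _ _ _) (@measurable_fst _ _ _ _)).
  apply: measurable_to_Cn1 => [j|j||] /=.
  - by rewrite (_ : (fun _ => _) = (fun q : (n.*2.-tuple mR * mR) * mR => nth 0 q.1.1 (j : 'I_n).*2))//; apply/funext => q; rewrite mxE.
  - by rewrite (_ : (fun _ => _) = (fun q : (n.*2.-tuple mR * mR) * mR => nth 0 q.1.1 (j : 'I_n).*2.+1))//; apply/funext => q; rewrite mxE.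
  - exact: (measurableT_comp (@measurable_snd _ _ _ _) (@measurable_fst _ _ _ _)).
  - exact: measurable_snd.
have mG2 := measurableT_comp mw mP.
have mG3 := @measurable_fun_fubini_tonelli_F _ _ _ _ R leb _ mG2 (fun q => w0 _).
have mW : measurable_fun [set: n.*2.-tuple mR] W.
  by apply: (@measurable_fun_fubini_tonelli_F _ _ _ _ R leb _ mG3) => q; apply: integral_ge0 => s _; exact: w0.
have W0 u : (0 <= W u)%E by apply: integral_ge0 => t _; exact: integral_ge0.
transitivity (\int[lebesgue_tuple n.*2]_u W u)%E; first by [].
apply: (eq_trans (esym (tuple_shift a mW W0))); apply: eq_integral => u _.
have rE : row_of_seq n [tuple tnth u i + tnth a i | i < n.*2] = x.1 + row_of_seq n u.
  apply/rowP => j; rewrite !mxE.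
  have k1 : (j.*2 < n.*2)%N by rewrite ltn_double.
  have k2 : (j.*2.+1 < n.*2)%N by rewrite ltn_Sdouble.
  rewrite (nth_mktuple _ _ (Ordinal k1)) (nth_mktuple _ _ (Ordinal k2)) !tnth_mktuple.
  rewrite !(tnth_nth 0) /= heis_coordRe heis_coordIm; case: (x.1 0 j) => c d /=.
  by apply/eqP; rewrite eq_complex /= ![_ + nth _ _ _]addrC !eqxx.
rewrite /W rE.
pose A := x.2 - him (row_of_seq n u) x.1 / 2.
pose B := 4^-1 * sqnorm x.1 + h + hre (row_of_seq n u) x.1 / 2.
have mF t : measurable_fun [set: mR] (fun s : mR => (wabs F (x.1 + row_of_seq n u, ((t : R) +i* (s : R))%C))%:E).
  by rewrite -rE; exact: (measurableT_comp mG2 (pair1_measurable (_, t))).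
rewrite -(@lebesgue_shift _ A (fun t => \int[leb]_s (wabs F (x.1 + row_of_seq n u, ((t : R) +i* (s : R))%C))%:E)%E).
- apply: eq_integral => t _; rewrite -(@lebesgue_shift _ B _ (mF (t + A)) (fun s => w0 _)).
  by apply: eq_integral => s _; rewrite /polymove /A /B [(t + _)%R]addrC [(s + _)%R]addrC.
- rewrite -rE; exact: (measurableT_comp mG3 (pair1_measurable _)).
- by move=> t; exact: integral_ge0.
Qed.
End box.

(** The exponent n + 2 is that of the volume of the Whitney box: each horizontal complex variable
    contributes r^2, of order h, and the last variable contributes h^2. *)
Lemma submean_heis : exists2 c : R, 0 < c & forall F x (h : R), cholo F -> 0 < h ->
  ((c * h ^+ n.+2 * cabs (F (Psi_inv x h)))%:E <=
   \int[lam]_y \int[leb]_(s in `]0%R, +oo[) ((wbox x h y s)%:R * cabs (F (Psi_inv (y : H) (s : R))))%:E)%E.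
Proof.
(* Then r^2 = h / k satisfies n r^2 <= h / 4, as required for the box to stay in the domain. *)
pose k : R := 4 * n.+1%:R.
have k0 : 0 < k by rewrite mulr_gt0.
exists ((16 * k)^-1 ^+ n / 256) => [|F x h hF h0]; first by rewrite divr_gt0// exprn_gt0// invr_gt0 mulr_gt0.
pose r := Num.sqrt (h / k).
have hk : 0 < h / k by rewrite divr_gt0.
have r0 : 0 < r by rewrite sqrtr_gt0.
have r2 : r ^+ 2 = h / k by rewrite sqr_sqrtr ?ltW.
have rh : n%:R * r ^+ 2 <= h / 4.
  rewrite r2 mulrA ler_pdivrMr// (_ : h / 4 * k = n.+1%:R * h); last by rewrite /k; field.
  by rewrite ler_wpM2r ?(ltW h0)// ler_nat.
have h4 : 0 < h / 4 by rewrite divr_gt0.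
have := @submean_polycube R n x h h0 F r hF r0 rh (h / 4) h4 (lexx _).
rewrite -(wabs_integral x h hF) (wabs_shift x h hF).
rewrite (_ : (r ^+ 2 / 16) ^+ n * ((h / 4) ^+ 2 / 16) = (16 * k)^-1 ^+ n / 256 * h ^+ n.+2); last first.
  rewrite r2 (_ : h / k / 16 = (16 * k)^-1 * h); last by field; rewrite gt_eqF.
  rewrite exprMn -[n.+2]addn2 exprD; by move: (_ ^+ n) (h ^+ n) => c d; field.
move=> /le_trans; apply.
have bnd u t s : \1_(@tbox R r n.*2) u * sgabs F (polymove x h (row_of_seq n u) t s) *
     \1_(`[(- (h / 4)), (h / 4)]) t * \1_(`[(- (h / 4)), (h / 4)]) s <=
   (wbox x h (hpart (polymove x h (row_of_seq n u) t s)) (rho (polymove x h (row_of_seq n u) t s)))%:R *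
      sgabs F (polymove x h (row_of_seq n u) t s).
  rewrite !indicE; have R0 : 0 <= (wbox x h (hpart (polymove x h (row_of_seq n u) t s)) (rho (polymove x h (row_of_seq n u) t s)))%:R *
      sgabs F (polymove x h (row_of_seq n u) t s) by rewrite mulr_ge0 ?sgabs_ge0.
  have [ub|ub] := pselect (tbox r u); last by rewrite memNset// !mul0r.
  have [tb|tb] := pselect (`[(- (h / 4)), (h / 4)]%classic t); last by rewrite (memNset tb) mulr0 mul0r.
  have [sb|sb] := pselect (`[(- (h / 4)), (h / 4)]%classic s); last by rewrite (memNset sb) mulr0.
  rewrite !mem_set// mul1r !mulr1 ler_peMl ?sgabs_ge0//.
  rewrite (_ : wbox _ _ _ _ = true)//; apply/andP.
  move: tb sb; rewrite /= !in_itv/= -ler_norml => tb /andP[s1 s2].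
  have uu := sqnorm_tbox n (ltW r0) ub.
  have := hdist_polymove x h (row_of_seq n u) t s; rewrite rho_polymove -/(hpart _).
  have := sqnorm_ge0 (row_of_seq n u : 'rV[C]_n).
  move: uu tb rh; rewrite -[2 * n%:R * _]mulrA.
  move: (sqnorm _) (n%:R * r ^+ 2) (hdist _ _ ^+ 2) (`|t|) => A B D0 E h1 h2 h3 h5 h6.
  by split; [|apply/andP; split]; move: h1 h2 h3 h5 h6 s1 s2 h0; clear; lra.
have pos u t s : 0 <= \1_(@tbox R r n.*2) u * sgabs F (polymove x h (row_of_seq n u) t s) *
     \1_(`[(- (h / 4)), (h / 4)]) t * \1_(`[(- (h / 4)), (h / 4)]) s.
  by apply: mulr_ge0 => //; apply: mulr_ge0 => //; apply: mulr_ge0 => //; exact: sgabs_ge0.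
apply: ge0_le_integralW => u _.
  by apply: integral_ge0 => t _; apply: integral_ge0 => s _; rewrite lee_fin pos.
apply: ge0_le_integralW => t _; first by apply: integral_ge0 => s _; rewrite lee_fin pos.
by apply: ge0_le_integralW => s _; rewrite lee_fin ?pos ?bnd.
Qed.
End heis_submean.

(** * Hardy-Sobolev functions are bounded by potentials *)

Section vertical_integral.
Context {R : realType}.
Local Notation C := (Cplx R).
Local Notation mR := (measurableTypeR R).
Local Notation leb := (@lebesgue_measure R).

Definition rderiv (u : R -> R) (s l : R) := forall e : R, 0 < e ->
  exists2 d : R, 0 < d & forall t, `|t - s| < d -> `|u t - u s - l * (t - s)| <= e * `|t - s|.

Lemma rderiv_is_derive u s l : rderiv u s l -> is_derive s 1 u l.
Proof.
move=> h; have cv : k^-1 *: (u (k *: 1 + s) - u s) @[k --> 0^'] --> l.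
  apply/cvgrPdist_le => e e0; have [d d0 dP] := h e e0.
  apply/nbhs_ballP; exists d => //= w; rewrite -ball_normE /= sub0r normrN => wd w0.
  have := dP (w + s); rewrite addrK => /(_ wd) hw.
  have w1 : 0 < `|w| by rewrite normr_gt0.
  rewrite distrC -(ler_pM2r w1); apply: le_trans hw.
  rewrite -normrM le_eqVlt; apply/orP; left; apply/eqP; congr (`|_|).
  by rewrite /GRing.scale /= mulr1; field.
by split; [apply/cvg_ex; exists l | apply: cvg_lim].
Qed.

Lemma FTC_cont_on (u v : R -> R) (a b : R) : a < b ->
  (forall s, a <= s <= b -> rderiv u s (v s)) -> cont_on a b v -> u b - u a = rint a b v.
Proof.
move=> ab du cv.
have dd s : a <= s <= b -> is_derive s 1 u (v s) by move=> /du; exact: rderiv_is_derive.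
have cu s : a <= s <= b -> {for s, continuous u}.
  by move=> /dd [h _]; apply: differentiable_continuous; apply/derivable1_diffP.
have Iaa : a <= a <= b by rewrite lexx ltW.
have Ibb : a <= b <= b by rewrite lexx ltW.
have := @continuous_FTC2 R v u a b ab.
rewrite /rint /Rintegral => ->; first by rewrite -EFinB.
- apply: continuous_in_subspaceT => x; rewrite inE/= in_itv/= => xab.
  apply/cvgrPdist_lt => e e0; have [d d0 dP] := cv x xab e e0.
  apply/nbhs_ballP; exists d => // y; rewrite /ball/= => xy.
  by rewrite distrC; apply: dP; rewrite distrC.
- split.
  + move=> s; rewrite in_itv/= => /andP[s1 s2].
    by have [|] := dd s; rewrite ?(ltW s1) ?(ltW s2).
  + by apply: cvg_at_right_filter; exact: cu.
  + by apply: cvg_at_left_filter; exact: cu.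
move=> s; rewrite in_itv/= => /andP[s1 s2].
by rewrite derive1E; have [|_ ->] := dd s; rewrite ?(ltW s1) ?(ltW s2).
Qed.

(** Inserting the bound for the next g and exchanging the integrals leaves the integral of t^k over
    [h, r], which is at most r^(k + 1). The factor 2 in the hypothesis is the loss of [aint_le]. *)
Lemma iterate_tail (g : nat -> mR -> R) :
  (forall k, measurable_fun [set: mR] (g k : mR -> mR)) -> (forall k t, 0 <= g k t) ->
  (forall k (s : R), 0 < s -> ((g k s)%:E <= 2%:E * \int[leb]_(t in `]s, +oo[) (g k.+1 t)%:E)%E) ->
  forall k (h : R), 0 < h ->
    ((g 0%N h)%:E <= (2 ^+ k.+1)%:E * \int[leb]_(t in `]h, +oo[) ((t : R) ^+ k * g k.+1 t)%:E)%E.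
Proof.
move=> mg g0 hg k h h0; elim: k => [|k IH].
  rewrite expr1; apply: (le_trans (hg 0%N h h0)); apply: lee_wpmul2l => //.
  by apply: ge0_le_integralW => t _; rewrite ?expr0 ?mul1r ?lee_fin.
apply: (le_trans IH); rewrite [2 ^+ k.+2]exprSr EFinM -muleA; apply: lee_wpmul2l; first by rewrite lee_fin exprn_ge0.
pose A (p : mR * mR) : R := ((h < p.1) && (p.1 < p.2))%:R * ((p.1 : R) ^+ k * g k.+2 p.2).
have A0 p : 0 <= A p.
  rewrite /A; case: (ltP h p.1) => hp; last by rewrite mul0r.
  by rewrite mulr_ge0// mulr_ge0// exprn_ge0// ltW// (lt_trans h0).
have mA : measurable_fun [set: mR * mR] (fun p => (A p)%:E).
  apply/measurable_EFinP; apply: measurable_funM.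
    rewrite (_ : (fun _ => _) = \1_(fst @^-1` (`]h, +oo[ : set mR) `&` (fun p : mR * mR => p.2 - p.1 : mR)%R @^-1` `]0, +oo[)).
      apply: measurable_indic; apply: measurableI; rewrite -[X in measurable X]setTI.
        by apply: (@measurable_fst _ _ mR mR) => //; exact: measurable_itv.
      have md : measurable_fun [set: mR * mR] (fun p : mR * mR => p.2 - p.1 : mR)%R.
        by apply: measurable_funB.
      by apply: md => //; exact: measurable_itv.
    apply/funext => p; rewrite indicE; congr ((nat_of_bool _)%:R).
    by rewrite in_setI; congr andb; apply/idP/idP; rewrite inE /= in_itv/= andbT ?subr_gt0.
  apply: measurable_funM; first by apply: measurable_funX.
  by apply: (measurableT_comp (mg _)).
have E1 : (\int[leb]_(t in `]h, +oo[) ((t : R) ^+ k * g k.+1 t)%:E <=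
    2%:E * \int[leb]_t \int[leb]_r (A (t, r))%:E)%E.
  rewrite -ge0_integralZl//; last 2 first.
  - exact: (@measurable_fun_fubini_tonelli_F _ _ _ _ R leb _ mA).
  - by move=> t _; apply: integral_ge0 => r _; rewrite lee_fin.
  rewrite [leLHS]integral_mkcond; apply: ge0_le_integralW => t _; rewrite /patch; case: ifPn => //.
    by rewrite inE /= in_itv/= andbT => ht; rewrite lee_fin mulr_ge0 ?exprn_ge0// ltW// (lt_trans h0).
  rewrite inE /= in_itv/= andbT => ht; have t0 := lt_trans h0 ht.
  have tk : (0 <= ((t : R) ^+ k)%:E)%E by rewrite lee_fin exprn_ge0// ltW.
  rewrite EFinM; apply: (le_trans (lee_wpmul2l tk (hg k.+1 t t0))).
  rewrite muleCA; apply: lee_wpmul2l => //.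
  rewrite -ge0_integralZl//; last 2 first.
  - by apply/measurable_EFinP; apply: measurable_funTS; exact: mg.
  - by move=> r _; rewrite lee_fin.
  rewrite [leLHS]integral_mkcond; apply: ge0_le_integralW => r _; rewrite /patch; case: ifPn => //; rewrite ?lee_fin//.
    by rewrite mulr_ge0// exprn_ge0// ltW.
  by rewrite inE /= in_itv/= andbT => tr; rewrite /A /= ht tr mul1r.
  by move=> _; rewrite mule_ge0//; apply: integral_ge0 => r _; rewrite lee_fin.
apply: (le_trans E1); apply: lee_wpmul2l => //.
have -> : (\int[leb]_t \int[leb]_r (A (t, r))%:E = \int[leb]_r \int[leb]_t (A (t, r))%:E)%E.
  by apply: (@fubini_tonelli _ _ _ _ R leb leb (fun p => (A p)%:E) mA) => p; rewrite lee_fin.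
rewrite [leRHS]integral_mkcond; apply: ge0_le_integralW => r _.
  by apply: integral_ge0 => t _; rewrite lee_fin.
have [hr|rh] := ltP h r; last first.
  rewrite /patch memNset; last by rewrite /= in_itv/= andbT; apply/negP; rewrite -leNgt.
  rewrite integral0_eq//.
  by move=> t _; rewrite /A /=; case: (ltP h t) => ht; rewrite ?mul0r// ltNge (le_trans rh (ltW ht)) mul0r.
rewrite /patch mem_set; last by rewrite /= in_itv/= hr.
have r0 : 0 < r := lt_trans h0 hr.
apply: (@le_trans _ _ (\int[leb]_(t in `[h, r]) (cst (r ^+ k * g k.+2 r)%:E) t)%E).
  rewrite [leRHS]integral_mkcond; apply: ge0_le_integralW => t _; first by rewrite lee_fin.
  rewrite /A /= /patch.
  case: (ltP h t) => ht; case: (ltP t r) => tr /=; rewrite ?mul0r ?mul1r; case: ifPn => // ; rewrite ?lee_fin ?mulr_ge0 ?exprn_ge0 ?(ltW r0)//.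
    by move=> _; rewrite ler_wpM2r// lerXn2r ?nnegrE ?(ltW r0) ?(ltW tr)// ltW// (lt_trans h0).
  by rewrite notin_setE /= in_itv/= (ltW ht) (ltW tr).
rewrite integral_cst//= lebesgue_measure_itv/= lte_fin hr -EFinB -EFinM lee_fin.
rewrite mulrC mulrA ler_wpM2r// exprS ler_wpM2r ?exprn_ge0 ?(ltW r0)//.
by rewrite lerBlDr lerDl ltW.
Qed.
End vertical_integral.

Section vertical.
Variables (R : realType) (n : nat).
Local Notation C := (Cplx R).
Local Notation V := (Cn1 R n).
Local Notation H := (heis R n).
Local Notation mR := (measurableTypeR R).
Local Notation leb := (@lebesgue_measure R).
Implicit Types (F : V -> C) (x y : H).

(** Decay at fixed z is all that integration from infinity requires, and the Cauchy estimates in the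
    last variable pass it on to [dlast F]. *)
Definition vanish_vert F := forall (z : 'rV[C]_n) (e : R), 0 < e -> exists M : R,
  forall w : C, M < complex.Im w -> cabs (F (z, w)) <= e.

Lemma vanishes_vert F : vanishes_at_infinity F -> vanish_vert F.
Proof.
move=> hF z e e0.
have r0 : 0 < Num.sqrt (sqnorm z) + 1 by rewrite ltr_wpDl// sqrtr_ge0.
have nb : nbhs (0 : \bar R)%E [set y : \bar R | (y < e%:E)%E].
  by apply: open_nbhs_nbhs; split; [exact: open_ereal_lt_ereal | rewrite /= lte_fin].
have [M MP] := hF _ r0 _ nb.
exists M => w /MP /= hw; rewrite -lee_fin; apply: le_trans (ltW hw).
by apply: ereal_sup_ubound; exists z => //=; rewrite lerDl.
Qed.

Lemma vanish_dlast F : cholo F -> vanish_vert F -> vanish_vert (dlast F).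
Proof.
move=> hF vF z e e0; have [M MP] := vF z (e / 4) ltac:(by rewrite divr_gt0).
(* The summand 1 keeps the whole unit square around w above both bounds. *)
exists (Num.max M (4^-1 * sqnorm z) + 1) => w wM.
have far (a : C) : square 0 1 a -> siegel (z, w + a) /\ cabs (F (z, w + a)) <= e / 4.
  move=> /squareP[_]; rewrite subr0 ler_norml => /andP[a1 _].
  have h : Num.max M (4^-1 * sqnorm z) < complex.Im (w + a) by rewrite raddfD /=; move: wM a1; clear; lra.
  move: h; rewrite gt_max => /andP[h1 h2]; split; last exact: MP.
  by rewrite /siegel /= /rho /= subr_gt0.
have E a : (z, w) + a *: (0, 1) = (z, w + a) :> V.
  by rewrite Cn1_addZ /= scaler0 addr0 mulr1.
have [||l [lD lM _]] := @cauchy_estimate R (fun a => F ((z, w) + a *: (0, 1))) 1 (e / 4) ltr01 ltac:(by rewrite divr_ge0 ?ltW).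
- by move=> a /far[h _]; apply: cdiff_line => //; rewrite E.
- by move=> a /far[_ h]; rewrite E.
have -> : dlast F (z, w) = l by case/is_derive_cderiv: lD.
by apply: (le_trans lM); rewrite divr1 mulrC divfK.
Qed.

Lemma Psi_inv_line y s : Psi_inv y s = Psi_inv y 0 + (0 + s%:C * 'i) *: (0, 1) :> V.
Proof.
rewrite Cn1_addZ /= scaler0 addr0 mulr1 /Psi_inv; congr pair.
by apply/eqP; rewrite eq_complex /=; apply/andP; split; apply/eqP; ring.
Qed.

Lemma siegel_Psi_inv y s : 0 < s -> siegel (Psi_inv y s : V).
Proof. by move=> s0; rewrite /siegel /= rho_Psi_inv. Qed.

Lemma i_abs1 : cabs ('i : C) = 1.
Proof. by rewrite /Normc.normc /= expr0n/= add0r expr1n sqrtr1. Qed.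

(** The fundamental theorem of calculus on [h, T], where the derivative in s is i times [dlast F];
    for T large the value at T is at most e. *)
Lemma vertical_le F y (h : R) : cholo F -> vanish_vert F -> 0 < h ->
  ((sgabs F (Psi_inv y h))%:E <= 2%:E * \int[leb]_(s in `]h, +oo[) (sgabs (dlast F) (Psi_inv y s))%:E)%E.
Proof.
move=> hF vF h0; have hdF := cholo_dlast hF.
set I := (2%:E * _)%E.
have msg : measurable_fun [set: mR] (fun s : mR => sgabs (dlast F) (Psi_inv y s)).
  apply: (measurableT_comp (measurable_sgabs hdF)).
  exact: (measurable_Psi_inv (measurable_cst (y : borel H)) (@measurable_id _ _ _)).
have key (T : R) : h < T -> ((cabs (F (Psi_inv y T) - F (Psi_inv y h)))%:E <= I)%E.
  move=> hT.
  pose f s := 'i * dlast F (Psi_inv y s).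
  have spos (s : R) : h <= s <= T -> 0 < s by move=> /andP[s1 _]; exact: lt_le_trans h0 s1.
  have cf : ccont_on h T f.
    apply: (@ccontat_line R (fun z => 'i * dlast F (Psi_inv y 0 + z *: (0, 1))) 0 'i); first by rewrite i_abs1.
      by move=> s; rewrite /f Psi_inv_line.
    move=> s /spos s0; apply/ccontatZ/cdiff_cont/cdiff_line => //.
    by rewrite -Psi_inv_line; exact: siegel_Psi_inv.
  have dF (s : R) : 0 < s -> forall e : R, 0 < e -> exists2 d : R, 0 < d & forall t, `|t - s| < d ->
      cabs (F (Psi_inv y t) - F (Psi_inv y s) - f s * (t - s)%:C) <= e * `|t - s|.
    move=> s0 e e0.
    have ss := siegel_Psi_inv y s0.
    have [_ /(_ (0, 1))[l lP]] := hF _ ss.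
    have El : dlast F (Psi_inv y s) = l by case/is_derive_cderiv: (lP).
    have [d d0 dP] := lP e e0; exists d => // t td.
    have := dP ((t - s)%:C * 'i); rewrite subr0 scale0r addr0 cabsM i_abs1 mulr1 cabs_real => /(_ td).
    rewrite (_ : Psi_inv y s + _ = Psi_inv y t); last first.
      rewrite [LHS](_ : _ = Psi_inv y 0 + ((0 + s%:C * 'i) + (t - s)%:C * 'i) *: (0, 1)).
        by rewrite [RHS]Psi_inv_line; congr (_ + _ *: _); rewrite rmorphB; ring.
      by rewrite scalerDl addrA -Psi_inv_line.
    by rewrite /f El; congr (cabs (_ - _) <= _); ring.
  have [c1 c2] := cf.
  have r1 : complex.Re (F (Psi_inv y T)) - complex.Re (F (Psi_inv y h)) = rint h T (fun s => complex.Re (f s)).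
    apply: (FTC_cont_on (u := fun s => complex.Re (F (Psi_inv y s)))) => // s /spos s0 e e0.
    have [d d0 dP] := dF s s0 e e0; exists d => // t /dP ht; apply: le_trans ht.
    apply: le_trans (cabs_Re _); rewrite le_eqVlt; apply/orP; left; apply/eqP; congr (`|_|).
    by case: (F _) => ? ?; case: (F _) => ? ?; case: (f s) => ? ? /=; ring.
  have r2 : complex.Im (F (Psi_inv y T)) - complex.Im (F (Psi_inv y h)) = rint h T (fun s => complex.Im (f s)).
    apply: (FTC_cont_on (u := fun s => complex.Im (F (Psi_inv y s)))) => // s /spos s0 e e0.
    have [d d0 dP] := dF s s0 e e0; exists d => // t /dP ht; apply: le_trans ht.
    apply: le_trans (cabs_Im _); rewrite le_eqVlt; apply/orP; left; apply/eqP; congr (`|_|).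
    by case: (F _) => ? ?; case: (F _) => ? ?; case: (f s) => ? ? /=; ring.
  apply: (@le_trans _ _ (aint h T f)%:E).
    rewrite lee_fin /aint; apply: (le_trans (cabs_le_ReIm _)).
    by rewrite !raddfB /= r1 r2; apply: lerD; exact: rint_norm.
  rewrite /I integral_itv_obnd_cbnd; last by apply: measurable_funTS; apply/measurable_EFinP.
  rewrite [X in (_ * X)%E]integral_mkcond.
  apply: aint_le => //.
  - by apply/(measurable_restrictT _ (measurable_itv _)); apply: measurable_funTS; apply/measurable_EFinP.
  - by move=> s; rewrite /patch; case: ifPn; rewrite ?lee_fin ?sgabs_ge0.
  move=> s sI; rewrite /patch mem_set; last by rewrite /= in_itv/= andbT; case/andP: sI.
  by rewrite lee_fin /f cabsM i_abs1 mul1r sgabsE//; apply/siegel_Psi_inv/spos.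
rewrite sgabsE; last exact: siegel_Psi_inv.
apply/lee_addgt0Pr => e e0; have [M MP] := vF y.1 e e0.
pose T := Num.max M h + 1.
have hT : h < T by rewrite /T ltr_pwDr// le_max lexx orbT.
have MT : cabs (F (Psi_inv y T)) <= e.
  apply: MP => /=; apply: (@lt_le_trans _ _ T); first by rewrite /T ltr_pwDr// le_max lexx.
  by rewrite lerDr mulr_ge0 ?sqnorm_ge0.
apply: (@le_trans _ _ ((cabs (F (Psi_inv y T) - F (Psi_inv y h)))%:E + (cabs (F (Psi_inv y T)))%:E)%E).
  rewrite -EFinD lee_fin cabsB -lerBlDr; exact: cabsDB.
by apply: leeD; [exact: key | rewrite lee_fin].
Qed.

Lemma cholo_iter_dlast F k : cholo F -> cholo (iter k (@dlast R n) F).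
Proof. by move=> hF; elim: k => //= k; exact: cholo_dlast. Qed.

Lemma vanish_iter_dlast F k : cholo F -> vanish_vert F -> vanish_vert (iter k (@dlast R n) F).
Proof.
move=> hF vF; elim: k => //= k IH.
exact: (vanish_dlast (cholo_iter_dlast k hF) IH).
Qed.

Lemma vertical_iter_le F y (h : R) m : cholo F -> vanish_vert F -> 0 < h ->
  ((cabs (F (Psi_inv y h)))%:E <= (2 ^+ m.+1)%:E *
    \int[leb]_(s in `]h, +oo[) ((s : R) ^+ m * cabs (iter m.+1 (@dlast R n) F (Psi_inv y s)))%:E)%E.
Proof.
move=> hF vF h0.
have := @iterate_tail R (fun k s => sgabs (iter k (@dlast R n) F) (Psi_inv y s)) _ _ _ m h h0.
rewrite /= sgabsE; last exact: siegel_Psi_inv.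
move=> /(_ _ _ _)/le_trans H; apply: H.
- move=> k; apply: (measurableT_comp (measurable_sgabs (cholo_iter_dlast k hF))).
  exact: (measurable_Psi_inv (measurable_cst (y : borel H)) (@measurable_id _ _ _)).
- by move=> k t; exact: sgabs_ge0.
- by move=> k s s0; apply: vertical_le => //; [exact: cholo_iter_dlast | exact: vanish_iter_dlast].
apply: lee_wpmul2l; first by rewrite lee_fin exprn_ge0.
apply: ge0_le_integralW => s; rewrite /= in_itv/= andbT => hs; have s0 := lt_trans h0 hs.
  by rewrite lee_fin mulr_ge0 ?sgabs_ge0// exprn_ge0// ltW.
by rewrite sgabsE//; exact: siegel_Psi_inv.
Qed.
End vertical.

(** Homogeneity, like monotonicity, holds without measurability: scaling simple functions gives one
    inequality, and the same argument for 1 / k gives the other. *)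
Lemma ge0_integralZW d (T : measurableType d) (R : realType) (mu : {measure set T -> \bar R})
    (D : set T) (f : T -> \bar R) (k : R) :
  (forall x, D x -> (0 <= f x)%E) -> 0 <= k ->
  (\int[mu]_(x in D) (k%:E * f x) = k%:E * \int[mu]_(x in D) f x)%E.
Proof.
have le (c : R) (g : T -> \bar R) : (forall x, D x -> (0 <= g x)%E) -> 0 < c ->
    (c%:E * \int[mu]_(x in D) g x <= \int[mu]_(x in D) (c%:E * g x))%E.
  move=> g0 c0; rewrite muleC -lee_pdivlMr//.
  rewrite [leLHS]ge0_integralE//; apply: ge_ereal_sup => _ [h hg <-].
  rewrite lee_pdivlMr// muleC -sintegralrM.
  rewrite ge0_integralE => [|x Dx]; last by rewrite mule_ge0 ?g0// lee_fin ltW.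
  apply: ereal_sup_ubound; exists (scale_nnsfun h (ltW c0)) => // x /=.
  rewrite EFinM /patch; have := hg x; rewrite /patch; case: ifPn => _ hx.
    by apply: lee_wpmul2l => //; rewrite lee_fin ltW.
  have c0' : (0 <= c%:E)%E by rewrite lee_fin ltW.
  by have := lee_wpmul2l c0' (hx : (_ <= 0)%E); rewrite mule0.
move=> f0; rewrite le_eqVlt => /predU1P[<-|k0].
  by rewrite mul0e integral0_eq// => x _; rewrite mul0e.
apply/eqP; rewrite eq_le le// andbT.
have kf0 x : D x -> (0 <= k%:E * f x)%E by move=> Dx; rewrite mule_ge0 ?f0// lee_fin ltW.
have := @le k^-1 (fun x => k%:E * f x)%E kf0; rewrite invr_gt0 => /(_ k0).
rewrite [X in (_ <= X)%E -> _](_ : _ = \int[mu]_(x in D) f x)%E; last first.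
  by apply: eq_integral => x _; rewrite muleA -EFinM mulVf ?mul1e// gt_eqF.
rewrite -[in X in X -> _](@lee_pmul2l _ k%:E) ?lte_fin// muleA -EFinM mulfV ?gt_eqF// mul1e.
exact.
Qed.

Section hardy_pointwise.
Variables (R : realType) (n : nat).
Local Notation C := (Cplx R).
Local Notation V := (Cn1 R n).
Local Notation H := (heis R n).
Local Notation mR := (measurableTypeR R).
Local Notation leb := (@lebesgue_measure R).
Local Notation lam := (@lebesgue_heis R n).
Implicit Types (F : V -> C) (x y : H).

Lemma measurable_le_indic d (T : measurableType d) (f g : T -> mR) :
  measurable_fun [set: T] f -> measurable_fun [set: T] g ->
  measurable_fun [set: T] (fun a => ((f a : R) <= g a)%R%:R : mR).
Proof.
move=> mf mg; rewrite (_ : (fun _ => _) = (fun a => \1_([set` `[(0 : R), +oo[]) (g a - f a : R))).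
  by apply: measurable_indic_itv; exact: measurable_funB.
apply/funext => a; rewrite indicE; congr ((nat_of_bool _)%:R); apply/idP/idP.
  by move=> h; rewrite inE /= in_itv/= andbT subr_ge0.
by rewrite inE /= in_itv/= andbT subr_ge0.
Qed.

Lemma natr_andb (a b : bool) : (a && b)%:R = a%:R * b%:R :> R.
Proof. by case: a; rewrite ?mul1r ?mul0r. Qed.

Lemma powR_ratio k l (s : R) : 0 < s -> s `^ (k%:R - l%:R) = s ^+ k / s ^+ l.
Proof.
move=> s0; rewrite powRDp// ?powRN ?powR_mulrn// ltW//.
Qed.

(** Each value in the vertical formula is replaced by its mean over a Whitney box, then the
    integrals are exchanged. At a fixed point (y, t) only heights s with t / 2 <= s <= 2 t
    contribute, which forces d(x, y)^2 + h <= 4 t: the means over boxes become an integral over a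
    cone above x. *)
Lemma cone_integral k : exists2 c : R, 0 < c & forall F (F' := iter k.+1 (@dlast R n) F) x (h : R),
  cholo F -> vanish_vert F -> 0 < h ->
  ((cabs (F (Psi_inv x h)))%:E <= c%:E * \int[lam]_y \int[leb]_(s in `]0%R, +oo[)
     ((hN x h y <= 4 * s)%R%:R * ((s : R) `^ (k.+1%:R - n.+2%:R)) * sgabs F' (Psi_inv (y : H) (s : R)))%:E)%E.
Proof.
have [c c0 hc] := submean_heis R n.
exists (2 ^+ k.+1 * (c^-1 * (2 ^+ k * 2 ^+ n.+2 * 2))).
  apply: mulr_gt0; first exact: exprn_gt0.
  apply: mulr_gt0; first by rewrite invr_gt0.
  by apply: mulr_gt0 => //; apply: mulr_gt0; exact: exprn_gt0.
move=> F F' x h hF vF h0.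
have hF' : cholo F' := cholo_iter_dlast k.+1 hF.
pose K (y : borel H) (s : mR) : R := sgabs F' (Psi_inv (y : H) (s : R)).
have K0 y s : 0 <= K y s by exact: sgabs_ge0.
(* The integrand in (y, s, t): s is the height in the vertical formula, t the height inside the box
   of size s. *)
pose E (q : borel H * mR * mR) : R := (h <= q.1.2)%R%:R * ((q.1.2 : R) `^ (k%:R - n.+2%:R)) *
   (wbox x q.1.2 q.1.1 q.2)%:R * K q.1.1 q.2.
have E0 q : 0 <= E q.
  rewrite /E; case: (leP h q.1.2) => hq; last by rewrite !mul0r.
  have q0 : 0 <= q.1.2 := le_trans (ltW h0) hq.
  by rewrite mulr_ge0// mulr_ge0// mul1r powR_ge0.
have m11 : measurable_fun [set: borel H * mR * mR] (fun q => q.1.1 : borel H).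
  exact: (measurableT_comp (@measurable_fst _ _ _ _) (@measurable_fst _ _ _ _)).
have m12 : measurable_fun [set: borel H * mR * mR] (fun q => q.1.2 : mR).
  exact: (measurableT_comp (@measurable_snd _ _ _ _) (@measurable_fst _ _ _ _)).
have m2 : measurable_fun [set: borel H * mR * mR] (fun q => q.2 : mR) by exact: measurable_snd.
have mE : measurable_fun [set: borel H * mR * mR] (fun q => (E q)%:E).
  apply/measurable_EFinP; apply: measurable_funM; last first.
    apply: (measurableT_comp (measurable_sgabs hF')); exact: measurable_Psi_inv.
  apply: measurable_funM.
    apply: measurable_funM; first by apply: measurable_le_indic => //; exact: measurable_cst.
    exact: (measurableT_comp (measurable_powR _) m12).
  rewrite (_ : (fun _ => _) = (fun q : borel H * mR * mR => (hdist x q.1.1 ^+ 2 <= q.1.2)%R%:R *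
    ((q.1.2 / 2 <= q.2)%R%:R * (q.2 <= 2 * q.1.2)%R%:R))).
    apply: measurable_funM; [|apply: measurable_funM]; apply: measurable_le_indic => //.
    - by apply: measurable_funX; exact: (measurable_hdist (measurable_cst (x : borel H)) m11).
    - by apply: measurable_funM => //; exact: measurable_cst.
    - by apply: measurable_funM => //; exact: measurable_cst.
  by apply/funext => q; rewrite /wbox !natr_andb.
have mE1 := @measurable_fun_fubini_tonelli_F _ _ _ _ R leb _ mE (fun q => E0 q).
have e0 : (0 <= (2 ^+ k.+1)%:E :> \bar R)%E by rewrite lee_fin exprn_ge0.
apply: (le_trans (vertical_iter_le x k hF vF h0)); rewrite EFinM -muleA; apply: lee_wpmul2l => //.
apply: (@le_trans _ _ ((c^-1)%:E * \int[leb]_s \int[lam]_y \int[leb]_t (E (y, s, t))%:E)%E).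
  rewrite -ge0_integralZW ?invr_ge0 ?(ltW c0)//; last first.
    by move=> s _; apply: integral_ge0 => y _; apply: integral_ge0 => t _; rewrite lee_fin.
  rewrite [leLHS]integral_mkcond; apply: ge0_le_integralW => s _; rewrite /patch; case: ifPn.
  - rewrite inE /= in_itv/= andbT => hs; rewrite lee_fin mulr_ge0 ?cabs_ge0// exprn_ge0// ltW//.
    exact: lt_trans h0 hs.
  - by [].
  - rewrite inE /= in_itv/= andbT => hs; have s0 : 0 < s := lt_trans h0 hs.
    have sk : 0 < (s : R) ^+ n.+2 by exact: exprn_gt0.
    have := hc F' x s hF' s0.
    set J := (\int[lam]_y _)%E => hJ.
    have pJ : (0 <= c^-1 * (s `^ (k%:R - n.+2%:R)))%R.
      by rewrite mulr_ge0 ?invr_ge0 ?(ltW c0)// powR_ge0.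
    apply: (@le_trans _ _ ((c^-1 * (s `^ (k%:R - n.+2%:R)))%R%:E * J)%E).
      apply: le_trans (lee_wpmul2l _ hJ); last by rewrite lee_fin.
      rewrite -EFinM lee_fin le_eqVlt powR_ratio//; apply/orP; left; apply/eqP.
      by field; rewrite !gt_eqF.
    rewrite EFinM -muleA; apply: lee_wpmul2l; first by rewrite lee_fin invr_ge0 ltW.
    have pk : 0 <= s `^ (k%:R - n.+2%:R) by exact: powR_ge0.
    rewrite /J -ge0_integralZW//; last first.
      by move=> y _; apply: integral_ge0 => t _; rewrite lee_fin mulr_ge0 ?cabs_ge0.
    apply: ge0_le_integralW => y _.
      by rewrite mule_ge0 ?lee_fin//; apply: integral_ge0 => t _; rewrite lee_fin mulr_ge0 ?cabs_ge0.
    rewrite -ge0_integralZW//; last first.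
      by move=> t _; rewrite lee_fin mulr_ge0 ?cabs_ge0.
    rewrite [leLHS]integral_mkcond; apply: ge0_le_integralW => t _; rewrite /patch; case: ifPn.
    + by move=> _; rewrite -EFinM lee_fin !mulr_ge0 ?cabs_ge0.
    + by [].
    + rewrite inE /= in_itv/= andbT => t0.
      rewrite -EFinM lee_fin /E /= (ltW hs) mul1r /K sgabsE ?mulrA//.
      exact: siegel_Psi_inv.
    + by move=> _; rewrite lee_fin.
  - move=> _; rewrite mule_ge0 ?lee_fin ?invr_ge0 ?(ltW c0)//.
    by apply: integral_ge0 => y _; apply: integral_ge0 => t _; rewrite lee_fin.
rewrite [in leRHS]EFinM -muleA; apply: lee_wpmul2l; first by rewrite lee_fin invr_ge0 ltW.
rewrite -(heis_tonelli leb mE1) => [|p]; last by apply: integral_ge0 => t _; rewrite lee_fin.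
have P0 : 0 <= 2 ^+ k * 2 ^+ n.+2 * 2 :> R by apply: mulr_ge0 => //; apply: mulr_ge0; exact: exprn_ge0.
pose L y (t : R) : R := (hN x h y <= 4 * t)%R%:R * (t `^ (k.+1%:R - n.+2%:R)) * K y t.
have L0 y t : 0 < t -> 0 <= L y t.
  by move=> t0; rewrite /L mulr_ge0// mulr_ge0// powR_ge0.
have mL : measurable_fun [set: borel H * mR] (fun q => L q.1 q.2 : mR).
  apply: measurable_funM; last first.
    by apply: (measurableT_comp (measurable_sgabs hF')); exact: measurable_Psi_inv.
  apply: measurable_funM.
    apply: measurable_le_indic; last by apply: measurable_funM => //; exact: measurable_cst.
    apply: measurable_funD => //; apply: measurable_funX.
    exact: (measurable_hdist (measurable_cst (x : borel H)) (@measurable_fst _ _ _ _)).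
  exact: (measurableT_comp (measurable_powR _) (@measurable_snd _ _ _ _)).
have key y t : (\int[leb]_s (E (y, s, t))%:E <= (2 ^+ k * 2 ^+ n.+2 * 2)%:E *
    ((fun t : R => (L y t)%:E) \_ `]0%R, +oo[) t)%E.
  have [t0|t0] := ltP 0 t; last first.
    rewrite /patch memNset; last by rewrite /= in_itv/= andbT; apply/negP; rewrite -leNgt.
    rewrite mule0 integral0_eq// => s _; rewrite /E /wbox /=; case: (leP h s) => hs; last by rewrite !mul0r.
    rewrite (_ : (s / 2 <= t) = false) ?andbF ?mulr0 ?mul0r//=.
    by apply/negbTE; rewrite -ltNge (le_lt_trans t0)// divr_gt0// (lt_le_trans h0).
  rewrite /patch mem_set; last by rewrite /= in_itv/= t0.
  rewrite -EFinM; pose M : R := 2 ^+ k * 2 ^+ n.+2 * ((hN x h y <= 4 * t)%R%:R * (t ^+ k / t ^+ n.+2) * K y t).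
  have M0 : 0 <= M.
    apply: mulr_ge0; first by rewrite mulr_ge0// exprn_ge0.
    by rewrite mulr_ge0// mulr_ge0// divr_ge0 ?exprn_ge0// ltW.
  (* The interval [0, 2 t] contains all contributing s; its length raises the power of t from k to k
     + 1. *)
  apply: (@le_trans _ _ (\int[leb]_(s in `[0%R, (2 * t)%R]) (cst M%:E) s)%E).
    rewrite [leRHS]integral_mkcond; apply: ge0_le_integralW => s _; first by rewrite lee_fin.
    rewrite /E /=.
    have [w1|w1] := boolP (wbox x s y t); last first.
      by rewrite mulr0 mul0r /patch; case: ifPn; rewrite ?lee_fin.
    case: (leP h s) => hs; last by rewrite !mul0r /patch; case: ifPn; rewrite ?lee_fin.
    have /andP[d1 /andP[d2 d3]] := w1.
    have s0 : 0 < s := lt_le_trans h0 hs.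
    rewrite mul1r mulr1 /patch mem_set ?lee_fin; last first.
      by rewrite /= in_itv/= (ltW s0) /=; move: d2; clear; lra.
    rewrite /M (_ : (hN x h y <= 4 * t) = true) ?mul1r; last first.
      rewrite /hN; move: d1 d2 hs; move: (hdist x y ^+ 2) => dd; clear; lra.
    rewrite powR_ratio// mulrA ler_wpM2r// mulrACA; apply: ler_pM; rewrite ?exprn_ge0 ?invr_ge0 ?exprn_ge0 ?(ltW s0)//.
      by rewrite -exprMn lerXn2r ?nnegrE ?mulr_ge0 ?(ltW s0) ?(ltW t0)//; move: d2; clear; lra.
    rewrite (_ : 2 ^+ n.+2 / t ^+ n.+2 = ((t / 2) ^+ n.+2)^-1); last by rewrite expr_div_n invf_div.
    have t2 : 0 < t / 2 by rewrite divr_gt0.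
    rewrite lef_pV2 ?posrE; [|exact: exprn_gt0|exact: exprn_gt0].
    by rewrite lerXn2r ?nnegrE ?(ltW s0) ?(ltW t2)//; move: d3; clear; lra.
  rewrite integral_cst//= lebesgue_measure_itv/= lte_fin mulr_gt0// sube0 -EFinM lee_fin.
  rewrite /M /L powR_ratio// [t ^+ k.+1]exprSr le_eqVlt; apply/orP; left; apply/eqP; ring.
have LL0 y t : (0 <= ((fun t : R => (L y t)%:E) \_ `]0%R, +oo[) t)%E.
  by rewrite /patch; case: ifPn => //; rewrite inE /= in_itv/= andbT => t0; rewrite lee_fin L0.
rewrite -ge0_integralZW//; last first.
  by move=> y _; rewrite integral_mkcond; apply: integral_ge0 => t _; exact: LL0.
apply: ge0_le_integralW => y _.
  by apply: integral_ge0 => s _; apply: integral_ge0 => t _; rewrite lee_fin.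
have mEy : measurable_fun [set: mR * mR] (fun q => (E (y, q.1, q.2))%:E).
  apply: (measurableT_comp mE); apply: measurable_fun_pair => //.
  by apply: measurable_fun_pair => //; exact: measurable_cst.
rewrite (@fubini_tonelli _ _ _ _ R leb leb (fun q => (E (y, q.1, q.2))%:E) mEy (fun q => E0 _)).
rewrite [in leRHS]integral_mkcond -ge0_integralZW//; last by move=> t _; exact: LL0.
by apply: ge0_le_integralW => t _; [apply: integral_ge0 => s _; rewrite lee_fin | exact: key].
Qed.
End hardy_pointwise.

(** * Cauchy-Schwarz inequality in the height *)

Section tail.
Context {R : realType}.
Local Notation mR := (measurableTypeR R).
Local Notation leb := (@lebesgue_measure R).

(** Turns a family of weighted arithmetic-geometric bounds back into a product bound for an extended
    value P; for g > 0 the optimal l is a / g. *)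
Lemma amgm_opt (P : \bar R) (g a : R) : 0 <= g -> 0 < a ->
  (forall l : R, 0 < l -> (P <= (l * g ^+ 2 + l^-1 * a ^+ 2)%:E)%E) -> (P <= (2 * (g * a))%:E)%E.
Proof.
rewrite le_eqVlt => /predU1P[<-|g0] a0 h.
  rewrite mul0r mulr0; case: P h => [p| |] h; last by rewrite leNye.
    rewrite lee_fin leNgt; apply/negP => p0.
    (* For g = 0 this large l reduces the remaining term to p / 2. *)
    have := h (2 * a ^+ 2 / p) ltac:(by rewrite divr_gt0// mulr_gt0// exprn_gt0).
    rewrite lee_fin expr0n/= mulr0 add0r (_ : (2 * a ^+ 2 / p)^-1 * a ^+ 2 = p / 2); last by field; rewrite !gt_eqF.
    by move: p0; clear; lra.
  by have := h 1 ltr01; rewrite leye_eq.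
have := h (a / g) ltac:(by rewrite divr_gt0).
rewrite (_ : a / g * g ^+ 2 + _ = 2 * (g * a))//; field.
by rewrite !gt_eqF.
Qed.

Lemma ge0_integral_le_add d (T : measurableType d) (mu : {measure set T -> \bar R}) (D : set T)
    (f g h : T -> \bar R) : measurable D -> measurable_fun D g -> measurable_fun D h ->
  (forall x, D x -> 0 <= f x)%E -> (forall x, D x -> 0 <= g x)%E -> (forall x, D x -> 0 <= h x)%E ->
  (forall x, D x -> f x <= g x + h x)%E ->
  (\int[mu]_(x in D) f x <= \int[mu]_(x in D) g x + \int[mu]_(x in D) h x)%E.
Proof.
move=> mD mg mh f0 g0 h0 fgh; rewrite -ge0_integralD//; exact: ge0_le_integralW.
Qed.

(** The square of the weight is s^(-2 b - 1) on s >= N / 4 and integrates to a multiple of N^(-2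
    b). *)
Lemma tail_cauchy_schwarz (b : R) : 0 < b -> exists2 c : R, 0 < c &
  forall (u : mR -> R) (N G : R), measurable_fun [set: mR] (u : mR -> mR) -> (forall s, 0 <= u s) ->
  0 < N -> (\int[leb]_(s in `]0%R, +oo[) (u s ^+ 2)%:E = G%:E)%E ->
  (\int[leb]_(s in `]0%R, +oo[) ((N <= 4 * s)%R%:R * (s : R) `^ (- (b + 2^-1)) * u s)%:E <=
    (c * (N `^ (- b) * Num.sqrt G))%:E)%E.
Proof.
move=> b0.
(* The exponent -2 b - 1 is split into -1/2 and -e, since [growth_integral] asks for a singular
   exponent below 1; on s >= D the two factors are comparable because s + D <= 2 s. *)
pose e : R := 2 * b + 2^-1.
have e0 : 0 <= e by rewrite addr_ge0 ?mulr_ge0 ?ltW.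
have h1 : 0 < 2^-1 :> R by rewrite invr_gt0.
have h2 : 2^-1 < 1 :> R by rewrite invf_lt1// ltr1n.
have h3 : 1 < 2^-1 + e by rewrite /e; lra.
have [C C0 hC] := @growth_integral R 1 2^-1 e 2 h1 e0 ltac:(by []) h2 h3.
pose k := Num.sqrt (2 `^ e * C).
have k0 : 0 < k by rewrite sqrtr_gt0 mulr_gt0// powR_gt0.
exists (2 * (k * 4 `^ b)); first by rewrite !mulr_gt0// powR_gt0.
move=> u N G mu u0 N0 uG.
have G0 : 0 <= G.
  by rewrite -lee_fin -uG; apply: integral_ge0 => s _; rewrite lee_fin sqr_ge0.
pose D := N / 4; have D0 : 0 < D by rewrite divr_gt0.
pose a := k * D `^ (- b).
have a0 : 0 < a by rewrite mulr_gt0// powR_gt0.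
have DE : D `^ (- b) = 4 `^ b * N `^ (- b).
  by rewrite /D powRM ?(ltW N0)// ?invr_ge0// mulrC powRVp// opprK.
rewrite (_ : 2 * (k * 4 `^ b) * _ = 2 * (Num.sqrt G * a)); last by rewrite /a DE; ring.
apply: amgm_opt => // l l0; rewrite sqr_sqrtr// EFinD (EFinM l) (EFinM l^-1) -uG.
pose q (s : mR) : R := (N <= 4 * (s : R))%R%:R * (s : R) `^ (- (b + 2^-1)).
have q0 s : 0 <= q s by rewrite mulr_ge0// powR_ge0.
have mq : measurable_fun [set: mR] (q : mR -> mR).
  apply: measurable_funM; last exact: measurable_powR.
  apply: measurable_le_indic; first exact: measurable_cst.
  by apply: measurable_funM => //; exact: measurable_cst.
have l0' := ltW l0.
have qA : (\int[leb]_(s in `]0%R, +oo[) (q s ^+ 2)%:E <= (a ^+ 2)%:E)%E.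
  have := hC _ mR leb (fun s : mR => `|s : R|) _ (fun s => normr_ge0 _) lebesgue_abs_growth D D0.
  have mN : measurable_fun [set: mR] (fun s : mR => `|s : R| : mR) by exact: normr_measurable.
  move=> /(_ mN) hI.
  apply: (@le_trans _ _ ((2 `^ e)%:E * (C * D `^ (1 - 2^-1 - e))%:E)%E); last first.
    rewrite -EFinM lee_fin /a exprMn sqr_sqrtr; last by rewrite mulr_ge0 ?powR_ge0 ?ltW.
    rewrite mulrA ler_wpM2l// ?mulr_ge0 ?powR_ge0 ?(ltW C0)//.
    rewrite -powR_mulrn ?powR_ge0// -powRrM le_eqVlt; apply/orP; left; apply/eqP; congr (_ `^ _).
    by rewrite /e; field.
  apply: le_trans (lee_wpmul2l _ hI); last by rewrite lee_fin powR_ge0.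
  rewrite -ge0_integralZW ?powR_ge0//; last by move=> s _; rewrite lee_fin mulr_ge0 ?powR_ge0.
  rewrite [leLHS]integral_mkcond; apply: ge0_le_integralW => s _; rewrite /patch; case: ifPn => //.
  - by rewrite lee_fin sqr_ge0.
  - rewrite inE /= in_itv/= andbT => s0; rewrite -EFinM lee_fin /q.
    have [Ns|Ns] := leP N (4 * (s : R)); last by rewrite mul0r expr0n/= mulr_ge0 ?powR_ge0// mulr_ge0 ?powR_ge0.
    rewrite mul1r -powR_mulrn ?powR_ge0// -powRrM gtr0_norm//.
    rewrite (_ : - (b + 2^-1) * 2%:R = - 2^-1 + - e); last by rewrite /e; field.
    rewrite powRDp// [leRHS]mulrCA ler_wpM2l ?powR_ge0//.
    have -> : s `^ (- e) = 2 `^ e * (2 * s) `^ (- e).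
      by rewrite powRM ?(ltW s0)// mulrA -powRDp// subrr powRr0 mul1r.
    rewrite ler_wpM2l ?powR_ge0// powRN_le//; first by rewrite addr_gt0.
    by rewrite mulr_natl mulr2n lerD2l /D ler_pdivrMr// mulrC.
  - by move=> _; rewrite mule_ge0// lee_fin ?powR_ge0// mulr_ge0 ?powR_ge0.
apply: (@le_trans _ _ (\int[leb]_(s in `]0%R, +oo[) (l%:E * (u s ^+ 2)%:E) +
   \int[leb]_(s in `]0%R, +oo[) ((l^-1)%:E * (q s ^+ 2)%:E))%E).
  apply: ge0_integral_le_add => //.
  - apply: measurable_funTS; apply/measurable_EFinP; apply: measurable_funM; first exact: measurable_cst.
    exact: measurable_funX.
  - apply: measurable_funTS; apply/measurable_EFinP; apply: measurable_funM; first exact: measurable_cst.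
    exact: measurable_funX.
  - by move=> s _; rewrite lee_fin mulr_ge0 ?q0.
  - by move=> s _; rewrite lee_fin mulr_ge0 ?sqr_ge0.
  - by move=> s _; rewrite lee_fin mulr_ge0 ?sqr_ge0 ?invr_ge0.
  move=> s _; rewrite -!EFinM -EFinD lee_fin -/(q s).
  move: (q s) (u s) (q0 s) (u0 s) => x y x0 y0.
  rewrite -(ler_pM2l l0) mulrDr !mulrA mulfV ?gt_eqF// mul1r.
  have := sqr_ge0 (l * y - x); have : 0 <= l * x * y by rewrite !mulr_ge0.
  by move=> *; nra.
rewrite ge0_integralZW//; last by move=> s _; rewrite lee_fin sqr_ge0.
rewrite ge0_integralZW ?invr_ge0//; last by move=> s _; rewrite lee_fin sqr_ge0.
by apply: leeD => //; apply: lee_wpmul2l => //; rewrite lee_fin invr_ge0.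
Qed.
End tail.

Section hardy_estimate.
Variables (R : realType) (n : nat) (alpha : R) (m : nat).
Hypotheses (alpha_gt : n%:R / 2 < alpha) (alpha_lt : alpha < (n%:R + 1) / 2) (m_gt : alpha < m%:R).
Local Notation C := (Cplx R).
Local Notation V := (Cn1 R n).
Local Notation H := (heis R n).
Local Notation mR := (measurableTypeR R).
Local Notation leb := (@lebesgue_measure R).
Local Notation lam := (@lebesgue_heis R n).
Implicit Types (F : V -> C) (x y : H).

(** The exponent is half of 2 m - (2 alpha + 1): the square of [vdens] is the integrand of
    [hs_integral] in the coordinates (y, s). *)
Definition vdens F y (s : R) : R :=
  sgabs (iter m (@dlast R n) F) (Psi_inv y s) * s `^ (m%:R - alpha - 2^-1).

Lemma vdens_ge0 F y s : 0 <= vdens F y s.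
Proof. by rewrite mulr_ge0 ?sgabs_ge0 ?powR_ge0. Qed.

Lemma measurable_vdens F : cholo F ->
  measurable_fun [set: borel H * mR] (fun q => vdens F q.1 q.2 : mR).
Proof.
move=> hF; apply: measurable_funM.
  by apply: (measurableT_comp (measurable_sgabs (cholo_iter_dlast m hF))); exact: measurable_Psi_inv.
exact: (measurableT_comp (measurable_powR _) (@measurable_snd _ _ _ _)).
Qed.

Lemma hs_integralE F : cholo F ->
  (hs_integral alpha m F = \int[lam]_y \int[leb]_(s in `]0%R, +oo[) (vdens F y s ^+ 2)%:E)%E.
Proof.
move=> hF; have hF' := cholo_iter_dlast m hF.
pose f (z : borel V) : \bar R := ((rho (z : V) ^+ m * sgabs (iter m (@dlast R n) F) z) ^+ 2
   * rho (z : V) `^ (- (2 * alpha + 1)))%:E.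
have mrho : measurable_fun [set: borel V] (fun z : borel V => rho (z : V) : mR).
  by apply: (@continuous_borel_measurable R V); exact: rho_continuous.
have mf : measurable_fun [set: borel V] f.
  apply/measurable_EFinP; apply: measurable_funM; last exact: (measurableT_comp (measurable_powR _) mrho).
  apply: measurable_funX; apply: measurable_funM; first exact: measurable_funX.
  exact: measurable_sgabs.
have f0 z : (0 <= f z)%E by rewrite lee_fin mulr_ge0 ?sqr_ge0 ?powR_ge0.
transitivity (\int[@lebesgue_Cn1 R n]_(z in @siegel R n) f z)%E.
  apply: eq_integral => z; rewrite inE => zs; rewrite /f sgabsE// cabsM cabs_real ger0_norm//.
  by rewrite exprn_ge0// ltW.
rewrite (siegel_integral (measurable_funTS mf) (fun z _ => f0 z)).
apply: eq_integral => y _; apply: eq_integral => s; rewrite inE/= in_itv/= andbT => s0.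
rewrite /f /vdens rho_Psi_inv; congr (_%:E).
move: (sgabs _ _) => K.
have E : (s ^+ m) ^+ 2 * s `^ (- (2 * alpha + 1)) = (s `^ (m%:R - alpha - 2^-1)) ^+ 2.
  rewrite -!powR_mulrn ?powR_ge0 ?(ltW s0)// -!powRrM -powRDp//; congr (_ `^ _).
  by field.
by rewrite !exprMn -E; ring.
Qed.

(** The function g is the L^2 norm of [vdens] on the vertical line over y. In [cone_integral] the
    exponent m - (n + 2) splits into m - alpha - 1/2, absorbed in [vdens], and -(n + 1 - alpha +
    1/2), whose tail yields the kernel of [hpot]. *)
Lemma hardy_pointwise : exists2 c : R, 0 < c & forall F, hardy_sobolev alpha m F ->
  exists g : borel H -> R, [/\ measurable_fun [set: borel H] (g : borel H -> mR),
    forall y, 0 <= g y, (\int[lam]_y (g y ^+ 2)%:E <= hs_integral alpha m F)%E &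
    forall x (h : R), 0 < h -> ((cabs (F (Psi_inv x h)))%:E <= c%:E * hpot alpha g x h)%E].
Proof.
have m0 : (0 < m)%N.
  by rewrite -(ltr_nat R); apply: lt_trans m_gt; exact: (alpha_gt0 alpha_gt alpha_lt).
have b0 := b_gt0 alpha_gt alpha_lt.
have [c1 c10 h1] := cone_integral R n m.-1.
have [c2 c20 h2] := tail_cauchy_schwarz b0.
rewrite prednK// in h1.
exists (c1 * c2); first exact: mulr_gt0.
move=> F [/holomorphic_cholo hF /vanishes_vert vF Ffin].
have mv := measurable_vdens hF.
have mv2 : measurable_fun [set: borel H * mR] (fun q => ((fun s => (vdens F q.1 s ^+ 2)%:E) \_ `]0%R, +oo[) q.2).
  rewrite (_ : (fun _ => _) = (fun q : borel H * mR => (\1_(`]0%R, +oo[%classic) q.2 * vdens F q.1 q.2 ^+ 2)%:E)); last first.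
    apply/funext => q; rewrite indicE /patch; case: (q.2 \in _); first by rewrite mul1r.
    by rewrite mul0r.
  apply/measurable_EFinP; apply: measurable_funM; last exact: measurable_funX.
  by apply: measurable_indic_itv; exact: measurable_snd.
pose G2 (y : borel H) : \bar R := (\int[leb]_(s in `]0%R, +oo[) (vdens F y s ^+ 2)%:E)%E.
have G20 y : (0 <= G2 y)%E by apply: integral_ge0 => s _; rewrite lee_fin sqr_ge0.
have mG2 : measurable_fun [set: borel H] G2.
  rewrite (_ : G2 = fun y => (\int[leb]_s ((fun s => (vdens F y s ^+ 2)%:E) \_ `]0%R, +oo[) s)%E); last first.
    by apply/funext => y; rewrite /G2 integral_mkcond.
  apply: (@measurable_fun_fubini_tonelli_F _ _ _ _ R leb _ mv2) => q.
  by rewrite /patch; case: ifPn; rewrite ?lee_fin ?sqr_ge0.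
have G2fin : lam.-integrable [set: borel H] G2.
  apply/integrableP; split => //.
  rewrite (_ : (fun x => `|G2 x|%E) = G2); last by apply/funext => y; rewrite gee0_abs.
  by rewrite -/G2 in Ffin *; rewrite -hs_integralE.
(* [fine] gives 0 where the vertical norm is infinite; this happens only on a null set, and the
   final comparison is almost everywhere. *)
pose g (y : borel H) : R := fine (G2 y) `^ 2^-1.
have gE y : g y = Num.sqrt (fine (G2 y)) by rewrite /g powR12_sqrt// fine_ge0.
have mg : measurable_fun [set: borel H] (g : borel H -> mR).
  apply: (measurableT_comp (measurable_powR _)).
  exact: (measurableT_comp (fine_measurable measurableT)).
have g0 y : 0 <= g y by exact: powR_ge0.
exists g; split => //.
  rewrite hs_integralE//; apply: ge0_le_integralW => y _; first by rewrite lee_fin sqr_ge0.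
  rewrite gE sqr_sqrtr ?fine_ge0//; have := G20 y; rewrite -/(G2 y).
  by case: (G2 y) => //= _; rewrite leey.
move=> x h hh0; apply: (le_trans (h1 F x h hF vF hh0)).
rewrite EFinM -muleA; apply: lee_wpmul2l; first by rewrite lee_fin ltW.
pose J (y : borel H) : \bar R := (\int[leb]_(s in `]0%R, +oo[) ((hN x h y <= 4 * s)%R%:R * (s : R) `^ (- (n%:R + 1 - alpha + 2^-1)) * vdens F y s)%:E)%E.
have -> : (\int[lam]_y \int[leb]_(s in `]0%R, +oo[)
     ((hN x h y <= 4 * s)%R%:R * ((s : R) `^ (m%:R - n.+2%:R)) * sgabs (iter m (@dlast R n) F) (Psi_inv (y : H) (s : R)))%:E
   = \int[lam]_y J y)%E.
  apply: eq_integral => y _; apply: eq_integral => s; rewrite inE/= in_itv/= andbT => s0.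
  rewrite /vdens; move: (sgabs _ _) => K; congr (_%:E).
  rewrite -!mulrA; congr (_ * _); rewrite mulrC [RHS]mulrCA; congr (_ * _).
  by rewrite -powRDp//; congr (_ `^ _); rewrite -[n.+2]addn2 natrD; field.
have mJ : measurable_fun [set: borel H] J.
  rewrite (_ : J = fun y => (\int[leb]_s ((fun s : R => ((hN x h y <= 4 * s)%R%:R * (s : R) `^ (- (n%:R + 1 - alpha + 2^-1)) * vdens F y s)%:E) \_ `]0%R, +oo[) s)%E); last first.
    by apply/funext => y; rewrite /J integral_mkcond.
  pose f (q : borel H * mR) : R := (\1_(`]0%R, +oo[%classic) q.2 * ((hN x h q.1 <= 4 * (q.2 : R))%R%:R * (q.2 : R) `^ (- (n%:R + 1 - alpha + 2^-1)) * vdens F q.1 q.2)).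
  have mf : measurable_fun [set: borel H * mR] (fun q => (f q)%:E).
    apply/measurable_EFinP; apply: measurable_funM; first by apply: measurable_indic_itv; exact: measurable_snd.
    apply: measurable_funM => //; apply: measurable_funM; last first.
      exact: (measurableT_comp (measurable_powR _) (@measurable_snd _ _ _ _)).
    apply: measurable_le_indic; last by apply: measurable_funM => //; exact: measurable_cst.
    exact: (measurableT_comp (measurable_hN x h) (@measurable_fst _ _ _ _)).
  have f0 q : (0 <= (f q)%:E)%E.
    by rewrite lee_fin /f mulr_ge0// mulr_ge0 ?vdens_ge0// mulr_ge0// powR_ge0.
  have := @measurable_fun_fubini_tonelli_F _ _ _ _ R leb _ mf f0.
  apply: eq_measurable_fun => y _; apply: eq_integral => s _ /=.
  rewrite /f indicE /patch /=; case: (s \in _); first by rewrite mul1r.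
  by rewrite mul0r.
have J0 y : (0 <= J y)%E.
  by apply: integral_ge0 => s _; rewrite lee_fin mulr_ge0 ?vdens_ge0// mulr_ge0// powR_ge0.
rewrite /hpot -(ge0_integralZW _ _ (ltW c20)); last by move=> y _; rewrite lee_fin mulr_ge0// hP_ge0.
apply: ae_ge0_le_integral => //.
- by move=> y _; rewrite mule_ge0 ?lee_fin ?(ltW c20)// mulr_ge0 ?hP_ge0.
- apply/measurable_EFinP; apply: measurable_funM; first exact: measurable_cst.
  by apply: measurable_funM => //; exact: measurable_hP.
have := integrable_ae measurableT G2fin; apply: filterS => y /(_ I) Gf _.
rewrite -EFinM gE.
apply: (h2 (fun s => vdens F y s)) => //.
- exact: (measurableT_comp mv (pair1_measurable y)).
- by move=> s; exact: vdens_ge0.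
- exact: hN_gt0.
- by rewrite fineK.
Qed.
End hardy_estimate.

(** * From weak type to strong type *)

Section strong_type.
Context {R : realType} {I : finType}.
Variables (a u : I -> R) (K : I -> I -> R) (C q G : R).
Hypotheses (a0 : forall i, 0 <= a i) (u0 : forall i, 0 <= u i) (K0 : forall i j, 0 <= K i j).
Hypotheses (Ksym : forall i j, K i j = K j i) (C0 : 0 < C) (q0 : 0 < q).

Let mass (E : {set I}) := \sum_(i in E) a i.
Let T (F : {set I}) w := \sum_(i in F) a i * K w i.
Let A (F : {set I}) := \sum_(i in F) a i * T F i.

(** [hW] is the weak type inequality, with the energy of F in place of a squared L^2 norm. [hQ] is a
    maximum principle, bounding the kernel at any point by its value at a suitable point of F. [hG]
    is the duality between u and the energy, in the form of Young's inequality with a free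
    parameter. *)
Hypothesis hW : forall (E F : {set I}) (t : R), 0 <= t -> (forall i, i \in E -> t <= T F i) ->
  t ^+ 2 * mass E <= C * A F.
Hypothesis hQ : forall (F : {set I}) w, F != finset.set0 ->
  exists2 j, j \in F & forall i, i \in F -> K w i <= q * K j i.
Hypothesis hG : forall (c : I -> R) (l : R), (forall i, 0 <= c i) -> 0 < l ->
  \sum_i c i * u i <= l * G + l^-1 * \sum_i \sum_j c i * c j * K i j.

Let mass_ge0 E : 0 <= mass E. Proof. exact: sumr_ge0. Qed.
Let T_ge0 F w : 0 <= T F w. Proof. by apply: sumr_ge0 => i _; rewrite mulr_ge0. Qed.
Let A_ge0 F : 0 <= A F. Proof. by apply: sumr_ge0 => i _; rewrite mulr_ge0. Qed.

(* Induction on [E], removing a point where the potential is smallest: there the weak type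
   inequality bounds the potential by [r / sqrt (mass E)]. *)
Lemma level_sum_le (E F : {set I}) :
  \sum_(i in E) a i * T F i <= 2 * (Num.sqrt (C * A F) * Num.sqrt (mass E)).
Proof.
set r := Num.sqrt (C * A F).
have r0 : 0 <= r by exact: sqrtr_ge0.
elim: {E}#|E| {1 3 4}E (erefl #|E|) => [|k IH] E Ek.
  have -> : E = finset.set0 by apply/eqP; rewrite -cards_eq0 Ek.
  by rewrite big_set0 !mulr_ge0 ?sqrtr_ge0.
have [i0 i0E] : exists i, i \in E by apply/finset.set0Pn; rewrite -card_gt0 Ek.
case: (@arg_minP _ _ _ i0 (mem E) (T F) i0E) => i /= iE imin.
have {}iE : i \in E by [].
have Ei : #|E :\ i| = k by move: Ek; rewrite (cardsD1 i) iE => -[].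
rewrite (big_setD1 i)//=; move: (IH _ Ei); clear IH.
have -> : mass E = a i + mass (E :\ i) by rewrite /mass (big_setD1 i).
set m := mass (E :\ i); set S := \sum_(_ in _) _.
have m0 : 0 <= m := mass_ge0 _.
have am0 : 0 <= a i + m by rewrite addr_ge0.
have hw : Num.sqrt (a i + m) * T F i <= r.
  rewrite -[T F i]ger0_norm// -sqrtr_sqr -sqrtrM// ler_wsqrtr// mulrC.
  have -> : a i + m = mass E by rewrite /mass (big_setD1 i).
  by apply: hW => // j jE; exact: imin.
move: (sqrtr_ge0 (a i + m)) (sqrtr_ge0 m) (sqr_sqrtr am0) (sqr_sqrtr m0) hw (T_ge0 F i) (a0 i) r0.
have : Num.sqrt m <= Num.sqrt (a i + m) by rewrite ler_wsqrtr// lerDr.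
move: (Num.sqrt (a i + m)) (Num.sqrt m) => s s'.
move: (T F i) (a i) r S => t b r' S'.
clear; move=> ss s0 s'0 es es' st t0 b0 r0 hS.
(* The mass b of the removed point is s^2 - s'^2, so b t <= 2 (s - s') s t <= 2 (s - s') r', and the
   differences of square roots telescope. *)
have eb : b = (s - s') * (s + s') by nra.
have d0 : 0 <= s - s' by rewrite subr_ge0.
have h1 : b * t <= 2 * ((s - s') * r').
  rewrite eb; apply: (@le_trans _ _ ((s - s') * (2 * (s * t)))).
    by rewrite -mulrA ler_wpM2l// mulrA ler_wpM2r//; lra.
  by rewrite mulrCA ler_wpM2l// ler_wpM2l.
by move: h1 hS; lra.
Qed.

(** Take E = F in [level_sum_le], square, and cancel one factor [A F]. *)
Lemma energy_le (F : {set I}) : A F <= 4 * C * mass F.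
Proof.
have := level_sum_le F F; rewrite -/(A F) => h.
have h2 : A F ^+ 2 <= 4 * C * mass F * A F.
  have -> : 4 * C * mass F * A F = (2 * (Num.sqrt (C * A F) * Num.sqrt (mass F))) ^+ 2.
    by rewrite !exprMn !sqr_sqrtr// ?mulr_ge0 ?(ltW C0)//; ring.
  by rewrite lerXn2r ?nnegrE ?mulr_ge0 ?sqrtr_ge0.
have [A1|A1] := ltP 0 (A F); first by rewrite -(ler_pM2r A1) -expr2.
by apply: (le_trans A1); rewrite !mulr_ge0// ltW.
Qed.

(** By Chebyshev's inequality and [energy_le] the points where the potential exceeds 8 C carry at
    most half of the mass. On the remaining set the potential is bounded, and the maximum principle
    [hQ] extends the bound to all points. *)
Lemma half_mass (F : {set I}) : exists2 E : {set I}, E \subset F &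
  mass F <= 2 * mass E /\ forall w, T E w <= 8 * C * q.
Proof.
pose E := [set i in F | T F i <= 8 * C].
have EF : E \subset F by apply/fintype.subsetP => i; rewrite inE => /andP[].
have TEF w : T E w <= T F w.
  rewrite /T [leRHS](big_setID E)/= (finset.setIidPr EF) lerDl.
  by apply: sumr_ge0 => i _; rewrite mulr_ge0.
exists E => //; split.
  have mE : mass F = mass E + mass (F :\: E) by rewrite /mass (big_setID E)/= (finset.setIidPr EF).
  have h : 8 * C * mass (F :\: E) <= A F.
    rewrite /A (big_setID E)/= (finset.setIidPr EF); apply: (@le_trans _ _ (\sum_(i in F :\: E) a i * T F i)).
      rewrite /mass mulr_sumr; apply: ler_sum => i; rewrite !inE => /andP[h1 h2].
      by rewrite mulrC ler_wpM2l// ltW// ltNge; move: h1; rewrite h2.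
    by rewrite lerDr; apply: sumr_ge0 => i _; rewrite mulr_ge0.
  have h2 := energy_le F.
  have h3 : C * (2 * mass (F :\: E)) <= C * mass F.
    by move: (A F) (mass F) (mass (F :\: E)) h h2 => x y z; move: C => C' h h2; lra.
  by move: h3; rewrite ler_pM2l// mE; move: (mass E) (mass _) => x y; lra.
move=> w; have [E0|E0] := eqVneq E finset.set0.
  by rewrite E0 /T big_set0 !mulr_ge0// ltW.
have [j jE jP] := hQ w E0.
apply: (@le_trans _ _ (q * T E j)).
  by rewrite /T mulr_sumr; apply: ler_sum => i iE; rewrite mulrCA ler_wpM2l// jP.
rewrite mulrC ler_wpM2r ?(ltW q0)//; apply: (le_trans (TEF j)).
by move: jE; rewrite inE => /andP[].
Qed.

Lemma geometric_sum_le (k : nat) : \sum_(j < k.+1) 2 ^+ j <= 2 * 2 ^+ k :> R.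
Proof.
elim: k => [|k IH]; first by rewrite big_ord1 expr0; lra.
rewrite big_ord_recr /=; apply: (le_trans (lerD IH (lexx _))).
by rewrite exprS; lra.
Qed.

(** By symmetry only pairs k <= j count, up to a factor 2. Then the potential is bounded by M, and
    the powers 2^k sum to at most twice 2^j, which leaves 4^j times the mass of [E j]. *)
Lemma bilinear_levels (J : nat) (E : nat -> {set I}) (M : R) : 0 <= M ->
  (forall j w, T (E j) w <= M) ->
  \sum_(j < J) \sum_(k < J) 2 ^+ j * 2 ^+ k * (\sum_(i in E j) a i * T (E k) i) <=
    4 * M * \sum_(j < J) 4 ^+ j * mass (E j).
Proof.
move=> M0 hM.
pose B (j k : nat) : R := 2 ^+ j * 2 ^+ k * (\sum_(i in E j) a i * T (E k) i).
have B0 j k : 0 <= B j k by rewrite !mulr_ge0 ?exprn_ge0//; apply: sumr_ge0 => i _; rewrite mulr_ge0.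
have Bsym j k : B j k = B k j.
  rewrite /B [2 ^+ j * _]mulrC; congr (_ * _).
  rewrite /T; under eq_bigr do rewrite mulr_sumr.
  rewrite exchange_big /=; apply: eq_bigr => i _; rewrite mulr_sumr; apply: eq_bigr => l _.
  by rewrite Ksym; ring.
have Bl j k : B j k <= 2 ^+ j * 2 ^+ k * (M * mass (E j)).
  apply: ler_wpM2l; first by rewrite mulr_ge0 ?exprn_ge0.
  by rewrite /mass mulr_sumr; apply: ler_sum => i _; rewrite mulrC ler_wpM2r.
have s1 : \sum_(j < J) \sum_(k < J) B j k <=
    2 * \sum_(j < J) \sum_(k < J | (k <= j)%N) B j k.
  have e : \sum_(j < J) \sum_(k < J) B j k = \sum_(j < J) \sum_(k < J | (k <= j)%N) B j k +
      \sum_(j < J) \sum_(k < J | ~~ (k <= j)%N) B j k.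
    by rewrite -big_split; apply: eq_bigr => j _ /=; rewrite (bigID (fun k : 'I_J => (k <= j)%N)).
  rewrite e mulr_natl mulr2n lerD2l (exchange_big_dep predT)//=.
  apply: ler_sum => j _; apply: (@le_trans _ _ (\sum_(i < J | ~~ (j <= i)%N) B j i)).
    by apply: ler_sum => i _; rewrite Bsym.
  rewrite [leRHS](bigID (fun i : 'I_J => ~~ (j <= i)%N))/= ler_wpDr ?sumr_ge0//.
  rewrite le_eqVlt; apply/orP; left; apply/eqP; apply: eq_bigl => i.
  by rewrite -ltnNge; case: ltngtP.
apply: (le_trans s1).
rewrite (_ : 4 * M * _ = 2 * (2 * M * \sum_(j < J) 4 ^+ j * mass (E j))); last by ring.
rewrite ler_pM2l// mulr_sumr; apply: ler_sum => j _.
apply: (@le_trans _ _ (\sum_(k < j.+1) 2 ^+ j * 2 ^+ k * (M * mass (E j)))).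
  rewrite (big_ord_widen J (fun k => 2 ^+ j * 2 ^+ k * (M * mass (E j))) (ltn_ord j)).
  by apply: ler_sum.
rewrite -mulr_suml -mulr_sumr (_ : 4 ^+ j = 2 ^+ j * 2 ^+ j); last by rewrite -exprMn -natrM.
rewrite (_ : 2 * M * _ = 2 ^+ j * (2 * 2 ^+ j) * (M * mass (E j))); last by ring.
rewrite ler_wpM2r ?mulr_ge0// ler_wpM2l ?exprn_ge0//.
exact: geometric_sum_le.
Qed.

(* On each dyadic level set of [u] keep the part given by [half_mass], where at least half of the mass
   remains and the potential is bounded: the cross terms of the energy of the sum of [2 ^ j] times
   these parts then add up geometrically, and [hG] is applied to that sum. *)
Lemma strong_type_finite : \sum_i a i * u i ^+ 2 <= 2048 * (C * q) * G.
Proof.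
have [t t0 tP] : exists2 t : R, 0 < t & forall i, 0 < u i -> t <= u i.
  exists (\big[Num.min/1]_(i | 0 < u i) u i); first by apply: lt_bigmin.
  by move=> i ui; exact: bigmin_le_cond.
have lev i : exists k : nat, 0 < u i -> 2 ^+ k * t <= u i < 2 ^+ k.+1 * t.
  have [ui|ui] := ltP 0 (u i); last by exists 0%N.
  have [k kP] := @dyadic_bracket R (u i / t) ltac:(by rewrite ler_pdivlMr// mul1r tP).
  by exists k => _; move: kP; rewrite ler_pdivlMr// ltr_pdivrMr.
have [k kP] := @choice _ _ (fun i k => 0 < u i -> 2 ^+ k * t <= u i < 2 ^+ k.+1 * t) lev.
pose J := (\max_i k i).+1.
(* On these superlevel sets u >= 2^j t. A point with u > 0 lies in those with j <= k i, so its
   powers 4^j add up to the order of u^2 / t^2. *)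
pose E (j : nat) : {set I} := finset.finset (fun i => (0 < u i) && (j <= k i)%N).
have [E' E'P] := @choice _ _ (fun j (E' : {set I}) => E' \subset E j /\
   (mass (E j) <= 2 * mass E' /\ forall w, T E' w <= 8 * C * q))
   (fun j => let: ex_intro2 X h1 h2 := half_mass (E j) in ex_intro _ X (conj h1 h2)).
pose S := \sum_(j < J) 4 ^+ j * mass (E j).
have S0 : 0 <= S by apply: sumr_ge0 => j _; rewrite mulr_ge0 ?exprn_ge0.
have up : \sum_i a i * u i ^+ 2 <= 4 * t ^+ 2 * S.
  have -> : S = \sum_i a i * \sum_(j < J | i \in E j) 4 ^+ j.
    rewrite /S; under eq_bigr do rewrite /mass mulr_sumr.
    rewrite (exchange_big_dep predT)//=; apply: eq_bigr => i _; rewrite mulr_sumr.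
    by apply: eq_bigr => j _; rewrite mulrC.
  have pos (P : pred 'I_J) : 0 <= 4 * t ^+ 2 * \sum_(j < J | P j) 4 ^+ j.
    apply: mulr_ge0; first by rewrite mulr_ge0 ?sqr_ge0.
    by apply: sumr_ge0 => j _; rewrite exprn_ge0.
  rewrite mulr_sumr; apply: ler_sum => i _; rewrite [leRHS]mulrCA ler_wpM2l//.
  have [ui|ui] := ltP 0 (u i); last first.
    have -> : u i = 0 by apply/eqP; rewrite eq_le ui u0.
    rewrite expr0n/=; exact: pos.
  have kJ : (k i < J)%N by rewrite ltnS leq_bigmax.
  have iE : i \in E (Ordinal kJ) by rewrite inE ui /=.
  rewrite (bigD1 (Ordinal kJ))//= mulrDr.
  apply: ler_wpDr; first exact: (pos (fun j : 'I_J => (i \in E j) && (j != Ordinal kJ))).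
  have /andP[_ h] := kP i ui.
  have -> : 4 * t ^+ 2 * 4 ^+ k i = (2 ^+ (k i).+1 * t) ^+ 2.
    by rewrite (_ : 4 ^+ k i = 2 ^+ k i * 2 ^+ k i) ?exprS; [ring | rewrite -exprMn -natrM].
  by rewrite lerXn2r ?nnegrE ?(ltW h)// ?mulr_ge0 ?exprn_ge0 ?ltW.
pose c i := \sum_(j < J | i \in E' j) 2 ^+ j * a i.
have c0 i : 0 <= c i by apply: sumr_ge0 => j _; rewrite mulr_ge0 ?exprn_ge0.
have low : S <= 2 / t * \sum_i c i * u i.
  rewrite /S /c; under [in leRHS]eq_bigr do rewrite mulr_suml.
  rewrite (exchange_big_dep predT)//= mulr_sumr; apply: ler_sum => j _.
  have [EE [EM _]] := E'P j.
  apply: (@le_trans _ _ (4 ^+ j * (2 * mass (E' j)))); first by rewrite ler_wpM2l ?exprn_ge0.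
  rewrite /mass !mulr_sumr; apply: ler_sum => i iE'.
  have := fintype.subsetP EE i iE'; rewrite inE => /andP[ui ji].
  have /andP[h _] := kP i ui.
  rewrite (_ : 4 ^+ j = 2 ^+ j * 2 ^+ j); last by rewrite -exprMn -natrM.
  have h1 : 2 ^+ j <= u i / t.
    rewrite ler_pdivlMr//; apply: le_trans h; rewrite ler_wpM2r ?(ltW t0)//.
    by rewrite ler_weXn2l// ler1n.
  rewrite (_ : 2 / t * _ = 2 ^+ j * (u i / t) * (2 * a i)); last by field; rewrite gt_eqF.
  by rewrite ler_wpM2r ?mulr_ge0// ler_wpM2l ?exprn_ge0.
pose M := 8 * C * q.
have M0 : 0 < M by rewrite !mulr_gt0.
have quad : \sum_i \sum_j c i * c j * K i j <= 4 * M * S.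
  have hQ' := @bilinear_levels J E' M (ltW M0) (fun j => (E'P j).2.2).
  apply: (@le_trans _ _ (4 * M * \sum_(j < J) 4 ^+ j * mass (E' j))); last first.
    apply: ler_wpM2l; first by rewrite mulr_ge0// ltW.
    apply: ler_sum => j _; apply: ler_wpM2l; first exact: exprn_ge0.
    rewrite /mass [leRHS](big_setID (E' j))/= (finset.setIidPr (E'P j).1) lerDl.
    exact: sumr_ge0.
  apply: le_trans hQ'; rewrite le_eqVlt; apply/orP; left; apply/eqP.
  have sumc X : \sum_i c i * X i = \sum_(j < J) 2 ^+ j * \sum_(i in E' j) a i * X i.
    rewrite /c; under eq_bigr do rewrite mulr_suml.
    rewrite (exchange_big_dep predT)//=; apply: eq_bigr => j _; rewrite mulr_sumr.
    by apply: eq_bigr => i _; rewrite mulrA.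
  transitivity (\sum_i c i * \sum_(k < J) 2 ^+ k * T (E' k) i).
    apply: eq_bigr => i _; rewrite -(sumc (K i)) mulr_sumr; apply: eq_bigr => l _.
    by rewrite mulrA.
  rewrite sumc; apply: eq_bigr => j _; rewrite mulr_sumr.
  under eq_bigr do rewrite mulr_sumr mulr_sumr.
  rewrite exchange_big /=; apply: eq_bigr => l _; rewrite mulr_sumr; apply: eq_bigr => i _; ring.
(* With this l the quadratic term becomes S / 2, which is absorbed on the left. *)
have := hG c0 (_ : 0 < 16 * M / t); rewrite divr_gt0 ?mulr_gt0// => /(_ isT) hg.
have h1 : S <= 2 / t * (16 * M / t * G + (16 * M / t)^-1 * (4 * M * S)).
  apply: (le_trans low); rewrite ler_wpM2l ?divr_ge0 ?(ltW t0)//; apply: (le_trans hg).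
  rewrite lerD2l; apply: ler_wpM2l => //; rewrite invr_ge0; apply: ltW.
  by apply: divr_gt0 => //; exact: mulr_gt0.
have e1 : 2 / t * (16 * M / t * G + (16 * M / t)^-1 * (4 * M * S)) = 32 * M * G / t ^+ 2 + S / 2.
  by field; rewrite !gt_eqF.
have h2 : S <= 64 * M * G / t ^+ 2.
  by move: h1; rewrite e1 (_ : 64 * M * G / t ^+ 2 = 2 * (32 * M * G / t ^+ 2)); [lra|ring].
apply: (le_trans up); apply: (@le_trans _ _ (4 * t ^+ 2 * (64 * M * G / t ^+ 2))).
  by rewrite ler_wpM2l// mulr_ge0 ?sqr_ge0.
rewrite le_eqVlt; apply/orP; left; apply/eqP; rewrite /M; field.
by rewrite gt_eqF.
Qed.
End strong_type.

(** * Tents and coverings *)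

Section greedy.
Context {R : realType} {I : finType}.

(** Take a point of largest weight, discard it and everything in conflict with it, and repeat. *)
Lemma greedy_selection (conf : rel I) (w : I -> R) (S : {set I}) : symmetric conf ->
  exists P : {set I}, [/\ P \subset S,
    {in P &, forall p p', p != p' -> ~~ conf p p'} &
    forall j, j \in S -> exists2 p, p \in P & ((j == p) || conf j p) && (w j <= w p)].
Proof.
move=> csym; elim: {S}#|S| {-2}S (leqnn #|S|) => [|k IH] S Sk.
  exists finset.set0; split; [exact: finset.sub0set|by move=> p p'; rewrite finset.in_set0|].
  by move=> j jS; move: Sk; rewrite leqn0 cards_eq0 => /eqP S0; rewrite S0 finset.in_set0 in jS.
have [->|/finset.set0Pn[i0 i0S]] := eqVneq S finset.set0.
  by exists finset.set0; split; [exact: finset.sub0set|by move=> p p'; rewrite finset.in_set0|move=> j; rewrite finset.in_set0].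
case: (@arg_maxP _ _ _ i0 (mem S) w i0S) => p /= pS pmax.
have {}pS : p \in S by [].
pose S' := [set j in S | ~~ ((j == p) || conf j p)].
have S'S : S' \subset S by apply/fintype.subsetP => j; rewrite inE => /andP[].
have S'k : (#|S'| <= k)%N.
  rewrite -ltnS; apply: leq_trans Sk; apply: proper_card; apply/properP; split => //.
  by exists p; rewrite // inE eqxx andbF.
have [P [PS Pc Pw]] := IH _ S'k.
exists (p |: P); split.
- apply/fintype.subsetP => j; rewrite in_setU1 => /predU1P[->//|jP].
  exact: (fintype.subsetP S'S _ (fintype.subsetP PS _ jP)).
- have h j : j \in P -> ~~ conf j p.
    by move=> jP; have := fintype.subsetP PS _ jP; rewrite inE negb_or => /and3P[].
  move=> i j; rewrite !in_setU1 => /predU1P[->|iP] /predU1P[->|jP]; rewrite ?eqxx//.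
  + by move=> _; rewrite csym h.
  + by move=> _; exact: h.
  + exact: Pc.
move=> j jS; have [jp|jp] := boolP ((j == p) || conf j p).
  by exists p; [rewrite in_setU1 eqxx | rewrite jp; exact: pmax].
have [|q qP hq] := Pw j; first by rewrite inE jS.
by exists q => //; rewrite in_setU1 qP orbT.
Qed.

Lemma sum_assign (S P : {set I}) (r : rel I) (a : I -> R) : (forall i, 0 <= a i) ->
  (forall j, j \in S -> exists2 p, p \in P & r j p) ->
  \sum_(j in S) a j <= \sum_(p in P) \sum_(j in S | r j p) a j.
Proof.
move=> a0 h; rewrite (exchange_big_dep (mem S))/=; last by move=> p j _ /andP[].
apply: ler_sum => j jS; have [p pP jp] := h j jS.
by rewrite (bigD1 p)/= ?pP ?jS//= lerDl sumr_ge0.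
Qed.
End greedy.

Lemma sum_measure_le d (T : measurableType d) (R : realType) (m : {measure set T -> \bar R})
    (I : finType) (P : {set I}) (A : I -> set T) (B : set T) :
  (forall i, measurable (A i)) -> measurable B -> (forall i, i \in P -> A i `<=` B) ->
  {in P &, forall i j, i != j -> A i `&` A j = set0} ->
  (\sum_(i in P) m (A i) <= m B)%E.
Proof.
move=> mA mB sub dis.
have E D : measurable D -> m D = (\int[m]_v (\1_D v)%:E)%E.
  by move=> mD; rewrite integral_indic// setIT.
rewrite E//; under eq_bigr do rewrite E//.
rewrite -big_enum /= -ge0_integral_sum//; last first.
  by move=> p; apply/measurable_EFinP; exact: measurable_indic.
apply: ge0_le_integralW => v _; first by apply: sume_ge0 => p _; rewrite lee_fin.
rewrite sumEFin lee_fin big_enum /=.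
have [[p pP pv]|no] := pselect (exists2 p, p \in P & A p v); last first.
  by rewrite big1 // => p pP; rewrite indicE memNset// => pv; apply: no; exists p.
rewrite (bigD1 p)//= indicE mem_set// indicE mem_set; last exact: sub pv.
rewrite big1 ?addr0// => p' /andP[p'P pp']; rewrite indicE memNset// => p'v.
by have : (A p' `&` A p) v by []; rewrite dis.
Qed.

Section covering.
Variables (R : realType) (n : nat).
Local Notation H := (heis R n).
Local Notation lam := (@lebesgue_heis R n).

Lemma packing_count (k : R) : 0 < k -> exists2 N : R, 0 < N &
  forall (I : finType) (x : I -> H) (P : {set I}) (y : H) (r : R), 0 < r ->
  (forall p, p \in P -> hball (x p) r `<=` hball y (k * r)) ->
  {in P &, forall p p', p != p' -> hball (x p) r `&` hball (x p') r = set0} ->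
  #|P|%:R <= N.
Proof.
move=> k0; have [c [C0 [c0 C00 hV]]] := hball_volume R n.
exists (C0 / c * (k ^+ 2) ^+ n.+1); first by rewrite mulr_gt0 ?divr_gt0 ?exprn_gt0.
move=> I x P y r r0 sub dis.
have r2 : 0 < (r ^+ 2) ^+ n.+1 by rewrite !exprn_gt0.
have h : (\sum_(p in P) lam (hball (x p) r) <= lam (hball y (k * r)))%E.
  by apply: (sum_measure_le lam) => // [i|]; exact: measurable_hball.
have h1 : ((#|P|%:R * (c * (r ^+ 2) ^+ n.+1))%R%:E <= (C0 * (k ^+ 2 * r ^+ 2) ^+ n.+1)%R%:E)%E.
  have kr : 0 < k * r by rewrite mulr_gt0.
  rewrite -exprMn; apply: le_trans (hV y (k * r) kr).2; apply: le_trans h.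
  rewrite mulr_natl -sumr_const -sumEFin; apply: lee_sum => p _; exact: (hV (x p) r r0).1.
move: h1; rewrite lee_fin [(k ^+ 2 * _) ^+ _]exprMn => h1.
have cr : 0 < c * (r ^+ 2) ^+ n.+1 by rewrite mulr_gt0.
rewrite -(ler_pM2r cr); apply: (le_trans h1); rewrite le_eqVlt; apply/orP; left; apply/eqP.
by field; rewrite gt_eqF.
Qed.

Lemma hball_disjoint_dist (x y : H) (r s z : R) : ~ (hball x r `&` hball y s = set0) ->
  hdist x y < r + s.
Proof.
move=> /eqP/set0P[v [xv yv]]; apply: (le_lt_trans (hdist_triangle x v y)).
by rewrite [hdist v y]hdistC; exact: ltrD.
Qed.

(** Balls are selected by decreasing t, which will be the mass of the tent, and not by radius. The
    Lipschitz condition makes the radii of conflicting balls comparable; the points assigned to p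
    then split into boundedly many clusters at scale r p / 8, and a cluster with representative q
    has total mass at most t q <= t p. *)
Lemma covering : exists2 N : R, 0 < N &
  forall (I : finType) (x : I -> H) (r a t : I -> R) (S : {set I}),
  (forall i, 0 <= a i) -> (forall i, 0 <= t i) ->
  (forall i, i \in S -> 0 < r i) ->
  (forall i j, i \in S -> j \in S -> r i <= r j + hdist (x i) (x j) / 3) ->
  (forall p (S' : {set I}), p \in S -> S' \subset S ->
     (forall j, j \in S' -> hdist (x j) (x p) + r j / 8 <= r p) -> \sum_(j in S') a j <= t p) ->
  exists D : {set I}, [/\ D \subset S,
    {in D &, forall p p', p != p' -> hball (x p) (r p) `&` hball (x p') (r p') = set0} &
    \sum_(i in S) a i <= N * \sum_(p in D) t p].
Proof.
have [N N0 hN] := @packing_count 32 ltac:(by []).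
exists N => // I x r a t S a0 t0 r0 rlip hat.
pose conf (i j : I) : bool := `[< hball (x i) (r i) `&` hball (x j) (r j) <> set0 >].
have csym : symmetric conf by move=> i j; rewrite /conf setIC.
have [D [DS Dc Dw]] := greedy_selection t S csym.
exists D; split => //.
  move=> p p' pD p'D pp'; have := Dc p p' pD p'D pp'.
  by move=> /asboolP/contrapT.
apply: (le_trans (sum_assign a0 Dw)); rewrite mulr_sumr; apply: ler_sum => p pD.
have pS := fintype.subsetP DS _ pD; have rp0 := r0 p pS.
pose S0 := [set j in S | ((j == p) || conf j p) && (t j <= t p)].
have S0S : S0 \subset S by apply/fintype.subsetP => j; rewrite inE => /andP[].
(* From |r j - r p| <= d / 3 and d <= r j + r p the ratio of the radii is at most 2. *)
have near j : j \in S0 -> [/\ r j <= 2 * r p, r p <= 2 * r j & hdist (x j) (x p) <= 3 * r p].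
  rewrite inE => /and3P[jS jp _]; have rj0 := r0 j jS.
  have h1 := rlip j p jS pS; have h2 := rlip p j pS jS; rewrite hdistC in h2.
  have h3 : hdist (x j) (x p) <= r j + r p.
    case/orP: jp => [/eqP->|/asboolP jp]; first by rewrite hdistxx addr_ge0 ?ltW.
    exact/ltW/hball_disjoint_dist.
  by split; move: h1 h2 h3 rj0 rp0; move: (r j) (r p) (hdist _ _); clear; move=> *; lra.
have rp8 : 0 < r p / 8 by rewrite divr_gt0.
(* A second selection, with constant weight, yields representatives whose small balls are disjoint.
   They lie in the ball of radius 4 r p = 32 (r p / 8), so volumes bound their number. *)
pose conf' (i j : I) : bool := `[< hball (x i) (r p / 8) `&` hball (x j) (r p / 8) <> set0 >].
have csym' : symmetric conf' by move=> i j; rewrite /conf' setIC.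
have [P [PS0 Pc Pw]] := greedy_selection (fun=> 0 : R) S0 csym'.
have -> : \sum_(j in S | ((j == p) || conf j p) && (t j <= t p)) a j = \sum_(j in S0) a j.
  by apply: eq_bigl => j; rewrite inE.
apply: (le_trans (sum_assign a0 Pw)).
apply: (@le_trans _ _ (\sum_(i in P) t p)).
  apply: ler_sum => q qP; have qS0 := fintype.subsetP PS0 _ qP.
  have qS := fintype.subsetP S0S _ qS0.
  have [q1 q2 q3] := near q qS0.
  apply: (@le_trans _ _ (t q)); last by move: qS0; rewrite inE => /and3P[].
  pose Sq := [set j in S0 | ((j == q) || conf' j q) && (0 <= 0 :> R)].
  have -> : \sum_(j in S0 | ((j == q) || conf' j q) && (0 <= 0 :> R)) a j = \sum_(j in Sq) a j.
    by apply: eq_bigl => j; rewrite [in RHS]inE.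
  apply: hat => //.
    by apply/fintype.subsetP => j; rewrite inE => /andP[/(fintype.subsetP S0S)].
  move=> j; rewrite inE => /and3P[jS0 jq _]; have [j1 j2 j3] := near j jS0.
  have h : hdist (x j) (x q) <= r p / 8 + r p / 8.
    case/orP: jq => [/eqP->|/asboolP jq]; first by rewrite hdistxx addr_ge0 ?ltW.
    exact/ltW/hball_disjoint_dist.
  by move: h j1 q2; move: (r j) (r p) (r q) (hdist _ _); clear; move=> *; lra.
rewrite sumr_const -[leLHS]mulr_natl ler_wpM2r//.
apply: (hN I x P (x p) (r p / 8)) => //.
  move=> q qP v qv; have [_ _ q3] := near q (fintype.subsetP PS0 _ qP).
  rewrite /hball /=; apply: (le_lt_trans (hdist_triangle _ (x q) _)).
  rewrite hdistC; move: q3 qv rp0; rewrite /hball /=; move: (hdist _ _) (hdist _ _) (r p); clear; move=> *; lra.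
move=> q q' qP q'P qq'; have := Pc q q' qP q'P qq'.
by move=> /asboolP/contrapT.
Qed.

Lemma Lnorm2_sqr (f : borel H -> R) :
  ('N[lam]_2%:E [EFin \o f] ^+ 2 = \int[lam]_y (f y ^+ 2)%:E)%E.
Proof.
rewrite unlock /=; set J := (\int[lam]_x _)%E.
have -> : (\int[lam]_y (f y ^+ 2)%:E)%E = J.
  apply: eq_integral => y _; congr (_%:E).
  by rewrite powR_mulrn// real_normK ?num_real.
have J0 : (0 <= J)%E by apply: integral_ge0 => y _; rewrite lee_fin powR_ge0.
case: J J0 => [j| |]//= j0; last by rewrite ifF ?mulyy// gt_eqF// invr_gt0.
rewrite lee_fin in j0.
by rewrite -EFinM -expr2 -powR_mulrn ?powR_ge0// -powRrM mulVf// powRr1.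
Qed.
End covering.

Section tents.
Variables (R : realType) (n : nat).
Local Notation C := (Cplx R).
Local Notation V := (Cn1 R n).
Local Notation U := (siegelU R n).
Local Notation H := (heis R n).
Local Notation mR := (measurableTypeR R).

Lemma Psi_inv_hpart (p : V) : Psi_inv (hpart p) (rho p) = p.
Proof.
rewrite /Psi_inv /hpart /rho /= addrC subrK [RHS]surjective_pairing; congr pair.
by case: (p.2).
Qed.

Lemma siegel_val (z : U) : siegel (set_val z : V).
Proof. exact: set_valP. Qed.

Lemma tentP (E : set H) (z : U) :
  tent E z <-> hball (hpart (set_val z)) (Num.sqrt (rho (set_val z : V))) `<=` E.
Proof.
split=> [[x [h [h0 sub ->]]]|sub]; first by rewrite hpart_Psi_inv rho_Psi_inv.
by exists (hpart (set_val z)), (rho (set_val z : V)); split; [exact: siegel_val|exact: sub|rewrite Psi_inv_hpart].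
Qed.

Lemma continuous_set_val : continuous (set_val : U -> V).
Proof. exact: initial_continuous. Qed.

Lemma measurable_set_val : measurable_fun [set: borel U] (set_val : borel U -> borel V).
Proof. by apply: (@continuous_borel U V); exact: continuous_set_val. Qed.

Lemma him_continuous (v : 'rV[C]_n) : continuous (fun u : 'rV[C]_n => him u v : R).
Proof.
apply: (@continuous_big R^o) => [|j _ z]; first exact: add_continuous.
have c1 : {for z, continuous (fun x : 'rV[C]_n => x 0 j : C)} by exact: coord_continuous.
have c2 := @continuous_comp _ _ _ (fun x : 'rV[C]_n => x 0 j : C) _ z c1 (@Re_continuous _ _).
have c3 := @continuous_comp _ _ _ (fun x : 'rV[C]_n => x 0 j : C) _ z c1 (@Im_continuous _ _).
exact: (cvgB (cvgM c3 (cvg_cst _)) (cvgM c2 (cvg_cst _))).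
Qed.

Lemma hdist4_continuous (w : H) : continuous (fun p : V => (hdist (hpart p) w ^+ 2) ^+ 2 : R).
Proof.
rewrite (_ : (fun _ => _) = (fun p : V => 16^-1 * sqnorm (p.1 - w.1) ^+ 2 + htau (hpart p) w ^+ 2)); last first.
  by apply/funext => p; rewrite hdist_pow4.
move=> p.
have c0 : {for p, continuous (fun p : V => sqnorm (p.1 - w.1) : R)}.
  apply: (@continuous_comp _ _ _ (fun p : V => p.1 - w.1) (@sqnorm R n)); last exact: sqnorm_continuous.
  by apply: cvgB; [exact: cvg_fst|exact: cvg_cst].
have c1 : {for p, continuous (fun p : V => htau (hpart p) w : R)}.
  rewrite /htau; apply: (@cvgD _ R^o); first apply: (@cvgB _ R^o); last apply: (@cvgM R).
  - apply: (@continuous_comp _ _ _ (fun q : V => q.2) (fun z : C => complex.Re z : R)); first exact: cvg_snd.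
    exact: Re_continuous.
  - exact: cvg_cst.
  - exact: cvg_cst.
  - apply: (@continuous_comp _ _ _ (fun q : V => q.1) (fun u => him u w.1 : R)); first exact: cvg_fst.
    exact: him_continuous.
by apply: (@cvgD _ R^o); [apply: (@cvgM R); first exact: cvg_cst|]; apply: (@cvgM R).
Qed.

(** For arbitrary E the complement is open: a point lies off the tent when some w outside E has d^2
    < rho. This is stated with fourth powers of the distance, which are polynomial and hence
    continuous. *)
Lemma measurable_tent (E : set H) : measurable (tent E : set (borel U)).
Proof.
rewrite -[tent E]setCK; apply: measurableC; apply: sub_sigma_algebra.
rewrite (_ : ~` tent E = \bigcup_(w in ~` E) ((set_val : U -> V) @^-1`
   [set p : V | 0 < rho p ^+ 2 - (hdist (hpart p) w ^+ 2) ^+ 2])).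
  apply: bigcup_open => w _; apply: open_comp; first by move=> z _; exact: continuous_set_val.
  rewrite (_ : [set p : V | _] = (fun p : V => rho p ^+ 2 - (hdist (hpart p) w ^+ 2) ^+ 2) @^-1` [set x | 0 < x])//.
  apply: open_comp; last exact: open_gt.
  move=> p _; apply: (@cvgB _ R^o); last exact: hdist4_continuous.
  by apply: (@cvgM R); exact: rho_continuous.
have key (z : U) w : 0 < rho (set_val z : V) ^+ 2 - (hdist (hpart (set_val z)) w ^+ 2) ^+ 2 <->
    hball (hpart (set_val z)) (Num.sqrt (rho (set_val z : V))) w.
  have r0 := siegel_val z; rewrite /siegel /= in r0.
  rewrite subr_gt0 ltr_pXn2r ?nnegrE ?sqr_ge0 ?(ltW r0)// /hball /=.
  by rewrite -{1}(sqr_sqrtr (ltW r0)) ltr_pXn2r ?nnegrE ?hdist_ge0 ?sqrtr_ge0.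
apply/seteqP; split => z /=.
  by move=> /tentP/existsNP[w /not_implyP[h1 h2]]; exists w => //; exact/key.
by move=> [w wE /key h] /tentP sub; apply: wE; exact: sub.
Qed.

(** The ball that decides membership in the tent has radius sqrt rho <= 2 sqrt h, and its centre is
    within sqrt h of x: together 3 sqrt h. *)
Lemma tent_sub (x y : H) (h r : R) (z : U) : 0 <= h -> 0 <= r ->
  hdist x (hpart (set_val z)) ^+ 2 <= h -> rho (set_val z : V) <= 4 * h ->
  hdist x y + 3 * Num.sqrt h <= r -> tent (hball y r) z.
Proof.
move=> h0 r0 d1 d2 d3; apply/tentP => w; rewrite /hball /= => dw.
have d1' : hdist x (hpart (set_val z)) <= Num.sqrt h.
  by rewrite -[leLHS]ger0_norm ?hdist_ge0// -sqrtr_sqr ler_wsqrtr.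
have d2' : Num.sqrt (rho (set_val z : V)) <= 2 * Num.sqrt h.
  apply: (le_trans (ler_wsqrtr d2)); rewrite sqrtrM// (_ : 4 = 2 ^+ 2) ?sqrtr_sqr ?ger0_norm//.
  by rewrite -natrX.
have t1 := hdist_triangle y x w; have t2 := hdist_triangle x (hpart (set_val z)) w.
rewrite [hdist y x]hdistC in t1.
move: d1' d2' d3 dw t1 t2; move: (hdist _ _) (hdist _ _) (hdist _ _) (hdist _ _) (hdist _ _).
by move: (Num.sqrt h) (Num.sqrt (rho _)); clear; move=> *; lra.
Qed.

End tents.

(** * Upper bound for the capacity *)

Section capacity_bound.
Variables (R : realType) (n : nat) (alpha : R).
Hypotheses (alpha_gt : n%:R / 2 < alpha) (alpha_lt : alpha < (n%:R + 1) / 2).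
Local Notation H := (heis R n).
Local Notation mR := (measurableTypeR R).
Local Notation lam := (@lebesgue_heis R n).

(** A multiple c / t of f is admissible for A, because the regularised potential at a point near y
    is dominated by the Riesz potential at y. The constant 5184 = 72^2 is dictated by the radii in
    [weak_type]. *)
Lemma capacity_le : exists2 c : R, 0 < c & forall (f : borel H -> R) (t : R) (A : set H),
  measurable_fun [set: borel H] (f : borel H -> mR) -> (forall y, 0 <= f y) ->
  (\int[lam]_y (f y ^+ 2)%:E < +oo)%E -> 0 < t ->
  (forall y, A y -> exists x (h : R), [/\ 0 < h, hdist x y ^+ 2 <= 5184 * h & (t%:E <= hpot alpha f x h)%E]) ->
  ((t ^+ 2)%:E * capacity alpha A <= c%:E * \int[lam]_y (f y ^+ 2)%:E)%E.
Proof.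
have [c c0 hc] := hpot_le_riesz alpha_gt alpha_lt (ltac:(rewrite ler1n//) : 1 <= 5184 :> R).
exists (c ^+ 2); first by rewrite exprn_gt0.
move=> f t A mf f0 ffin t0 hA.
have ct0 : 0 < c / t by rewrite divr_gt0.
pose g y := c / t * f y.
have mg : measurable_fun [set: borel H] (g : borel H -> mR).
  by apply: measurable_funM => //; exact: measurable_cst.
have g0 y : 0 <= g y by rewrite mulr_ge0// ltW.
have gI : (\int[lam]_y (g y ^+ 2)%:E = ((c / t) ^+ 2)%:E * \int[lam]_y (f y ^+ 2)%:E)%E.
  rewrite -ge0_integralZW ?sqr_ge0//; last by move=> y _; rewrite lee_fin sqr_ge0.
  by apply: eq_integral => y _; rewrite -EFinM exprMn.
have -> : ((c ^+ 2)%:E * \int[lam]_y (f y ^+ 2)%:E = (t ^+ 2)%:E * \int[lam]_y (g y ^+ 2)%:E)%E.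
  rewrite gI muleA -EFinM expr_div_n mulrCA mulfV ?mulr1//.
  by rewrite gt_eqF// exprn_gt0.
apply: lee_wpmul2l; first by rewrite lee_fin sqr_ge0.
apply: ereal_inf_lbound; exists g; last exact: Lnorm2_sqr.
split => //.
  rewrite inE; apply/andP; split; rewrite inE//=.
  rewrite /finite_norm; have : ('N[lam]_2%:E [EFin \o g] ^+ 2 < +oo)%E.
    by rewrite Lnorm2_sqr gI lte_mul_pinfty// lee_fin sqr_ge0.
  by have := Lnorm_ge0 lam 2%:E (EFin \o g); case: ('N[lam]_2%:E [EFin \o g])%E => [r _ _|_|//]; [exact: ltry | rewrite expe2 mulyy ltxx].
move=> y /hA[x [h [h0 xy ht]]].
have := hc f mf f0 x h y h0 xy; move=> /(le_trans ht) h1.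
have -> : (riesz_potential alpha g y = (c / t)%:E * riesz_potential alpha f y)%E.
  rewrite !riesz_potentialE// muleCA; congr (_ * _)%E.
  rewrite -ge0_integralZW ?(ltW ct0)//; last by move=> z _; rewrite lee_fin mulr_ge0// powR_ge0.
  by apply: eq_integral => z _; rewrite -EFinM mulrCA.
have t1 : (0 <= (t^-1)%:E)%E by rewrite lee_fin invr_ge0 ltW.
have := lee_wpmul2l t1 h1; rewrite -EFinM mulVf ?gt_eqF// muleA -EFinM.
by rewrite [t^-1 * c]mulrC.
Qed.
End capacity_bound.

(** * Subcapacitary measures are Carleson measures *)

Section weak_type.
Variables (R : realType) (n : nat) (alpha : R).
Hypotheses (alpha_gt : n%:R / 2 < alpha) (alpha_lt : alpha < (n%:R + 1) / 2).
Local Notation H := (heis R n).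
Local Notation U := (siegelU R n).
Local Notation V := (Cn1 R n).
Local Notation mR := (measurableTypeR R).
Local Notation lam := (@lebesgue_heis R n).
Variable mu : {measure set (borel U) -> \bar R}.
Hypothesis hmu : subcapacitary alpha mu.

(** A ball has finite capacity, since a multiple of the kernel [hP] at its centre is admissible.
    Finiteness allows the masses to be treated as real numbers. *)
Lemma tent_mass_fin (x : H) (r : R) : 0 < r -> (mu (tent (hball x r)) < +oo)%E.
Proof.
move=> r0; have [c c0 hc] := hmu.
have h0 : 0 < r ^+ 2 by rewrite exprn_gt0.
have := hc 1%N (fun=> x) (fun=> r) (fun=> r0) _.
rewrite big_ord1 => /(_ _)/le_lt_trans; apply.
  by apply/trivIsetP => i j _ _; rewrite !ord1 eqxx.
have [c1 c10 hc1] := hPP_integral_ge alpha_gt alpha_lt.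
have [c2 c20 hc2] := hPP_integral_le alpha_gt alpha_lt.
have [c3 c30 hc3] := capacity_le alpha_gt alpha_lt.
pose f (y : borel H) : R := hP alpha x (r ^+ 2) y.
pose t := c1 * hK alpha x (r ^+ 2) x (r ^+ 2).
have t0 : 0 < t by rewrite mulr_gt0// powR_gt0// hdistxx expr0n/= add0r addr_gt0.
have fE : (\int[lam]_y (f y ^+ 2)%:E = \int[lam]_y (hP alpha x (r ^+ 2) y * hP alpha x (r ^+ 2) y)%:E)%E.
  by apply: eq_integral => y _; rewrite expr2.
have ffin : (\int[lam]_y (f y ^+ 2)%:E < +oo)%E.
  by rewrite fE; apply: le_lt_trans (hc2 x (r ^+ 2) x (r ^+ 2) h0 h0) _; exact: ltry.
have := hc3 f t (\bigcup_(i : 'I_1) hball x r) (measurable_hP _ _ _) (fun y => hP_ge0 _ _ _ _) ffin t0.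
move=> /(_ _) h; apply: lte_mul_pinfty; rewrite ?lee_fin ?(ltW c0)//.
have {}h := h _.
case: (capacity alpha _) h => [s| |] h; [exact: ltry| |by []].
have /h : forall y, (\bigcup_(i : 'I_1) hball x r) y -> exists x0 (h : R),
    [/\ 0 < h, hdist x0 y ^+ 2 <= 5184 * h & (t%:E <= hpot alpha f x0 h)%E].
  move=> y [_ _]; rewrite /hball /= => xy; exists x, (r ^+ 2); split => //.
    apply: (@le_trans _ _ (r ^+ 2)); last by rewrite ler_peMl ?(ltW h0)// ler1n.
    by rewrite lerXn2r ?nnegrE ?hdist_ge0 ?(ltW r0) ?(ltW xy).
  exact: (hc1 x (r ^+ 2) x (r ^+ 2) h0 h0).
rewrite mulry gtr0_sg ?exprn_gt0// mul1e leNgt lte_mul_pinfty//.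
by rewrite lee_fin ltW.
Qed.

Lemma cell_mass_fin (x : H) (h : R) (Q : set (borel U)) : 0 < h -> measurable Q ->
  (forall z, Q z -> hdist x (hpart (set_val z)) ^+ 2 <= h /\ rho (set_val z : V) <= 4 * h) ->
  (mu Q < +oo)%E.
Proof.
move=> h0 mQ hQ; have r0 : 0 < 3 * Num.sqrt h by rewrite mulr_gt0// sqrtr_gt0.
apply: le_lt_trans (tent_mass_fin x r0); apply: le_measure; rewrite ?inE//.
  exact: measurable_tent.
move=> z /hQ[z1 z2]; apply: (@tent_sub _ _ x x h) => //; rewrite ?(ltW h0) ?(ltW r0)//.
by rewrite hdistxx add0r.
Qed.

(** A large potential at (x j, h j) makes a multiple of f admissible on the ball of radius 72 sqrt
    (h j) about x j. The radius [r i] is a third of the largest depth of x i in such balls: it is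
    Lipschitz with constant 1/3, as [covering] asks, and the ball of radius [r i] stays inside the
    one that realises the maximum. *)
Lemma weak_type : exists2 c : R, 0 < c & forall (I : finType) (x : I -> H) (h : I -> R) (Q : I -> set (borel U)),
  (forall i, 0 < h i) -> (forall i, measurable (Q i)) ->
  (forall i j, i != j -> Q i `&` Q j = set0) ->
  (forall i z, Q i z -> hdist (x i) (hpart (set_val z)) ^+ 2 <= h i /\ rho (set_val z : V) <= 4 * h i) ->
  forall (E : {set I}) (f : borel H -> R) (t : R),
  measurable_fun [set: borel H] (f : borel H -> mR) -> (forall y, 0 <= f y) ->
  (\int[lam]_y (f y ^+ 2)%:E < +oo)%E -> 0 < t ->
  (forall i, i \in E -> (t%:E <= hpot alpha f (x i) (h i))%E) ->
  ((t ^+ 2 * \sum_(i in E) fine (mu (Q i)))%:E <= c%:E * \int[lam]_y (f y ^+ 2)%:E)%E.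
Proof.
have [c c0 hc] := hmu.
have [N N0 hN] := covering R n.
have [c3 c30 hc3] := capacity_le alpha_gt alpha_lt.
exists (N * c * c3); first by rewrite !mulr_gt0.
move=> I x h Q h0 mQ dQ hQ E f t mf f0 ffin t0 hE.
have If0 : (0 <= \int[lam]_y (f y ^+ 2)%:E)%E by apply: integral_ge0 => y _; rewrite lee_fin sqr_ge0.
have [->|/finset.set0Pn[i0 i0E]] := eqVneq E finset.set0.
  by rewrite big_set0 mulr0 mule_ge0// lee_fin !mulr_ge0// ltW.
pose v i j := 72 * Num.sqrt (h j) - hdist (x i) (x j).
have jP i : exists j, j \in E /\ forall k, k \in E -> v i k <= v i j.
  by case: (@arg_maxP _ _ _ i0 (mem E) (v i) i0E) => j /= jE jmax; exists j.
have [jm jmP] := @choice _ _ (fun i j => j \in E /\ forall k, k \in E -> v i k <= v i j) jP.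
pose r i := v i (jm i) / 3.
have s0 i : 0 < Num.sqrt (h i) by rewrite sqrtr_gt0.
(* Here 24 = 72 / 3. It gives r i / 8 >= 3 sqrt (h i), so that [tent_sub] places the cells of a
   cluster in one tent. *)
have rE i : i \in E -> 24 * Num.sqrt (h i) <= r i.
  move=> iE; have := (jmP i).2 i iE; rewrite /r {1}/v hdistxx; move: (v _ _) (s0 i).
  by move: (Num.sqrt _) => *; lra.
have rpos i : i \in E -> 0 < r i.
  by move=> iE; apply: lt_le_trans (rE i iE); rewrite mulr_gt0.
have finQ i : mu (Q i) \is a fin_num.
  by rewrite ge0_fin_numE//; apply: (@cell_mass_fin (x i) (h i)) => // z; exact: hQ.
have finT i : i \in E -> mu (tent (hball (x i) (r i))) \is a fin_num.
  by move=> iE; rewrite ge0_fin_numE//; exact/tent_mass_fin/rpos.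
have [|||||D [DE Ddis Dsum]] := hN I x r (fun i => fine (mu (Q i)))
    (fun i => fine (mu (tent (hball (x i) (r i))))) E.
- by move=> i; rewrite fine_ge0.
- by move=> i; rewrite fine_ge0.
- exact: rpos.
- move=> i j _ jE; have := (jmP j).2 (jm i) (jmP i).1.
  have := hdist_triangle (x j) (x i) (x (jm i)); rewrite [hdist (x j) (x i)]hdistC.
  rewrite /r /v; move: (72 * _) (72 * _) (hdist _ _) (hdist _ _) (hdist _ _) (hdist _ _).
  by move=> *; lra.
- move=> p S' pE S'E S'p; rewrite -lee_fin -sumEFin fineK ?finT//.
  under eq_bigr do rewrite fineK//.
  apply: sum_measure_le => //; first exact: measurable_tent.
    move=> j jS' z /hQ[z1 z2]; apply: (@tent_sub _ _ (x j) (x p) (h j)) => //; rewrite ?(ltW (h0 j)) ?(ltW (rpos p pE))//.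
    have := S'p j jS'; have := rE j (fintype.subsetP S'E _ jS').
    by move: (hdist _ _) (r j) (r p) (Num.sqrt _) => *; lra.
  by move=> i j _ _; exact: dQ.
have Dfin : (\sum_(p in D) fine (mu (tent (hball (x p) (r p)))))%:E =
   (\sum_(i < #|D|) mu (tent (hball (x (enum_val i)) (r (enum_val i)))))%E.
  rewrite -sumEFin big_enum_val /=; apply: eq_bigr => i _; rewrite fineK// finT//.
  exact: (fintype.subsetP DE _ (enum_valP i)).
have := hc #|D| (fun i => x (enum_val i)) (fun i => r (enum_val i)) _ _.
rewrite -Dfin => /(_ _ _) h1.
have {}h1 := h1 (fun i => rpos _ (fintype.subsetP DE _ (enum_valP i))).
have {}h1 := h1 ltac:(apply/trivIsetP => i j _ _ ij; apply: Ddis; rewrite ?enum_valP// (inj_eq enum_val_inj)//).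
have := hc3 f t _ mf f0 ffin t0 (_ : forall y, (\bigcup_i hball (x (@enum_val _ (mem D) i)) (r (enum_val i))) y -> _).
move=> h2.
have {}h2 : ((t ^+ 2)%:E * capacity alpha (\bigcup_i hball (x (@enum_val _ (mem D) i)) (r (enum_val i))) <= c3%:E * \int[lam]_y (f y ^+ 2)%:E)%E.
  apply: h2 => y [i _]; set p := enum_val i; rewrite /hball /= => py.
  have pE : p \in E := fintype.subsetP DE _ (enum_valP i).
  have [jE _] := jmP p; exists (x (jm p)), (h (jm p)); split => //; last exact: hE.
  have h3 : hdist (x (jm p)) y <= 72 * Num.sqrt (h (jm p)).
    have := hdist_triangle (x (jm p)) (x p) y; rewrite [hdist (x (jm p)) (x p)]hdistC.
    have := rpos p pE; move: py; rewrite /r /v.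
    by move: (72 * _) (hdist _ _) (hdist _ _) (hdist _ _) => *; lra.
  apply: (@le_trans _ _ ((72 * Num.sqrt (h (jm p))) ^+ 2)).
    by rewrite lerXn2r ?nnegrE ?hdist_ge0// mulr_ge0 ?sqrtr_ge0.
  by rewrite exprMn sqr_sqrtr ?(ltW (h0 _))// -natrX.
have t2 : 0 <= t ^+ 2 by exact: sqr_ge0.
apply: (@le_trans _ _ ((t ^+ 2 * N)%:E * (\sum_(p in D) fine (mu (tent (hball (x p) (r p)))))%:E)%E).
  by rewrite -EFinM lee_fin -(mulrA (t ^+ 2)); apply: ler_wpM2l.
apply: (@le_trans _ _ ((t ^+ 2 * N)%:E * (c%:E * capacity alpha (\bigcup_i hball (x (@enum_val _ (mem D) i)) (r (enum_val i)))))%E).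
  by apply: lee_wpmul2l => //; rewrite lee_fin mulr_ge0// ltW.
rewrite [t ^+ 2 * N]mulrC muleA -EFinM (_ : N * t ^+ 2 * c = N * c * t ^+ 2); last by ring.
rewrite EFinM -muleA [(_ * c3)%:E]EFinM -muleA; apply: lee_wpmul2l => //.
by rewrite lee_fin mulr_ge0// ltW.
Qed.
End weak_type.

Lemma ge0_integral_lincomb (R : realType) d (T : measurableType d) (nu : {measure set T -> \bar R})
    (D : set T) (I : finType) (P : pred I) (a : I -> R) (f : I -> T -> R) :
  measurable D -> (forall i, 0 <= a i) -> (forall i y, 0 <= f i y) ->
  (forall i, measurable_fun D (f i : T -> measurableTypeR R)) ->
  (\int[nu]_(y in D) (\sum_(i | P i) a i * f i y)%:E =
   \sum_(i | P i) (a i)%:E * \int[nu]_(y in D) (f i y)%:E)%E.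
Proof.
move=> mD a0 f0 mf.
transitivity (\int[nu]_(y in D) (\sum_(i <- enum P) (a i * f i y)%:E))%E.
  by apply: eq_integral => y _; rewrite sumEFin big_enum.
rewrite ge0_integral_sum//; last 2 first.
- move=> i; apply/measurable_EFinP; apply: (@measurable_funM _ _ _ _ (fun=> a i) (f i)) => //; exact: mf.
- by move=> i y _; rewrite lee_fin mulr_ge0.
rewrite big_enum /=; apply: eq_bigr => i _.
by under eq_integral do rewrite EFinM; rewrite ge0_integralZW// => y _; rewrite lee_fin.
Qed.

(** * Energies of discrete measures *)

Section potential_sum.
Variables (R : realType) (n : nat) (alpha : R).
Local Notation H := (heis R n).
Local Notation mR := (measurableTypeR R).
Local Notation lam := (@lebesgue_heis R n).

Variables (I : finType) (P : pred I) (a h : I -> R) (x : I -> H).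
Hypotheses (a0 : forall i, 0 <= a i) (h0 : forall i, 0 < h i).

(** The adjoint of the potential, applied to the discrete measure with masses a i at the points (x
    i, h i); its squared L^2 norm is comparable with the energy for the kernel [hK]. *)
Definition hPsum (y : H) : R := \sum_(i | P i) a i * hP alpha (x i) (h i) y.

Lemma hPsum_ge0 y : 0 <= hPsum y.
Proof. by apply: sumr_ge0 => i _; rewrite mulr_ge0// hP_ge0. Qed.

Lemma measurable_hPsum : measurable_fun [set: borel H] (hPsum : borel H -> mR).
Proof.
rewrite (_ : hPsum = fun y => \sum_(i <- enum P) a i * hP alpha (x i) (h i) y); last first.
  by apply/funext => y; rewrite big_enum.
apply: measurable_sum => i; apply: measurable_funM => //; exact: measurable_hP.
Qed.

Lemma hpot_hPsum w (k : R) :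
  (hpot alpha hPsum w k = \sum_(i | P i) (a i)%:E * \int[lam]_y (hP alpha w k y * hP alpha (x i) (h i) y)%:E)%E.
Proof.
rewrite -ge0_integral_lincomb//.
- by apply: eq_integral => y _; rewrite mulr_sumr; congr (_%:E); apply: eq_bigr => i _; ring.
- by move=> i y; rewrite mulr_ge0 ?hP_ge0.
- by move=> i; apply: measurable_funM; exact: measurable_hP.
Qed.
End potential_sum.

Section potential_sum_bounds.
Variables (R : realType) (n : nat) (alpha : R).
Hypotheses (alpha_gt : n%:R / 2 < alpha) (alpha_lt : alpha < (n%:R + 1) / 2).
Local Notation H := (heis R n).
Local Notation mR := (measurableTypeR R).
Local Notation lam := (@lebesgue_heis R n).

Lemma hpot_hPsum_ge : exists2 c : R, 0 < c & forall (I : finType) (P : pred I) (a h : I -> R) (x : I -> H) w (k : R),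
  (forall i, 0 <= a i) -> (forall i, 0 < h i) -> 0 < k ->
  ((c * \sum_(i | P i) a i * hK alpha w k (x i) (h i))%:E <= hpot alpha (hPsum alpha P a h x) w k)%E.
Proof.
have [c c0 hc] := hPP_integral_ge alpha_gt alpha_lt; exists c => // I P a h x w k a0 h0 k0.
rewrite hpot_hPsum// mulr_sumr -sumEFin; apply: lee_sum => i _.
by rewrite mulrCA EFinM; apply: lee_wpmul2l; [rewrite lee_fin | exact: hc].
Qed.

Lemma hPsum_sqr_le : exists2 c : R, 0 < c & forall (I : finType) (P : pred I) (a h : I -> R) (x : I -> H),
  (forall i, 0 <= a i) -> (forall i, 0 < h i) ->
  (\int[lam]_y (hPsum alpha P a h x y ^+ 2)%:E <=
    (c * \sum_(i | P i) a i * \sum_(j | P j) a j * hK alpha (x i) (h i) (x j) (h j))%:E)%E.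
Proof.
have [c c0 hc] := hPP_integral_le alpha_gt alpha_lt; exists c => // I P a h x a0 h0.
set f := hPsum alpha P a h x.
have -> : (\int[lam]_y (f y ^+ 2)%:E = \int[lam]_y (\sum_(i | P i) a i * (hP alpha (x i) (h i) y * f y))%:E)%E.
  apply: eq_integral => y _; rewrite expr2 {1}/f /hPsum mulr_suml; congr (_%:E).
  by apply: eq_bigr => i _; rewrite mulrA.
rewrite ge0_integral_lincomb//; last 2 first.
- by move=> i y; rewrite mulr_ge0 ?hP_ge0// hPsum_ge0.
- by move=> i; apply: measurable_funM; [exact: measurable_hP | exact: measurable_hPsum].
rewrite mulr_sumr -sumEFin; apply: lee_sum => i _; rewrite mulrCA EFinM.
apply: lee_wpmul2l; first by rewrite lee_fin.
rewrite -/(hpot alpha f (x i) (h i)) hpot_hPsum// mulr_sumr -sumEFin; apply: lee_sum => j _.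
by rewrite mulrCA EFinM; apply: lee_wpmul2l; [rewrite lee_fin | exact: hc].
Qed.

(** The sum is the integral of g times [hPsum]. Young's inequality with parameter l c makes the
    constant of [hPsum_sqr_le] cancel in the energy term. *)
Lemma sum_hpot_le : exists2 c : R, 0 < c & forall (I : finType) (P : pred I) (a h : I -> R) (x : I -> H) (g : borel H -> R) (l : R),
  (forall i, 0 <= a i) -> (forall i, 0 < h i) ->
  measurable_fun [set: borel H] (g : borel H -> mR) -> (forall y, 0 <= g y) -> 0 < l ->
  (\sum_(i | P i) (a i)%:E * hpot alpha g (x i) (h i) <=
   (l * c)%:E * \int[lam]_y (g y ^+ 2)%:E +
   (l^-1 * \sum_(i | P i) a i * \sum_(j | P j) a j * hK alpha (x i) (h i) (x j) (h j))%:E)%E.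
Proof.
have [c c0 hc] := hPsum_sqr_le; exists c => // I P a h x g l a0 h0 mg g0 l0.
have lc0 : 0 < l * c by rewrite mulr_gt0.
have h1 := hc I P a h x a0 h0; set f := hPsum alpha P a h x in h1.
set S := \sum_(i | P i) a i * _ in h1 *.
rewrite (_ : (\sum_(i | P i) _)%E = \int[lam]_y (f y * g y)%:E)%E; last first.
  rewrite -ge0_integral_lincomb//.
  - apply: eq_integral => y _; rewrite /f /hPsum mulr_suml; congr (_%:E).
    by apply: eq_bigr => i _; rewrite mulrA.
  - by move=> i y; rewrite mulr_ge0 ?hP_ge0.
  - by move=> i; apply: measurable_funM => //; exact: measurable_hP.
have f0 y : 0 <= f y by exact: hPsum_ge0.
have mf : measurable_fun [set: borel H] (f : borel H -> mR) by exact: measurable_hPsum.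
apply: (@le_trans _ _ (\int[lam]_y ((l * c)%:E * (g y ^+ 2)%:E) + \int[lam]_y ((l * c)^-1%:E * (f y ^+ 2)%:E))%E).
  apply: ge0_integral_le_add => //.
  - by apply/measurable_EFinP; apply: measurable_funM => //; exact: measurable_funX.
  - by apply/measurable_EFinP; apply: measurable_funM => //; exact: measurable_funX.
  - by move=> y _; rewrite lee_fin mulr_ge0.
  - by move=> y _; rewrite -EFinM lee_fin mulr_ge0 ?sqr_ge0// ltW.
  - by move=> y _; rewrite -EFinM lee_fin mulr_ge0 ?sqr_ge0// invr_ge0 ltW.
  - move=> y _; rewrite -!EFinM -EFinD lee_fin.
    move: (f0 y) (g0 y) lc0; move: (l * c) (f y) (g y) => k F G F0 G0 k0.
    rewrite -subr_ge0 (_ : _ - _ = ((k * G - F) ^+ 2 + k * (F * G)) / k); last by field; rewrite gt_eqF.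
    by rewrite divr_ge0 ?(ltW k0)// addr_ge0 ?sqr_ge0// mulr_ge0 ?(ltW k0)// mulr_ge0.
rewrite !ge0_integralZW ?(ltW lc0) ?invr_ge0 ?(ltW lc0)//; last 2 first.
- by move=> y _; rewrite lee_fin sqr_ge0.
- by move=> y _; rewrite lee_fin sqr_ge0.
apply: leeD2l; apply: (@le_trans _ _ ((l * c)^-1%:E * (c * S)%:E)%E).
  by apply: lee_wpmul2l => //; rewrite lee_fin invr_ge0 ltW.
by rewrite -EFinM lee_fin invfM -mulrA mulKf// gt_eqF.
Qed.

Lemma hpot_fin (g : borel H -> R) x (h : R) : measurable_fun [set: borel H] (g : borel H -> mR) ->
  (forall y, 0 <= g y) -> (\int[lam]_y (g y ^+ 2)%:E < +oo)%E -> 0 < h ->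
  hpot alpha g x h \is a fin_num.
Proof.
move=> mg g0 gfin h0.
have [c c0 hc] := sum_hpot_le.
have := hc 'I_1 xpredT (fun=> 1) (fun=> h) (fun=> x) g 1 ltac:(by []) ltac:(by []) mg g0 ltac:(by []).
rewrite !big_ord1 mul1e !mul1r => /le_lt_trans hh.
rewrite ge0_fin_numE; last by apply: integral_ge0 => y _; rewrite lee_fin mulr_ge0// hP_ge0.
apply: hh; rewrite lte_add_pinfty ?ltry// lte_mul_pinfty ?lee_fin ?(ltW c0)//.
Qed.
End potential_sum_bounds.

Section discrete_carleson.
Variables (R : realType) (n : nat) (alpha : R).
Hypotheses (alpha_gt : n%:R / 2 < alpha) (alpha_lt : alpha < (n%:R + 1) / 2).
Local Notation H := (heis R n).
Local Notation U := (siegelU R n).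
Local Notation V := (Cn1 R n).
Local Notation mR := (measurableTypeR R).
Local Notation lam := (@lebesgue_heis R n).

(** A maximum principle: if (x, h) is nearer to w than (y, k) in the sense of the hypothesis, then
    d(x, y)^2 + h + k is at most 4 d(w, y)^2 + 3 k by the triangle inequality. The height l only
    lowers the left-hand side. *)
Lemma hK_quasi (x y w : H) (h k l : R) : 0 < h -> 0 < k -> 0 < l ->
  hdist w x ^+ 2 + h <= hdist w y ^+ 2 + k ->
  hK alpha w l y k <= 4 `^ (n%:R + 1 - 2 * alpha) * hK alpha x h y k.
Proof.
move=> h0 k0 l0 hle; have s0 := ltW (sg_gt0 alpha_gt alpha_lt); rewrite /hK.
have D0 : 0 < hdist x y ^+ 2 + h + k by rewrite -addrA ltr_wpDl ?sqr_ge0// addr_gt0.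
have E : 4 `^ (n%:R + 1 - 2 * alpha) = 4^-1 `^ (- (n%:R + 1 - 2 * alpha)) by rewrite powRVp// opprK.
rewrite E -powRM ?(ltW D0)//; apply: powRN_le => //; first by rewrite mulr_gt0.
have := hdist_sq_triangle x w y; rewrite (hdistC x w) (hdistC y w).
have := sqr_ge0 (hdist w y); have := sqr_ge0 (hdist w x).
by move: (hdist w x ^+ 2) (hdist w y ^+ 2) (hdist x y ^+ 2) hle h0 k0 l0 => *; lra.
Qed.

Variable mu : {measure set (borel U) -> \bar R}.
Hypothesis hmu : subcapacitary alpha mu.

(** An instance of [strong_type_finite] with a the masses of the cells and u the potential of g at
    their centres. Its weak type hypothesis is [weak_type] for the function [hPsum] of the masses
    themselves, its duality hypothesis is [sum_hpot_le]. *)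
Lemma discrete_carleson : exists2 c : R, 0 < c & forall (I : finType) (x : I -> H) (h : I -> R) (Q : I -> set (borel U)),
  (forall i, 0 < h i) -> (forall i, measurable (Q i)) ->
  (forall i j, i != j -> Q i `&` Q j = set0) ->
  (forall i z, Q i z -> hdist (x i) (hpart (set_val z)) ^+ 2 <= h i /\ rho (set_val z : V) <= 4 * h i) ->
  forall (g : borel H -> R),
  measurable_fun [set: borel H] (g : borel H -> mR) -> (forall y, 0 <= g y) ->
  (\int[lam]_y (g y ^+ 2)%:E < +oo)%E ->
  (\sum_i mu (Q i) * (hpot alpha g (x i) (h i) ^+ 2) <= c%:E * \int[lam]_y (g y ^+ 2)%:E)%E.
Proof.
have [cw cw0 hw] := weak_type alpha_gt alpha_lt hmu.
have [c1 c10 hc1] := @hpot_hPsum_ge R n alpha alpha_gt alpha_lt.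
have [c2 c20 hc2] := @hPsum_sqr_le R n alpha alpha_gt alpha_lt.
have [c3 c30 hc3] := @sum_hpot_le R n alpha alpha_gt alpha_lt.
pose C := cw * c2 / c1 ^+ 2; pose q := 4 `^ (n%:R + 1 - 2 * alpha) : R.
have C0 : 0 < C by rewrite divr_gt0 ?exprn_gt0// mulr_gt0.
have q0 : 0 < q by rewrite powR_gt0.
exists (2048 * (C * q) * c3); first exact: mulr_gt0 (mulr_gt0 (ltr0n R 2048) (mulr_gt0 C0 q0)) c30.
move=> I x h Q h0 mQ dQ hQ g mg g0 gfin.
set G := (\int[lam]_y (g y ^+ 2)%:E)%E in gfin *.
have G0 : (0 <= G)%E by apply: integral_ge0 => y _; rewrite lee_fin sqr_ge0.
have Gf : G \is a fin_num by rewrite ge0_fin_numE.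
have uf i : hpot alpha g (x i) (h i) \is a fin_num by exact: hpot_fin.
have af i : mu (Q i) \is a fin_num.
  by rewrite ge0_fin_numE//; apply: (@cell_mass_fin _ _ _ alpha_gt alpha_lt mu hmu (x i) (h i)) => // z; exact: hQ.
pose a i := fine (mu (Q i)); pose u i := fine (hpot alpha g (x i) (h i)).
pose K i j := hK alpha (x i) (h i) (x j) (h j).
have a0 i : 0 <= a i by exact: fine_ge0.
have u0 i : 0 <= u i by apply: fine_ge0; apply: integral_ge0 => y _; rewrite lee_fin mulr_ge0// hP_ge0.
have K0 i j : 0 <= K i j by exact: hK_ge0.
have Ks i j : K i j = K j i by exact: hKC.
have W (E F : {set I}) (t : R) : 0 <= t -> (forall i, i \in E -> t <= \sum_(j in F) a j * K i j) ->
    t ^+ 2 * \sum_(i in E) a i <= C * \sum_(i in F) a i * \sum_(j in F) a j * K i j.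
  move=> t0 tE; set S := \sum_(i in F) _.
  have S0 : 0 <= S by apply: sumr_ge0 => i _; rewrite mulr_ge0// sumr_ge0// => j _; rewrite mulr_ge0.
  have := t0; rewrite le_eqVlt => /orP[/eqP <-|{}t0].
    by rewrite expr0n mul0r mulr_ge0// ltW.
  have h1 := hc2 I (mem F) a h x a0 h0; rewrite -/S in h1.
  set f := hPsum alpha (mem F) a h x in h1.
  have ffin : (\int[lam]_y (f y ^+ 2)%:E < +oo)%E := le_lt_trans h1 (ltry _).
  have ct0 : 0 < c1 * t by rewrite mulr_gt0.
  have hE i : i \in E -> ((c1 * t)%:E <= hpot alpha f (x i) (h i))%E.
    move=> iE; apply: le_trans (hc1 I (mem F) a h x (x i) (h i) a0 h0 (h0 i)).
    by rewrite lee_fin ler_pM2l//; exact: tE.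
  have h2 := hw I x h Q h0 mQ dQ hQ E f (c1 * t) (measurable_hPsum _ _ _ _ _) (hPsum_ge0 alpha _ h x a0) ffin ct0 hE.
  have h3 : (cw%:E * \int[lam]_y (f y ^+ 2)%:E <= cw%:E * (c2 * S)%:E)%E.
    by apply: lee_wpmul2l => //; rewrite lee_fin ltW.
  have := le_trans h2 h3; rewrite -EFinM lee_fin exprMn -(mulrA (c1 ^+ 2)) mulrC -ler_pdivlMr ?exprn_gt0//.
  by rewrite (_ : cw * (c2 * S) / c1 ^+ 2 = C * S)// /C mulrA mulrAC.
have QQ (F : {set I}) w : F != finset.set0 -> exists2 j, j \in F & forall i, i \in F -> K w i <= q * K j i.
  move=> /finset.set0Pn[i0 i0F].
  case: (@arg_minP _ _ _ i0 (mem F) (fun j => hdist (x w) (x j) ^+ 2 + h j) i0F) => j /= jF jmin.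
  by exists j => // i iF; apply: hK_quasi => //; exact: jmin.
have GG (c : I -> R) (l : R) : (forall i, 0 <= c i) -> 0 < l ->
    \sum_i c i * u i <= l * (c3 * fine G) + l^-1 * \sum_i \sum_j c i * c j * K i j.
  move=> cc0 l0; have := hc3 I xpredT c h x g l cc0 h0 mg g0 l0; rewrite -/G -(fineK Gf).
  rewrite (eq_bigr (fun i => (c i * u i)%:E)); last by move=> i _; rewrite /u EFinM fineK.
  rewrite sumEFin -EFinM -EFinD lee_fin mulrA => /le_trans; apply.
  rewrite lerD2l le_eqVlt; apply/orP; left; apply/eqP; congr (_ * _); apply: eq_bigr => i _; rewrite mulr_sumr.
  by apply: eq_bigr => j _; rewrite mulrA.
have := strong_type_finite a0 u0 K0 Ks C0 q0 W QQ GG.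
rewrite -(fineK Gf) -EFinM mulrA => h1.
rewrite (eq_bigr (fun i => (a i * u i ^+ 2)%:E)); first by rewrite sumEFin lee_fin.
by move=> i _; rewrite EFinM EFin_expe /a /u !fineK.
Qed.
End discrete_carleson.

(** * Whitney cells of the Siegel domain *)

Section whitney.
Variables (R : realType) (n : nat).
Local Notation C := (Cplx R).
Local Notation H := (heis R n).
Local Notation U := (siegelU R n).
Local Notation V := (Cn1 R n).
Local Notation mR := (measurableTypeR R).

Lemma rational_near (a e : R) : 0 < e -> exists q : rat, `|ratr q - a| < e.
Proof.
move=> e0; have [|q] := @rat_in_itvoo R (a - e) (a + e); first by rewrite ltrBlDr -addrA ltrDl addr_gt0.
by rewrite in_itv/= => qP; exists q; rewrite ltr_distl.
Qed.

Lemma rational_heis_near (y : H) (e : R) : 0 < e -> exists (t : n.*2.-tuple rat) (s : rat),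
  hdist ((row_of_seq n (map ratr t) : 'rV[C]_n, ratr s : R) : H) y ^+ 2 <= e.
Proof.
move=> e0; pose d := Num.min 1 (e / (n%:R + 1)).
have n0 : 0 < n%:R + 1 :> R by rewrite ltr_wpDl.
have d0 : 0 < d by rewrite lt_min ltr01 divr_gt0.
have d1 : d <= 1 by rewrite ge_min lexx.
have de : d * (n%:R + 1) <= e by rewrite -ler_pdivlMr// ge_min lexx orbT.
have [k kP] := @choice _ _ (fun (i : 'I_n.*2) (q : rat) => `|ratr q - heis_coord y i| < d)
  (fun i => rational_near (heis_coord y i) d0).
pose t := [tuple k i | i < n.*2]; pose u : 'rV[C]_n := row_of_seq n (map ratr t).
have [s sP] := rational_near (y.2 - 2^-1 * him u y.1) (divr_gt0 e0 (ltr0n R 2)).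
exists t, s; apply: le_trans (hdist_sq_le _ _) _.
have h1 : `|htau ((u, ratr s : R) : H) y| < e / 2.
  by move: sP; rewrite /htau /= (_ : ratr s - (_ - _) = ratr s - y.2 + 2^-1 * him u y.1)//; ring.
have tn i : (i < n.*2)%N -> `|nth 0 (map (@ratr R) t) i - heis_coord y i| < d.
  move=> hi; rewrite (nth_map 0) ?size_tuple//; have := kP (Ordinal hi).
  by rewrite -(tnth_nth 0 t (Ordinal hi)) tnth_mktuple.
have h2 : sqnorm (u - y.1) <= 2 * n%:R * d ^+ 2.
  rewrite sqnormE (_ : 2 * _ * _ = \sum_(j < n) (2 * d ^+ 2)); last first.
    by rewrite sumr_const card_ord -mulr_natl; ring.
  apply: ler_sum => j _; rewrite !mxE.
  have := tn j.*2; have := tn j.*2.+1; rewrite ltn_double ltn_Sdouble ltn_ord.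
  move=> /(_ isT) h3 /(_ isT); move: h3; rewrite !heis_coordRe !heis_coordIm.
  move: (nth _ _ _) (nth _ _ _); case: (y.1 0 j) => p q /= p' q'.
  rewrite !ltr_norml => /andP[a1 a2] /andP[a3 a4]; nra.
have h3 : d ^+ 2 <= d by rewrite expr2 ler_piMl ?(ltW d0).
have h4 : n%:R * d ^+ 2 <= n%:R * d by rewrite ler_wpM2l.
have n1 := ler0n R n; rewrite /=; move: h1 h2 de d0 e0 h4; rewrite -/u.
by move: (sqnorm _) `|_| => *; lra.
Qed.

(** Rational coordinates and rational heights are enumerated through a countable type. Density of
    the rationals supplies a height between s / 2 and s and a centre close enough for it. *)
Lemma whitney_centers : exists (x : nat -> H) (h : nat -> R), (forall k, 0 < h k) /\
  forall y (s : R), 0 < s -> exists k, [/\ hdist (x k) y ^+ 2 <= h k, h k <= 2 * s & s <= 4 * h k].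
Proof.
pose T : countType := (n.*2.-tuple rat * rat * rat)%type.
pose x k : H := if @unpickle T k is Some (t, s, _) then (row_of_seq n (map ratr t), ratr s) else (0, 0).
pose h k : R := if @unpickle T k is Some (_, _, q) then (if 0 < q then ratr q else 1) else 1.
exists x, h; split=> [k|y s s0].
  by rewrite /h; case: unpickle => [[[_ _] q]|]//; case: ifP => // q0; rewrite ltr0q.
have [|q] := @rat_in_itvoo R (s / 2) s; first by rewrite ltr_pdivrMr// ltr_pMr// ltr1n.
rewrite in_itv/= => /andP[q1 q2].
have q0 : 0 < ratr q :> R by apply: lt_trans q1; rewrite divr_gt0.
have [t [r tr]] := rational_heis_near y q0.
exists (pickle ((t, r, q) : T)); rewrite /x /h !pickleK/=.
rewrite ltr0q in q0; rewrite q0; split => //; lra.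
Qed.
(** Overlapping Whitney neighbourhoods are made disjoint by subtracting the earlier ones. The cells
    may be small or empty: what matters is that each stays in its neighbourhood and that together
    they cover. *)
Lemma whitney_cells : exists (x : nat -> H) (h : nat -> R) (Q : nat -> set (borel U)),
  [/\ forall k, 0 < h k, forall k, measurable (Q k), forall i j, i != j -> Q i `&` Q j = set0,
    forall k z, Q k z -> [/\ hdist (x k) (hpart (set_val z)) ^+ 2 <= h k,
      h k <= 2 * rho (set_val z : V) & rho (set_val z : V) <= 4 * h k] &
    forall z, exists k, Q k z].
Proof.
have [x [h [h0 hcov]]] := whitney_centers.
pose N k : set (borel U) := [set z : U | [/\ hdist (x k) (hpart (set_val z)) ^+ 2 <= h k,
   h k <= 2 * rho (set_val z : V) & rho (set_val z : V) <= 4 * h k]].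
have mN k : measurable (N k).
  have m1 : measurable_fun [set: borel U] (fun z : borel U => hdist (x k) (hpart (set_val z)) ^+ 2 : mR).
    apply: measurable_funX; apply: measurable_hdist; first exact: measurable_cst.
    exact: (measurableT_comp (@measurable_hpart R n) (@measurable_set_val R n)).
  have m2 : measurable_fun [set: borel U] (fun z : borel U => rho (set_val z : V) : mR).
    apply: measurableT_comp (@measurable_set_val R n).
    by apply: (@continuous_borel_measurable R V); exact: rho_continuous.
  rewrite (_ : N k = (fun z : borel U => hdist (x k) (hpart (set_val z)) ^+ 2 : mR) @^-1` `]-oo, h k] `&`
     (fun z : borel U => rho (set_val z : V) : mR) @^-1` `[h k / 2, 4 * h k]); last first.
    apply/seteqP; split => z /=; rewrite !in_itv/= ler_pdivrMr// [_ * 2]mulrC.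
      by move=> [? ? ?]; split => //; apply/andP.
    by move=> [? /andP[? ?]].
  by apply: measurableI; rewrite -[X in measurable X]setTI; [exact: m1|exact: m2].
exists x, h, (seqDU N); split => //.
- exact: seqDU_measurable.
- by move=> i j ij; have /trivIsetP := trivIset_seqDU N; apply.
- by move=> k z [].
- move=> z; have [k kP] := hcov (hpart (set_val z)) _ (siegel_val z).
  have : (\bigcup_k seqDU N k) z by rewrite -seqDU_bigcup_eq; exists k.
  by move=> [j _ jz]; exists j.
Qed.
End whitney.

Section subcapacitary_carleson.
Variables (R : realType) (n : nat) (alpha : R) (m : nat).
Hypotheses (alpha_gt : n%:R / 2 < alpha) (alpha_lt : alpha < (n%:R + 1) / 2) (m_gt : alpha < m%:R).
Local Notation H := (heis R n).
Local Notation U := (siegelU R n).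
Local Notation V := (Cn1 R n).
Local Notation mR := (measurableTypeR R).
Local Notation lam := (@lebesgue_heis R n).

Lemma hpot_comparable : exists2 c : R, 0 < c & forall (g : borel H -> R) x (h : R) y (s : R),
  (forall y, 0 <= g y) -> 0 < h -> hdist x y ^+ 2 <= h -> h <= 2 * s ->
  (hpot alpha g y s <= c%:E * hpot alpha g x h)%E.
Proof.
have b0 := b_gt0 alpha_gt alpha_lt.
(* The triangle inequality gives a factor 3, and h <= 2 s a further 2. *)
exists (6 `^ (n%:R + 1 - alpha)); first by rewrite powR_gt0.
move=> g x h y s g0 h0 xy hs; have s0 : 0 < s by lra.
rewrite /hpot -ge0_integralZW ?powR_ge0//; last by move=> z _; rewrite lee_fin mulr_ge0 ?hP_ge0.
apply: ge0_le_integralW => z _; first by rewrite lee_fin mulr_ge0 ?hP_ge0.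
rewrite -EFinM lee_fin mulrA ler_wpM2r// /hP.
have hN0 := hN_gt0 x z h0.
have -> : 6 `^ (n%:R + 1 - alpha) = 6^-1 `^ (- (n%:R + 1 - alpha)) by rewrite powRVp// opprK.
rewrite -powRM ?(ltW hN0)//; apply: powRN_le; rewrite ?(ltW b0) ?mulr_gt0//.
have := hN_comparable z h0 xy; rewrite /hN; have := sqr_ge0 (hdist y z).
by move: (hdist x z ^+ 2) (hdist y z ^+ 2) => *; lra.
Qed.

Definition hs_const : R := 4 ^+ m / Gamma (2 * m%:R - 2 * alpha).

Lemma hs_const_gt0 : 0 < hs_const.
Proof.
rewrite /hs_const; apply: divr_gt0; first by rewrite exprn_gt0.
by apply: Gamma_gt0; have := m_gt; lra.
Qed.

Variable mu : {measure set (borel U) -> \bar R}.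
Hypothesis hmu : subcapacitary alpha mu.

(** On each cell |F| is at most c2 c3 times the potential of g at the centre. The constant of
    [discrete_carleson] does not depend on the number of cells, so the bound passes from finitely
    many to all. *)
Lemma subcapacitary_carleson : carleson alpha m mu.
Proof.
have [x [h [Q [h0 mQ dQ QN QT]]]] := whitney_cells R n.
have [c1 c10 hc1] := discrete_carleson alpha_gt alpha_lt hmu.
have [c2 c20 hc2] := hardy_pointwise alpha_gt alpha_lt m_gt.
have [c3 c30 hc3] := hpot_comparable.
have G0 := hs_const_gt0.
pose K : R := (c2 * c3) ^+ 2; have K0 : 0 < K by rewrite exprn_gt0// mulr_gt0.
exists (K * c1 / hs_const); first by rewrite divr_gt0// mulr_gt0.
move=> F hF; rewrite /hs_normsq -/hs_const muleA -EFinM divfK ?gt_eqF//.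
have [g [mg g0 gle gF]] := hc2 F hF.
have gfin : (\int[lam]_y (g y ^+ 2)%:E < +oo)%E by apply: le_lt_trans gle _; have [] := hF.
apply: (@le_trans _ _ ((K * c1)%:E * \int[lam]_y (g y ^+ 2)%:E)%E); last first.
  by apply: lee_wpmul2l => //; rewrite lee_fin mulr_ge0// ltW.
pose v k := hpot alpha g (x k) (h k).
have vf k : v k \is a fin_num by exact: (hpot_fin alpha_gt alpha_lt).
pose u k := fine (v k).
have u0 k : 0 <= u k by apply: fine_ge0; apply: integral_ge0 => y _; rewrite lee_fin mulr_ge0 ?hP_ge0.
pose f k (z : borel U) : \bar R := (K * u k ^+ 2 * \1_(Q k) z)%:E.
have f0 k z : (0 <= f k z)%E by rewrite lee_fin mulr_ge0// mulr_ge0 ?sqr_ge0// ltW.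
apply: (@le_trans _ _ (\int[mu]_z (\sum_(0 <= k <oo) f k z))%E).
  apply: ge0_le_integralW => z _; first by rewrite lee_fin sqr_ge0.
  have [k zk] := QT z.
  apply: (@le_trans _ _ (\sum_(0 <= i < k.+1) f i z)%E); last by apply: nneseries_lim_ge.
  rewrite big_nat_recr//=; apply: (@le_trans _ _ (f k z)); last first.
    by rewrite leeDr// sume_ge0.
  rewrite /f indicE mem_set// mulr1 lee_fin /K -exprMn.
  have [N1 N2 N3] := QN _ _ zk.
  rewrite ler_pXn2r ?nnegrE ?cabs_ge0 ?mulr_ge0 ?(ltW c20) ?(ltW c30)//.
  have := gF (hpart (set_val z)) _ (siegel_val z); rewrite Psi_inv_hpart => h1.
  have h2 := hc3 g (x k) (h k) (hpart (set_val z)) (rho (set_val z : V)) g0 (h0 k) N1 N2.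
  rewrite -lee_fin; apply: (le_trans h1).
  apply: (@le_trans _ _ (c2%:E * (c3%:E * v k))%E).
    by apply: lee_wpmul2l => //; rewrite lee_fin ltW.
  by rewrite -(fineK (vf k)) -!EFinM mulrA.
rewrite integral_nneseries//; last first.
  by move=> k; apply/measurable_EFinP; apply: measurable_funM => //; exact: measurable_indic.
apply: lime_le; first by apply: is_cvg_nneseries => k _ _; apply: integral_ge0.
apply: nearW => L.
have := hc1 'I_L (fun k => x k) (fun k => h k) (fun k => Q k) (fun k => h0 k) (fun k => mQ k)
  (fun i j ij => dQ i j ij) _ g mg g0 gfin.
move=> /(_ (fun i z zi => conj (let: And3 a _ _ := QN _ _ zi in a) (let: And3 _ _ a := QN _ _ zi in a))) h1.
rewrite big_mkord (eq_bigr (fun k : 'I_L => K%:E * (mu (Q k) * hpot alpha g (x k) (h k) ^+ 2))%E); last first.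
  move=> k _; rewrite /f ge0_integralZ_indic//; last by rewrite mulr_ge0 ?sqr_ge0// ltW.
  by rewrite EFinM (EFin_expe (u k) 2) /u fineK// -muleA [(_ * mu _)%E]muleC.
rewrite -ge0_sume_distrr; last by move=> k _; rewrite mule_ge0// sqre_ge0.
by rewrite [(K * c1)%:E]EFinM -muleA; apply: lee_wpmul2l => //; rewrite lee_fin ltW.
Qed.
End subcapacitary_carleson.

(** * Test functions *)

Section kernel.
Variables (R : realType) (n : nat).
Local Notation C := (Cplx R).
Local Notation V := (Cn1 R n).
Local Notation H := (heis R n).
Local Notation e1 := ((0, 1) : V).
Implicit Types (w x y : H) (z : V).

Definition hlin (u : 'rV[C]_n) z : C := - 'i * z.2 - 2^-1 * hdot z.1 u.

Lemma hlin_linear u : linear (hlin u).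
Proof.
move=> a p q; rewrite /hlin /= /hdot.
have -> : \sum_(j < n) (a *: p.1 + q.1) 0 j * (u 0 j)^* =
   a * (\sum_(j < n) p.1 0 j * (u 0 j)^*) + \sum_(j < n) q.1 0 j * (u 0 j)^*.
  by rewrite mulr_sumr -big_split; apply: eq_bigr => j _; rewrite !mxE mulrDl mulrA.
move: (\sum_(j < n) _) (\sum_(j < n) _) => P Q.
by rewrite -[a *: (_ - _)]/(a * (_ - _)) -[a *: p.2]/(a * p.2); ring.
Qed.

HB.instance Definition _ u := @GRing.isLinear.Build _ _ _ _ (hlin u) (hlin_linear u).

Lemma hlin_continuous u : continuous (hlin u).
Proof.
move=> p; apply: (@cvgB _ C); apply: (@cvgM C); try exact: cvg_cst; first exact: cvg_snd.
apply: (@continuous_comp _ _ _ (fun q : V => q.1) (fun v : 'rV[C]_n => hdot v u)); first exact: cvg_fst.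
apply: (@continuous_big C^o) => [|j _ v]; first exact: add_continuous.
have c1 : {for v, continuous (fun x : 'rV[C]_n => x 0 j : C)} by exact: coord_continuous.
exact: (cvgM c1 (cvg_cst _)).
Qed.

(* Up to the factor 2, the Cauchy-Szego base [(zeta_{n+1} - conj omega_{n+1}) / i - zeta'.conj omega' / 2]
   for [omega = Psi_inv w k]. *)
Definition hA w (k : R) z : C := hlin w.1 z + ((4^-1 * sqnorm w.1 + k) +i* w.2)%C.

Lemma ReD (a b : C) : complex.Re (a + b) = complex.Re a + complex.Re b.
Proof. by case: a; case: b. Qed.

Lemma hlinE u z : hlin u z = ((complex.Im z.2 - 2^-1 * hre z.1 u) +i* (- complex.Re z.2 - 2^-1 * him z.1 u))%C.
Proof.
rewrite /hlin hdotE; have -> : (2^-1 : C) = (2^-1 : R)%:C by rewrite fmorphV /= rmorph_nat.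
by case: z.2 => a b; apply/eqP; rewrite eq_complex /=; apply/andP; split; apply/eqP; ring.
Qed.

Lemma hA_Psi_inv w k y s :
  hA w k (Psi_inv y s) = ((k + s + 4^-1 * sqnorm (y.1 - w.1)) +i* (- htau y w))%C.
Proof.
rewrite /hA hlinE /htau sqnormB; apply/eqP; rewrite eq_complex /=.
by apply/andP; split; apply/eqP; field.
Qed.

Lemma Re_hA w k z : complex.Re (hA w k z) = complex.Im z.2 + 4^-1 * sqnorm w.1 + k - 2^-1 * hre z.1 w.1.
Proof. by rewrite /hA hlinE ReD /=; ring. Qed.

Lemma Re_hA_gt0 w k z : 0 < k -> siegel z -> 0 < complex.Re (hA w k z).
Proof.
move=> k0 zs; rewrite -(Psi_inv_hpart z) hA_Psi_inv /=.
by rewrite ltr_wpDr ?mulr_ge0 ?sqnorm_ge0// addr_gt0.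
Qed.

(** The real part is the sum of the heights and |z|^2 / 4, the imaginary part is minus [htau]; so
    the modulus is comparable with the squared distance plus the heights. *)
Lemma hA_near w k y s : 0 < k -> 0 < s ->
  (hdist y w ^+ 2 + s + k) / 2 <= cabs (hA w k (Psi_inv y s)) /\
  cabs (hA w k (Psi_inv y s)) <= 2 * (hdist y w ^+ 2 + s + k).
Proof.
move=> k0 s0; rewrite hA_Psi_inv; set A := (_ +i* _)%C.
have t1 := htau_le_hdist y w; have t2 := hdist_sq_le y w; have t3 := sqnorm_le_hdist y w.
have q0 := sqnorm_ge0 (y.1 - w.1).
have h1 := cabs_Re A; have h2 := cabs_Im A; have h3 := cabs_le_ReIm A.
move: h1 h2 h3; rewrite /A /= normrN ger0_norm; last by rewrite !addr_ge0 ?mulr_ge0 ?(ltW k0) ?(ltW s0).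
by move: (cabs _) t1 t2 t3 q0; move: (hdist _ _ ^+ 2) `|_| (sqnorm _) => *; split; lra.
Qed.

Lemma cabs_shift_ge (b : R) (a : C) : 0 <= b -> 0 <= complex.Re a ->
  cabs a <= cabs (b%:C + a) /\ b <= cabs (b%:C + a).
Proof.
move=> b0; have h := cabs_Re (b%:C + a); case: a h => p q /= h p0.
have bp : 0 <= b + p by rewrite addr_ge0.
rewrite ger0_norm// in h; split; last by apply: le_trans h; rewrite lerDl.
rewrite /Normc.normc /= add0r ler_sqrt ?addr_ge0 ?sqr_ge0// lerD2r.
by rewrite ler_pXn2r ?nnegrE// lerDr.
Qed.

Lemma differentiable_hA w k z : differentiable (hA w k) z.
Proof.
apply: differentiableD; last exact: differentiable_cst.
by apply: linear_differentiable; exact: hlin_continuous.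
Qed.

Lemma is_derive_hA w k z : is_derive z e1 (hA w k) (- 'i).
Proof.
apply/is_derive_cderiv => e e0; exists 1 => // a _.
rewrite subr0 (_ : _ - _ - _ = 0) ?Normc.normc0 ?mulr_ge0 ?cabs_ge0 ?(ltW e0)//.
rewrite !Cn1_addZ /hA /hlin /= scale0r mul0r !scaler0 !addr0 mulr1.
by move: (hdot _ _) => t; ring.
Qed.

Lemma pole_neq0 (b : R) w k z : 0 <= b -> 0 < k -> siegel z -> b%:C + hA w k z != 0.
Proof.
move=> b0 k0 zs; have R0 := Re_hA_gt0 w k0 zs.
apply/eqP => E; have := congr1 (fun a : C => complex.Re a) E; rewrite ReD /=.
by move=> E'; have := ltr_wpDl b0 R0; rewrite E' ltxx.
Qed.

Definition pole (b : R) w (k : R) (q : nat) z : C := (b%:C + hA w k z)^-1 ^+ q.+1.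

Lemma differentiable_pole (b : R) w k q z : 0 <= b -> 0 < k -> siegel z -> differentiable (pole b w k q) z.
Proof.
move=> b0 k0 zs.
have d1 : differentiable (fun z => (b%:C + hA w k z)^-1 : C) z.
  apply: differentiableV; last exact: pole_neq0.
  by apply: differentiableD; [exact: differentiable_cst|exact: differentiable_hA].
rewrite (_ : pole b w k q = (fun z => (b%:C + hA w k z)^-1 : C) ^+ q.+1); last first.
  by apply/funext => p; rewrite exprfctE.
exact: differentiableX.
Qed.

Lemma is_derive_pole (b : R) w k q z : 0 <= b -> 0 < k -> siegel z ->
  is_derive z e1 (pole b w k q) (q.+1%:R * 'i * pole b w k q.+1 z).
Proof.
move=> b0 k0 zs; have nz := pole_neq0 w b0 k0 zs.
have dB : is_derive z e1 (fun z => b%:C + hA w k z : C) (- 'i).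
  apply: is_derive_eq (is_deriveD (is_derive_cst _ _ _) (is_derive_hA _ _ _)) _.
  by rewrite add0r.
have [dB1 dB2] := dB.
have dV : is_derive z e1 (fun z => (b%:C + hA w k z)^-1 : C) ('i * (b%:C + hA w k z)^-1 ^+ 2).
  apply: DeriveDef; first exact: derivableV.
  by rewrite deriveV// dB2 -[_ *: _]/(_ * _) exprVn; ring.
rewrite (_ : pole b w k q = (fun z => (b%:C + hA w k z)^-1 : C) ^+ q.+1); last first.
  by apply/funext => p; rewrite exprfctE.
apply: is_derive_eq (is_deriveX q.+1 dV) _.
by rewrite -[_ *: _]/(_ * _) /pole /= [in RHS]exprS [in RHS]exprS expr2; ring.
Qed.
End kernel.

Section iterated_derivative.
Variables (R : realType) (n : nat).
Local Notation C := (Cplx R).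
Local Notation V := (Cn1 R n).
Local Notation e1 := ((0, 1) : V).

(** The induction hypothesis holds only on the Siegel domain; the domain is open, so the two
    functions agree near z and have the same derivative there. *)
Lemma iter_dlastE (G : nat -> V -> C) :
  (forall k z, siegel z -> is_derive z e1 (G k) (G k.+1 z)) ->
  forall k z, siegel z -> iter k (@dlast R n) (G 0%N) z = G k z.
Proof.
move=> dG; elim=> [//|k IH] z zs /=.
have E : \forall p \near z, iter k (@dlast R n) (G 0%N) p = G k p.
  have : nbhs z (@siegel R n) by apply: open_nbhs_nbhs; split => //; exact: siegel_open.
  by apply: filterS => p; exact: IH.
rewrite {1}/dlast (near_eq_derive _ E).
by have [_ ->] := dG k z zs.
Qed.

Lemma is_derive_lincomb (I : Type) (s : seq I) (c : I -> C) (f : I -> V -> C) (l : I -> C) z :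
  (forall i, is_derive z e1 (f i) (l i)) ->
  is_derive z e1 (fun z => \sum_(i <- s) c i * f i z : C) (\sum_(i <- s) c i * l i).
Proof.
move=> h; elim: s => [|i s IH].
  rewrite big_nil (_ : (fun _ => _) = cst 0); first exact: is_derive_cst.
  by apply/funext => p; rewrite big_nil.
rewrite big_cons (_ : (fun _ => _) = (c i \*: f i) + (fun z => \sum_(i <- s) c i * f i z : C)).
  exact: is_deriveD (is_deriveZ (c i) (h i)) IH.
by apply/funext => p; rewrite big_cons.
Qed.

Lemma differentiable_lincomb (I : Type) (s : seq I) (c : I -> C) (f : I -> V -> C) z :
  (forall i, differentiable (f i) z) ->
  differentiable (fun z => \sum_(i <- s) c i * f i z : C) z.
Proof.
move=> h; elim: s => [|i s IH].
  rewrite (_ : (fun _ => _) = cst 0); first exact: differentiable_cst.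
  by apply/funext => p; rewrite big_nil.
rewrite (_ : (fun _ => _) = (c i \*: f i) + (fun z => \sum_(i <- s) c i * f i z : C)).
  exact: differentiableD (differentiableZ _ (h i)) IH.
by apply/funext => p; rewrite big_cons.
Qed.
End iterated_derivative.

(** * Dyadic sums in place of fractional powers *)

Section dyadic.
Context {R : realType}.
Local Notation mR := (measurableTypeR R).
Local Notation leb := (@lebesgue_measure R).

Lemma powR2_gt1 (s : R) : 0 < s -> 1 < 2 `^ s.
Proof.
move=> s0; rewrite /powR ifF; last by apply/negbTE; rewrite pnatr_eq0.
by rewrite expR_gt1 mulr_gt0// ln_gt0// ltr1n.
Qed.

Lemma dyadic_low_le (e b N : R) (M : nat) : 0 < e -> 0 < b -> 0 < N ->
  \sum_(l < M) (b * 2 ^+ l <= N)%R%:R * (b * 2 ^+ l) `^ e <= (2 `^ e - 1)^-1 * 2 `^ e * N `^ e.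
Proof.
move=> e0 b0 N0; set k := (2 `^ e - 1)^-1.
have p1 : 1 < 2 `^ e := powR2_gt1 e0.
have k0 : 0 < k by rewrite invr_gt0 subr_gt0.
have kE : k + 1 = k * 2 `^ e by rewrite /k; field; rewrite gt_eqF// subr_gt0.
(* Two bounds are carried by the induction: the one by the next term keeps the sum geometric as long
   as terms are below N, and it yields the one by N^e whenever such a term is added. *)
suff : \sum_(l < M) (b * 2 ^+ l <= N)%R%:R * (b * 2 ^+ l) `^ e <= k * (b * 2 ^+ M) `^ e /\
   \sum_(l < M) (b * 2 ^+ l <= N)%R%:R * (b * 2 ^+ l) `^ e <= k * 2 `^ e * N `^ e by case.
have bl0 j : 0 < b * 2 ^+ j by rewrite mulr_gt0// exprn_gt0.
have bS j : (b * 2 ^+ j.+1) `^ e = 2 `^ e * (b * 2 ^+ j) `^ e.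
  rewrite (_ : b * 2 ^+ j.+1 = 2 * (b * 2 ^+ j)); last by rewrite exprS mulrCA.
  exact: powRM (ler0n _ 2) (ltW (bl0 j)).
elim: M => [|M [IH1 IH2]].
  by rewrite big_ord0 !mulr_ge0 ?powR_ge0// ltW.
rewrite !big_ord_recr /= bS; move: (\sum_(l < M) _) IH1 IH2 => S IH1 IH2.
have P0 := powR_ge0 (b * 2 ^+ M) e.
case: (leP (b * 2 ^+ M) N) => bN; last first.
  rewrite mul0r addr0; split => //; apply: le_trans IH1 _; rewrite ler_wpM2l ?(ltW k0)//.
  by rewrite ler_peMl// ltW.
have PN : (b * 2 ^+ M) `^ e <= N `^ e.
  by apply: ge0_ler_powR => //; rewrite ?nnegrE ?(ltW e0) ?(ltW (bl0 M)) ?(ltW N0).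
have h : S + 1 * (b * 2 ^+ M) `^ e <= k * 2 `^ e * (b * 2 ^+ M) `^ e.
  by rewrite -kE mulrDl lerD2r.
split; first by rewrite mulrA.
by apply: le_trans h _; rewrite ler_wpM2l// mulr_ge0 ?powR_ge0// ltW.
Qed.

(** The induction removes the first term and doubles b; the maximum of b and N in the proof makes
    the bound stable under this. *)
Lemma dyadic_high_le (f b N : R) (M : nat) : 0 < f -> 0 < b -> 0 < N ->
  \sum_(l < M) (N < b * 2 ^+ l)%R%:R * (b * 2 ^+ l) `^ (- f) <= (1 - 2 `^ (- f))^-1 * N `^ (- f).
Proof.
move=> f0 b0 N0; set k := (1 - 2 `^ (- f))^-1.
have p1 : 2 `^ (- f) < 1 :> R by rewrite powR2_lt1// oppr_lt0.
have k0 : 0 < k by rewrite invr_gt0 subr_gt0.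
have kE : 1 + k * 2 `^ (- f) = k by rewrite /k; field; rewrite gt_eqF// subr_gt0.
suff : \sum_(l < M) (N < b * 2 ^+ l)%R%:R * (b * 2 ^+ l) `^ (- f) <= k * (Num.max b N) `^ (- f).
  move/le_trans; apply; rewrite ler_wpM2l ?(ltW k0)//; apply: powRN_le; rewrite ?(ltW f0)//.
  by rewrite le_max lexx orbT.
elim: M b b0 => [|M IH] b b0; first by rewrite big_ord0 mulr_ge0 ?powR_ge0// ltW.
rewrite big_ord_recl expr0 mulr1.
rewrite (eq_bigr (fun l : 'I_M => (N < 2 * b * 2 ^+ l)%R%:R * (2 * b * 2 ^+ l) `^ (- f))); last first.
  by move=> l _; rewrite lift0 exprS mulrA [b * 2]mulrC.
have b20 : 0 < 2 * b by rewrite mulr_gt0.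
have := IH _ b20; move: (\sum_(l < M) _) => S hS.
case: (ltP N b) => Nb.
  apply: (@le_trans _ _ (b `^ (- f) + k * (2 `^ (- f) * b `^ (- f)))).
    rewrite mul1r lerD2l; apply: le_trans hS _; rewrite -powRM ?(ltW b0)// ler_wpM2l ?(ltW k0)//.
    by apply: powRN_le; rewrite ?(ltW f0) ?le_max ?lexx.
  by rewrite mulrA -[X in X + _]mul1r -mulrDl kE.
rewrite mul0r add0r; apply: le_trans hS _; rewrite ler_wpM2l ?(ltW k0)//.
by apply: powRN_le; rewrite ?(ltW f0)// le_max lexx orbT.
Qed.

(** A dyadic version of the integral of B^(e - 1) (B + N)^-q over (0, +oo): the terms with B <= N
    grow geometrically as e > 0, those with B > N decay geometrically as e < q. *)
Lemma dyadic_sum_le (e q : R) : 0 < e -> e < q -> exists2 c : R, 0 < c & forall (b N : R) (M : nat),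
  0 < b -> 0 < N ->
  \sum_(l < M) (b * 2 ^+ l) `^ e * (b * 2 ^+ l + N) `^ (- q) <= c * N `^ (e - q).
Proof.
move=> e0 eq; have f0 : 0 < q - e by rewrite subr_gt0.
have p1 : 1 < 2 `^ e := powR2_gt1 e0.
have p2 : 2 `^ (- (q - e)) < 1 :> R by rewrite powR2_lt1// oppr_lt0.
exists ((2 `^ e - 1)^-1 * 2 `^ e + (1 - 2 `^ (- (q - e)))^-1).
  by rewrite addr_gt0 ?invr_gt0 ?subr_gt0// mulr_gt0 ?powR_gt0// invr_gt0 subr_gt0.
move=> b N M b0 N0; have q0 : 0 < q by rewrite (lt_trans e0).
have bl0 j : 0 < b * 2 ^+ j by rewrite mulr_gt0// exprn_gt0.
have h1 := dyadic_low_le M e0 b0 N0; have h2 := dyadic_high_le M f0 b0 N0.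
have NE : N `^ (e - q) = N `^ e * N `^ (- q) by rewrite powRDp.
apply: (@le_trans _ _ (\sum_(l < M) ((b * 2 ^+ l <= N)%R%:R * (b * 2 ^+ l) `^ e * N `^ (- q) +
    (N < b * 2 ^+ l)%R%:R * (b * 2 ^+ l) `^ (- (q - e))))).
  apply: ler_sum => l _; have B0 := bl0 l; move: (b * 2 ^+ l) B0 => B B0.
  case: (leP B N) => BN; rewrite ?mul1r ?mul0r ?addr0 ?add0r.
    by rewrite ler_wpM2l ?powR_ge0// powRN_le ?(ltW q0)// lerDr ltW.
  rewrite (_ : - (q - e) = e + - q); last by ring.
  by rewrite powRDp// ler_wpM2l ?powR_ge0// powRN_le ?(ltW q0)// lerDl ltW.
rewrite big_split /= -mulr_suml mulrDl; apply: lerD; last by rewrite -[e - q]opprB.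
by rewrite NE mulrA ler_wpM2r ?powR_ge0.
Qed.

(** The factor s^(g - 1) need not be singular, so only s^(t - 1) with t = min(g, 1/2) goes into the
    singular factor of [growth_integral]; the rest is bounded by a power of s + N. *)
Lemma weight_integral_le (g q : R) : 0 < g -> g < q -> exists2 c : R, 0 < c & forall N : R, 0 < N ->
  (\int[leb]_(s in `]0%R, +oo[) ((s : R) `^ (g - 1) * (N + s) `^ (- q))%:E <= (c * N `^ (g - q))%:E)%E.
Proof.
move=> g0 gq; pose t : R := Num.min g 2^-1.
have t0 : 0 < t by rewrite lt_min g0 invr_gt0/=.
have tg : t <= g by rewrite ge_min lexx.
have t2 : t <= 2^-1 by rewrite ge_min lexx orbT.
have [C C0 hC] := @growth_integral R 1 (1 - t) (q - g + t) 2 ltac:(lra) ltac:(lra) ltac:(by []) ltac:(lra) ltac:(lra).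
exists C => // N N0.
have mN : measurable_fun [set: mR] (fun s : mR => `|s : R| : mR) by exact: normr_measurable.
have := hC _ mR leb (fun s : mR => `|s : R|) mN (fun s => normr_ge0 _) lebesgue_abs_growth N N0.
rewrite (_ : 1 - (1 - t) - (q - g + t) = g - q); last by ring.
apply: le_trans; rewrite [leLHS]integral_mkcond; apply: ge0_le_integralW => s _; rewrite /patch; case: ifPn => //.
- by rewrite lee_fin mulr_ge0 ?powR_ge0.
- rewrite inE /= in_itv/= andbT => s0; rewrite lee_fin gtr0_norm//.
  have Ns : 0 < s + N by rewrite addr_gt0.
  rewrite (_ : g - 1 = - (1 - t) + (g - t)); last by ring.
  rewrite powRDp// -mulrA ler_wpM2l ?powR_ge0// [N + s]addrC.
  rewrite (_ : - (q - g + t) = (g - t) + - q); last by ring.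
  rewrite (powRDp _ _ Ns) ler_wpM2r ?powR_ge0//.
  by apply: ge0_ler_powR; rewrite ?nnegrE ?subr_ge0// ?lerDl ltW.
- by move=> _; rewrite lee_fin mulr_ge0 ?powR_ge0.
Qed.
End dyadic.

Section vanishing.
Variables (R : realType) (n : nat).
Local Notation C := (Cplx R).
Local Notation V := (Cn1 R n).
Local Notation H := (heis R n).
Implicit Types (F : V -> C).

Definition vanish_unif F := forall r e : R, 0 < r -> 0 < e -> exists M : R,
  forall (z : 'rV[C]_n) (w : C), Num.sqrt (sqnorm z) <= r -> M < complex.Im w -> cabs (F (z, w)) <= e.

Lemma vanish_unif_vanishes F : vanish_unif F -> vanishes_at_infinity F.
Proof.
move=> hF r r0 A A0.
have /nbhs_ballP[e /= e0 eA] : nbhs (0 : R) (fun x => A x%:E) by exact: A0.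
have [M hM] := hF r (e / 2) r0 (divr_gt0 e0 (ltr0n R 2)).
exists M => w Mw /=; set S := ereal_sup _.
have S1 : (S <= (e / 2)%:E)%E.
  by apply: ge_ereal_sup => _ [z zr <-]; rewrite lee_fin; exact: hM.
have S0 : (0 <= S)%E.
  apply: le_trans (ereal_sup_ubound (_ : _ (cabs (F (0, w)))%:E)); first by rewrite lee_fin cabs_ge0.
  exists 0 => //=; rewrite /sqnorm big1 ?sqrtr0 ?(ltW r0)// => j _.
  by rewrite mxE Normc.normc0 expr0n.
have Sf : S \is a fin_num by rewrite ge0_fin_numE// (le_lt_trans S1)// ltry.
rewrite -(fineK Sf); apply: eA; rewrite /ball /= sub0r normrN ger0_norm ?fine_ge0//.
have : fine S <= e / 2 by rewrite -lee_fin fineK.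
by move/le_lt_trans; apply; rewrite ltr_pdivrMr// ltr_pMr// ltr1n.
Qed.

Lemma vanish_unif_lincomb (I : Type) (s : seq I) (c : I -> C) (f : I -> V -> C) :
  (forall i, vanish_unif (f i)) -> vanish_unif (fun z => \sum_(i <- s) c i * f i z).
Proof.
move=> h; elim: s => [|i s IH] r e r0 e0.
  by exists 0 => z w _ _; rewrite big_nil Normc.normc0 ltW.
have k0 : 0 < cabs (c i) + 1 by rewrite ltr_wpDl ?cabs_ge0.
have e2 : 0 < e / 2 by rewrite divr_gt0.
have [M1 h1] := h i r (e / 2 / (cabs (c i) + 1)) r0 (divr_gt0 e2 k0).
have [M2 h2] := IH r (e / 2) r0 e2.
exists (Num.max M1 M2) => z w zr; rewrite gt_max => /andP[w1 w2].
rewrite big_cons; apply: le_trans (cabsD _ _) _; rewrite [leRHS]splitr.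
apply: lerD; last exact: h2.
have := h1 z w zr w1; rewrite ler_pdivlMr// => hh; apply: le_trans hh.
by rewrite cabsM mulrC ler_wpM2l ?cabs_ge0// lerDl.
Qed.

(** Re hA is at least the imaginary part of the last coordinate minus a bounded multiple of |z|, so
    the pole is small uniformly for |z| <= r. *)
Lemma vanish_unif_pole (b : R) (w : H) (k : R) : 0 <= b -> 0 < k -> vanish_unif (pole b w k 0).
Proof.
move=> b0 k0 r e r0 e0; exists (e^-1 + 2^-1 * (r * Num.sqrt (sqnorm w.1))) => z v zr Mv.
set q := r * Num.sqrt (sqnorm w.1) in Mv.
have hz : hre z w.1 <= q.
  apply: (@le_trans _ _ (Num.sqrt (sqnorm z) * Num.sqrt (sqnorm w.1))); last first.
    by rewrite ler_wpM2r ?sqrtr_ge0.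
  apply: le_trans (ler_norm _) _; rewrite -sqrtr_sqr -sqrtrM ?sqnorm_ge0// ler_wsqrtr//.
  by apply: le_trans (hdot_cauchy_schwarz z w.1); rewrite lerDl sqr_ge0.
have R1 : e^-1 <= complex.Re (hA w k (z, v)).
  rewrite Re_hA /=; have := sqnorm_ge0 w.1; move: Mv hz k0.
  move: q (hre _ _) (sqnorm _) (e^-1).
  by move=> *; lra.
have ei : 0 < e^-1 by rewrite invr_gt0.
have R0 := le_trans (ltW ei) R1.
have [c1 _] := cabs_shift_ge b0 R0.
have c2 := cabs_Re (hA w k (z, v)); rewrite ger0_norm// in c2.
have c3 := le_trans R1 (le_trans c2 c1).
rewrite /pole expr1 cabsV invf_ple ?posrE//; exact: lt_le_trans c3.
Qed.
End vanishing.

(** Lagrange's identity: twice the difference of the two sides is a sum of squares with nonnegative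
    coefficients. *)
Lemma weighted_cauchy_schwarz (R : realFieldType) (I : finType) (a v w : I -> R) :
  (forall i, 0 <= a i) -> (forall i, 0 < w i) ->
  (\sum_i a i * v i) ^+ 2 <= (\sum_i a i * w i) * \sum_i a i * (v i ^+ 2 / w i).
Proof.
move=> a0 w0; set S := \sum_i a i * v i; set P := \sum_i _ * w _; set T := \sum_i _.
suff : S ^+ 2 + S ^+ 2 <= P * T + T * P by lra.
rewrite /S /P /T expr2 !big_distrlr /= -!big_split; apply: ler_sum => i _.
rewrite -!big_split; apply: ler_sum => j _ /=.
have wi := w0 i; have wj := w0 j.
rewrite -subr_ge0 (_ : _ - _ = a i * a j * (w i * v j - w j * v i) ^+ 2 / (w i * w j)); last first.
  by field; rewrite !gt_eqF.
by apply: divr_ge0; apply: mulr_ge0; rewrite ?sqr_ge0 ?mulr_ge0 ?(ltW wi) ?(ltW wj).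
Qed.

Section test_function.
Variables (R : realType) (n : nat) (alpha : R).
Hypotheses (alpha_gt : n%:R / 2 < alpha) (alpha_lt : alpha < (n%:R + 1) / 2).
Local Notation C := (Cplx R).
Local Notation V := (Cn1 R n).
Local Notation H := (heis R n).
Local Notation mR := (measurableTypeR R).
Local Notation leb := (@lebesgue_measure R).
Local Notation lam := (@lebesgue_heis R n).
Local Notation e1 := ((0, 1) : V).

(** Since Re hA > 0, the modulus of b + hA is at least b and at least |hA| >= N / 2, with N as in
    [hA_near]; hence it is at least (b + N) / 3. *)
Lemma cabs_pole_le (b : R) (w : H) (k : R) q (y : H) (s : R) : 0 < b -> 0 < k -> 0 < s ->
  cabs (pole b w k q (Psi_inv y s)) <=
  3 ^+ q.+1 * (b + (hdist y w ^+ 2 + s + k)) `^ (- q.+1%:R).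
Proof.
move=> b0 k0 s0; have [h1 _] := hA_near w y k0 s0.
have R0 := ltW (Re_hA_gt0 w k0 (siegel_Psi_inv y s0)).
have [h2 h3] := cabs_shift_ge (ltW b0) R0.
rewrite /pole cabsX cabsV; move: (cabs (_ + _)) (cabs _) h1 h2 h3 => B A h1 h2 h3.
set N := (_ + _ + _) in h1 *; have N0 : 0 < N by rewrite /N -addrA ltr_wpDl ?sqr_ge0// addr_gt0.
have B0 : 0 < B := lt_le_trans b0 h3.
have bN0 : 0 < b + N by rewrite addr_gt0.
rewrite powRN powR_mulrn ?(ltW bN0)// -exprVn -exprMn ler_pXn2r ?nnegrE ?invr_ge0 ?(ltW B0)//; last first.
  by rewrite mulr_ge0// invr_ge0 ltW.
rewrite -[leRHS]invrK lef_pV2 ?posrE ?invr_gt0 ?mulr_gt0 ?invr_gt0// invfM invrK mulrC ler_pdivrMr//.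
by clear N0 bN0; move: N h1 => *; lra.
Qed.

Section sum_of_poles.
Variables (I : finType) (M : nat) (b : R) (a h : I -> R) (x : I -> H).
Hypotheses (b0 : 0 < b) (a0 : forall i, 0 <= a i) (h0 : forall i, 0 < h i).

Local Notation d l := (b * 2 ^+ l).

(* The sum over the dyadic poles [d l] stands for the fractional power [hA ^ -(n + 1 - 2 alpha)]. *)
Definition tfun (q : nat) (z : V) : C := \sum_(p : I * 'I_M)
  ((a p.1 * d p.2 `^ (2 * alpha - n%:R))%:C * (q`!%:R * 'i ^+ q)) * pole (d p.2) (x p.1) (h p.1) q z.

Let d0 l : 0 < d l. Proof. by rewrite mulr_gt0// exprn_gt0. Qed.

Lemma is_derive_tfun q z : siegel z -> is_derive z e1 (tfun q) (tfun q.+1 z).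
Proof.
move=> zs; apply: is_derive_eq.
  apply: is_derive_lincomb => p; exact: is_derive_pole (ltW (d0 _)) (h0 _) zs.
rewrite /tfun; apply: eq_bigr => p _; rewrite factS natrM exprS.
by move: (pole _ _ _ _ _) (_%:C) => P A; ring.
Qed.

Lemma holomorphic_tfun : holomorphic (tfun 0).
Proof.
move=> z zs; apply: differentiable_lincomb => p.
exact: differentiable_pole (ltW (d0 _)) (h0 _) zs.
Qed.

Lemma vanishes_tfun : vanishes_at_infinity (tfun 0).
Proof.
apply: vanish_unif_vanishes; apply: vanish_unif_lincomb => p.
exact: vanish_unif_pole (ltW (d0 _)) (h0 _).
Qed.

Lemma iter_dlast_tfun q z : siegel z -> iter q (@dlast R n) (tfun 0) z = tfun q z.
Proof. by move=> zs; apply: (@iter_dlastE _ _ tfun) => // k p; exact: is_derive_tfun. Qed.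

(** Every pole has positive real part, so all terms may be dropped but the one with d k <= N < 2 d
    k. There |d k + hA| <= 5 d k, and the real part of the pole is at least 1 / (25 d k). The bounds
    on N guarantee that this k is among the M terms. *)
Lemma tfun_ge (y : H) (s : R) : 0 < s ->
  (forall i, b <= hdist y (x i) ^+ 2 + s + h i < d M) ->
  \sum_i a i * hK alpha y s (x i) (h i) <= 25 * cabs (tfun 0 (Psi_inv y s)).
Proof.
move=> s0 hb; have sg0 := sg_gt0 alpha_gt alpha_lt.
have := cabs_Re (tfun 0 (Psi_inv y s)); move/(le_trans (ler_norm _)) => hRe.
apply: (@le_trans _ _ (25 * complex.Re (tfun 0 (Psi_inv y s)))); last by rewrite ler_wpM2l.
rewrite /tfun (big_morph _ (@ReD R) (erefl : complex.Re (0 : C) = 0)).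
rewrite (eq_bigr (fun p : I * 'I_M => a p.1 * (d p.2 `^ (2 * alpha - n%:R) *
   complex.Re (pole (d p.2) (x p.1) (h p.1) 0 (Psi_inv y s))))); last first.
  move=> p _; rewrite fact0 expr0 !mulr1; move: (pole _ _ _ _ _) (_ `^ _) => [u v] A /=; ring.
have Re0 l i : complex.Re (pole (d l) (x i) (h i) 0 (Psi_inv y s)) =
    (d l + complex.Re (hA (x i) (h i) (Psi_inv y s))) / cabs ((d l)%:C + hA (x i) (h i) (Psi_inv y s)) ^+ 2.
  rewrite /pole expr1; case: (hA _ _ _) => u v /=.
  by rewrite /Normc.normc sqr_sqrtr ?addr_ge0 ?sqr_ge0.
have Rp i : 0 < complex.Re (hA (x i) (h i) (Psi_inv y s)) := Re_hA_gt0 (x i) (h0 i) (siegel_Psi_inv y s0).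
rewrite -(pair_bigA _ (fun i (l : 'I_M) => a i * (d l `^ (2 * alpha - n%:R) *
   complex.Re (pole (d l) (x i) (h i) 0 (Psi_inv y s))))) /= mulr_sumr.
apply: ler_sum => i _; rewrite -mulr_sumr [leRHS]mulrCA ler_wpM2l//.
have /andP[hb1 hb2] := hb i; have [_ A2] := hA_near (x i) y (h0 i) s0.
rewrite /hK; set N := hdist _ _ ^+ 2 + s + h i in hb1 hb2 A2 *.
have N0 : 0 < N := lt_le_trans b0 hb1.
have [|k /andP[k1 k2]] := @dyadic_bracket R (N / b); first by rewrite ler_pdivlMr// mul1r.
have kM : (k < M)%N.
  by rewrite -(@ltr_eXn2l R 2) ?ltr1n//; apply: le_lt_trans k1 _; rewrite ltr_pdivrMr// mulrC.
move: k1 k2; rewrite ler_pdivlMr// ltr_pdivrMr// exprS -mulrA [_ * b]mulrC => k1 k2.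
rewrite (bigD1 (Ordinal kM))//= mulrDr; apply: ler_wpDr.
  rewrite mulr_ge0//; apply: sumr_ge0 => l _; rewrite mulr_ge0 ?powR_ge0// Re0.
  by rewrite divr_ge0 ?sqr_ge0// addr_ge0 ?(ltW (Rp i)) ?(ltW (d0 l)).
rewrite Re0; have D0 := d0 k; move: (d k) D0 k1 k2 => D D0 k1 k2.
set B := cabs (_ + _).
have BD : B <= 5 * D.
  apply: le_trans (cabsD _ _) _; rewrite cabs_real gtr0_norm//.
  by move: (cabs _) A2 => *; lra.
have [_ B1] := cabs_shift_ge (ltW D0) (ltW (Rp i)); rewrite -/B in B1.
have B0 : 0 < B := lt_le_trans D0 B1.
apply: (@le_trans _ _ (D `^ (- (n%:R + 1 - 2 * alpha)))).
  by apply: powRN_le => //; exact: ltW.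
rewrite (_ : - (n%:R + 1 - 2 * alpha) = (2 * alpha - n%:R) + - 1); last by ring.
rewrite powRDp// mulrCA ler_wpM2l ?powR_ge0// powR_inv1 ?(ltW D0)//.
rewrite mulrA ler_pdivlMr ?exprn_gt0// ler_pdivrMl//.
apply: (@le_trans _ _ ((5 * D) ^+ 2)); first by rewrite ler_pXn2r ?nnegrE ?(ltW B0)// mulr_ge0// ltW.
rewrite (_ : (5 * D) ^+ 2 = D * (25 * D)); last by ring.
by rewrite ler_wpM2l ?(ltW D0)// ler_wpM2l// lerDl ltW.
Qed.
End sum_of_poles.

(** Here moduli may be summed: the exponent 2 alpha - n of the weights lies strictly between 0 and q
    + 1, so the dyadic sum of the q-th derivatives has size N^(2 alpha - n - q - 1). *)
Lemma tfun_le (q : nat) : exists2 c : R, 0 < c & forall (I : finType) (M : nat) (b : R) (a h : I -> R) (x : I -> H),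
  0 < b -> (forall i, 0 <= a i) -> (forall i, 0 < h i) -> forall (y : H) (s : R), 0 < s ->
  cabs (tfun M b a h x q (Psi_inv y s)) <=
    c * \sum_i a i * (hdist y (x i) ^+ 2 + s + h i) `^ (- (n%:R + 1 - 2 * alpha + q%:R)).
Proof.
have e0 : 0 < 2 * alpha - n%:R by have := alpha_gt; lra.
have eq : 2 * alpha - n%:R < q.+1%:R.
  rewrite -natr1; have := sg_gt0 alpha_gt alpha_lt; have := ler0n R q; lra.
have [c c0 hc] := dyadic_sum_le e0 eq.
exists (q`!%:R * 3 ^+ q.+1 * c); first by rewrite !mulr_gt0// ?exprn_gt0// ltr0n fact_gt0.
move=> I M b a h x b0 a0 h0 y s s0.
apply: le_trans (cabs_sum_le _ _) _.
pose N i := hdist y (x i) ^+ 2 + s + h i.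
have N0 i : 0 < N i by rewrite /N -addrA ltr_wpDl ?sqr_ge0// addr_gt0.
apply: (@le_trans _ _ (\sum_(p : I * 'I_M) a p.1 * (q`!%:R * 3 ^+ q.+1 *
   ((b * 2 ^+ p.2) `^ (2 * alpha - n%:R) * (b * 2 ^+ p.2 + N p.1) `^ (- q.+1%:R))))).
  apply: ler_sum => -[i l] _ /=.
  have d0 : 0 < b * 2 ^+ l by rewrite mulr_gt0// exprn_gt0.
  rewrite !cabsM cabsX i_abs1 expr1n mulr1 cabs_real ger0_norm; last by rewrite mulr_ge0 ?powR_ge0.
  have -> : cabs (q`!%:R : C) = q`!%:R by rewrite -(rmorph_nat (@real_complex R)) cabs_real ger0_norm.
  have := cabs_pole_le (x i) q y d0 (h0 i) s0; rewrite -/(N i).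
  move: (_ `^ (- _)) (_ `^ _) (powR_ge0 (b * 2 ^+ l) (2 * alpha - n%:R)) (cabs _) => P D D0 Q QP.
  rewrite (_ : _ * (_ * (D * P)) = a i * D * q`!%:R * (3 ^+ q.+1 * P)); last by ring.
  by rewrite ler_wpM2l// !mulr_ge0.
rewrite -(pair_bigA _ (fun i (l : 'I_M) => a i * (q`!%:R * 3 ^+ q.+1 *
   ((b * 2 ^+ l) `^ (2 * alpha - n%:R) * (b * 2 ^+ l + N i) `^ (- q.+1%:R))))) /= mulr_sumr.
apply: ler_sum => i _; rewrite -mulr_sumr -mulr_sumr -/(N i) [leRHS]mulrCA ler_wpM2l// -[leRHS]mulrA ler_wpM2l//.
apply: le_trans (hc b (N i) M b0 (N0 i)) _.
by rewrite le_eqVlt; apply/orP; left; apply/eqP; congr (_ * _ `^ _); rewrite -natr1; ring.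
Qed.
End test_function.

Section test_function_norm.
Variables (R : realType) (n : nat) (alpha : R) (m : nat).
Hypotheses (alpha_gt : n%:R / 2 < alpha) (alpha_lt : alpha < (n%:R + 1) / 2) (m_gt : alpha < m%:R).
Local Notation C := (Cplx R).
Local Notation V := (Cn1 R n).
Local Notation H := (heis R n).
Local Notation mR := (measurableTypeR R).
Local Notation leb := (@lebesgue_measure R).
Local Notation lam := (@lebesgue_heis R n).

(** Cauchy-Schwarz with the weights W = N^-(n + 1 - alpha), the values of the kernels [hP] at y. The
    height integral of the squared m-th derivative of one term is of order W^2, and division by W
    leaves W. So the vertical integral is at most a multiple of the square of [hPsum] at y, whose
    integral is controlled by the energy. *)
Lemma tfun_hs_integral_le : exists2 c : R, 0 < c & forall (I : finType) (M : nat) (b : R) (a h : I -> R) (x : I -> H),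
  0 < b -> (forall i, 0 <= a i) -> (forall i, 0 < h i) ->
  (hs_integral alpha m (tfun alpha M b a h x 0) <=
    (c * \sum_i a i * \sum_j a j * hK alpha (x i) (h i) (x j) (h j))%:E)%E.
Proof.
have [c1 c10 hc1] := @tfun_le R n alpha alpha_gt alpha_lt m.
have [c2 c20 hc2] := @hPsum_sqr_le R n alpha alpha_gt alpha_lt.
have g0 : 0 < 2 * m%:R - 2 * alpha by have := m_gt; lra.
pose q : R := 2 * (n%:R + 1 - 2 * alpha + m%:R).
have gq : 2 * m%:R - 2 * alpha < q.
  by rewrite /q; have := sg_gt0 alpha_gt alpha_lt; have := alpha_gt0 alpha_gt alpha_lt; lra.
have [c3 c30 hc3] := weight_integral_le g0 gq.
exists (c1 ^+ 2 * c3 * c2); first by rewrite !mulr_gt0// exprn_gt0.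
move=> I M b a h x b0 a0 h0.
set F := tfun alpha M b a h x 0.
have hF : cholo F by apply: holomorphic_cholo; exact: holomorphic_tfun.
rewrite (hs_integralE alpha m hF).
apply: (@le_trans _ _ (\int[lam]_y ((c1 ^+ 2 * c3)%:E * (hPsum alpha xpredT a h x (y : H) ^+ 2)%:E))%E); last first.
  have k0 : 0 <= c1 ^+ 2 * c3 by rewrite mulr_ge0 ?sqr_ge0// ltW.
  rewrite ge0_integralZW//; last by move=> y _; rewrite lee_fin sqr_ge0.
  by rewrite -(mulrA (c1 ^+ 2 * c3)) [leRHS]EFinM; apply: lee_wpmul2l => //; exact: hc2.
apply: ge0_le_integralW => y _; first by apply: integral_ge0 => s _; rewrite lee_fin sqr_ge0.
pose N i := hN (x i) (h i) y; have N0 i : 0 < N i by exact: hN_gt0.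
pose W i := N i `^ (- (n%:R + 1 - alpha)); have W0 i : 0 < W i by exact: powR_gt0.
pose P := hPsum alpha xpredT a h x y.
have P0 : 0 <= P by exact: hPsum_ge0.
pose f i (s : mR) : R := (W i)^-1 * ((s : R) `^ (2 * m%:R - 2 * alpha - 1) * (N i + s) `^ (- q)).
have f0 i s : 0 <= f i s by rewrite mulr_ge0 ?invr_ge0 ?(ltW (W0 i))// mulr_ge0 ?powR_ge0.
have mf i : measurable_fun [set: mR] (f i : mR -> mR).
  apply: measurable_funM; first exact: measurable_cst.
  apply: measurable_funM; first exact: measurable_powR.
  apply: (measurableT_comp (measurable_powR _)); apply: measurable_funD => //; exact: measurable_cst.
have cP : 0 <= c1 ^+ 2 * P by rewrite mulr_ge0 ?sqr_ge0.
apply: (@le_trans _ _ (\int[leb]_(s in `]0%R, +oo[) ((c1 ^+ 2 * P)%:E * (\sum_i a i * f i s)%:E))%E).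
  apply: ge0_le_integralW => s; first by move=> _; rewrite lee_fin sqr_ge0.
  rewrite /= in_itv/= andbT => s0; rewrite -EFinM lee_fin /vdens sgabsE; last exact: siegel_Psi_inv.
  rewrite iter_dlast_tfun//; last exact: siegel_Psi_inv.
  have := hc1 I M b a h x b0 a0 h0 y s s0.
  set v := fun i => (hdist y (x i) ^+ 2 + s + h i) `^ (- (n%:R + 1 - 2 * alpha + m%:R)).
  have := weighted_cauchy_schwarz v a0 W0; rewrite -/P => cs hv.
  have v0 : 0 <= \sum_i a i * v i by apply: sumr_ge0 => i _; rewrite mulr_ge0 ?powR_ge0.
  have sw : (s `^ (m%:R - alpha - 2^-1)) ^+ 2 = s `^ (2 * m%:R - 2 * alpha - 1).
    by rewrite -powR_mulrn ?powR_ge0// -powRrM; congr (_ `^ _); field.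
  rewrite exprMn sw.
  apply: (@le_trans _ _ (c1 ^+ 2 * (P * \sum_i a i * (v i ^+ 2 / W i)) * s `^ (2 * m%:R - 2 * alpha - 1))).
    rewrite ler_wpM2r ?powR_ge0//; apply: (@le_trans _ _ ((c1 * \sum_i a i * v i) ^+ 2)).
      by rewrite ler_pXn2r ?nnegrE ?cabs_ge0// mulr_ge0// ltW.
    by rewrite exprMn ler_wpM2l ?sqr_ge0.
  rewrite le_eqVlt; apply/orP; left; apply/eqP.
  have -> : \sum_i a i * f i s = (\sum_i a i * (v i ^+ 2 / W i)) * s `^ (2 * m%:R - 2 * alpha - 1).
    rewrite mulr_suml; apply: eq_bigr => i _.
    have vE : v i ^+ 2 = (N i + s) `^ (- q).
      rewrite /v /N /hN hdistC [in RHS]addrAC -powR_mulrn ?powR_ge0// -powRrM.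
      by congr (_ `^ _); rewrite /q; ring.
    by rewrite /f vE; ring.
  by ring.
rewrite ge0_integralZW//; last first.
  by move=> s _; rewrite lee_fin sumr_ge0// => i _; rewrite mulr_ge0.
rewrite ge0_integral_lincomb//; last by move=> i; apply: measurable_funTS; exact: mf.
apply: (@le_trans _ _ ((c1 ^+ 2 * P)%:E * (\sum_i (a i * (c3 * W i))%:E))%E).
  apply: lee_wpmul2l => //; apply: lee_sum => i _; rewrite EFinM; apply: lee_wpmul2l; first by rewrite lee_fin.
  rewrite /f; under eq_integral do rewrite EFinM.
  rewrite ge0_integralZW ?invr_ge0 ?(ltW (W0 i))//; last by move=> s _; rewrite lee_fin mulr_ge0 ?powR_ge0.
  apply: (@le_trans _ _ ((W i)^-1%:E * (c3 * N i `^ (2 * m%:R - 2 * alpha - q))%:E)%E).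
    by apply: lee_wpmul2l; [rewrite lee_fin invr_ge0 (ltW (W0 i))|exact: hc3].
  rewrite -EFinM lee_fin mulrCA ler_wpM2l ?(ltW c30)//.
  rewrite /W -powRN opprK -powRDp// le_eqVlt; apply/orP; left; apply/eqP.
  by congr (_ `^ _); rewrite /q; ring.
rewrite sumEFin -!EFinM lee_fin.
rewrite (eq_bigr (fun i => c3 * (a i * hP alpha (x i) (h i) y))); last by move=> i _; rewrite mulrCA.
rewrite -mulr_sumr -/(hPsum alpha xpredT a h x y) -/P le_eqVlt; apply/orP; left; apply/eqP; ring.
Qed.

Lemma tfun_hardy_sobolev (I : finType) (M : nat) (b : R) (a h : I -> R) (x : I -> H) :
  0 < b -> (forall i, 0 <= a i) -> (forall i, 0 < h i) -> hardy_sobolev alpha m (tfun alpha M b a h x 0).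
Proof.
move=> b0 a0 h0; split; [exact: holomorphic_tfun|exact: vanishes_tfun|].
by have [c _ hc] := tfun_hs_integral_le; apply: le_lt_trans (hc I M b a h x b0 a0 h0) (ltry _).
Qed.

(** lo and hi only determine the first dyadic scale and the number M of terms; neither c nor 25
    depends on them. *)
Lemma test_function : exists2 c : R, 0 < c & forall (I : finType) (a h : I -> R) (x : I -> H) (lo hi : R),
  0 < lo -> (forall i, 0 <= a i) -> (forall i, 0 < h i) -> exists F : V -> C,
  [/\ hardy_sobolev alpha m F,
     (hs_integral alpha m F <= (c * \sum_i a i * \sum_j a j * hK alpha (x i) (h i) (x j) (h j))%:E)%E &
     forall (y : H) (s : R), 0 < s -> (forall i, lo <= hdist y (x i) ^+ 2 + s + h i <= hi) ->
       \sum_i a i * hK alpha y s (x i) (h i) <= 25 * cabs (F (Psi_inv y s))].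
Proof.
have [c c0 hc] := tfun_hs_integral_le; exists c => // I a h x lo hi lo0 a0 h0.
have [M hM] : exists M : nat, hi < lo * 2 ^+ M.
  exists (Num.bound `|hi / lo|); rewrite mulrC -ltr_pdivrMr//.
  apply: le_lt_trans (ler_norm _) _; apply: lt_trans (archi_boundP (normr_ge0 _)) _.
  by rewrite -natrX ltr_nat ltn_expl.
exists (tfun alpha M lo a h x 0); split; first exact: tfun_hardy_sobolev.
- exact: hc.
- move=> y s s0 hb; apply: (tfun_ge alpha_gt alpha_lt) => // i.
  by have /andP[-> /le_lt_trans] := hb i; apply.
Qed.
End test_function_norm.

(** * Carleson measures are subcapacitary *)

Section carleson_subcapacitary.
Variables (R : realType) (n : nat) (alpha : R) (m : nat).
Hypotheses (alpha_gt : n%:R / 2 < alpha) (alpha_lt : alpha < (n%:R + 1) / 2) (m_gt : alpha < m%:R).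
Local Notation C := (Cplx R).
Local Notation V := (Cn1 R n).
Local Notation U := (siegelU R n).
Local Notation H := (heis R n).
Local Notation mR := (measurableTypeR R).
Local Notation lam := (@lebesgue_heis R n).

Definition near_cell (x : H) (h : R) (z : U) := [/\ hdist x (hpart (set_val z)) ^+ 2 <= h,
  h <= 2 * rho (set_val z : V) & rho (set_val z : V) <= 4 * h].

Lemma near_cell_dist (x w : H) (h k : R) (z : U) : near_cell x h z ->
  hdist (hpart (set_val z)) w ^+ 2 + rho (set_val z : V) + k <= 2 * hdist x w ^+ 2 + 6 * h + k.
Proof.
move=> [z1 z2 z3]; have := hdist_sq_triangle (hpart (set_val z)) x w.
rewrite (hdistC _ x) (hdistC w x); move: (rho _) z2 z3 => r z2 z3.
by move: (hdist x _ ^+ 2) z1 (hdist x w ^+ 2) (hdist _ _ ^+ 2) => *; lra.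
Qed.

Lemma near_cell_hK (x w : H) (h k : R) (z : U) : 0 < h -> 0 < k -> near_cell x h z ->
  hK alpha x h w k <= 6 `^ (n%:R + 1 - 2 * alpha) * hK alpha (hpart (set_val z)) (rho (set_val z : V)) w k.
Proof.
move=> h0 k0 zc; have s0 := ltW (sg_gt0 alpha_gt alpha_lt); rewrite /hK.
have D0 : 0 < hdist (hpart (set_val z)) w ^+ 2 + rho (set_val z : V) + k.
  by rewrite -addrA ltr_wpDl ?sqr_ge0// addr_gt0//; exact: siegel_val.
have -> : 6 `^ (n%:R + 1 - 2 * alpha) = 6^-1 `^ (- (n%:R + 1 - 2 * alpha)) by rewrite powRVp// opprK.
rewrite -powRM ?(ltW D0)//; apply: powRN_le => //; first by rewrite mulr_gt0.
have := near_cell_dist w k zc; have := sqr_ge0 (hdist x w).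
by move: (hdist _ _ ^+ 2 + rho _ + k) (hdist x w ^+ 2) => *; lra.
Qed.

Variable mu : {measure set (borel U) -> \bar R}.
Hypothesis hmu : carleson alpha m mu.

(** The Carleson inequality is applied to a test function built from the masses a: on [Q i] its
    modulus is at least a fixed multiple of the potential of the masses at (x i, h i), and its norm
    is bounded by their energy. *)
Lemma carleson_cells : exists2 c : R, 0 < c & forall (I : finType) (x : I -> H) (a h : I -> R) (Q : I -> set (borel U)),
  (forall i, 0 <= a i) -> (forall i, 0 < h i) -> (forall i, measurable (Q i)) ->
  (forall i j, i != j -> Q i `&` Q j = set0) -> (forall i z, Q i z -> near_cell (x i) (h i) z) ->
  (\sum_i ((\sum_j a j * hK alpha (x i) (h i) (x j) (h j)) ^+ 2)%:E * mu (Q i) <=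
   (c * \sum_i a i * \sum_j a j * hK alpha (x i) (h i) (x j) (h j))%:E)%E.
Proof.
have [c1 c10 hc1] := hmu.
have [c2 c20 hc2] := test_function alpha_gt alpha_lt m_gt.
have G0 := hs_const_gt0 m_gt.
pose b : R := 6 `^ (n%:R + 1 - 2 * alpha); have b0 : 0 < b by rewrite powR_gt0.
pose k := (b * 25) ^+ 2; have k0 : 0 < k by rewrite exprn_gt0// mulr_gt0.
exists (k * (c1 * (hs_const alpha m * c2))); first exact: mulr_gt0 k0 (mulr_gt0 c10 (mulr_gt0 G0 c20)).
move=> I x a h Q a0 h0 mQ dQ cQ; set S := \sum_i a i * _.
(* [L^-1] lies below every h i, and the sum of all [T i j] lies above every quantity d^2 + s + h j
   that occurs on a cell: these are the lo and hi of the test function. *)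
pose L : R := 1 + \sum_i (h i)^-1.
have hL i : L^-1 <= h i.
  rewrite -[h i]invrK lef_pV2 ?posrE ?invr_gt0//; last first.
    by rewrite ltr_pwDl// sumr_ge0// => j _; rewrite invr_ge0 ltW.
  rewrite /L (bigD1 i)//= addrCA lerDl addr_ge0// sumr_ge0// => j _.
  by rewrite invr_ge0 ltW.
have L0 : 0 < L^-1 by rewrite invr_gt0 ltr_pwDl// sumr_ge0// => j _; rewrite invr_ge0 ltW.
pose T i j := 2 * hdist (x i) (x j) ^+ 2 + 6 * h i + h j.
have T0 i j : 0 <= T i j by have hi := h0 i; have hj := h0 j; have := sqr_ge0 (hdist (x i) (x j)); rewrite /T; lra.
have [F [F1 F2 F3]] := hc2 I a h x L^-1 (\sum_i \sum_j T i j) L0 a0 h0.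
pose u i := \sum_j a j * hK alpha (x i) (h i) (x j) (h j).
have u0 i : 0 <= u i by apply: sumr_ge0 => j _; rewrite mulr_ge0 ?hK_ge0.
have Fge i z : Q i z -> u i <= b * 25 * cabs (F (set_val z)).
  move=> /cQ zc; have := F3 (hpart (set_val z)) (rho (set_val z : V)) (siegel_val z).
  rewrite Psi_inv_hpart => hF; rewrite -mulrA.
  apply: (@le_trans _ _ (b * \sum_j a j * hK alpha (hpart (set_val z)) (rho (set_val z : V)) (x j) (h j))).
    rewrite mulr_sumr; apply: ler_sum => j _; rewrite mulrCA ler_wpM2l//.
    exact: near_cell_hK.
  rewrite ler_wpM2l ?(ltW b0)//; apply: hF => j; apply/andP; split.
    apply: le_trans (hL j) _; rewrite lerDr addr_ge0 ?sqr_ge0//; exact/ltW/siegel_val.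
  apply: le_trans (near_cell_dist (x j) (h j) zc) _; rewrite -/(T i j).
  rewrite (bigD1 i)//= (bigD1 j)//= -addrA lerDl addr_ge0 ?sumr_ge0// => i' _.
  by rewrite sumr_ge0.
have hQ : (\int[mu]_z (\sum_i u i ^+ 2 * \1_(Q i) z)%:E <= k%:E * \int[mu]_z (cabs (F (set_val z)) ^+ 2)%:E)%E.
  rewrite -ge0_integralZW ?(ltW k0)//; last by move=> z _; rewrite lee_fin sqr_ge0.
  apply: ge0_le_integralW => z _.
    by rewrite lee_fin sumr_ge0// => i _; rewrite mulr_ge0 ?sqr_ge0.
  rewrite -EFinM lee_fin; have k1 : 0 <= k * cabs (F (set_val z)) ^+ 2 by rewrite mulr_ge0 ?sqr_ge0 ?(ltW k0).
  have [[i iz]|no] := pselect (exists i, Q i z); last first.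
    by rewrite big1// => i _; rewrite indicE memNset ?mulr0// => iz; apply: no; exists i.
  rewrite (bigD1 i)//= big1 => [|j ji]; last first.
    rewrite indicE memNset ?mulr0// => jz.
    by have : (Q j `&` Q i) z by []; rewrite dQ.
  rewrite indicE mem_set// mulr1 addr0 /k -exprMn ler_pXn2r ?nnegrE ?u0 ?mulr_ge0 ?cabs_ge0 ?(ltW b0)//.
  exact: Fge.
have u20 i : 0 <= u i ^+ 2 by exact: sqr_ge0.
rewrite ge0_integral_lincomb// in hQ; last by move=> i; exact: measurable_indic.
apply: (@le_trans _ _ (\sum_i (u i ^+ 2)%:E * \int[mu]_z (\1_(Q i) z)%:E)%E).
  by apply: lee_sum => i _; rewrite (integral_indic _ measurableT)// setIT.
apply: (le_trans hQ); rewrite -(mulrA k) [leRHS]EFinM; apply: lee_wpmul2l; first by rewrite lee_fin ltW.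
apply: (le_trans (hc1 F F1)); rewrite -(mulrA c1) [leRHS]EFinM; apply: lee_wpmul2l; first by rewrite lee_fin ltW.
rewrite /hs_normsq -/(hs_const alpha m) -(mulrA (hs_const _ _)) [leRHS]EFinM; apply: lee_wpmul2l; first by rewrite lee_fin ltW.
exact: F2.
Qed.

(** [carleson_cells] for a single cell with mass 1, where the kernel at the centre is a positive
    number. *)
Lemma carleson_cell_fin (x : H) (h : R) (Q : set (borel U)) : 0 < h -> measurable Q ->
  (forall z, Q z -> near_cell x h z) -> mu Q \is a fin_num.
Proof.
move=> h0 mQ cQ; have [c c0 hc] := carleson_cells.
have := hc 'I_1 (fun=> x) (fun=> 1) (fun=> h) (fun=> Q) (fun=> ler01) (fun=> h0) (fun=> mQ) _ (fun=> cQ).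
move=> /(_ (fun i j => _)) hh; have {}hh := hh ltac:(by move=> i j; rewrite !ord1 eqxx).
move: hh; rewrite !big_ord1 !mul1r => hh.
rewrite ge0_fin_numE//; case: (mu Q) (measure_ge0 mu Q) hh => [r _ _||]//; first exact: ltry.
move=> _; rewrite mulry gtr0_sg ?mul1e//; apply: exprn_gt0; apply: powR_gt0.
by rewrite hdistxx expr0n add0r addr_gt0.
Qed.

(** With a the masses of the cells, u their potential and S the sum of a u, [carleson_cells] bounds
    the sum of a u^2 by c S. By Cauchy-Schwarz S^2 is at most the total mass times c S, and one
    factor S cancels. *)
Lemma cells_energy_le : exists2 c : R, 0 < c & forall (I : finType) (x : I -> H) (h : I -> R) (Q : I -> set (borel U))
  (a := fun i => fine (mu (Q i))), (forall i, 0 < h i) -> (forall i, measurable (Q i)) ->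
  (forall i j, i != j -> Q i `&` Q j = set0) -> (forall i z, Q i z -> near_cell (x i) (h i) z) ->
  \sum_i a i * \sum_j a j * hK alpha (x i) (h i) (x j) (h j) <= c * \sum_i a i.
Proof.
have [c c0 hc] := carleson_cells; exists c => // I x h Q a h0 mQ dQ cQ.
have a0 i : 0 <= a i by exact: fine_ge0.
have aE i : mu (Q i) = (a i)%:E by rewrite /a fineK//; apply: carleson_cell_fin (h0 i) _ (cQ i).
have := hc I x a h Q a0 h0 mQ dQ cQ.
pose u i := \sum_j a j * hK alpha (x i) (h i) (x j) (h j); rewrite -/(u _).
rewrite (eq_bigr (fun i => (a i * u i ^+ 2)%:E)); last by move=> i _; rewrite aE muleC.
rewrite sumEFin lee_fin; set S := \sum_i a i * u i => hS.
have cs := weighted_cauchy_schwarz u a0 (fun=> ltr01).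
rewrite -/S in cs; have S0 : 0 <= S.
  by apply: sumr_ge0 => i _; rewrite mulr_ge0// sumr_ge0// => j _; rewrite mulr_ge0 ?hK_ge0.
have A0 : 0 <= \sum_i a i by exact: sumr_ge0.
have {}cs : S ^+ 2 <= (\sum_i a i) * (c * S).
  apply: le_trans cs _; apply: ler_pM.
  - by apply: sumr_ge0 => i _; rewrite mulr1.
  - by apply: sumr_ge0 => i _; rewrite divr1 mulr_ge0 ?sqr_ge0.
  - by apply: ler_sum => i _; rewrite mulr1.
  - by apply: le_trans hS; apply: ler_sum => i _; rewrite divr1.
have := S0; rewrite le_eqVlt => /orP[/eqP <-|Sp]; first by rewrite mulr_ge0// ltW.
by move: cs; rewrite mulrCA mulrA expr2 ler_pM2r.
Qed.

(** By [hpot_ge1] the potential of f is bounded below at the centres of nonempty cells, so the total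
    mass is at most k times the pairing of f with the masses. Duality bounds the pairing by the
    integral of f^2 and the energy, and the energy is at most c1 times the mass. *)
Lemma cells_mass_le : exists2 c : R, 0 < c & forall (I : finType) (x : I -> H) (h : I -> R) (Q : I -> set (borel U))
  (f : borel H -> R), (forall i, 0 < h i) -> (forall i, measurable (Q i)) ->
  (forall i j, i != j -> Q i `&` Q j = set0) -> (forall i z, Q i z -> near_cell (x i) (h i) z) ->
  measurable_fun [set: borel H] (f : borel H -> mR) -> (forall y, 0 <= f y) ->
  (forall i z, Q i z -> forall y, hball (hpart (set_val z)) (Num.sqrt (rho (set_val z : V))) y ->
     (1 <= riesz_potential alpha f y)%E) ->
  (\sum_i mu (Q i) <= c%:E * \int[lam]_y (f y ^+ 2)%:E)%E.
Proof.
have [c1 c10 hc1] := cells_energy_le.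
have [c2 c20 hc2] := hpot_ge1 alpha_gt alpha_lt.
have [c3 c30 hc3] := hpot_comparable alpha_gt alpha_lt.
have [c4 c40 hc4] := sum_hpot_le alpha_gt alpha_lt.
pose k := c2 * c3; have k0 : 0 < k by rewrite mulr_gt0.
(* With this l the energy term is at most half of the total mass and is absorbed. *)
pose l := 2 * (k * c1); have l0 : 0 < l by rewrite !mulr_gt0.
exists (2 * (k * (l * c4))); first by rewrite !mulr_gt0.
move=> I x h Q f h0 mQ dQ cQ mf f0 hf.
pose a i := fine (mu (Q i)); have a0 i : 0 <= a i by exact: fine_ge0.
have aE i : mu (Q i) = (a i)%:E by rewrite /a fineK//; apply: carleson_cell_fin (h0 i) _ (cQ i).
have P0 i : (0 <= hpot alpha f (x i) (h i))%E by apply: integral_ge0 => y _; rewrite lee_fin mulr_ge0 ?hP_ge0.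
have step i : ((a i)%:E <= k%:E * ((a i)%:E * hpot alpha f (x i) (h i)))%E.
  (* An empty cell has mass 0; in any other cell one point z gives access to the admissibility
     condition. *)
  have [E|/set0P[z zi]] := eqVneq (Q i) set0.
    by rewrite /a E measure0 mul0e mule0.
  rewrite muleCA -[leLHS]mule1; apply: lee_wpmul2l; first by rewrite lee_fin.
  apply: le_trans (hc2 f mf f0 (hpart (set_val z)) _ (siegel_val z) (hf i z zi)) _.
  rewrite /k EFinM -muleA; apply: lee_wpmul2l; first by rewrite lee_fin ltW.
  by have [z1 z2 _] := cQ i z zi; apply: hc3.
have := hc4 I xpredT a h x f l a0 h0 mf f0 l0.
have := hc1 I x h Q h0 mQ dQ cQ; rewrite -/(a _).
set S := \sum_i _; set A := \sum_i a i => SA; rewrite -/S.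
set X := (\int[lam]_y (f y ^+ 2)%:E)%E => hX.
have A0 : 0 <= A by exact: sumr_ge0.
have X0 : (0 <= X)%E by apply: integral_ge0 => y _; rewrite lee_fin sqr_ge0.
have h1 : (A%:E <= k%:E * ((l * c4)%:E * X + (l^-1 * S)%:E))%E.
  apply: (@le_trans _ _ (k%:E * \sum_i ((a i)%:E * hpot alpha f (x i) (h i)))%E).
    rewrite ge0_sume_distrr; last by move=> i _; apply: mule_ge0; rewrite ?lee_fin.
    by rewrite /A -sumEFin; apply: lee_sum => i _; exact: step.
  by apply: lee_wpmul2l => //; rewrite lee_fin ltW.
rewrite (eq_bigr (fun i => (a i)%:E)) ?sumEFin//.
case: X X0 h1 {hX} => [X X0|_ _|//]; last first.
  by rewrite mulry gtr0_sg ?mul1e ?leey// !mulr_gt0.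
rewrite -(EFinM (l * c4)) -EFinD -!EFinM !lee_fin -/A => h1.
have h2 : k * (l^-1 * S) <= A / 2.
  apply: (@le_trans _ _ (k * (l^-1 * (c1 * A)))).
    by rewrite ler_wpM2l ?(ltW k0)// ler_wpM2l ?invr_ge0 ?(ltW l0).
  rewrite le_eqVlt; apply/orP; left; apply/eqP; rewrite /l; field.
  by rewrite !gt_eqF.
rewrite (_ : 2 * (k * (l * c4)) * X = 2 * (k * (l * c4 * X))); last by ring.
by move: h1; rewrite mulrDr; move: (k * (l^-1 * S)) (k * (l * c4 * X)) h2 => *; lra.
Qed.

Lemma tent_disjoint (E E' : set H) : E `&` E' = set0 -> tent E `&` tent E' = set0 :> set U.
Proof.
move=> EE; rewrite -subset0 => z [/tentP z1 /tentP z2].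
have c : hball (hpart (set_val z)) (Num.sqrt (rho (set_val z : V))) (hpart (set_val z)).
  by rewrite /hball /= hdistxx sqrtr_gt0; exact: siegel_val.
have : (E `&` E') (hpart (set_val z)) by split; [exact: z1|exact: z2].
by rewrite EE.
Qed.

(** The tents are disjoint, so their masses add up to at most the mass of their union, which is cut
    into Whitney cells. For a point of a tent the ball that decides membership lies in the base
    ball, where f is admissible: this is the condition in [cells_mass_le]. *)
Lemma carleson_subcapacitary : subcapacitary alpha mu.
Proof.
have [c c0 hc] := cells_mass_le; exists c => // N y r r0 dB.
have [x [h [Q [h0 mQ dQ QN QT]]]] := whitney_cells R n.
rewrite -lee_pdivrMl//; apply: le_ereal_inf_tmp => _ [f [f0 fL hf] <-].
rewrite Lnorm2_sqr lee_pdivrMl//.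
have mf : measurable_fun [set: borel H] (f : borel H -> mR).
  by move: fL; rewrite inE => /andP[]; rewrite inE.
pose T : set (borel U) := \bigcup_i tent (hball (y i) (r i)).
have mT : measurable T by apply: fin_bigcup_measurable => // i _; exact: measurable_tent.
apply: (@le_trans _ _ (mu T)).
  rewrite (eq_bigl (fun i => i \in [set: 'I_N]%SET)); last by move=> i; rewrite finset.in_setT.
  apply: sum_measure_le => //.
  - by move=> i; exact: measurable_tent.
  - by move=> i _ z zi; exists i.
  - move=> i j _ _ ij; apply: tent_disjoint.
    by move/trivIsetP : dB => /(_ i j Logic.I Logic.I ij).
apply: (@le_trans _ _ (\sum_(0 <= k <oo) mu (Q k `&` T))%E).
  apply: measure_sigma_subadditive => //; first by move=> k; exact: measurableI.
  by move=> z zT; have [k kz] := QT z; exists k.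
apply: lime_le; first by apply: is_cvg_nneseries => k _ _.
apply: nearW => L; rewrite big_mkord.
apply: (hc 'I_L (fun k => x k) (fun k => h k) (fun k => Q k `&` T) f) => //.
- by move=> k; exact: measurableI.
- by move=> i j ij; rewrite setIACA dQ// set0I.
- by move=> i z [/QN].
- move=> i z [_ [j _ /tentP zj]] w wz; apply: hf; exists j => //; exact: zj.
Qed.
End carleson_subcapacitary.

Theorem theorem1p4 (R : realType) (n : nat) (n_ge1 : (1 <= n)%N)
    (mu : {measure set (borel (siegelU R n)) -> \bar R})
    (mu_radon : radon_measure mu)
    (alpha : R) (alpha_gt : n%:R / 2 < alpha)
    (alpha_lt : alpha < (n%:R + 1) / 2)
    (m : nat) (m_gt : alpha < m%:R) :
  carleson alpha m mu <-> subcapacitary alpha mu.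
Proof.
split; first exact: carleson_subcapacitary.
exact: subcapacitary_carleson.
Qed.
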